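(* Let $\alpha,s\in(0,1)$, $H_1,H_2\in(0,\tfrac12]$, $T>0$, and let $f$ be a deterministic mapping with $\|f(v)\|_{L^2(D)}\le C_f(1+\|v\|_{L^2(D)})$ and $\|f(v)-f(w)\|_{L^2(D)}\le C_f\|v-w\|_{L^2(D)}$ for all $v,w\in L^2(D)$ and some constant $C_f>0$. Assume $\frac{2sH_2}{\alpha}+H_1-1>0$ and $H_1+2s-1>0$. For $N,M\in\mathbb N^*$, $\tau=T/M$, $t_n=n\tau$, let $\bar u_N$ be the solution of the spectral Galerkin semi-discretization of $\partial_t u+{}_0\partial_t^{1-\alpha}A^s u=f(u)+\xi^{H_1,H_2}$ (zero initial value, zero Dirichlet boundary condition) and let $\bar u_N^n$ be the solution of the fully discrete Mittag--Leffler Euler integrator scheme. Then for every (arbitrarily small) $\epsilon>0$ there is a constant $C$, independent of $N$, $\tau$ and $n$, such that for all $n=1,\dots,M$ $$\mathbb{E}\|\bar u_N(t_n)-\bar u_N^n\|_{L^2(D)}^2\le C\tau^{H_2+\frac{\alpha(H_1-1)}{2s}-\epsilon}.$$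
   Context: $D=(0,1)$. $A=-\Delta$ on $D$ with zero Dirichlet boundary condition, with non-decreasing eigenvalues $\lambda_k$ and $L^2$-normalized eigenfunctions $\phi_k$, $k\ge1$; $A^{q}v=\sum_{k}\lambda_k^{q}(v,\phi_k)\phi_k$, where $(\cdot,\cdot)$ is the $L^2(D)$ inner product. ${}_0\partial_t^{1-\alpha}u=\frac{1}{\Gamma(\alpha)}\frac{\partial}{\partial t}\int_0^t(t-r)^{\alpha-1}u(r)dr$ is the Riemann--Liouville derivative. $E_{\alpha,\beta}(z)=\sum_{k\ge0}z^k/\Gamma(k\alpha+\beta)$ is the Mittag--Leffler function. Noise: $\xi^{H_1,H_2}=\frac{\partial^2W^{H_1,H_2}}{\partial x\partial t}$, where $W^{H_1,H_2}$ is a fractional Brownian sheet on $D\times[0,T]$, i.e. a centered Gaussian field on a stochastic basis $(\Omega,\mathcal F,(\mathcal F_t)_{t\in[0,T]},\mathbb P)$ with $\mathbb{E}[W^{H_1,H_2}(x,t)W^{H_1,H_2}(y,r)]=\frac{x^{2H_1}+y^{2H_1}-|x-y|^{2H_1}}{2}\cdot\frac{t^{2H_2}+r^{2H_2}-|t-r|^{2H_2}}{2}$. Integrals $\int\!\int g(y,r)\xi^{H_1,H_2}(y,r)\,dy\,dr$ of deterministic $g$ are Wiener integrals with respect to $W^{H_1,H_2}$ (rectangular increments for indicator functions, extended linearly and by $L^2(\Omega)$-closure). Semi-discrete solution: $\mathbb H_N=\mathrm{span}\{\phi_1,\dots,\phi_N\}$, $P_N$ is the $L^2(D)$-orthogonal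 projection onto $\mathbb H_N$, $A_N^s:\mathbb H_N\to\mathbb H_N$ is the restriction of $A^s$. $\bar u_N\in\mathbb H_N$ solves $\partial_t\bar u_N+{}_0\partial_t^{1-\alpha}A_N^s\bar u_N=P_Nf(\bar u_N)+\xi_{RS}^{H_1,H_2}$, $\bar u_N(0)=0$, with $\xi_{RS}^{H_1,H_2}(x,t)=\sum_{j=1}^N\int_D\phi_j(y)\xi^{H_1,H_2}(y,t)dy\,\phi_j(x)$; that is, $\bar u_N(x,t)=\int_0^t\mathcal S_{R,N}(t-r)P_Nf(\bar u_N(r))dr+\int_0^t\int_DG_{R,S}(t-r,x,y)\xi^{H_1,H_2}(y,r)dydr$, where $\mathcal S_{R,N}(t)v=\sum_{k=1}^NE_{\alpha,1}(-\lambda_k^st^\alpha)(v,\phi_k)\phi_k$ and $G_{R,S}(t,x,y)=\sum_{k=1}^NE_{\alpha,1}(-\lambda_k^st^\alpha)\phi_k(x)\phi_k(y)$. Fully discrete scheme (Mittag--Leffler Euler integrator): with $I_i=(t_{i-1},t_i]$, $\chi_I$ the characteristic function of $I$, and $\xi_R^{H_1,H_2}(x,t)=\sum_{i=1}^M\sum_{k=1}^N\frac1\tau\Big(\int_{I_i}\int_D\phi_k(y)\xi^{H_1,H_2}(y,r)dydr\Big)\phi_k(x)\chi_{I_i}(t)$, set $\bar u_N^0=0$ and for $n\ge1$ $\bar u_N^n=\sum_{i=1}^n\int_{t_{i-1}}^{t_i}\mathcal S_{R,N}(t_n-r)P_Nf(\bar u_N^{i-1})dr+\sum_{i=1}^n\int_{t_{i-1}}^{t_i}\int_DG_{R,S}(t_n-r,x,y)\xi_R^{H_1,H_2}(y,r)dydr$.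 *)

(* Defs.v *)
From HB Require Import structures.
From mathcomp Require Import all_boot all_order all_algebra.
From mathcomp Require Import all_classical all_reals all_analysis.

Set Implicit Arguments.
Unset Strict Implicit.
Unset Printing Implicit Defensive.

Import Order.TTheory GRing.Theory Num.Theory.
Import numFieldNormedType.Exports.

Local Open Scope classical_set_scope.
Local Open Scope ring_scope.

Definition Gamma {R : realType} (x : R) : R :=
  \int[lebesgue_measure]_(t in `]0, +oo[) (t `^ (x - 1) * expR (- t)).

Definition mittag_leffler {R : realType} (a b z : R) : R :=
  limn (series (fun k => z ^+ k / Gamma (k%:R * a + b))).

(* An element of L^2(D) is represented by a measurable function on the whole
   line; its values outside D are irrelevant, because all norms and integrals
   are taken with respect to [lebD], which does not charge the complement of D.
   Thus L^2(D) is [Lfun lebD 2%:E] and its norm is ['N[lebD]_2%:E[_]]. *)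

Definition D {R : realType} : set R := `]0, 1[%classic.

Definition lebD (R : realType) :
    {measure set (measurableTypeR R) -> \bar R} :=
  mrestr lebesgue_measure (measurable_itv (`]0, 1[ : interval R)).

Definition L2D (R : realType) : {pred R -> R} :=
  fun v => (v : measurableTypeR R -> R) \in Lfun (lebD R) 2%:E.

Definition normD {R : realType} (v : R -> R) : \bar R :=
  'N[lebD R]_2%:E[EFin \o v]%E.

Definition innerD {R : realType} (v w : R -> R) : R :=
  \int[lebD R]_x (v x * w x).

(* A (possibly nonlinear) map of L^2(D) into itself, of linear growth and
   Lipschitz.  The Lipschitz bound forces [f] to respect equality almost
   everywhere on D. *)
Definition growth_lipschitz {R : realType} (Cf : R)
    (f : (R -> R) -> (R -> R)) : Prop :=
  [/\ forall v, v \in @L2D R -> f v \in @L2D R,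
      forall v, v \in @L2D R ->
        (normD (f v) <= Cf%:E * (1 + normD v))%E
    & forall v w, v \in @L2D R -> w \in @L2D R ->
        (normD (f v \- f w)%R <= Cf%:E * normD (v \- w)%R)%E].

(* Eigenfunctions of minus the Laplacian, extended by zero outside D: continuity
   on the line then encodes the zero boundary values. *)
Definition dirichlet_eigenfunction {R : realType} (m : R) (psi : R -> R) :
    Prop :=
  [/\ continuous psi,
      forall x, ~ D x -> psi x = 0
    & forall x, D x ->
        [/\ derivable psi x 1, derivable (derive1 psi) x 1 &
            - derive1 (derive1 psi) x = m * psi x]].

(* Indices start at 1; index 0 is not used.  The last clause says that the
   list contains every eigenvalue, with its full multiplicity. *)
Definition dirichlet_eigensystem {R : realType} (lambda : nat -> R)
    (phi : nat -> R -> R) : Prop :=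
  [/\ forall k, (1 <= k)%N -> dirichlet_eigenfunction (lambda k) (phi k),
      forall j k, (1 <= j)%N -> (j <= k)%N -> lambda j <= lambda k,
      forall j k, (1 <= j)%N -> (1 <= k)%N ->
        innerD (phi j) (phi k) = (j == k)%:R
    & forall m psi, dirichlet_eigenfunction m psi ->
        (forall k, (1 <= k)%N -> innerD psi (phi k) = 0) ->
        forall x, psi x = 0].

Definition P_N {R : realType} (phi : nat -> R -> R) (N : nat) (v : R -> R) :
    R -> R :=
  fun x => \sum_(1 <= k < N.+1) innerD v (phi k) * phi k x.

Definition S_RN {R : realType} (alpha s : R) (lambda : nat -> R)
    (phi : nat -> R -> R) (N : nat) (t : R) (v : R -> R) : R -> R :=
  fun x => \sum_(1 <= k < N.+1)
    mittag_leffler alpha 1 (- (lambda k `^ s * t `^ alpha))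
    * innerD v (phi k) * phi k x.

Definition G_RS {R : realType} (alpha s : R) (lambda : nat -> R)
    (phi : nat -> R -> R) (N : nat) (t x y : R) : R :=
  \sum_(1 <= k < N.+1)
    mittag_leffler alpha 1 (- (lambda k `^ s * t `^ alpha))
    * phi k x * phi k y.

Definition is_filtration {R : realType} {d} {Omega : measurableType d}
    (T : R) (F : R -> set (set Omega)) : Prop :=
  [/\ forall t, 0 <= t <= T -> sigma_algebra setT (F t),
      forall t, 0 <= t <= T -> F t `<=` measurable
    & forall r t, 0 <= r -> r <= t -> t <= T -> F r `<=` F t].

(* Law N(0, sigma^2), the degenerate case sigma = 0 being the Dirac mass. *)
Definition centered_gaussian {R : realType} {d} {Omega : measurableType d}
    (P : probability Omega R) (X : Omega -> R) : Prop :=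
  exists sigma : R, forall B : set (measurableTypeR R), measurable B ->
    P (X @^-1` B) =
      (if sigma == 0 then \d_(0 : R) B else normal_prob 0 sigma B).

Definition fbm_cov {R : realType} (H a b : R) : R :=
  (a `^ (2 * H) + b `^ (2 * H) - `|a - b| `^ (2 * H)) / 2.

(* [fbm_cov] is used for x,t >= 0.  [W x t] matters only for (x,t) in D x [0,T]. *)
Definition fractional_brownian_sheet {R : realType} {d}
    {Omega : measurableType d} (P : probability Omega R)
    (F : R -> set (set Omega)) (T H1 H2 : R) (W : R -> R -> {RV P >-> R}) :
    Prop :=
  [/\ forall x t, D x -> 0 <= t <= T ->
        forall B : set (measurableTypeR R), measurable B ->
        F t (W x t @^-1` B),
      forall (m : nat) (c x t : 'I_m -> R),
        (forall i, D (x i) /\ 0 <= t i <= T) ->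
        centered_gaussian P (fun w => \sum_(i < m) c i * W (x i) (t i) w)
    & forall x y t r, D x -> D y -> 0 <= t <= T -> 0 <= r <= T ->
        'E_P[W x t \* W y r]%E = (fbm_cov H1 x y * fbm_cov H2 t r)%:E].
Arguments fractional_brownian_sheet {R d Omega} P.

(* A step function is a list of entries (c, (a, b), (l, u)), each of which
   stands for c times the indicator function of (a, b] x (l, u]. *)

Definition step_data (R : realType) : Type :=
  seq (R * (R * R) * (R * R)).

Definition step_in {R : realType} (T : R) (e : step_data R) : Prop :=
  forall c a b l u, (c, (a, b), (l, u)) \in e ->
    [/\ 0 < a, a <= b, b < 1, 0 <= l & l <= u <= T].

Definition step_fun {R : realType} (e : step_data R) (p : R * R) : R :=
  \sum_(q <- e) let: (c, (a, b), (l, u)) := q in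
    c * (\1_(`]a, b]%classic) p.1 * \1_(`]l, u]%classic) p.2).

Definition step_integral {R : realType} {Omega : Type} (W : R -> R -> Omega -> R)
    (e : step_data R) (w : Omega) : R :=
  \sum_(q <- e) let: (c, (a, b), (l, u)) := q in
    c * (W b u w - W a u w - W b l w + W a l w).

(* [X] is the integral of [g] over D x [0,T] with respect to [W]: the pair
   (g, X) lies in the closure in L^2(D x (0,T)) x L^2(Omega) of the graph of
   the integral of step functions. *)
Definition wiener_integral {R : realType} {d} {Omega : measurableType d}
    (P : probability Omega R) (T : R) (W : R -> R -> {RV P >-> R})
    (g : R -> R -> R) (X : {RV P >-> R}) : Prop :=
  measurable_fun ((D `*` `[0, T]) : set (measurableTypeR R * measurableTypeR R))
    (fun p => g p.1 p.2) /\
  exists e : nat -> step_data R,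
    [/\ forall n, step_in T (e n),
        (fun n => (\int[lebesgue_measure \x lebesgue_measure]_(p in D `*` `[0%R, T])
           ((g p.1 p.2 - step_fun (e n) p) ^+ 2)%:E)%E) @ \oo --> 0%E
      & (fun n => (\int[P]_w
           ((X w - step_integral (fun x t => W x t : Omega -> R) (e n) w) ^+ 2)%:E)%E)
          @ \oo --> 0%E].
Arguments wiener_integral {R d Omega} P.

(* [u] is a measurable process with values in H_N = span(phi_1, ..., phi_N);
   [u t w] is its value, a function on D, at time t and outcome w. *)
Definition HN_process {R : realType} {d} {Omega : measurableType d} (T : R)
    (phi : nat -> R -> R) (N : nat) (u : R -> Omega -> R -> R) : Prop :=
  exists c : nat -> measurableTypeR R * Omega -> R,
    (forall k, measurable_fun (`[0, T] `*` setT) (c k)) /\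
    (forall t w x, 0 <= t <= T ->
       u t w x = \sum_(1 <= k < N.+1) c k (t, w) * phi k x).

(* Mild form of the semi-discrete equation.  The second clause makes the Lebesgue
   integral in time well defined. *)
Definition semidiscrete_solution {R : realType} {d} {Omega : measurableType d}
    (P : probability Omega R) (alpha s T : R) (lambda : nat -> R)
    (phi : nat -> R -> R) (f : (R -> R) -> (R -> R))
    (W : R -> R -> {RV P >-> R}) (N : nat) (u : R -> Omega -> R -> R) : Prop :=
  [/\ HN_process T phi N u,
      {ae P, forall w,
        (\int[lebesgue_measure]_(r in `[0%R, T]) normD (u r w) < +oo)%E},
      {ae P, forall w, forall x, u 0 w x = 0}
    & forall t x, 0 <= t <= T -> D x ->
        exists Z : {RV P >-> R},
          wiener_integral P T W
            (fun y r => \1_(`[0, t]%classic) r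
                        * G_RS alpha s lambda phi N (t - r) x y) Z /\
          {ae P, forall w, u t w x =
            \int[lebesgue_measure]_(r in `[0, t])
               S_RN alpha s lambda phi N (t - r) (P_N phi N (f (u r w))) x
            + Z w}].
Arguments semidiscrete_solution {R d Omega} P.

Definition grid {R : realType} (tau : R) (n : nat) : R := n%:R * tau.

Definition cell {R : realType} (tau : R) (i : nat) : set R :=
  `]grid tau i.-1, grid tau i]%classic.

(* [zeta i k] stands for the integral of phi_k over I_i x D against the noise. *)
Definition xi_R {R : realType} {Omega : Type} (phi : nat -> R -> R)
    (N M : nat) (tau : R) (zeta : nat -> nat -> Omega -> R)
    (w : Omega) (x t : R) : R :=
  \sum_(1 <= i < M.+1) \sum_(1 <= k < N.+1)
    tau^-1 * zeta i k w * phi k x * \1_(cell tau i) t.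

Definition mittag_leffler_euler {R : realType} {d} {Omega : measurableType d}
    (P : probability Omega R) (alpha s T : R) (lambda : nat -> R)
    (phi : nat -> R -> R) (f : (R -> R) -> (R -> R))
    (W : R -> R -> {RV P >-> R}) (N M : nat) (U : nat -> Omega -> R -> R) :
    Prop :=
  let tau := T / M%:R in
  [/\ forall n, (n <= M)%N -> exists c : nat -> {RV P >-> R},
        forall w x, U n w x = \sum_(1 <= k < N.+1) c k w * phi k x,
      forall w x, U 0%N w x = 0
    & exists zeta : nat -> nat -> {RV P >-> R},
        (forall i k, (1 <= i <= M)%N -> (1 <= k <= N)%N ->
           wiener_integral P T W (fun y r => \1_(cell tau i) r * phi k y)
             (zeta i k)) /\
        forall n, (1 <= n <= M)%N -> {ae P, forall w, forall x, D x ->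
          U n w x =
            \sum_(1 <= i < n.+1) \int[lebesgue_measure]_(r in cell tau i)
               S_RN alpha s lambda phi N (grid tau n - r)
                 (P_N phi N (f (U i.-1 w))) x
          + \sum_(1 <= i < n.+1) \int[lebesgue_measure]_(r in cell tau i)
               \int[lebD R]_y
                 (G_RS alpha s lambda phi N (grid tau n - r) x y
                  * xi_R phi N M tau (fun j k => zeta j k : Omega -> R)
                      w y r)}].
Arguments mittag_leffler_euler {R d Omega} P.

(* Main.v *)
Require Import Defs.
From HB Require Import structures.
From mathcomp Require Import all_boot all_order all_algebra.
From mathcomp Require Import all_classical all_reals all_analysis.
From mathcomp Require Import measurable_realfun ring lra.

Set Implicit Arguments.
Unset Strict Implicit.
Unset Printing Implicit Defensive.

Import Order.TTheory GRing.Theory Num.Theory.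
Import numFieldNormedType.Exports.

Local Open Scope classical_set_scope.
Local Open Scope ring_scope.

(** Write v_k(t) = E_{alpha,1}(-lambda_k^s t^alpha). In the basis phi_k, the semi-discrete solution
    and the scheme are both the sum of a memory integral of v_k against a Lipschitz drift and of a
    Wiener integral of a(r) phi_k(y). For the former a(r) is v_k(t - r) on [0, t] ([hist]); for the
    latter it is the average of that function over the time cells ([mean_hist]). Everything rests on
    second moments of Wiener integrals of differences of such integrands; the rest is Gronwall.

    For H <= 1/2 these moments are norms of Gagliardo type. The function l^(2H) is a mixture over
    shifts h of 2 min(h, l) ([integral_min_shift_index1]), and 2 min(h, b - a) is the squared L2
    norm of the increment of step h of the indicator of ]a, b] ([integral_dif_ind_sqr]). Hence, for
    step functions, the second moment is [qform], a mixture over pairs of shifts of squared L2 norms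
    of rectangular increments ([wiener_isometry_step]). Closability of this form extends the upper
    bound to all integrands, up to a factor 4 ([wint_bound]), and on products a(r) phi(y) the form
    factorises ([qform_tensor]).

    The space factor is of order w_k^(1 - 2 H1) with w_k = sqrt(lambda_k), because phi_k is bounded
    and Lipschitz with a constant of order w_k. For the time factor, v_k takes values in [0, 1],
    decreases, and its square is at most a constant times lambda_k^(- s q / alpha) x^(-q) for 0 <= q
    <= 2 alpha ([mlk_decay]). Two histories at distance delta, or a history and its averages over
    cells of length delta, then differ by order delta^(2 H2 - q) in the form. Since w_k >= k, the
    sum over modes is bounded once 2 H1 + 2 s q / alpha - 1 > 1, that is, once q exceeds q0 = alpha
    (1 - H1) / s. The two conditions on the parameters say q0 < 2 H2 and q0 < 2 alpha. So some q >
    q0 has q < 2 alpha and rho = 2 H2 - q > H2 - q0 / 2, which beats the exponent of the theorem.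

    The shape of v_k is obtained without complete monotonicity. The function v(t) =
    E_{alpha,1}(-t^alpha) solves v + k * v = 1, where k is the kernel of the fractional integral
    ([volterra_mlv]). A positivity principle for such equations ([volterra_gt0]), applied to v and
    to v(t) - v(t + h), yields positivity and monotonicity; these give the decay.

    From the noise estimates follow, uniformly in N, a second moment bound, proved first on events
    where the path has bounded L1 norm, a bound of order rho for time increments, and by a discrete
    Gronwall argument the error estimate ([mild_error_bound]). *)

(** * Lebesgue integrals: change of variables, powers, Tonelli *)

Section basics.
Context {R : realType}.
Notation mu := (@lebesgue_measure R).

(** The integral of a nonnegative function is a supremum over the simple functions below it, and
    that supremum grows with the function; so the comparison also covers non-measurable
    integrands. *)
Lemma ge0_integral_mono d (T : measurableType d) (m : {measure set T -> \bar R})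
    (A : set T) (f g : T -> \bar R) :
  (forall x, A x -> 0 <= f x)%E -> (forall x, A x -> f x <= g x)%E ->
  (\int[m]_(x in A) f x <= \int[m]_(x in A) g x)%E.
Proof.
move=> f0 fg.
rewrite !(integral_mkcond A).
have h0 x : (0 <= (f \_ A) x)%E by apply: erestrict_ge0.
have h1 x : (0 <= (g \_ A) x)%E.
  by apply: erestrict_ge0 => y Ay; exact: le_trans (f0 _ Ay) (fg _ Ay).
rewrite !ge0_integralTE//; apply: ereal_sup_le => _ [h hf <-].
exists h => // x; apply: le_trans (hf x) _.
by rewrite /patch; case: ifPn => // /set_mem; exact: fg.
Qed.

Lemma ge0_integral_shift (f : R -> \bar R) (h : R) :
  measurable_fun setT f -> (forall x, 0 <= f x)%E ->
  (\int[mu]_x f (x + h)%R = \int[mu]_x f x)%E.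
Proof.
move=> mf f0.
pose phi : measurableTypeR R -> measurableTypeR R := fun x => x + h.
have mphi : measurable_fun setT phi.
  by apply: measurable_funD.
have -> : (\int[mu]_x f x = \int[pushforward mu phi]_x f x)%E.
  apply: eq_measure_integral => A mA _.
  apply: (@lebesgue_measure_unique R (pushforward mu phi)) => //.
  move=> X [[a b]] /= _ <-.
  rewrite /pushforward /=.
  have -> : phi @^-1` `]a, b] = `]a - h, b - h]%classic.
    by apply/seteqP; split => x /=; rewrite !in_itv /= /phi ltrBlDr lerBrDr.
  rewrite !lebesgue_measure_itv /= !lte_fin ltrD2r.
  by case: ifPn => // _; rewrite -!EFinD; congr EFin; ring.
rewrite ge0_integral_pushforward//.
Qed.

Lemma ge0_integral_opp (f : R -> \bar R) :
  measurable_fun setT f -> (forall x, 0 <= f x)%E ->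
  (\int[mu]_x f (- x)%R = \int[mu]_x f x)%E.
Proof.
move=> mf f0.
pose phi : measurableTypeR R -> measurableTypeR R := fun x => - x.
have mphi : measurable_fun setT phi by apply: measurable_funN.
have -> : (\int[mu]_x f x = \int[pushforward mu phi]_x f x)%E.
  by apply: eq_measure_integral => A mA _; exact/esym/lebesgue_measureN.
by rewrite ge0_integral_pushforward.
Qed.

Lemma ge0_integral_scale (f : R -> \bar R) (c : R) : 0 < c ->
  measurable_fun setT f -> (forall x, 0 <= f x)%E ->
  (c%:E * \int[mu]_x f (c * x)%R = \int[mu]_x f x)%E.
Proof.
move=> c0 mf f0.
pose phi : measurableTypeR R -> measurableTypeR R := fun x => c * x.
have mphi : measurable_fun setT phi by apply: measurable_funM.
have cge0 := ltW c0.
pose nu : {measure set (measurableTypeR R) -> \bar R} :=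
  measure_function_pushforward__canonical__measure_function_Measure mu mphi.
have -> : (\int[mu]_x f x = \int[mscale (NngNum cge0) nu]_x f x)%E.
  apply: eq_measure_integral => A mA _.
  apply: (@lebesgue_measure_unique R (mscale (NngNum cge0) nu)) => //.
  move=> X [[a b]] /= _ <-.
  rewrite /mscale /= /pushforward /=.
  have -> : phi @^-1` `]a, b] = `]c^-1 * a, c^-1 * b]%classic.
    apply/seteqP; split => x /=; rewrite !in_itv /= /phi.
      by rewrite ltr_pdivrMl// ler_pdivlMl.
    by rewrite ltr_pdivrMl// ler_pdivlMl.
  rewrite !lebesgue_measure_itv /= !lte_fin ltr_pM2l ?invr_gt0//.
  case: ifPn => [_|_]; last by rewrite mule0.
  by rewrite -!EFinD -EFinM; congr EFin; rewrite -mulrBr mulrA divff ?mul1r// gt_eqF.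
rewrite ge0_integral_mscale//= ge0_integral_pushforward//.
Qed.


(** For negative [a] the integrand blows up at 0. The fundamental theorem of calculus is applied on
    intervals that stay away from 0 and increase to ]0, d], and monotone convergence concludes. *)
Lemma integral_powR (a d : R) : -1 < a -> 0 < d ->
  (\int[mu]_(x in `]0%R, d]) (x `^ a)%:E = (d `^ (a + 1) / (a + 1))%:E)%E.
Proof.
move=> a1 d0; have a10 : 0 < a + 1 by lra.
(* The denominator [i.+2] keeps the left end strictly below [d], also for [i = 0]. *)
pose F (i : nat) : set R := `[d / i.+2%:R, d]%classic.
have di i : 0 < d / i.+2%:R by rewrite divr_gt0.
have did i : d / i.+2%:R < d by rewrite ltr_pdivrMr// ltr_pMr// ltr1n.
have FE : `]0, d]%classic = \bigcup_i F i.
  apply/seteqP; split => x /=; rewrite in_itv /=.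
    move=> /andP[x0 xd].
    have [n nx] : exists n : nat, d / x < n%:R.
      by exists (Num.bound (d / x)); apply: archi_boundP; rewrite divr_ge0// ltW.
    exists n => //; rewrite /F /= in_itv /= xd andbT.
    rewrite ler_pdivrMr// mulrC -ler_pdivrMr// (le_trans (ltW nx))// ler_nat.
    by rewrite -addn2 leq_addr.
  by move=> [i _]; rewrite /F /= in_itv /= => /andP[dx ->]; rewrite (lt_le_trans (di i) dx).
pose G (x : R) := x `^ (a + 1) / (a + 1).
have intF i : (\int[mu]_(x in F i) (x `^ a)%:E = (G d)%:E - (G (d / i.+2%:R))%:E)%E.
  have cpow (b x : R) : 0 < x -> {for x, continuous (@powR R ^~ b)}.
    move=> x0; apply: differentiable_continuous; apply/derivable1_diffP.
    by apply: derivable_powR; rewrite in_itv /= x0.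
  have cG (x : R) : 0 < x -> {for x, continuous G}.
    by move=> x0; apply: cvgM; [exact: cpow|exact: cvg_cst].
  apply: (@continuous_FTC2 _ _ G) => //.
  - apply: continuous_in_subspaceT => x; rewrite inE /= in_itv /= => /andP[dx _].
    by apply: cpow; exact: lt_le_trans dx.
  - split.
    + move=> x; rewrite in_itv /= => /andP[dx _]; apply: derivableM => //.
      by apply: derivable_powR; rewrite in_itv /= (lt_trans (di i) dx).
    + by apply: cvg_at_right_filter; apply: cG.
    + by apply: cvg_at_left_filter; apply: cG.
  - move=> x; rewrite in_itv /= => /andP[dx _].
    have x0 := lt_trans (di i) dx.
    rewrite derive1E /G deriveM//; last by apply: derivable_powR; rewrite in_itv /= x0.
    rewrite derive_cst scaler0 add0r -derive1E powR_derive1 ?in_itv /= ?x0//.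
    by rewrite addrK /GRing.scale /= mulrA mulVf ?mul1r// gt_eqF.
have mp : measurable_fun setT (fun x : R => (x `^ a)%:E).
  by apply/measurable_EFinP; exact: measurable_powR.
have cv : (\int[mu]_(x in F i) (x `^ a)%:E @[i --> \oo] -->
    \int[mu]_(x in \bigcup_i F i) (x `^ a)%:E)%E.
  apply: ge0_nondecreasing_set_cvg_integral => //.
  - move=> m n mn; apply/subsetPset => x; rewrite /F /= !in_itv /= => /andP[+ ->].
    rewrite andbT; apply: le_trans; rewrite ler_pM2l// lef_pV2 ?posrE//.
    by rewrite ler_nat !ltnS.
  - by move=> i; exact: measurable_itv.
  - by move=> i; apply: measurable_funTS.
  - by move=> i x _; rewrite lee_fin powR_ge0.
rewrite FE -(cvg_lim _ cv)//; apply/cvg_lim => //.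
rewrite (_ : (fun i => _) = (fun i => (G d - G (d / i.+2%:R))%:E)); last first.
  by apply/funext => i; rewrite intF EFinB.
apply: cvg_EFin; first by near=> n.
rewrite [X in _ --> X](_ : _ = G d - 0); last by rewrite subr0.
apply: cvgB; first exact: cvg_cst.
rewrite -[X in _ --> X](mul0r (a + 1)^-1).
apply: cvgM; last exact: cvg_cst.
have /cvg_at_rightP := powR_cvg0 a10; apply; split => //.
rewrite -[X in _ --> X](mulr0 d); apply: cvgM; first exact: cvg_cst.
by have := @cvg_harmonic R; rewrite -(cvg_shiftS (@harmonic R)).
Unshelve. all: by end_near. Qed.

Lemma ge0_integrable d (T : measurableType d) (m : {measure set T -> \bar R})
    (A : set T) (f : T -> R) :
  measurable A -> measurable_fun A f -> (forall x, A x -> 0 <= f x) ->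
  (\int[m]_(x in A) (f x)%:E < +oo)%E -> m.-integrable A (EFin \o f).
Proof.
move=> mA mf f0 fi; apply/integrableP; split; first exact/measurable_EFinP.
rewrite (_ : (\int[m]_(x in A) _ = \int[m]_(x in A) (f x)%:E)%E)//.
by apply: eq_integral => x; rewrite inE => Ax /=; rewrite ger0_norm// f0.
Qed.

Lemma tonelli d1 d2 (T1 : measurableType d1) (T2 : measurableType d2)
    (m1 : {sigma_finite_measure set T1 -> \bar R})
    (m2 : {sigma_finite_measure set T2 -> \bar R}) (f : T1 -> T2 -> \bar R) :
  measurable_fun setT (fun z : T1 * T2 => f z.1 z.2) ->
  (forall x y, 0 <= f x y)%E ->
  (\int[m1]_x \int[m2]_y f x y = \int[m2]_y \int[m1]_x f x y)%E.
Proof. by move=> mf f0; apply: (fubini_tonelli (fun z => f z.1 z.2)). Qed.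

End basics.

(** * The Gamma function and Euler's beta integral *)

Section gamma.
Context {R : realType}.
Notation mu := (@lebesgue_measure R).

Lemma ge0_integral_refl (f : R -> \bar R) (t : R) :
  measurable_fun setT f -> (forall x, 0 <= f x)%E ->
  (\int[mu]_x f (t - x)%R = \int[mu]_x f x)%E.
Proof.
move=> mf f0.
rewrite -(ge0_integral_shift (f := f) t)//.
rewrite -(ge0_integral_opp (f := fun x => f (x + t)))//; last first.
  by apply: measurableT_comp => //; exact: measurable_funD.
by apply: eq_integral => x _; rewrite addrC.
Qed.

Lemma integral_shift (f : R -> \bar R) (h : R) : measurable_fun setT f ->
  (\int[mu]_x f (x + h)%R = \int[mu]_x f x)%E.
Proof.
move=> mf; rewrite [LHS]integralE [RHS]integralE.
rewrite -(ge0_integral_shift (f := f^\+%E) h)//; last exact: measurable_funepos.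
rewrite -(ge0_integral_shift (f := f^\-%E) h)//; last exact: measurable_funeneg.
by congr (_ - _)%E; apply: eq_integral => x _; rewrite ?funeposE ?funenegE.
Qed.

(** Vanishing for x <= 0 turns convolutions over ]0, t[ into integrals over the line, where
    translation and scaling apply. *)
Definition ppow (a x : R) : R := if 0 < x then x `^ (a - 1) else 0.

Lemma ppow_ge0 a x : 0 <= ppow a x.
Proof. by rewrite /ppow; case: ifP => // _; rewrite powR_ge0. Qed.

Lemma ppow_gt0 a x : 0 < x -> 0 < ppow a x.
Proof. by move=> x0; rewrite /ppow x0 powR_gt0. Qed.

Lemma measurable_ppow a : measurable_fun setT (ppow a).
Proof.
rewrite (_ : ppow a = fun x => (x `^ (a - 1)) * \1_(`]0, +oo[%classic) x); last first.
  apply/funext => x; rewrite /ppow indicE mem_setE in_itv /= andbT.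
  by case: ifP; rewrite ?mulr1 ?mulr0.
by apply: measurable_funM => //; exact: measurable_powR.
Qed.

Lemma ppowM a x y : 0 < x -> ppow a (x * y) = x `^ (a - 1) * ppow a y.
Proof.
move=> x0; rewrite /ppow pmulr_rgt0//; case: ifPn => y0; last by rewrite mulr0.
by rewrite powRM// ltW.
Qed.

(** [Gamma] takes the [fine] part of its integral, which reads a divergent integral as 0; the
    extended value is kept until finiteness is proved. *)
Definition EGamma (a : R) : \bar R := (\int[mu]_t (ppow a t * expR (- t))%:E)%E.

Lemma GammaE (a : R) : Gamma a = fine (EGamma a).
Proof.
rewrite /Gamma /Rintegral /EGamma integral_mkcond; congr fine.
apply: eq_integral => x _; rewrite patchE mem_setE in_itv /= andbT /ppow.
by case: ifP; rewrite ?mul0r.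
Qed.

Lemma mgam a : measurable_fun setT (fun t : R => ppow a t * expR (- t)).
Proof.
apply: measurable_funM; first exact: measurable_ppow.
by apply: measurableT_comp => //.
Qed.


(** The integrand is dominated by t^(a - 1) on ]0, 1] and by a multiple of the exponential density
    of rate 1/2 beyond 1. *)
Lemma EGamma_lty (a : R) : 0 < a -> (EGamma a < +oo)%E.
Proof.
move=> a0.
pose p := a + 1; have p0 : 0 < p by rewrite /p; lra.
(* From t / (2p) <= exp(t / (2p)) comes t^p <= (2p)^p exp(t / 2); the last factor 2 compensates the
   rate 1/2 in front of the density. *)
pose C := (2 * p) `^ p * 2.
have C0 : 0 <= C by rewrite mulr_ge0 ?powR_ge0.
have h2 : (0 : R) < 2^-1 by rewrite invr_gt0.
have mI : measurable_fun setT (fun t : R => ((t `^ (a - 1)) * \1_(`]0, 1%R]%classic) t)).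
  by apply: measurable_funM => //; exact: measurable_powR.
apply: (@le_lt_trans _ _ (\int[mu]_t (((t `^ (a - 1)) * \1_(`]0%R, 1%R]%classic) t)%:E
    + (C * exponential_pdf 2^-1 t)%:E))%E).
  apply: ge0_integral_mono => t _.
    by rewrite lee_fin mulr_ge0 ?expR_ge0 ?ppow_ge0.
  have pdf0 : 0 <= C * exponential_pdf 2^-1 t.
    by rewrite mulr_ge0// exponential_pdf_ge0// ltW.
  rewrite -EFinD lee_fin /ppow; case: ifPn => t0; last first.
    by rewrite mul0r addr_ge0// mulr_ge0 ?powR_ge0.
  have [t1|t1] := leP t 1.
    apply: ler_wpDr => //.
    rewrite indicE mem_set /= ?in_itv /= ?t0 ?t1// mulr1.
    by rewrite ler_piMr ?powR_ge0// -expR0 ler_expR lerNl oppr0 ltW.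
  apply: ler_wpDl; first by rewrite mulr_ge0 ?powR_ge0.
  rewrite exponential_pdfE ?(ltW t0)//.
  have p20 : 0 < 2 * p by rewrite mulr_gt0.
  apply: (@le_trans _ _ (((2 * p) `^ p * expR (t / 2)) * expR (- t))).
    apply: ler_wpM2r; first exact: expR_ge0.
    apply: (@le_trans _ _ (t `^ p)); first by rewrite ler_powR ?(ltW t1)// /p; lra.
    have tE : t = (2 * p) * (t / (2 * p)) by rewrite mulrC divfK// gt_eqF.
    rewrite [in leLHS]tE powRM ?(ltW p20) ?divr_ge0 ?(ltW t0) ?(ltW p20)//.
    apply: ler_wpM2l; first exact: powR_ge0.
    apply: (@le_trans _ _ ((expR (t / (2 * p))) `^ p)).
      apply: ge0_ler_powR; rewrite ?nnegrE ?expR_ge0 ?divr_ge0 ?(ltW t0) ?(ltW p20) ?(ltW p0)//.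
      by apply: le_trans (expR_ge1Dx _); rewrite lerDr.
    rewrite /powR gt_eqF ?expR_gt0// expRK ler_expR.
    rewrite (_ : p * _ = t / 2)//.
    by field; rewrite gt_eqF.
  rewrite /C -!mulrA -expRD; apply: ler_wpM2l; first exact: powR_ge0.
  by rewrite [2 * _]mulrA divff ?mul1r// ler_expR; lra.
rewrite ge0_integralD//; last 4 first.
- by move=> t _; rewrite lee_fin mulr_ge0 ?powR_ge0.
- exact/measurable_EFinP.
- by move=> t _; rewrite lee_fin mulr_ge0 ?exponential_pdf_ge0// ltW.
- apply/measurable_EFinP; apply: measurable_funM => //.
  exact: measurable_exponential_pdf.
under [X in (_ + X)%E]eq_integral do rewrite EFinM.
rewrite ge0_integralZl_EFin//; last 2 first.
- by move=> t _; rewrite lee_fin exponential_pdf_ge0// ltW.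
- by apply/measurable_EFinP; exact: measurable_exponential_pdf.
rewrite integral_exponential_pdf// mule1.
rewrite (_ : (\int[mu]_t _ = \int[mu]_(t in `]0%R, 1%R]) (t `^ (a - 1))%:E)%E).
  by rewrite integral_powR// ?ltry//; lra.
rewrite [RHS]integral_mkcond; apply: eq_integral => t _.
by rewrite patchE indicE; case: ifPn; rewrite ?mulr1 ?mulr0.
Qed.

(** Only the mass over ]A, A + 1] is kept. With [A] free, this makes Gamma outgrow every geometric
    sequence, as the convergence of the Mittag-Leffler series requires. *)
Lemma EGamma_ge (a A : R) : 0 < A ->
  ((A `^ a * expR (- (A + 1)))%:E <= EGamma (a + 1))%E \/ a < 0.
Proof.
move=> A0; have [a0|?] := leP 0 a; [left|by right].
rewrite (@le_trans _ _ (\int[mu]_(t in `]A, (A + 1)%R]) (A `^ a * expR (- (A + 1)))%:E)%E)//.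
  rewrite integral_cst//= lebesgue_measure_itv /= lte_fin ltrDl ltr01.
  by rewrite -EFinD addrAC subrr add0r mule1.
rewrite /EGamma integral_mkcond; apply: ge0_integral_mono => t _.
  by apply: erestrict_ge0 => ? _; rewrite lee_fin mulr_ge0 ?powR_ge0 ?expR_ge0.
rewrite patchE mem_setE in_itv /=; case: ifPn; last first.
  by rewrite lee_fin mulr_ge0 ?ppow_ge0 ?expR_ge0.
move=> /andP[At tA]; rewrite lee_fin ler_pM ?powR_ge0 ?expR_ge0//.
  rewrite /ppow (lt_trans A0 At) addrK ge0_ler_powR ?nnegrE// ltW//.
  exact: lt_trans At.
by rewrite ler_expR lerN2.
Qed.

Lemma EGamma_gt0 (a : R) : 0 < a -> (0 < EGamma a)%E.
Proof.
move=> a0; rewrite (@lt_le_trans _ _ ((expR (- 1) * (1 / a))%:E))//.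
  by rewrite lte_fin mulr_gt0 ?expR_gt0 ?divr_gt0.
rewrite (@le_trans _ _ ((expR (- 1))%:E * \int[mu]_(t in `]0%R, 1%R]) (t `^ (a - 1))%:E)%E)//.
  rewrite integral_powR//; last lra.
  by rewrite subrK powR1 -EFinM.
rewrite -ge0_integralZl_EFin ?expR_ge0//; last 2 first.
- by move=> t _; rewrite lee_fin powR_ge0.
- by apply: measurable_funTS; apply/measurable_EFinP; exact: measurable_powR.
rewrite /EGamma integral_mkcond; apply: ge0_integral_mono => t _.
  by apply: erestrict_ge0 => ? _; rewrite -EFinM lee_fin mulr_ge0 ?powR_ge0 ?expR_ge0.
rewrite patchE mem_setE in_itv /=; case: ifPn; last first.
  by rewrite lee_fin mulr_ge0 ?ppow_ge0 ?expR_ge0.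
move=> /andP[t0 t1]; rewrite -EFinM lee_fin mulrC ler_pM ?powR_ge0 ?expR_ge0//.
  by rewrite /ppow t0.
by rewrite ler_expR lerN2.
Qed.

Lemma EGammaE (a : R) : 0 < a -> EGamma a = (Gamma a)%:E.
Proof.
move=> a0; rewrite GammaE fineK// ge0_fin_numE ?EGamma_lty//.
exact: ltW (EGamma_gt0 a0).
Qed.

Lemma Gamma_gt0 (a : R) : 0 < a -> 0 < @Gamma R a.
Proof. by move=> a0; rewrite -lte_fin -EGammaE// EGamma_gt0. Qed.

Lemma Gamma_ge (a A : R) : 0 <= a -> 0 < A ->
  A `^ a * expR (- (A + 1)) <= Gamma (a + 1).
Proof.
move=> a0 A0; have [|] := EGamma_ge a A0; last by rewrite ltNge a0.
by rewrite EGammaE ?lee_fin// ltr_wpDl.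
Qed.

Lemma Gamma1 : Gamma 1 = 1 :> R.
Proof.
apply: EFin_inj; rewrite -EGammaE//.
rewrite -(@integral_exponential_pdf R 1)//.
rewrite /EGamma; apply: ae_eq_integral => //.
- by apply/measurable_EFinP; exact: mgam.
- by apply/measurable_EFinP; exact: measurable_exponential_pdf.
- exists [set 0]; split => //; first exact: lebesgue_measure_set1.
  move=> t /= ht; apply: contrapT => /eqP t0; apply: ht => _; congr EFin.
  rewrite /ppow subrr powRr0; case: ifPn => h.
    by rewrite exponential_pdfE ?ltW// mulN1r.
  by rewrite lt0_exponential_pdf ?mul0r// lt_neqAle t0 leNgt.
Qed.

(* Euler's product [Gamma a * Gamma b], computed along the lines [s + r = t]. *)
Lemma conv_ppow (a b t : R) : 0 < a -> 0 < b -> 0 < t ->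
  (\int[mu]_s (ppow a s * ppow b (t - s))%:E =
   (t `^ (a + b - 1) * (Gamma a * Gamma b / Gamma (a + b)))%:E)%E.
Proof.
move=> a0 b0 t0; have ab0 : 0 < a + b by exact: addr_gt0.
pose Cv t := (\int[mu]_s (ppow a s * ppow b (t - s))%:E)%E.
have mab u : measurable_fun setT (fun s : R => ppow a s * ppow b (u - s)).
  apply: measurable_funM; first exact: measurable_ppow.
  apply: measurableT_comp; first exact: measurable_ppow.
  exact: measurable_funB.
have ab_ge0 u s : (0 <= (ppow a s * ppow b (u - s))%:E)%E.
  by rewrite lee_fin mulr_ge0 ?ppow_ge0.
(* Scaling makes the convolution homogeneous of degree a + b - 1, so only its value at 1 is unknown;
   [key] determines that value. *)
have CvE u : 0 < u -> Cv u = ((u `^ (a + b - 1))%:E * Cv 1%R)%E.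
  move=> u0; rewrite /Cv.
  rewrite -[LHS](@ge0_integral_scale _ (fun s : R => (ppow a s * ppow b (u - s))%:E) u u0);
    [|by apply/measurable_EFinP; exact: mab|by move=> s; exact: ab_ge0].
  have E s : ((ppow a (u * s) * ppow b (u - u * s))%:E =
      (u `^ (a - 1) * u `^ (b - 1))%:E * (ppow a s * ppow b (1 - s))%:E)%E.
    by rewrite -{2}(mulr1 u) -mulrBr !ppowM// mulrACA EFinM.
  under eq_integral do rewrite E.
  rewrite ge0_integralZl_EFin ?mulr_ge0 ?powR_ge0//; last by apply/measurable_EFinP; exact: mab.
  rewrite muleA -EFinM; congr ((_)%:E * _)%E.
  rewrite -powRD; last by rewrite (gt_eqF u0) implybT.
  rewrite -[X in X * _](powRr1 (ltW u0)) -powRD; last by rewrite (gt_eqF u0) implybT.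
  by congr (_ `^ _); ring.
have Cv0 u : u <= 0 -> Cv u = 0%E.
  move=> u0; apply: integral0_eq => s _; congr EFin.
  rewrite /ppow; case: ifPn => s0; rewrite ?mul0r//.
  by rewrite subr_gt0 ifF ?mulr0//; apply/negbTE; rewrite -leNgt; lra.
have mg2 : measurable_fun [set: measurableTypeR R * measurableTypeR R]
    (fun z : R * R => ((ppow a z.1 * ppow b (z.2 - z.1)) * expR (- z.2))%:E).
  apply/measurable_EFinP; apply: measurable_funM; last first.
    by apply: measurableT_comp => //; apply: measurableT_comp => //.
  apply: measurable_funM.
    by apply: measurableT_comp => //; exact: measurable_ppow.
  apply: measurableT_comp; first exact: measurable_ppow.
  by apply: measurable_funB.
have key : (EGamma a * EGamma b = Cv 1%R * EGamma (a + b))%E.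
  transitivity (\int[mu]_s \int[mu]_u ((ppow a s * ppow b (u - s)) * expR (- u))%:E)%E.
    rewrite {1}/EGamma -ge0_integralZr//; last 3 first.
    - by apply/measurable_EFinP; exact: mgam.
    - by move=> s _; rewrite lee_fin mulr_ge0 ?ppow_ge0 ?expR_ge0.
    - exact: ltW (EGamma_gt0 b0).
    apply: eq_integral => s _.
    rewrite -(@ge0_integral_shift _ _ s); last 2 first.
    - apply/measurable_EFinP; apply: measurable_funM; last first.
        by apply: measurableT_comp => //.
      apply: measurable_funM => //.
      apply: measurableT_comp; first exact: measurable_ppow.
      exact: measurable_funB.
    - by move=> x; rewrite lee_fin !mulr_ge0 ?ppow_ge0 ?expR_ge0.
    rewrite /EGamma -ge0_integralZl_EFin ?mulr_ge0 ?ppow_ge0 ?expR_ge0//; last 2 first.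
    - by move=> x _; rewrite lee_fin mulr_ge0 ?ppow_ge0 ?expR_ge0.
    - by apply/measurable_EFinP; exact: mgam.
    apply: eq_integral => x _; rewrite -EFinM; congr EFin.
    by rewrite addrK opprD expRD; ring.
  transitivity (\int[mu]_u \int[mu]_s ((ppow a s * ppow b (u - s)) * expR (- u))%:E)%E.
    apply: (fubini_tonelli (m1 := mu) (m2 := mu) (fun z : measurableTypeR R * measurableTypeR R =>
        ((ppow a z.1 * ppow b (z.2 - z.1)) * expR (- z.2))%:E)) => //.
    by move=> z; rewrite lee_fin !mulr_ge0 ?ppow_ge0 ?expR_ge0.
  transitivity (\int[mu]_u (Cv 1%R * (ppow (a + b) u * expR (- u))%:E))%E; last first.
    rewrite ge0_integralZl//.
    - by apply/measurable_EFinP; exact: mgam.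
    - by move=> s _; rewrite lee_fin mulr_ge0 ?ppow_ge0 ?expR_ge0.
    - by apply: integral_ge0 => s _; exact: ab_ge0.
  apply: eq_integral => u _ /=.
  under eq_integral do rewrite EFinM.
  rewrite ge0_integralZr ?lee_fin ?expR_ge0//; last by apply/measurable_EFinP; exact: mab.
  rewrite -/(Cv u) /ppow; case: ifPn => u0.
    by rewrite CvE// EFinM muleA [(_ * Cv 1%R)%E]muleC.
  by rewrite Cv0 ?mul0e ?mul0r ?mule0// leNgt.
rewrite -/(Cv t) (CvE _ t0) [RHS]EFinM; congr (_ * _)%E.
move: key; rewrite !EGammaE// -EFinM.
have := Gamma_gt0 ab0.
(* Finiteness of [Cv 1] has not been shown so far; infinite values contradict [key], whose left side
   is finite. *)
case: (Cv 1%R) => [r| |] G0.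
- by rewrite -EFinM => -[->]; congr EFin; rewrite mulfK// gt_eqF.
- by rewrite gt0_mulye ?lte_fin.
- by rewrite gt0_mulNye ?lte_fin.
Qed.

End gamma.

Local Opaque Gamma.

(** * Volterra equations with the fractional integral kernel *)

Section volterra.
Context {R : realType}.
Notation mu := (@lebesgue_measure R).
Variable alpha : R.
Hypothesis a0 : 0 < alpha.
Hypothesis a1 : alpha < 1.

Let G0 : 0 < @Gamma R alpha. Proof. exact: Gamma_gt0. Qed.

(** Kernel of the Riemann-Liouville fractional integral of order [alpha]; [kconv] is that
    integral. *)
Definition kern (x : R) : R := ppow alpha x / Gamma alpha.

Definition kconv (w : R -> R) (t : R) : R :=
  \int[mu]_(s in `]0, t[) (kern (t - s) * w s).

Lemma kern_ge0 x : 0 <= kern x.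
Proof. by rewrite divr_ge0 ?ppow_ge0// ltW. Qed.

Lemma kern_gt0 x : 0 < x -> 0 < kern x.
Proof. by move=> x0; rewrite divr_gt0 ?ppow_gt0. Qed.

Lemma measurable_kern : measurable_fun setT kern.
Proof. by apply: measurable_funM => //; exact: measurable_ppow. Qed.

Lemma measurable_kernB (t : R) : measurable_fun setT (fun s : R => kern (t - s)).
Proof.
by apply: measurableT_comp; [exact: measurable_kern|exact: measurable_funB].
Qed.

Lemma kern_le x y : 0 < x -> x <= y -> kern y <= kern x.
Proof.
move=> x0 xy; have y0 := lt_le_trans x0 xy.
rewrite ler_pM2r ?invr_gt0// /ppow x0 y0.
have E z : z `^ (alpha - 1) = (z `^ (1 - alpha))^-1 by rewrite -powRN opprB.
rewrite !E lef_pV2 ?posrE ?powR_gt0//.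
by apply: ge0_ler_powR; rewrite ?nnegrE ?(ltW x0) ?(ltW y0) ?subr_ge0 ?(ltW a1).
Qed.

(* log-convexity of the kernel *)
Lemma kern_cross (s t t0 u : R) : s < t -> t < t0 -> 0 <= s -> 0 < u ->
  kern (t0 - s) * kern (t + u) <= kern (t - s) * kern (t0 + u).
Proof.
move=> st tt0 s0 u0.
(* The kernel is multiplicative up to Gamma(alpha) and decreasing, so the claim becomes (t - s)(t0 +
   u) <= (t0 - s)(t + u); the gap is (t0 - t)(s + u). *)
have k2 x y : 0 < x -> 0 < y ->
    kern x * kern y = kern (x * y) / Gamma alpha.
  move=> x0 y0; rewrite /kern /ppow x0 y0 mulr_gt0// powRM ?(ltW x0) ?(ltW y0)//.
  by field; rewrite gt_eqF.
rewrite !k2; [|lra..].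
rewrite ler_pM2r ?invr_gt0//; apply: kern_le; first by apply: mulr_gt0; lra.
nra.
Qed.

Lemma integral_kern (b t : R) : 0 < b -> 0 < t ->
  (\int[mu]_(s in `]0%R, t[) (kern (t - s) * ppow b s)%:E =
   (t `^ (alpha + b - 1) * (Gamma b / Gamma (alpha + b)))%:E)%E.
Proof.
move=> b0 t0; rewrite integral_mkcond.
transitivity (((Gamma alpha)^-1)%:E *
    \int[mu]_s (ppow b s * ppow alpha (t - s))%:E)%E.
  rewrite -ge0_integralZl_EFin ?invr_ge0 ?(ltW G0)//; last 2 first.
  - by move=> s _; rewrite lee_fin mulr_ge0 ?ppow_ge0.
  - apply/measurable_EFinP; apply: measurable_funM; first exact: measurable_ppow.
    apply: measurableT_comp; first exact: measurable_ppow.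
    exact: measurable_funB.
  apply: eq_integral => s _; rewrite patchE mem_setE in_itv /=.
  case: ifPn => [_|]; first by rewrite -EFinM /kern; congr EFin; ring.
  rewrite negb_and -EFinM => /orP[] h; congr EFin.
    by rewrite /ppow (negbTE h) mul0r mulr0.
  by rewrite {2}/ppow ifF ?mulr0 ?mulr0//; apply/negbTE; rewrite subr_gt0.
rewrite conv_ppow// -EFinM; congr EFin; rewrite [b + alpha]addrC.
have := gt_eqF G0; have := gt_eqF (Gamma_gt0 (addr_gt0 a0 b0)).
move: (Gamma alpha) (Gamma (alpha + b)) (Gamma b) => x y z y0 x0.
by field; rewrite x0 y0.
Qed.

Lemma integrable_kern (b t : R) : 0 < b -> 0 < t ->
  mu.-integrable `]0, t[ (EFin \o (fun s : R => kern (t - s) * ppow b s)).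
Proof.
move=> b0 t0; apply: ge0_integrable => //.
- apply: measurable_funTS; apply: measurable_funM; last exact: measurable_ppow.
  exact: measurable_kernB.
- by move=> s _; rewrite mulr_ge0 ?ppow_ge0 ?kern_ge0.
- by rewrite integral_kern// ltry.
Qed.

Definition kint (t : R) := t `^ alpha / Gamma (alpha + 1).

Lemma integral_kern1 t : 0 < t ->
  (\int[mu]_(s in `]0%R, t[) (kern (t - s))%:E = (kint t)%:E)%E.
Proof.
move=> t0; have := @integral_kern 1 t ltr01 t0.
rewrite Gamma1 addrK mul1r => <-; apply: eq_integral => s.
rewrite inE /= in_itv /= => /andP[s0 _].
by rewrite /ppow s0 subrr powRr0 mulr1.
Qed.

Lemma integral_kern_tail (c t : R) : c < t ->
  (\int[mu]_(s in `]c, t[) (kern (t - s))%:E = (kint (t - c))%:E)%E.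
Proof.
move=> ct; rewrite -integral_kern1; last by rewrite subr_gt0.
rewrite [LHS]integral_mkcond [RHS]integral_mkcond.
rewrite -(@ge0_integral_shift _ _ c); last 2 first.
- apply/(measurable_restrictT _ _).1; first exact: measurable_itv.
  by apply/measurable_EFinP; apply: measurable_funTS; exact: measurable_kernB.
- by move=> x; apply: erestrict_ge0 => ? _; rewrite lee_fin kern_ge0.
apply: eq_integral => x _; rewrite !patchE !mem_setE !in_itv /=.
have -> : t - (x + c) = t - c - x by ring.
by rewrite ltrDr -ltrBrDr.
Qed.

Lemma integrable_kern1 t : 0 < t ->
  mu.-integrable `]0, t[ (EFin \o (fun s : R => kern (t - s))).
Proof.
move=> t0; apply: eq_integrable (@integrable_kern 1 t ltr01 t0) => //= s.
rewrite inE /= in_itv /= => /andP[s0 _].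
by rewrite /ppow s0 subrr powRr0 mulr1.
Qed.

Lemma continuous_bounded_itv (w : R -> R) (a b : R) : a <= b -> continuous w ->
  exists2 B, 0 < B & forall x, a <= x <= b -> `|w x| <= B.
Proof.
move=> ab cw.
have cn : {within `[a, b], continuous (fun x => `|w x|)}.
  apply: continuous_subspaceT => x; apply: continuous_comp; first exact: cw.
  exact: norm_continuous.
have [c _ cP] := EVT_max ab cn.
exists (`|w c| + 1); first by rewrite ltr_wpDl.
move=> x xab; rewrite ler_wpDr//; apply: cP; rewrite in_itv /= xab //.
Qed.

Lemma integrable_kconv (w : R -> R) (t0 t : R) : 0 < t -> t <= t0 -> continuous w ->
  mu.-integrable `]0, t[ (EFin \o (fun s : R => kern (t0 - s) * w s)).
Proof.
move=> t0p tt0 cw; have t00 := lt_le_trans t0p tt0.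
have [B B0 wB] := continuous_bounded_itv (ltW t00) cw.
have mw : measurable_fun setT w by exact: continuous_measurable_fun.
have iB : mu.-integrable `]0, t0[ (EFin \o (fun s : R => B * kern (t0 - s))).
  exact: (integrableZl _ B (integrable_kern1 t00)).
have : mu.-integrable `]0, t[ (EFin \o (fun s : R => B * kern (t0 - s))).
  apply: integrableS iB => //.
  by move=> x /=; rewrite !in_itv /= => /andP[-> /lt_le_trans ->].
apply: le_integrable => //.
  apply: measurable_funTS; apply/measurable_EFinP; apply: measurable_funM => //.
  exact: measurable_kernB.
move=> x; rewrite /= in_itv /= => /andP[x0 xt].
rewrite lee_fin !normrM mulrC; apply: ler_pM => //.
rewrite [leRHS]gtr0_norm//; apply: wB; rewrite (ltW x0) /=.
by rewrite (le_trans (ltW xt)).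
Qed.

(* At the first zero [t0] of [w], log-convexity bounds the part of the
   convolution over ]0, t[ and leaves too little mass on ]t, t0[. *)
Lemma volterra_gt0 (w p : R -> R) :
  continuous w -> 0 < w 0 ->
  (forall t, 0 < t -> w t + kconv w t = p t) ->
  (forall t, 0 < t -> 0 < p t) ->
  (exists B, forall t, 0 < t -> p t <= B) ->
  (forall s t t0, 0 < s -> s < t -> t < t0 ->
     kern (t0 - s) * p t <= kern (t - s) * p t0) ->
  forall t, 0 <= t -> 0 < w t.
Proof.
have ha0 := a0; have ha1 := a1.
move=> cw w0 eqw p0 [B pB] cross t1 t10; rewrite ltNge; apply/negP => wt1.
pose E := `[0, t1]%classic `&` [set t | w t <= 0].
have cE : compact E.
  apply: compact_closedI; first exact: segment_compact.
  by apply: (@closed_comp _ _ w [set x | x <= 0]) => [x _|]; [exact: cw|exact: closed_le].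
have E0 : E !=set0 by exists t1; split => //=; rewrite in_itv /= t10 lexx.
(* [t0] is the first time at which [w] is not positive; it exists because [E] is compact. *)
have [t0 []] := @compact_EVT_min _ _ id E E0 cE (continuous_subspaceT (fun x => cvg_id)).
rewrite inE /E /= in_itv /= => -[/andP[t0_ge0 t01] wt0] t0min.
have wpos t : 0 <= t -> t < t0 -> 0 < w t.
  move=> tge tlt; rewrite ltNge; apply/negP => wt.
  have /t0min : t \in E.
    by rewrite inE; split => //=; rewrite in_itv /= tge (le_trans (ltW tlt)).
  by rewrite leNgt tlt.
have t0p : 0 < t0.
  by rewrite lt_neqAle t0_ge0 andbT; apply/eqP => t00; move: wt0; rewrite -t00 leNgt w0.
have pt0 := p0 _ t0p.
have B0 : 0 < B by apply: lt_le_trans pt0 (pB _ t0p).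
have Ga1 : 0 < @Gamma R (alpha + 1) by apply: Gamma_gt0; lra.
pose c0 := p t0 * Gamma (alpha + 1) / B.
have c0p : 0 < c0 by rewrite divr_gt0// mulr_gt0.
(* Below [dl] the kernel mass satisfies B kint(t) < p(t0); equality would hold where t^alpha =
   [c0]. *)
pose dl := Num.min (t0 / 2) ((c0 / 2) `^ alpha^-1).
have dl0 : 0 < dl by rewrite lt_min divr_gt0//= powR_gt0// divr_gt0.
have dlt : dl < t0 by rewrite gt_min; apply/orP; left; lra.
have kdl t : 0 < t -> t <= dl -> B * kint t < p t0.
  move=> tp tdl; rewrite /kint mulrA ltr_pdivrMr// mulrC -ltr_pdivlMr// -/c0.
  apply: (@le_lt_trans _ _ (((c0 / 2) `^ alpha^-1) `^ alpha)); last first.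
    by rewrite -powRrM mulVf ?gt_eqF// powRr1; lra.
  apply: ge0_ler_powR; rewrite ?nnegrE ?powR_ge0 ?(ltW a0) ?(ltW tp)//.
  by apply: le_trans tdl _; rewrite ge_min lexx orbT.
have tdl : t0 - dl <= t0 by rewrite gerBl ltW.
(* [c] maximises [w] on the last window of length [dl], so that w <= w(c) on ]c, t0[ controls the
   recent part [I2]. *)
have [c cin cmax] := EVT_max tdl (continuous_subspaceT cw).
move: cin; rewrite in_itv /= => /andP[c1 c2].
have wc : 0 < w c.
  apply: lt_le_trans (cmax (t0 - dl) _); last by rewrite in_itv /= lexx; lra.
  by apply: wpos; lra.
have ct0 : c < t0.
  rewrite lt_neqAle c2 andbT; apply/eqP => ct; move: wc; rewrite ct ltNge wt0 //.
have cp : 0 < c by lra.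
pose I1 := \int[mu]_(s in `]0, c[) (kern (t0 - s) * w s).
pose I2 := \int[mu]_(s in `]c, t0[) (kern (t0 - s) * w s).
have int0 : mu.-integrable `]0, t0[ (EFin \o (fun s : R => kern (t0 - s) * w s)).
  by apply: integrable_kconv.
have I12 : kconv w t0 = I1 + I2.
  rewrite /I1 Rintegral_itv_bndo_bndc; last exact: integrable_kconv.
  have := @Rintegral_itvB _ _ _ _ c int0; rewrite !bnd_simp => /(_ (ltW cp) ct0).
  by rewrite -/I2 => <-; rewrite addrC subrK.
have H1 : p c * I1 <= p t0 * kconv w c.
  rewrite /I1 /kconv -!RintegralZl//; [|exact: integrable_kconv..].
  apply: le_Rintegral => //.
  - by apply: (integrableZl _ (p c) (integrable_kconv cp (ltW ct0) cw)).
  - by apply: (integrableZl _ (p t0) (integrable_kconv cp (lexx _) cw)).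
  - move=> x; rewrite /= in_itv /= => /andP[x0 xc].
    have wx : 0 < w x by apply: wpos; lra.
    have := ler_wpM2r (ltW wx) (cross _ _ _ x0 xc ct0).
    by rewrite mulrAC [leRHS]mulrAC [X in X <= _]mulrC [X in _ <= X]mulrC.
have tc0 : 0 < t0 - c by lra.
have H2 : I2 <= w c * kint (t0 - c).
  have -> : kint (t0 - c) = \int[mu]_(s in `]c, t0[) kern (t0 - s).
    by rewrite /Rintegral integral_kern_tail.
  have sub : (`]c, t0[%classic : set R) `<=` `]0, t0[%classic.
    by move=> x /=; rewrite !in_itv /= => /andP[/(lt_trans cp) -> ->].
  have ik : mu.-integrable `]c, t0[ (EFin \o (fun s : R => kern (t0 - s))).
    by apply: integrableS (integrable_kern1 t0p).
  rewrite /I2 -RintegralZl//; apply: le_Rintegral => //.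
  - by apply: integrableS int0.
  - exact: (integrableZl _ (w c) ik).
  - move=> x; rewrite /= in_itv /= => /andP[cx xt].
    rewrite mulrC; apply: ler_wpM2r; first exact: kern_ge0.
    by apply: cmax; rewrite in_itv /= (ltW xt) andbT; lra.
(* Since w(t0) <= 0, the convolution at t0 is at least p(t0). Hence p(c) p(t0) <= p(c) (I1 + I2) <=
   p(t0) (p(c) - w(c)) + p(c) w(c) kint(t0 - c) < p(t0) p(c), a contradiction. *)
have e0 := eqw _ t0p; have ec := eqw _ cp.
have pc := p0 _ cp; have pcB := pB _ cp.
have tcd : t0 - c <= dl by rewrite lerBlDl -lerBlDr.
have k1 := kdl _ tc0 tcd.
have kge : 0 <= kint (t0 - c) by rewrite divr_ge0 ?powR_ge0// ltW.
have h3 : p c * I2 <= p c * (w c * kint (t0 - c)) by rewrite ler_wpM2l// ltW.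
have h4 : w c * (p c * kint (t0 - c)) <= w c * (B * kint (t0 - c)).
  by rewrite ler_wpM2l ?(ltW wc)// ler_wpM2r.
have h5 : w c * (B * kint (t0 - c)) < w c * p t0 by rewrite ltr_pM2l.
have h6 : p c * p t0 <= p c * (I1 + I2).
  by rewrite ler_wpM2l ?(ltW pc)//; lra.
have h7 : p t0 * kconv w c = p t0 * p c - p t0 * w c by rewrite -ec; ring.
lra.
Qed.

End volterra.

Local Opaque Gamma.

(** * The Mittag-Leffler function and its Volterra equation *)

Section mittag_leffler.
Context {R : realType}.
Notation mu := (@lebesgue_measure R).
Variable alpha : R.
Hypothesis a0 : 0 < alpha.
Hypothesis a1 : alpha < 1.

Let ja_gt0 (j : nat) : 0 < j%:R * alpha + 1.
Proof. by rewrite ltr_wpDl// mulr_ge0// ltW. Qed.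

Let mlc (j : nat) : R := (Gamma (j%:R * alpha + 1))^-1.

Let mlc_gt0 j : 0 < mlc j.
Proof. by rewrite invr_gt0 Gamma_gt0. Qed.

(** [Gamma_ge] with A = Y^(1/alpha) bounds Y^j / Gamma(j alpha + 1) by exp(A + 1). As X <= Y / 2,
    the series is dominated by a geometric one of ratio 1/2. *)
Let mlc_cvg (X : R) : 0 <= X -> cvgn (series (fun j => X ^+ j * mlc j)).
Proof.
move=> X0.
pose Y := 2 * X + 1; have Y0 : 0 < Y by rewrite ltr_wpDl// mulr_ge0.
pose A := Y `^ alpha^-1; have A0 : 0 < A by rewrite powR_gt0.
have AY : A `^ alpha = Y by rewrite -powRrM mulVf ?gt_eqF// powRr1// ltW.
apply: (@series_le_cvg _ _ (geometric (expR (A + 1)) 2^-1)).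
- by move=> j; rewrite mulr_ge0 ?exprn_ge0 ?(ltW (mlc_gt0 _)).
- by move=> j; rewrite /geometric /= mulr_ge0 ?expR_ge0 ?exprn_ge0.
- move=> j; rewrite /geometric /=.
  have jge : 0 <= j%:R * alpha by rewrite mulr_ge0// ltW.
  have GA := Gamma_ge jge A0.
  have AE : A `^ (j%:R * alpha) = Y ^+ j.
    by rewrite mulrC powRrM AY powR_mulrn// ltW.
  rewrite AE in GA.
  have YG : Y ^+ j * mlc j <= expR (A + 1).
    rewrite /mlc ler_pdivrMr ?Gamma_gt0//.
    rewrite -ler_pdivrMl ?expR_gt0// mulrC -expRN; exact: GA.
  apply: (@le_trans _ _ ((2^-1 * Y) ^+ j * mlc j)).
    rewrite ler_wpM2r ?(ltW (mlc_gt0 _))// lerXn2r ?nnegrE//; rewrite /Y; lra.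
  rewrite exprMn [leRHS]mulrC -mulrA; exact: ler_wpM2l.
- by apply: is_cvg_geometric_series; rewrite ger0_norm//; lra.
Qed.

Let mlp (n : nat) (x : R) : R := series (fun k => x ^+ k / Gamma (k%:R * alpha + 1)) n.

(** Tail of the majorant series; it bounds the error of the partial sums uniformly for |x| <= X. *)
Let rem (X : R) (n : nat) : R :=
  limn (series (fun j => X ^+ j * mlc j)) - series (fun j => X ^+ j * mlc j) n.

Let rem_cvg (X : R) : 0 <= X -> rem X @ \oo --> 0.
Proof.
move=> X0; rewrite /rem.
rewrite -[X in _ --> X](subrr (limn (series (fun j => X ^+ j * mlc j)))).
by apply: cvgB; [exact: cvg_cst|exact: mlc_cvg].
Qed.

Let ml_cvg (x : R) : mlp ^~ x @ \oo --> mittag_leffler alpha 1 x.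
Proof.
apply: normed_cvg.
rewrite (_ : [normed _] = series (fun j => `|x| ^+ j * mlc j)); first exact: mlc_cvg.
apply/funext => n; rewrite /series /=; apply: eq_bigr => j _.
by rewrite normrM normrX [X in _ * X](gtr0_norm (mlc_gt0 j)).
Qed.

Let ml_rem (X x : R) n : `|x| <= X ->
  `|mittag_leffler alpha 1 x - mlp n x| <= rem X n.
Proof.
move=> xX; have X0 : 0 <= X by exact: le_trans xX.
have cv : (fun m => `|mlp m x - mlp n x|) @ \oo -->
    `|mittag_leffler alpha 1 x - mlp n x|.
  by apply: cvg_norm; apply: cvgB; [exact: ml_cvg|exact: cvg_cst].
rewrite -(cvg_lim _ cv)//; apply: limr_le; first by apply/cvg_ex; eexists; exact: cv.
have nd : nondecreasing_seq (series (fun j => X ^+ j * mlc j)).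
  apply/nondecreasing_seqP => k; rewrite seriesSr lerDl.
  by rewrite mulr_ge0 ?exprn_ge0 ?(ltW (mlc_gt0 _)).
near=> m.
have nm : (n <= m)%N by near: m; exact: nbhs_infty_ge.
apply: (@le_trans _ _ (series (fun j => X ^+ j * mlc j) m - series (fun j => X ^+ j * mlc j) n)).
  rewrite /mlp !sub_series nm.
  apply: (le_trans (ler_norm_sum _ _ _)); apply: ler_sum => j _.
  rewrite normrM normrX [X in _ * X](gtr0_norm (mlc_gt0 j)).
  by rewrite ler_wpM2r ?(ltW (mlc_gt0 _))// lerXn2r ?nnegrE.
by rewrite /rem lerB//; apply: nondecreasing_cvgn_le nd _ _; exact: mlc_cvg.
Unshelve. all: by end_near. Qed.

Lemma continuous_mittag_leffler : continuous (mittag_leffler alpha 1).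
Proof.
move=> x; apply/cvgrPdist_lt => e e0.
pose X := `|x| + 1; have X0 : 0 <= X by rewrite addr_ge0.
have e3 : 0 < e / 3 by rewrite divr_gt0.
have /cvgr0Pnorm_lt /(_ _ e3)[n _ /(_ n (leqnn _))] := rem_cvg X0.
move=> /= /ltr_normlW remn.
have cp : forall m, continuous (mlp m).
  elim=> [|m IH].
    rewrite (_ : mlp 0 = cst 0); first exact: cst_continuous.
    by apply/funext => y; rewrite /mlp /series /= big_geq.
  rewrite (_ : mlp m.+1 = fun y => mlp m y + y ^+ m / Gamma (m%:R * alpha + 1)).
    move=> y; apply: cvgD; first exact: IH.
    by apply: cvgM; [exact: exprn_continuous|exact: cvg_cst].
  by apply/funext => y; rewrite /mlp seriesSr.
near=> y.
have yX : `|y| <= X.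
  rewrite -[y](subrK x) (le_trans (ler_normD _ _))// addrC lerD2l.
  rewrite distrC ltW//; near: y; apply: cvgr_dist_lt => //.
have h1 := ml_rem n yX.
have xX : `|x| <= X by rewrite lerDl.
have h2 := ml_rem n xX.
have h3 : `|mlp n x - mlp n y| < e / 3.
  by near: y; have /cvgrPdist_lt := cp n x; exact.
rewrite (_ : _ - _ = (mittag_leffler alpha 1 x - mlp n x) + (mlp n x - mlp n y)
   - (mittag_leffler alpha 1 y - mlp n y)); last by ring.
apply: (le_lt_trans (ler_normB _ _)).
apply: (@le_lt_trans _ _ (e / 3 + `|mlp n x - mlp n y| + e / 3)); last lra.
rewrite lerD ?(le_trans h1 (ltW remn))//.
by apply: (le_trans (ler_normD _ _)); rewrite lerD2r (le_trans h2 (ltW remn)).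
Unshelve. all: by end_near. Qed.

Lemma mittag_leffler0 : mittag_leffler alpha 1 0 = 1.
Proof.
apply/cvg_lim => //; rewrite -(cvg_shiftS _ _ ) /=.
rewrite (_ : (fun n => _) = cst 1); first exact: cvg_cst.
apply/funext => n; rewrite /series /= big_nat_recl//= expr0 mul0r add0r Gamma1 divr1.
by rewrite big1 ?addr0// => i _; rewrite exprS mul0r mul0r.
Qed.

(** The power t^alpha continued by 0, hence continuous on the whole line, as [volterra_gt0] asks of
    its solutions. *)
Definition pw (t : R) : R := (Num.max t 0) `^ alpha.

Lemma pwE t : 0 <= t -> pw t = t `^ alpha.
Proof. by move=> t0; rewrite /pw max_l. Qed.

Lemma pw_ge0 t : 0 <= pw t. Proof. exact: powR_ge0. Qed.

Lemma le_pw s t : s <= t -> pw s <= pw t.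
Proof.
move=> st; apply: ge0_ler_powR; first exact: ltW.
- by rewrite nnegrE le_max lexx orbT.
- by rewrite nnegrE le_max lexx orbT.
- by rewrite ge_max !le_max st lexx orbT.
Qed.

Lemma continuous_pw : continuous pw.
Proof.
move=> x; have [x0|x0|<-] := ltgtP 0 x.
- have cx : {for x, continuous (@powR R ^~ alpha)}.
    apply: differentiable_continuous; apply/derivable1_diffP.
    by apply: derivable_powR; rewrite in_itv /= x0.
  apply: (cvg_trans _ (_ : @powR R ^~ alpha y @[y --> x] --> pw x)).
    apply: near_eq_cvg; near=> y; rewrite /pw max_l//.
    by apply: ltW; near: y; exact: lt_nbhsr.
  by rewrite pwE ?(ltW x0)//; exact: cx.
- have E y : y < 0 -> pw y = 0.
    by move=> y0; rewrite /pw max_r ?(ltW y0)// powR0// gt_eqF.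
  apply: (cvg_trans _ (_ : cst 0 y @[y --> x] --> pw x)).
    apply: near_eq_cvg; near=> y; rewrite E//.
    by near: y; exact: lt_nbhsl.
  by rewrite E//; exact: cvg_cst.
- apply/cvgrPdist_lt => e e0.
  rewrite [pw 0]pwE// powR0 ?gt_eqF//.
  have ea : 0 < (e / 2) `^ alpha^-1 by rewrite powR_gt0// divr_gt0.
  near=> y; rewrite sub0r normrN ger0_norm ?pw_ge0//.
  apply: (@le_lt_trans _ _ (pw ((e / 2) `^ alpha^-1))).
    apply: le_pw; apply: ltW; near: y; exact: lt_nbhsl.
  by rewrite pwE ?(ltW ea)// -powRrM mulVf ?gt_eqF// powRr1; lra.
Unshelve. all: by end_near. Qed.

Definition mlv (t : R) : R := mittag_leffler alpha 1 (- pw t).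

Lemma continuous_mlv : continuous mlv.
Proof.
move=> x; apply: (@continuous_comp _ _ _ (fun t => - pw t) (mittag_leffler alpha 1)).
  by apply: continuousN; exact: continuous_pw.
exact: continuous_mittag_leffler.
Qed.

Lemma mlv0 : mlv 0 = 1.
Proof. by rewrite /mlv pwE// powR0 ?gt_eqF// oppr0 mittag_leffler0. Qed.

Let continuous_mlp n : continuous (fun s => mlp n (- pw s)).
Proof.
elim: n => [|m IH].
  rewrite (_ : (fun s => _) = cst 0); first exact: cst_continuous.
  by apply/funext => y; rewrite /mlp /series /= big_geq.
rewrite (_ : (fun s => _) = fun s => mlp m (- pw s) + (- pw s) ^+ m / Gamma (m%:R * alpha + 1)).
  move=> y; apply: cvgD; first exact: IH.
  apply: cvgM; last exact: cvg_cst.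
  apply: (@continuous_comp _ _ _ (fun s => - pw s) (fun z => z ^+ m)).
    by apply: continuousN; exact: continuous_pw.
  exact: exprn_continuous.
by apply/funext => y; rewrite /mlp seriesSr.
Qed.

(** The fractional integral maps s^(n alpha) / Gamma(n alpha + 1) to the same expression with n + 1,
    by the beta integral. On the alternating partial sums this shifts the index and changes the
    sign. *)
Let kconv_mlp n t : 0 < t ->
  kconv alpha (fun s => mlp n (- pw s)) t = 1 - mlp n.+1 (- pw t).
Proof.
move=> t0; elim: n => [|n IH].
  rewrite /kconv /mlp /series /= big_nat1 mul0r add0r expr0 Gamma1 divr1 subrr.
  under eq_Rintegral do rewrite big_geq// mulr0.
  by rewrite /Rintegral integral0.
have ct : continuous (fun s => (- pw s) ^+ n / Gamma (n%:R * alpha + 1)).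
  move=> y; apply: cvgM; last exact: cvg_cst.
  apply: (@continuous_comp _ _ _ (fun s => - pw s) (fun z => z ^+ n)).
    by apply: continuousN; exact: continuous_pw.
  exact: exprn_continuous.
have -> : kconv alpha (fun s => mlp n.+1 (- pw s)) t =
    kconv alpha (fun s => mlp n (- pw s)) t +
    kconv alpha (fun s => (- pw s) ^+ n / Gamma (n%:R * alpha + 1)) t.
  rewrite /kconv -RintegralD//; last 2 first.
  - exact: (integrable_kconv a0 t0 (lexx t) (@continuous_mlp n)).
  - exact: (integrable_kconv a0 t0 (lexx t) ct).
  by apply: eq_Rintegral => s _; rewrite /mlp seriesSr mulrDr.
rewrite IH /mlp [in RHS]seriesSr opprD addrA; congr (_ + _).
have pwn s : 0 < s -> pw s ^+ n = ppow (n%:R * alpha + 1) s.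
  move=> s0; rewrite pwE ?(ltW s0)// /ppow s0 addrK.
  by rewrite mulrC powRrM powR_mulrn// powR_ge0.
have -> : kconv alpha (fun s => (- pw s) ^+ n / Gamma (n%:R * alpha + 1)) t =
    \int[mu]_(s in `]0, t[) (((-1) ^+ n * mlc n) *
       (kern alpha (t - s) * ppow (n%:R * alpha + 1) s)).
  apply: eq_Rintegral => s; rewrite inE /= in_itv /= => /andP[s0 _].
  by rewrite (exprNn (pw s)) pwn// /mlc; ring.
rewrite RintegralZl//; last exact: integrable_kern.
rewrite /Rintegral integral_kern//=.
rewrite pwE ?(ltW t0)// [in RHS](exprNn (t `^ alpha)).
have -> : alpha + (n%:R * alpha + 1) - 1 = alpha * n.+1%:R by rewrite -natr1; ring.
have -> : alpha + (n%:R * alpha + 1) = n.+1%:R * alpha + 1 by rewrite -natr1; ring.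
rewrite powRrM powR_mulrn ?powR_ge0// /mlc !exprS.
have := gt_eqF (Gamma_gt0 (ja_gt0 n)); have := gt_eqF (Gamma_gt0 (ja_gt0 n.+1)).
move: (Gamma (n%:R * alpha + 1)) (Gamma (n.+1%:R * alpha + 1)) => x y y0 x0.
by field; rewrite x0 y0.
Qed.

(** Limit of [kconv_mlp]: on [0, t] the partial sums converge uniformly, with error [rem X n], and
    the kernel has finite mass [kint alpha t]. *)
Lemma volterra_mlv t : 0 < t -> mlv t + kconv alpha mlv t = 1.
Proof.
move=> t0; pose X := pw t; have X0 : 0 <= X by exact: pw_ge0.
have kX s : s <= t -> `|- pw s| <= X.
  by move=> st; rewrite normrN ger0_norm ?pw_ge0// le_pw.
have kle n : `|kconv alpha mlv t - kconv alpha (fun s => mlp n (- pw s)) t|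
    <= rem X n * kint alpha t.
  rewrite /kconv -RintegralB//; last 2 first.
  - exact: (integrable_kconv a0 t0 (lexx t) continuous_mlv).
  - exact: (integrable_kconv a0 t0 (lexx t) (@continuous_mlp n)).
  have cd : continuous (fun s => mlv s - mlp n (- pw s)).
    by move=> s; apply: cvgB; [exact: continuous_mlv|exact: continuous_mlp].
  rewrite (_ : Rintegral _ _ _ = \int[mu]_(s in `]0, t[)
      (kern alpha (t - s) * (mlv s - mlp n (- pw s)))); last first.
    by apply: eq_Rintegral => s _; rewrite mulrBr.
  have id := integrable_kconv a0 t0 (lexx t) cd.
  apply: (le_trans (le_normr_Rintegral _ id)) => //.
  have -> : kint alpha t = \int[mu]_(s in `]0, t[) kern alpha (t - s).
    by rewrite /Rintegral integral_kern1.
  have ik := integrable_kern1 a0 t0.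
  rewrite -RintegralZl//; apply: le_Rintegral => //.
  - exact: (integrable_norm id).
  - exact: (integrableZl _ (rem X n) ik).
  - move=> s; rewrite /= in_itv /= => /andP[s0 st].
    rewrite normrM [X in X * _]ger0_norm ?kern_ge0// mulrC.
    rewrite ler_wpM2r ?kern_ge0//.
    by apply: ml_rem; apply: kX; exact: ltW.
have H n : `|mlv t + kconv alpha mlv t - 1| <= rem X n.+1 + rem X n * kint alpha t.
  have h := kle n; rewrite kconv_mlp// in h.
  have h2 := ml_rem n.+1 (kX t (lexx t)).
  rewrite (_ : _ - 1 = (mlv t - mlp n.+1 (- pw t)) + (kconv alpha mlv t - (1 - mlp n.+1 (- pw t)))); last by ring.
  by apply: (le_trans (ler_normD _ _)); exact: lerD.
have cv : (fun n => rem X n.+1 + rem X n * kint alpha t) @ \oo --> 0.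
  rewrite -[X in _ --> X]addr0; apply: cvgD.
    by rewrite (cvg_shiftS (rem X)); exact: rem_cvg.
  by rewrite -[X in _ --> X](mul0r (kint alpha t)); apply: cvgM; [exact: rem_cvg|exact: cvg_cst].
have : `|mlv t + kconv alpha mlv t - 1| <= 0.
  rewrite -(cvg_lim _ cv)//; apply: limr_ge; first by apply/cvg_ex; eexists; exact: cv.
  by near=> n; exact: H.
by rewrite normr_le0 subr_eq0 => /eqP.
Unshelve. all: by end_near. Qed.

End mittag_leffler.

Local Opaque Gamma.

(** * Positivity, monotonicity and decay of the Mittag-Leffler function *)

Section mittag_leffler_monotone.
Context {R : realType}.
Notation mu := (@lebesgue_measure R).
Variable alpha : R.
Hypothesis a0 : 0 < alpha.
Hypothesis a1 : alpha < 1.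
Notation k := (kern alpha).
Notation v := (mlv alpha).

Let cv : continuous v. Proof. exact: continuous_mlv. Qed.

(** Positivity principle with right-hand side 1, for which the crossing condition is the
    monotonicity of the kernel. *)
Lemma mlv_gt0 t : 0 <= t -> 0 < v t.
Proof.
apply: (@volterra_gt0 _ _ a0 a1 v (cst 1)) => //.
- by rewrite mlv0.
- by move=> {}t; exact: volterra_mlv.
- by exists 1.
- move=> s t1 t0 s0 st tt0; rewrite !mulr1; apply: kern_le => //; lra.
Qed.

Let kv_gt0 (h u : R) : 0 < h -> h <= u ->
  0 < \int[mu]_(s in `]0, h[) (k (u - s) * v s).
Proof.
move=> h0 hu; have ha0 := a0.
have [c cin cmin] := EVT_min (ltW h0) (continuous_subspaceT cv).
move: cin; rewrite in_itv /= => /andP[c1 c2].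
have vc := mlv_gt0 c1.
apply: (@lt_le_trans _ _ (\int[mu]_(s in `]0, h[) (k u * v c))).
  rewrite Rintegral_cst//= lebesgue_measure_itv /= lte_fin h0 -EFinD subr0 /=.
  apply: mulr_gt0 => //; apply: mulr_gt0 => //; apply: kern_gt0 => //.
  exact: lt_le_trans hu.
apply: le_Rintegral; first exact: measurable_itv.
- apply: ge0_integrable => //.
    by move=> s _; apply: mulr_ge0; [exact: kern_ge0|exact: ltW].
  by rewrite integral_cst//= lebesgue_measure_itv /= lte_fin h0 -EFinD -EFinM ltry.
- exact: integrable_kconv.
- move=> s; rewrite /= in_itv /= => /andP[s0 sh].
  apply: ler_pM; [exact: kern_ge0|exact: ltW| |].
    by apply: kern_le => //; lra.
  by apply: cmin; rewrite in_itv /= !ltW.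
Qed.

Lemma mlv_le1 t : 0 <= t -> v t <= 1.
Proof.
rewrite le_eqVlt => /predU1P[<-|t0]; first by rewrite mlv0.
rewrite -(volterra_mlv a0 t0) lerDl.
by apply: ltW; apply: kv_gt0.
Qed.

Let aux (x y z k1 k2 q : R) : x + k1 = 1 -> y + k2 = 1 -> k2 = q + z ->
  x - y + (k1 - z) = q.
Proof. lra. Qed.

(** The difference w(t) = v(t) - v(t + h) solves w + k * w = p, where p(t) is the integral of k(t +
    h - s) v(s) over ]0, h[. This [p] is positive and bounded and inherits the crossing condition
    from [kern_cross], so the positivity principle applies to [w]. *)
Lemma mlv_lt (t h : R) : 0 <= t -> 0 < h -> v (t + h) < v t.
Proof.
move=> t0 h0; rewrite -subr_gt0.
pose w t := v t - v (t + h).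
pose p t := \int[mu]_(s in `]0, h[) (k (t + h - s) * v s).
have cvh : continuous (fun t => v (t + h)).
  by move=> x; apply: (@continuous_comp _ _ _ (fun t => t + h)); [apply: cvgD; [exact: cvg_id|exact: cvg_cst]|exact: cv].
have cw : continuous w by move=> x; apply: cvgB; [exact: cv|exact: cvh].
have ip u : h <= u -> mu.-integrable `]0, h[ (EFin \o (fun s : R => k (u - s) * v s)).
  by move=> hu; apply: integrable_kconv.
rewrite -/(w t); apply: (volterra_gt0 a0 a1 cw _ _ _ _ _ t0).
- rewrite /w add0r mlv0// subr_gt0 -(volterra_mlv a0 h0) ltrDl.
  exact: kv_gt0.
- move=> {t0} {}t t0; rewrite /w.
  have th0 : 0 < t + h by rewrite addr_gt0.
  have E1 := volterra_mlv a0 t0; have E2 := volterra_mlv a0 th0.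
  have -> : kconv alpha (fun t => v t - v (t + h)) t =
      kconv alpha v t - kconv alpha (fun t => v (t + h)) t.
    rewrite /kconv -RintegralB//; [|exact: integrable_kconv..].
    by apply: eq_Rintegral => s _; rewrite mulrBr.
  (* The convolution at t + h is cut at [h]: the early part is p(t), and the late one, translated by
     [h], is the convolution of the shifted function. *)
  suff E3 : kconv alpha v (t + h) = p t + kconv alpha (fun t => v (t + h)) t.
    exact: aux E1 E2 E3.
  have it : mu.-integrable `]0, (t + h)[ (EFin \o (fun s : R => k (t + h - s) * v s)).
    exact: integrable_kconv.
  have htp : h < t + h by rewrite ltrDr.
  have HB := @Rintegral_itvB _ _ _ _ h it.
  rewrite !bnd_simp in HB; have {}HB := HB (ltW h0) htp.
  rewrite -Rintegral_itv_bndo_bndc in HB; last by apply: ip; exact: ltW.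
  have {}HB : kconv alpha v (t + h) =
      \int[mu]_(s in `]h, (t + h)[) (k (t + h - s) * v s) + p t.
    by apply/eqP; rewrite -subr_eq; apply/eqP.
  apply: etrans HB (etrans (addrC _ _) (congr1 (+%R (p t)) _)).
  rewrite /kconv; apply: (congr1 fine).
  rewrite [LHS]integral_mkcond [RHS]integral_mkcond.
  apply: etrans (esym (integral_shift h _)) _; last first.
    apply: eq_integral => x _; rewrite !patchE !mem_setE !in_itv /=.
    by rewrite ltrDr ltrD2r (_ : t + h - (x + h) = t - x)//; ring.
  apply/(measurable_restrictT _ _).1; first exact: measurable_itv.
  apply/measurable_EFinP; apply: measurable_funTS; apply: measurable_funM.
    exact: measurable_kernB.
  exact: continuous_measurable_fun.
- by move=> {t0} {}t t0; apply: kv_gt0 => //; lra.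
- exists (p 0) => {t0} {}t t0; apply: le_Rintegral; first exact: measurable_itv.
  + by apply: ip; lra.
  + by apply: ip; lra.
  + move=> s; rewrite /= in_itv /= => /andP[s0 sh].
    apply: ler_wpM2r; first by apply: ltW; apply: mlv_gt0; exact: ltW.
    by apply: kern_le => //; lra.
- move=> s {t0} {}t t0 s0 st tt0.
  have hth : h <= t + h by lra.
  have hth0 : h <= t0 + h by lra.
  rewrite -[leLHS]RintegralZl; [|exact: measurable_itv|exact: ip].
  rewrite -[leRHS]RintegralZl; [|exact: measurable_itv|exact: ip].
  apply: le_Rintegral; first exact: measurable_itv.
  + exact: (integrableZl _ _ (ip _ hth)).
  + exact: (integrableZl _ _ (ip _ hth0)).
  + move=> x; rewrite /= in_itv /= => /andP[x0 xh].
    have hx : 0 < h - x by rewrite subr_gt0.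
    have vx : 0 <= v x by apply: ltW; apply: mlv_gt0; exact: ltW.
    have := kern_cross a0 a1 st tt0 (ltW s0) hx; rewrite !addrA => hc.
    have := ler_wpM2r vx hc.
    by rewrite -[X in X <= _]mulrA -[X in _ <= X]mulrA.
Qed.

Lemma mlv_le (s t : R) : 0 <= s -> s <= t -> v t <= v s.
Proof.
move=> s0; rewrite le_eqVlt => /predU1P[->//|st].
by rewrite -[t](subrK s) addrC; apply/ltW/mlv_lt => //; rewrite subr_gt0.
Qed.

(** Since [v] decreases, v(t) kint(t) is at most the convolution at t, which is 1 - v(t). *)
Lemma mlv_decay t : 0 <= t -> v t * t `^ alpha <= Gamma (alpha + 1).
Proof.
have ha0 := a0.
have G1 : 0 < @Gamma R (alpha + 1) by apply: Gamma_gt0; rewrite addr_gt0.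
rewrite le_eqVlt => /predU1P[<-|t0]; first by rewrite powR0 ?gt_eqF// mulr0 ltW.
suff h : v t * kint alpha t <= 1.
  by move: h; rewrite /kint mulrA ler_pdivrMr// mul1r.
apply: (@le_trans _ _ (kconv alpha v t)); last first.
  by rewrite -(volterra_mlv a0 t0) lerDr ltW// mlv_gt0// ltW.
have -> : kint alpha t = \int[mu]_(s in `]0, t[) k (t - s).
  by rewrite /Rintegral integral_kern1.
have ik := integrable_kern1 a0 t0.
rewrite -RintegralZl; [|exact: measurable_itv|exact: ik].
apply: le_Rintegral; first exact: measurable_itv.
- exact: (integrableZl _ _ ik).
- exact: integrable_kconv.
- move=> s; rewrite /= in_itv /= => /andP[s0 st].
  by rewrite mulrC ler_wpM2l ?kern_ge0// mlv_le// ltW.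
Qed.

End mittag_leffler_monotone.

Section mittag_leffler_neg.
Context {R : realType}.
Variable alpha : R.
Hypothesis a0 : 0 < alpha.
Hypothesis a1 : alpha < 1.
Notation E x := (mittag_leffler alpha 1 (- x)).

Let EE (x : R) : 0 <= x -> E x = mlv alpha (x `^ alpha^-1).
Proof.
move=> x0; rewrite /mlv pwE ?powR_ge0// -powRrM mulVf ?gt_eqF// powRr1//.
Qed.

Lemma mittag_leffler_ge0 (x : R) : 0 <= x -> 0 <= E x.
Proof. by move=> x0; rewrite EE// ltW// mlv_gt0// powR_ge0. Qed.

Lemma mittag_leffler_le1 (x : R) : 0 <= x -> E x <= 1.
Proof. by move=> x0; rewrite EE// mlv_le1// powR_ge0. Qed.

Lemma mittag_leffler_nincr (x y : R) : 0 <= x -> x <= y -> E y <= E x.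
Proof.
move=> x0 xy; have y0 := le_trans x0 xy.
rewrite (EE x0) (EE y0); apply: mlv_le => //.
  exact: powR_ge0.
by apply: ge0_ler_powR; rewrite ?nnegrE// invr_ge0 ltW.
Qed.

Lemma mittag_leffler_decay (x : R) : 0 <= x -> E x * x <= Gamma (alpha + 1).
Proof.
move=> x0; have := mlv_decay a0 a1 (powR_ge0 x alpha^-1).
by rewrite -EE// -powRrM mulVf ?gt_eqF// powRr1.
Qed.

End mittag_leffler_neg.

(** * Integration over D and the Dirichlet eigenvalue problem *)

Section restricted_lebesgue.
Context {R : realType}.
Notation mu := (@lebesgue_measure R).

Lemma ge0_integral_lebD (f : R -> \bar R) : measurable_fun setT f ->
  (forall x, 0 <= f x)%E ->
  (\int[lebD R]_x f x = \int[mu]_(x in `]0%R, 1%R[) f x)%E.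
Proof.
move=> mf f0.
have mD : measurable (`]0, 1[%classic : set (measurableTypeR R)) by [].
rewrite (@ge0_negligible_integral _ _ _ (lebD R) setT (~` `]0, 1[%classic))//; first last.
- by rewrite /lebD /mrestr; apply/(etrans (congr1 mu _) (measure0 mu)); rewrite setICl.
- exact: measurableC.
rewrite setTD setCK; apply: eq_measure_integral => A mA AD.
by rewrite /lebD /mrestr /=; congr (mu _); apply: setIidl.
Qed.

Lemma integral_lebD (f : R -> \bar R) : measurable_fun setT f ->
  (\int[lebD R]_x f x = \int[mu]_(x in `]0%R, 1%R[) f x)%E.
Proof.
move=> mf; rewrite [LHS]integralE [RHS]integralE.
rewrite ge0_integral_lebD//; last exact: measurable_funepos.
by rewrite ge0_integral_lebD//; exact: measurable_funeneg.
Qed.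

End restricted_lebesgue.

Section eigenfunctions.
Context {R : realType}.
Notation mu := (@lebesgue_measure R).

Lemma is_derive_within_continuous (g dg : R -> R) (a b : R) :
  (forall x : R, a <= x <= b -> is_derive x 1 g (dg x)) -> {within `[a, b], continuous g}.
Proof.
move=> dgx; apply: continuous_in_subspaceT => x; rewrite inE /= in_itv /= => xab.
apply: differentiable_continuous; apply/derivable1_diffP.
by have [] := dgx x xab.
Qed.

Lemma derive0_const (g : R -> R) : (forall x : R, 0 < x < 1 -> is_derive x 1 g 0) ->
  forall x y : R, 0 < x < 1 -> 0 < y < 1 -> g x = g y.
Proof.
move=> dg.
suff H (x y : R) : 0 < x -> x < y -> y < 1 -> g x = g y.
  move=> x y /andP[x0 x1] /andP[y0 y1].
  have [xy|yx|->//] := ltgtP x y; first exact: H.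
  by apply/esym; exact: H.
move=> x0 xy y1.
have dg' z : z \in `]x, y[%R -> is_derive z 1 g 0.
  by rewrite in_itv /= => /andP[xz zy]; apply: dg; rewrite (lt_trans x0 xz) (lt_trans zy y1).
have cg : {within `[x, y], continuous g}.
  apply: (@is_derive_within_continuous g (fun=> 0)) => z /andP[xz zy].
  by apply: dg; rewrite (lt_le_trans x0 xz) (le_lt_trans zy y1).
have [c _ /eqP] := MVT xy dg' cg.
by rewrite mul0r subr_eq0 eq_sym => /eqP.
Qed.

Variables (m : R) (psi : R -> R).
Hypothesis epsi : dirichlet_eigenfunction m psi.

Let cpsi : continuous psi. Proof. by case: epsi. Qed.
Let psi0 : psi 0 = 0.
Proof. by case: epsi => _ h _; apply: h; rewrite /D /= in_itv /= ltxx. Qed.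
Let psi1 : psi 1 = 0.
Proof. by case: epsi => _ h _; apply: h; rewrite /D /= in_itv /= ltxx andbF. Qed.

Let dpsi (x : R) : 0 < x < 1 -> is_derive x 1 psi (derive1 psi x).
Proof.
move=> xD; case: epsi => _ _ /(_ x); rewrite /D /= in_itv /= => /(_ xD)[h _ _].
by split=> //; rewrite derive1E.
Qed.
Let ddpsi (x : R) : 0 < x < 1 -> is_derive x 1 (derive1 psi) (- (m * psi x)).
Proof.
move=> xD; case: epsi => _ _ /(_ x); rewrite /D /= in_itv /= => /(_ xD)[_ h e].
by split=> //; rewrite -derive1E -e opprK.
Qed.

(* for m <= 0 the function psi ^+ 2 is convex and vanishes at both ends *)
Lemma dirichlet_eigenvalue_gt0 x : psi x != 0 -> 0 < m.
Proof.
move=> psix; rewrite ltNge; apply/negP => m0.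
have xD : 0 < x < 1.
  apply: contra_neqT psix => xD; case: epsi => _ h _; apply: h.
  by rewrite /D /= in_itv /=; exact/negP.
have /andP[x0 x1] := xD.
pose g y := psi y * psi y; pose dg y := psi y * derive1 psi y + derive1 psi y * psi y.
have dgE (y : R) : 0 < y < 1 -> is_derive y 1 g (dg y).
  move=> yD; have h := dpsi yD; apply: is_derive_eq; rewrite /dg /GRing.scale /=; ring.
pose ddg y := 2 * (derive1 psi y * derive1 psi y - m * (psi y * psi y)).
have ddgE (y : R) : 0 < y < 1 -> is_derive y 1 dg (ddg y).
  move=> yD; have h := dpsi yD; have h2 := ddpsi yD; apply: is_derive_eq.
  by rewrite /ddg /GRing.scale /=; ring.
have cg a b : {within `[a, b], continuous g}.
  by apply: continuous_subspaceT => y; apply: cvgM; exact: cpsi.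
have gx : 0 < g x by rewrite /g -expr2 lt_neqAle sqr_ge0 andbT eq_sym expf_neq0.
have g0 : g 0 = 0 by rewrite /g psi0 mul0r.
have g1 : g 1 = 0 by rewrite /g psi1 mul0r.
have dg0x y : y \in `]0, x[%R -> is_derive y 1 g (dg y).
  by rewrite in_itv /= => /andP[y0 yx]; apply: dgE; rewrite y0 (lt_trans yx x1).
have dgx1 y : y \in `]x, 1[%R -> is_derive y 1 g (dg y).
  by rewrite in_itv /= => /andP[xy y1]; apply: dgE; rewrite y1 (lt_trans x0 xy).
have [c cin ec] := MVT x0 dg0x (cg 0 x).
have [e ein ee] := MVT x1 dgx1 (cg x 1).
move: cin ein; rewrite !in_itv /= => /andP[c0 cx] /andP[xe e1].
have ce : c < e by lra.
have dgce y : y \in `]c, e[%R -> is_derive y 1 dg (ddg y).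
  rewrite in_itv /= => /andP[cy ye]; apply: ddgE.
  by rewrite (lt_trans c0 cy) (lt_trans ye e1).
have cdg : {within `[c, e], continuous dg}.
  apply: (@is_derive_within_continuous dg ddg) => y /andP[cy ye].
  by apply: ddgE; rewrite (lt_le_trans c0 cy) (le_lt_trans ye e1).
have [z zin ez] := MVT ce dgce cdg.
have dgc : 0 < dg c by move: ec; rewrite g0 !subr0 => ec; rewrite -(pmulr_lgt0 _ x0) -ec.
have dge : dg e < 0.
  have x10 : 0 < 1 - x by lra.
  by move: ee; rewrite g1 sub0r => ee; rewrite -(pmulr_llt0 _ x10) -ee oppr_lt0.
have ddgz : 0 <= ddg z.
  rewrite /ddg mulr_ge0// subr_ge0 (@le_trans _ _ 0)// -?expr2 ?sqr_ge0//.
  by rewrite mulr_le0_ge0// sqr_ge0.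
have : 0 <= ddg z * (e - c) by rewrite mulr_ge0//; lra.
by rewrite -ez; lra.
Qed.

(** Variation of constants: the vector (w psi, psi') turned by the angle w x has coordinates [A] and
    [B] with zero derivative. So w psi = a cos(w x) + b sin(w x) inside D; psi(0) = 0 gives a = 0,
    and psi(1) = 0 gives sin w = 0. *)
Lemma dirichlet_eigenfunction_sin x0 : psi x0 != 0 ->
  sin (Num.sqrt m) = 0 /\
  exists b, forall x, 0 <= x <= 1 -> psi x = b * sin (Num.sqrt m * x).
Proof.
move=> psix0; have m0 := dirichlet_eigenvalue_gt0 psix0.
set w := Num.sqrt m; have w0 : 0 < w by rewrite sqrtr_gt0.
have wm : w * w = m by rewrite -expr2 sqr_sqrtr// ltW.
pose A x := psi x * w * cos (w * x) - derive1 psi x * sin (w * x).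
pose B x := psi x * w * sin (w * x) + derive1 psi x * cos (w * x).
have dsw (x : R) : is_derive x 1 (fun x => sin (w * x)) (w * cos (w * x)).
  by apply: is_derive_eq; rewrite /GRing.scale /=; ring.
have dcw (x : R) : is_derive x 1 (fun x => cos (w * x)) (- (w * sin (w * x))).
  by apply: is_derive_eq; rewrite /GRing.scale /=; ring.
have dA (x : R) : 0 < x < 1 -> is_derive x 1 A 0.
  move=> xD; have h := dpsi xD; have h2 := ddpsi xD.
  have h3 := dsw x; have h4 := dcw x.
  by apply: is_derive_eq; rewrite /GRing.scale /= -wm; ring.
have dB (x : R) : 0 < x < 1 -> is_derive x 1 B 0.
  move=> xD; have h := dpsi xD; have h2 := ddpsi xD.
  have h3 := dsw x; have h4 := dcw x.
  by apply: is_derive_eq; rewrite /GRing.scale /= -wm; ring.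
have h12 : 0 < (2^-1 : R) < 1 by apply/andP; split; lra.
pose a := A 2^-1; pose b := B 2^-1.
have psiE x : 0 < x < 1 -> psi x * w = a * cos (w * x) + b * sin (w * x).
  move=> xD; rewrite /a /b -(derive0_const dA xD h12) -(derive0_const dB xD h12) /A /B.
  have := cos2Dsin2 (w * x); set c := cos _; set s := sin _ => cs.
  transitivity (psi x * w * (c ^+ 2 + s ^+ 2)); first by rewrite cs mulr1.
  by ring.
pose h x := psi x * w - (a * cos (w * x) + b * sin (w * x)).
have ch : continuous h.
  move=> x; apply: cvgB; first by apply: cvgM; [exact: cpsi|exact: cvg_cst].
  have cwx : w * y @[y --> x] --> w * x by apply: cvgM; [exact: cvg_cst|exact: cvg_id].
  apply: cvgD; apply: cvgM; try exact: cvg_cst.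
    by apply: (@continuous_comp _ _ _ (fun y => w * y) cos) => //; exact: continuous_cos.
  by apply: (@continuous_comp _ _ _ (fun y => w * y) sin) => //; exact: continuous_sin.
have hD x : 0 <= x <= 1 -> h x = 0.
  move=> /andP[x0' x1'].
  (* Interior points tending to [x], which carry the identity to the end points by continuity. *)
  pose u (n : nat) : R := x + (2^-1 - x) * harmonic n.
  have ux : u @ \oo --> x.
    rewrite -[X in _ --> X]addr0; apply: cvgD; first exact: cvg_cst.
    rewrite -[X in _ --> X](mulr0 (2^-1 - x)); apply: cvgM; first exact: cvg_cst.
    exact: cvg_harmonic.
  have hu n : h (u n) = 0.
    have hn0 : 0 < harmonic n :> R by rewrite /harmonic /= invr_gt0.
    have hn1 : harmonic n <= 1 :> R by rewrite /harmonic /= invf_le1// ler1n.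
    apply/eqP; rewrite subr_eq0 psiE// /u.
    by move: hn0 hn1; set z : R := harmonic n => z0 z1; apply/andP; split; nra.
  have : (h \o u) @ \oo --> h x by apply: (cvg_comp _ _ ux); exact: ch.
  rewrite (_ : h \o u = cst 0); last by apply/funext => n /=; exact: hu.
  by move=> c0; apply/esym; apply: (@cvg_unique _ _ _ _ _ _ (cvg_cst 0) c0).
have a0 : a = 0.
  have := hD 0; rewrite lexx ler01 => /(_ isT).
  by rewrite /h psi0 mul0r mulr0 cos0 sin0 mulr1 mulr0 addr0 sub0r => /eqP; rewrite oppr_eq0 => /eqP.
have psiE' x : 0 <= x <= 1 -> psi x = (b / w) * sin (w * x).
  move=> /hD /eqP; rewrite /h a0 mul0r add0r subr_eq0 => /eqP e.
  by rewrite mulrAC -e mulfK// gt_eqF.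
split; last by exists (b / w).
have x0D : 0 <= x0 <= 1.
  apply: contra_neqT psix0 => xD; case: epsi => _ h' _; apply: h'.
  by rewrite /D /= in_itv /=; apply: contraNnot xD => /andP[/ltW -> /ltW ->].
have bw : b / w != 0.
  by apply: contra_neq psix0 => bw0; rewrite psiE'// bw0 mul0r.
have := psiE' 1; rewrite lexx ler01 psi1 mulr1 => /(_ isT)/esym/eqP.
by rewrite mulf_eq0 (negbTE bw) /= => /eqP.
Qed.

End eigenfunctions.

Section eigensystem.
Context {R : realType}.
Notation mu := (@lebesgue_measure R).

Lemma sin_lipschitz (x y : R) : `|sin x - sin y| <= `|x - y|.
Proof.
wlog xy : x y / x < y => [H|].
  have [|yx|->] := ltgtP x y; [exact: H| |by rewrite !subrr].
  by rewrite distrC [leRHS]distrC; exact: H.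
have [c _ e] := @MVT _ sin cos x y xy (fun z _ => is_derive_sin z)
  (continuous_subspaceT (@continuous_sin R)).
rewrite distrC e normrM [leRHS]distrC ler_piMl//.
exact: cos_max.
Qed.

Lemma integral_sin_sqr (w : R) : 0 < w -> sin w = 0 ->
  (\int[mu]_(x in `]0%R, 1%R[) ((sin (w * x)) ^+ 2)%:E = (2^-1)%:E)%E.
Proof.
move=> w0 sw.
have ds (x : R) : is_derive x 1 (fun x => sin (w * x)) (w * cos (w * x)).
  by apply: is_derive_eq; rewrite /GRing.scale /=; ring.
have dc (x : R) : is_derive x 1 (fun x => cos (w * x)) (- (w * sin (w * x))).
  by apply: is_derive_eq; rewrite /GRing.scale /=; ring.
have csw : continuous (fun x : R => sin (w * x)).
  move=> x; apply: (@continuous_comp _ _ _ (fun x => w * x) sin); last exact: continuous_sin.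
  by apply: cvgM; [exact: cvg_cst|exact: cvg_id].
have cs : continuous (fun x : R => sin (w * x) ^+ 2).
  by move=> x; apply: (@continuous_comp _ _ _ (fun x : R => sin (w * x)) (fun y : R => y ^+ 2)); [exact: csw|exact: exprn_continuous].
pose F (x : R) := x * 2^-1 - (sin (w * x) * cos (w * x)) * (2 * w)^-1.
have dF (x : R) : is_derive x 1 F (sin (w * x) ^+ 2).
  have h1 := ds x; have h2 := dc x; apply: is_derive_eq; rewrite /GRing.scale /=.
  have -> : sin (w * x) ^+ 2 = 2^-1 * (1 - cos (w * x) ^+ 2 + sin (w * x) ^+ 2).
    by rewrite cos2sin2; field.
  by field; rewrite gt_eqF.
have cF : continuous F.
  by move=> x; apply: differentiable_continuous; apply/derivable1_diffP; have [] := dF x.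
rewrite integral_itv_obnd_cbnd; last first.
  by apply: measurable_funTS; apply/measurable_EFinP; exact: continuous_measurable_fun.
rewrite integral_itv_bndo_bndc; last first.
  by apply: measurable_funTS; apply/measurable_EFinP; exact: continuous_measurable_fun.
have h1 : {within `[0, 1], continuous (fun x : R => sin (w * x) ^+ 2)}.
  by apply: continuous_subspaceT => x; exact: cs.
have h2 : derivable_oo_LRcontinuous F 0 1.
  split; first by move=> x _; have [] := dF x.
    by apply: cvg_at_right_filter; exact: cF.
  by apply: cvg_at_left_filter; exact: cF.
have h3 : {in `]0, 1[, derive1 F =1 (fun x : R => sin (w * x) ^+ 2)}.
  by move=> x _; rewrite derive1E; have [_ ->] := dF x.
rewrite (continuous_FTC2 ltr01 h1 h2 h3).
by rewrite /F mulr1 sw !mul0r mulr0 sin0 !mul0r !subr0 mul1r sube0.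
Qed.

Lemma innerD_sin (w b1 b2 : R) (f g : R -> R) : 0 < w -> sin w = 0 ->
  continuous f -> continuous g ->
  (forall x, 0 <= x <= 1 -> f x = b1 * sin (w * x)) ->
  (forall x, 0 <= x <= 1 -> g x = b2 * sin (w * x)) ->
  innerD f g = b1 * b2 / 2.
Proof.
move=> w0 sw cf cg fE gE; rewrite /innerD /Rintegral integral_lebD; last first.
  apply/measurable_EFinP; apply: measurable_funM; exact: continuous_measurable_fun.
rewrite (_ : (\int[mu]_(x in _) _)%E =
    (\int[mu]_(x in `]0%R, 1%R[) ((b1 * b2)%:E * ((sin (w * x)) ^+ 2)%:E))%E); last first.
  apply: eq_integral => x; rewrite inE /= in_itv /= => /andP[x0 x1].
  by rewrite -EFinM fE ?gE ?(ltW x0) ?(ltW x1)//; congr EFin; ring.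
rewrite integralZl//; first by rewrite integral_sin_sqr.
apply: ge0_integrable => //.
- apply: measurable_funTS; apply: continuous_measurable_fun => x.
  apply: (@continuous_comp _ _ _ (fun x : R => sin (w * x)) (fun y : R => y ^+ 2)); last exact: exprn_continuous.
  apply: (@continuous_comp _ _ _ (fun x => w * x) sin); last exact: continuous_sin.
  by apply: cvgM; [exact: cvg_cst|exact: cvg_id].
- by move=> x _; exact: sqr_ge0.
- by rewrite integral_sin_sqr// ltry.
Qed.

Variables (lambda : nat -> R) (phi : nat -> R -> R).
Hypothesis es : dirichlet_eigensystem lambda phi.

Let w k := Num.sqrt (lambda k).

Let phiP k : (1 <= k)%N -> dirichlet_eigenfunction (lambda k) (phi k).
Proof. by case: es => h _ _ _; exact: h. Qed.

Lemma eigenfunction_continuous k : (1 <= k)%N -> continuous (phi k).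
Proof. by move=> k1; have [] := phiP k1. Qed.

Let phi_neq0 k : (1 <= k)%N -> exists x, phi k x != 0.
Proof.
move=> k1; apply: contrapT => h.
have hz x : phi k x = 0 by apply: contrapT => /eqP hx; apply: h; exists x.
case: es => _ _ /(_ k k k1 k1) + _; rewrite eqxx /innerD /Rintegral.
rewrite integral0_eq/=; first by move/esym/eqP; rewrite oner_eq0.
by move=> x _; rewrite hz mul0r.
Qed.

Let eigP k : (1 <= k)%N -> [/\ 0 < lambda k, sin (w k) = 0 &
  exists b, forall x, 0 <= x <= 1 -> phi k x = b * sin (w k * x)].
Proof.
move=> k1; have [x px] := phi_neq0 k1.
have l0 := dirichlet_eigenvalue_gt0 (phiP k1) px.
have [s0 [b bE]] := dirichlet_eigenfunction_sin (phiP k1) px.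
by split=> //; exists b.
Qed.

Let w_gt0 k : (1 <= k)%N -> 0 < w k.
Proof. by move=> /eigP[l0 _ _]; rewrite sqrtr_gt0. Qed.

(** The sine is positive on ]0, 2[, so two of its zeros are at least 2 apart; this replaces the
    exact value of pi. *)
Let sin_gap (x y : R) : 0 <= x -> x < y -> sin x = 0 -> sin y = 0 -> x + 2 <= y.
Proof.
move=> x0 xy sx sy; rewrite leNgt; apply/negP => yx.
have : 0 < sin (y - x) by apply: sin2_gt0; apply/andP; split; lra.
by rewrite sinB sx sy mul0r mulr0 subrr ltxx.
Qed.

(** If two consecutive eigenvalues were equal, both eigenfunctions would be multiples of one sine,
    and two normalised multiples of one function are not orthogonal. *)
Let w_neq k : (1 <= k)%N -> w k < w k.+1.
Proof.
move=> k1; have k2 : (1 <= k.+1)%N by [].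
have [l1 s1 [b1 b1E]] := eigP k1; have [l2 s2 [b2 b2E]] := eigP k2.
case: es => _ mono orth _.
have ll := mono _ _ k1 (leqnSn k).
rewrite ltr_sqrt// lt_neqAle ll andbT; apply/eqP => lE.
have wE : w k.+1 = w k by rewrite /w lE.
have := orth k k.+1 k1 k2; rewrite (ltn_eqF (ltnSn k)).
have b2E' x : 0 <= x <= 1 -> phi k.+1 x = b2 * sin (w k * x) by rewrite -wE; exact: b2E.
rewrite (innerD_sin (w_gt0 k1) s1 (eigenfunction_continuous k1) (eigenfunction_continuous k2) b1E b2E').
have e1 := orth k k k1 k1; rewrite eqxx in e1.
have e2 := orth k.+1 k.+1 k2 k2; rewrite eqxx in e2.
rewrite (innerD_sin (w_gt0 k1) s1 (eigenfunction_continuous k1) (eigenfunction_continuous k1) b1E b1E) in e1.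
rewrite (innerD_sin (w_gt0 k2) s2 (eigenfunction_continuous k2) (eigenfunction_continuous k2) b2E b2E) in e2.
move=> e3; have : b1 * b1 / 2 * (b2 * b2 / 2) = (b1 * b2 / 2) ^+ 2 by ring.
by rewrite e1 e2 e3 mulr1 expr0n => /eqP; rewrite oner_eq0.
Qed.

Lemma eigenvalue_sqrt_ge k : (1 <= k)%N -> k%:R <= w k.
Proof.
elim: k => // k IH _; case: k IH => [_|k IH].
  have w1 := w_gt0 (leqnn 1); have [_ s1 _] := eigP (leqnn 1).
  by have := sin_gap (lexx 0) w1 (@sin0 R) s1; lra.
have k1 : (1 <= k.+1)%N by [].
have h := IH k1; have [_ s1 _] := eigP k1; have [_ s2 _] := eigP (isT : (1 <= k.+2)%N).
have := sin_gap (ltW (w_gt0 k1)) (w_neq k1) s1 s2.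
by rewrite -(natr1 k.+1); lra.
Qed.

Lemma eigenvalueE k : (1 <= k)%N -> lambda k = w k ^+ 2.
Proof. by move=> /eigP[l0 _ _]; rewrite sqr_sqrtr// ltW. Qed.

(** The amplitude satisfies b^2 = 2 by normalisation, and the sine is bounded by 1 and
    1-Lipschitz. *)
Lemma eigenfunction_bounds k : (1 <= k)%N ->
  (forall x, `|phi k x| <= 2) /\
  (forall x y, `|phi k x - phi k y| <= 2 * w k * `|x - y|).
Proof.
move=> k1; have [l0 s0 [b bE]] := eigP k1.
have w0 := w_gt0 k1.
have b2 : `|b| <= 2.
  case: es => _ _ /(_ k k k1 k1) + _; rewrite eqxx.
  rewrite (innerD_sin w0 s0 (eigenfunction_continuous k1) (eigenfunction_continuous k1) bE bE) => e.
  have b22 : `|b| ^+ 2 = 2 by rewrite real_normK ?num_real// expr2; move: e => /=; lra.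
  by have := normr_ge0 b; rewrite leNgt => ?; apply/negP => ?; nra.
(* Clamping to [0, 1] writes the extension by zero as one formula on the line; [c] is 1-Lipschitz,
   hence so is the bound across the end points. *)
pose c (x : R) : R := if x < 0 then 0 else if 1 < x then 1 else x.
have phiE x : phi k x = b * sin (w k * c x).
  rewrite /c; have [x0|x0] := ltP x 0.
    rewrite mulr0 sin0 mulr0; have [_ h _] := phiP k1; apply: h.
    by rewrite /D /= in_itv /= ltNge (ltW x0).
  have [x1|x1] := ltP 1 x; last by apply: bE; rewrite x0.
  rewrite mulr1 s0 mulr0; have [_ h _] := phiP k1; apply: h.
  by rewrite /D /= in_itv /= [x < 1]ltNge (ltW x1) andbF.
have cl x y : `|c x - c y| <= `|x - y|.
  rewrite /c ler_norml; have := ler_norm (x - y); have := ler_norm (y - x).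
  rewrite [`|y - x|]distrC => h1 h2; have := normr_ge0 (x - y).
  by case: (ltP x 0) => ?; case: (ltP y 0) => ?; case: (ltP 1 x) => ?; case: (ltP 1 y) => ? ?; apply/andP; split; lra.
split=> [x|x y].
  rewrite phiE normrM; apply: (@le_trans _ _ (`|b| * 1)); last by rewrite mulr1.
  by apply: ler_wpM2l => //; exact: sin_max.
rewrite !phiE -mulrBr normrM -mulrA; apply: ler_pM => //.
apply: (le_trans (sin_lipschitz _ _)); rewrite -mulrBr normrM gtr0_norm//.
by rewrite ler_wpM2l// ltW.
Qed.

End eigensystem.

(** * Fractional covariances as mixtures over shifts *)

Section shift_index.
Context {R : realType}.
Notation mu := (@lebesgue_measure R).

(* [eta] pushes Lebesgue measure forward to the measure on shifts [h] with
   tail [H * h `^ (2 * H - 1)] below [L]; it represents [l `^ (2 * H)] as a mixture of the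
   functions [2 * min h l], also for H = 1/2, where it has a single atom. *)
Definition shift_index (H L : R) (eta : R -> R) : Prop :=
  [/\ measurable_fun setT eta, forall x, 0 <= eta x &
    forall s x, 0 < s -> s < L -> (s < eta x) = (0 < x < H * s `^ (2 * H - 1))].

(** For H < 1/2 the tail H s^(2H - 1) is inverted explicitly. For H = 1/2 it is the constant 1/2
    below [L], so an atom of mass 1/2 at [L] serves. *)
Lemma shift_index_exists (H L : R) : 0 < H -> H <= 2^-1 -> 0 < L ->
  exists eta, shift_index H L eta.
Proof.
move=> H0; rewrite le_eqVlt => /predU1P[->|H1] L0.
  exists (fun x => if 0 < x < 2^-1 then L else 0); split.
  - apply: measurable_fun_ifT => //; apply: measurable_and; exact: measurable_fun_ltr.
  - by move=> x; case: ifP => // _; exact: ltW.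
  - move=> s x s0 sL; rewrite (_ : 2 * 2^-1 - 1 = 0 :> R); last lra.
    by rewrite powRr0 mulr1; case: ifP => _; rewrite ?sL// ltNge (ltW s0).
pose b := 1 - 2 * H; have b0 : 0 < b by rewrite /b; lra.
exists (fun x => if 0 < x then (x / H) `^ (- b^-1) else 0); split.
- apply: measurable_fun_ifT => //; first exact: measurable_fun_ltr.
  have mxH : measurable_fun setT (fun t : R => t / H) by exact: measurable_funM.
  exact: (measurableT_comp (measurable_powR (- b^-1)) mxH).
- by move=> x; case: ifP => // _; exact: powR_ge0.
- move=> s x s0 sL; case: ifPn => [x0|/negbTE x0]; last by apply/negbTE; rewrite -leNgt ltW.
  have xH : 0 < x / H by rewrite divr_gt0.
  have -> : 2 * H - 1 = - b by rewrite /b; ring.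
  rewrite /= -ltr_pdivrMl// [_ * x]mulrC.
  set y := x / H; set z := y `^ (- b^-1).
  have z0 : 0 < z by rewrite powR_gt0.
  have -> : y = z `^ (- b).
    by rewrite -powRrM mulrNN mulVf ?gt_eqF// powRr1// ltW.
  rewrite !powRN ltf_pV2 ?posrE ?powR_gt0//.
  apply/idP/idP => [sz|]; first by apply: gt0_ltr_powR; rewrite ?nnegrE ?(ltW s0) ?(ltW z0).
  apply: contraTT; rewrite -!leNgt => zs.
  by apply: ge0_ler_powR; rewrite ?nnegrE ?(ltW s0) ?(ltW z0) ?(ltW b0).
Qed.

Variables (H L : R) (eta : R -> R).
Hypothesis etaP : shift_index H L eta.

Let meta : measurable_fun setT eta. Proof. by case: etaP. Qed.
Let eta0 x : 0 <= eta x. Proof. by case: etaP. Qed.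

(** Layer cake: min(eta, d)^p is the integral of p s^(p - 1) over s < d with s < eta. After Tonelli
    the tail contributes H s^(2H - 1), and a power remains to be integrated. *)
Lemma integral_min_shift_index (p d : R) : 0 < H -> 0 < p -> 0 < p + 2 * H - 1 ->
  0 < d -> d <= L ->
  (\int[mu]_x ((Num.min (eta x) d) `^ p)%:E =
   (p * H / (p + 2 * H - 1) * d `^ (p + 2 * H - 1))%:E)%E.
Proof.
move=> H0 p0 pH d0 dL.
pose K (x s : R) : R := if (0 < s < d) && (s < eta x) then p * ppow p s else 0.
have K0 x s : 0 <= K x s.
  by rewrite /K; case: ifP => // _; rewrite mulr_ge0 ?ppow_ge0// ltW.
have mK : measurable_fun [set: measurableTypeR R * measurableTypeR R]
    (fun z : R * R => (K z.1 z.2)%:E).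
  apply/measurable_EFinP; apply: measurable_fun_ifT => //.
    apply: measurable_and.
      by apply: measurable_and; apply: measurable_fun_ltr.
    by apply: measurable_fun_ltr => //; exact: measurableT_comp.
  apply: measurable_funM => //; apply: measurableT_comp => //.
  exact: measurable_ppow.
have int_pow (m : R) : 0 <= m ->
    (\int[mu]_(s in `]0%R, m[) (p * ppow p s)%:E = (m `^ p)%:E)%E.
  rewrite le_eqVlt => /predU1P[<-|m0].
    by rewrite set_itvoo0// integral_set0 powR0// gt_eqF.
  rewrite integral_itv_bndo_bndc; last first.
    apply: measurable_funTS; apply/measurable_EFinP; apply: measurable_funM => //.
    exact: measurable_ppow.
  transitivity (p%:E * \int[mu]_(s in `]0%R, m]) (s `^ (p - 1))%:E)%E.
    rewrite -ge0_integralZl_EFin ?(ltW p0)//; last 2 first.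
    - by move=> s _; rewrite lee_fin powR_ge0.
    - by apply: measurable_funTS; apply/measurable_EFinP; exact: measurable_powR.
    apply: eq_integral => s; rewrite inE /= in_itv /= => /andP[s0 _].
    by rewrite /ppow s0 -EFinM.
  rewrite integral_powR//; last by rewrite ltrBrDr addrC subrr.
  by rewrite subrK -EFinM mulrC divfK// gt_eqF.
transitivity (\int[mu]_x \int[mu]_s (K x s)%:E)%E.
  apply: eq_integral => x _.
  have m0 : 0 <= Num.min (eta x) d by rewrite le_min eta0 ltW.
  rewrite -(int_pow _ m0) integral_mkcond; apply: eq_integral => s _.
  rewrite patchE mem_setE in_itv /= lt_min /K.
  by rewrite -andbA [(s < d) && _]andbC; case: ifP.
rewrite tonelli; [|exact: mK|by move=> x y; rewrite lee_fin].
transitivity (\int[mu]_(s in `]0%R, d[) ((p * H)%:E * (s `^ (p + 2 * H - 2))%:E))%E.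
  rewrite [RHS]integral_mkcond; apply: eq_integral => s _.
  rewrite patchE mem_setE in_itv /=; case: ifPn => [/andP[s0 sd]|sd]; last first.
    by apply: integral0_eq => x _; rewrite /K (negbTE sd).
  have [_ _ spec] := etaP.
  have sL := lt_le_trans sd dL.
  transitivity (\int[mu]_(x in `]0%R, (H * s `^ (2 * H - 1))%R[) (p * ppow p s)%:E)%E.
    rewrite [RHS]integral_mkcond; apply: eq_integral => x _.
    by rewrite patchE mem_setE in_itv /= /K s0 sd spec//=; case: ifP.
  have Hs : 0 < H * s `^ (2 * H - 1) by rewrite mulr_gt0// powR_gt0.
  rewrite integral_cst//= lebesgue_measure_itv /= lte_fin Hs -EFinD subr0 -EFinM.
  rewrite -EFinM /ppow s0; congr EFin.
  rewrite (_ : p + 2 * H - 2 = (p - 1) + (2 * H - 1)); last by ring.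
  by rewrite [in RHS]powRD ?(gt_eqF s0) ?implybT//; ring.
rewrite integral_itv_bndo_bndc; last first.
  apply: measurable_funTS; apply: measurable_funeM; apply/measurable_EFinP.
  exact: measurable_powR.
rewrite ge0_integralZl_EFin ?mulr_ge0 ?(ltW p0) ?(ltW H0)//; last 2 first.
- by move=> s _; rewrite lee_fin powR_ge0.
- by apply: measurable_funTS; apply/measurable_EFinP; exact: measurable_powR.
rewrite integral_powR//; last by lra.
rewrite (_ : p + 2 * H - 2 + 1 = p + 2 * H - 1); last by ring.
by rewrite -EFinM; congr EFin; ring.
Qed.

(** The case p = 1: the variogram of fractional Brownian motion as a mixture over shifts. *)
Lemma integral_min_shift_index1 (d : R) : 0 < H -> 0 <= d -> d <= L ->
  (\int[mu]_x (2 * Num.min (eta x) d)%:E = (d `^ (2 * H))%:E)%E.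
Proof.
move=> H0; rewrite le_eqVlt => /predU1P[<- _|d0 dL].
  rewrite powR0; last by rewrite gt_eqF// mulr_gt0.
  by apply: integral0_eq => x _; rewrite min_r// mulr0.
have min0 x : 0 <= Num.min (eta x) d by rewrite le_min eta0 ltW.
under eq_integral do rewrite EFinM.
rewrite ge0_integralZl_EFin//; last 2 first.
- by move=> x _; rewrite lee_fin.
- by apply/measurable_EFinP; apply: measurable_minr.
have h2 : 0 < 1 + 2 * H - 1 by lra.
have := integral_min_shift_index H0 ltr01 h2 d0 dL.
rewrite (_ : (\int[mu]_x _)%E = (\int[mu]_x (Num.min (eta x) d)%:E)%E); last first.
  by apply: eq_integral => x _; rewrite powRr1.
move=> ->; rewrite -EFinM; congr EFin.
rewrite (_ : 1 + 2 * H - 1 = 2 * H); last by ring.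
by field; rewrite gt_eqF.
Qed.

End shift_index.

Section tensor_integrals.
Context {R : realType}.
Notation mu := (@lebesgue_measure R).

Lemma integral_sum_seq d (T : measurableType d) (m : {measure set T -> \bar R})
    (I : eqType) (s : seq I) (u : I -> T -> R) (U : I -> R) :
  (forall i, i \in s -> m.-integrable setT (EFin \o u i)) ->
  (forall i, i \in s -> (\int[m]_x (u i x)%:E = (U i)%:E)%E) ->
  m.-integrable setT (EFin \o (fun x => \sum_(i <- s) u i x)) /\
  (\int[m]_x (\sum_(i <- s) u i x)%:E = (\sum_(i <- s) U i)%:E)%E.
Proof.
elim: s => [|i s IH] hi hU.
  rewrite big_nil; split.
    rewrite (_ : EFin \o _ = cst 0%E); first exact: integrable0.
    by apply/funext => x /=; rewrite big_nil.
  by apply: integral0_eq => x _; rewrite big_nil.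
have sub j : j \in s -> j \in i :: s by move=> js; rewrite inE js orbT.
have [h1 h2] := IH (fun j js => hi j (sub j js)) (fun j js => hU j (sub j js)).
have ii := hi i (mem_head i s).
pose g x := \sum_(j <- s) u j x.
have E x : (\sum_(j <- i :: s) u j x)%:E = ((EFin \o u i) x + (EFin \o g) x)%E.
  by rewrite big_cons EFinD.
split.
  rewrite (_ : EFin \o _ = ((EFin \o u i) \+ (EFin \o g))%E); first exact: integrableD.
  by apply/funext => x; rewrite /= E.
under eq_integral do rewrite E.
by rewrite integralD//= h2 (hU i (mem_head i s)) big_cons EFinD.
Qed.

Lemma integral_sum_tensor d1 d2 (T1 : measurableType d1) (T2 : measurableType d2)
    (m1 : {measure set T1 -> \bar R}) (m2 : {measure set T2 -> \bar R})
    (I : eqType) (s : seq I) (u : I -> T1 -> R) (v : I -> T2 -> R) (U V : I -> R) :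
  (forall i, i \in s -> m1.-integrable setT (EFin \o u i)) ->
  (forall i, i \in s -> (\int[m1]_x (u i x)%:E = (U i)%:E)%E) ->
  (forall i, i \in s -> m2.-integrable setT (EFin \o v i)) ->
  (forall i, i \in s -> (\int[m2]_x (v i x)%:E = (V i)%:E)%E) ->
  (\int[m1]_x \int[m2]_y (\sum_(i <- s) u i x * v i y)%:E =
   (\sum_(i <- s) U i * V i)%:E)%E.
Proof.
move=> iu eu iv ev.
transitivity (\int[m1]_x (\sum_(i <- s) u i x * V i)%:E)%E.
  apply: eq_integral => x _.
  apply: (integral_sum_seq (u := fun i y => u i x * v i y) (U := fun i => u i x * V i) _ _).2.
    by move=> i si; exact: (integrableZl _ (u i x) (iv i si)).
  move=> i si; under eq_integral do rewrite EFinM.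
  by rewrite integralZl//= ?ev//; exact: iv.
apply: (integral_sum_seq (u := fun i x => u i x * V i) (U := fun i => U i * V i) _ _).2.
  move=> i si; apply: eq_integrable (integrableZl _ (V i) (iu i si)) => //.
  by move=> x _ /=; rewrite -EFinM mulrC.
move=> i si; under eq_integral do rewrite EFinM.
by rewrite integralZr//= ?eu//; exact: iu.
Qed.

End tensor_integrals.

Section difference.
Context {R : realType}.
Notation mu := (@lebesgue_measure R).

Definition dif (h : R) (f : R -> R) (y : R) : R := f (y + h) - f y.

Definition ind (a y : R) : R := \1_(`]0, a]%classic) y.

Lemma indE a y : ind a y = if 0 < y <= a then 1 else 0.
Proof. by rewrite /ind indicE mem_setE in_itv /=; case: ifP. Qed.

Lemma measurable_ind a : measurable_fun setT (ind a).
Proof. by rewrite (_ : ind a = \1_(`]0, a]%classic)). Qed.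

Lemma measurable_dif h f : measurable_fun setT f -> measurable_fun setT (dif h f).
Proof.
move=> mf; apply: measurable_funB => //; apply: measurableT_comp => //.
exact: measurable_funD.
Qed.

Lemma integral_indic_itv (a b : R) : a <= b ->
  (\int[mu]_x (\1_(`]a, b]%classic) x)%:E = (b - a)%:E)%E.
Proof.
move=> ab; rewrite integral_indic ?setIT//; apply: etrans (lebesgue_measure_itv _) _.
rewrite /= lte_fin; case: ltP => [_|ba]; first by rewrite EFinB.
by rewrite (le_anti (introT andP (conj ab ba))) subrr.
Qed.

Lemma indB (a b y : R) : 0 <= a -> a <= b ->
  ind b y - ind a y = (a < y <= b)%R%:R.
Proof.
move=> a0 ab; rewrite !indE.
have [ay|ya] := ltP a y.
  by rewrite (le_lt_trans a0 ay) andbF subr0 /=; case: (y <= b).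
by rewrite (le_trans ya ab) subrr.
Qed.

(** The indicator of ]a, b] and its translate differ on two intervals, one near each end, each of
    length min(h, b - a). *)
Lemma integral_dif_ind_sqr (h a b : R) : 0 <= h -> 0 <= a -> a <= b ->
  (\int[mu]_y ((dif h (ind b) y - dif h (ind a) y) ^+ 2)%:E =
   (2 * Num.min h (b - a))%:E)%E.
Proof.
move=> h0 a0 ab.
transitivity (\int[mu]_y ((\1_(`](a - h), (Num.min (b - h) a)]%classic) y)%:E +
    (\1_(`](Num.max a (b - h)), b]%classic) y)%:E))%E.
  apply: eq_integral => y _; rewrite -EFinD; congr EFin.
  rewrite !indicE !mem_setE !in_itv /= le_min gt_max.
  rewrite !ltrBlDr lerBrDr.
  have -> : dif h (ind b) y - dif h (ind a) y = (a < y + h <= b)%R%:R - (a < y <= b)%R%:R.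
    by rewrite -!indB// /dif; ring.
  rewrite [y <= a]leNgt [b < y + h]ltNge.
  have i1 : (a < y) ==> (a < y + h) by apply/implyP; lra.
  have i2 : (y + h <= b) ==> (y <= b) by apply/implyP; lra.
  move: i1 i2; case: (a < y); case: (a < y + h); case: (y + h <= b); case: (y <= b) => //= _ _; ring.
rewrite ge0_integralD; [|exact: measurableT|by []|by apply/measurable_EFinP|by []|by apply/measurable_EFinP].
have m1 : a - h <= Num.min (b - h) a by rewrite le_min; apply/andP; split; lra.
have m2 : Num.max a (b - h) <= b by rewrite ge_max; apply/andP; split; lra.
rewrite (integral_indic_itv m1) (integral_indic_itv m2).
rewrite -EFinD; congr EFin.
by case: (leP (b - h) a) => ?; case: (leP h (b - a)) => ?; lra.
Qed.

End difference.

Section polarization.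
Context {R : realType}.
Notation mu := (@lebesgue_measure R).

Lemma integral_half_comb d (T : measurableType d) (m : {measure set T -> \bar R})
    (f g k : T -> R) (A B C : R) :
  m.-integrable setT (EFin \o f) -> m.-integrable setT (EFin \o g) ->
  m.-integrable setT (EFin \o k) ->
  (\int[m]_x (f x)%:E = A%:E)%E -> (\int[m]_x (g x)%:E = B%:E)%E ->
  (\int[m]_x (k x)%:E = C%:E)%E ->
  m.-integrable setT (EFin \o (fun x => (f x + g x - k x) / 2)) /\
  (\int[m]_x ((f x + g x - k x) / 2)%:E = ((A + B - C) / 2)%:E)%E.
Proof.
move=> fi gi ki fA gB kC.
pose u (i : nat) : T -> R := nth (fun=> 0) [:: (fun x => 2^-1 * f x); (fun x => 2^-1 * g x); (fun x => - 2^-1 * k x)] i.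
pose U (i : nat) : R := nth 0 [:: 2^-1 * A; 2^-1 * B; - 2^-1 * C] i.
have [||h1 h2] := @integral_sum_seq _ _ _ m _ [:: 0%N; 1%N; 2%N] u U.
- move=> i; rewrite !inE => /or3P[]/eqP -> /=.
  + exact: (integrableZl _ _ fi).
  + exact: (integrableZl _ _ gi).
  + exact: (integrableZl _ _ ki).
- move=> i; rewrite !inE => /or3P[]/eqP -> /=; under eq_integral do rewrite EFinM.
  + by rewrite integralZl//= fA.
  + by rewrite integralZl//= gB.
  + by rewrite integralZl//= kC.
have E x : \sum_(i <- [:: 0%N; 1%N; 2%N]) u i x = (f x + g x - k x) / 2.
  by rewrite !big_cons big_nil /u /=; ring.
split.
  by apply: eq_integrable h1 => //= x _; rewrite /= E.
transitivity (\int[m]_x (\sum_(i <- [:: 0%N; 1%N; 2%N]) u i x)%:E)%E.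
  by apply: eq_integral => x _; rewrite E.
by rewrite h2 !big_cons big_nil /U /=; congr EFin; ring.
Qed.

(** The formula of [fbm_cov] with 2 min(h, .) in place of the power; mixing it over [h] gives back
    [fbm_cov] ([integral_dcov]). *)
Definition dcov (h a b : R) : R :=
  (2 * Num.min h a + 2 * Num.min h b - 2 * Num.min h `|a - b|) / 2.

Lemma integral_dif_ind (h a b : R) : 0 <= h -> 0 <= a -> 0 <= b ->
  mu.-integrable setT (EFin \o (fun y => dif h (ind a) y * dif h (ind b) y)) /\
  (\int[mu]_y (dif h (ind a) y * dif h (ind b) y)%:E = (dcov h a b)%:E)%E.
Proof.
move=> h0 a0 b0.
have md c : measurable_fun setT (dif h (ind c)).
  by apply: measurable_dif; exact: measurable_ind.
have I2 c e : 0 <= c -> 0 <= e ->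
    mu.-integrable setT (EFin \o (fun y => (dif h (ind e) y - dif h (ind c) y) ^+ 2)) /\
    (\int[mu]_y ((dif h (ind e) y - dif h (ind c) y) ^+ 2)%:E =
     (2 * Num.min h `|c - e|)%:E)%E.
  move=> c0 e0.
  have E2 : (\int[mu]_y ((dif h (ind e) y - dif h (ind c) y) ^+ 2)%:E =
     (2 * Num.min h `|c - e|)%:E)%E.
    have [ce|ec] := leP c e.
      by rewrite integral_dif_ind_sqr// ler0_norm ?subr_le0// opprB.
    rewrite gtr0_norm ?subr_gt0//; apply: etrans (integral_dif_ind_sqr h0 e0 (ltW ec)).
    by apply: eq_integral => y _; congr EFin; ring.
  split=> //; apply: ge0_integrable => //.
  - by apply: measurable_funX; apply: measurable_funB; exact: md.
  - by move=> y _; exact: sqr_ge0.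
  - by rewrite E2 ltry.
have d0 y : dif h (ind 0) y = 0.
  by rewrite /dif !indE; case: ifP => [/andP[? ?]|_]; [lra|]; case: ifP => [/andP[? ?]|_]; lra.
have I1 c : 0 <= c ->
    mu.-integrable setT (EFin \o (fun y => (dif h (ind c) y) ^+ 2)) /\
    (\int[mu]_y ((dif h (ind c) y) ^+ 2)%:E = (2 * Num.min h c)%:E)%E.
  move=> c0; have [h1 h2] := I2 0 c (lexx 0) c0.
  rewrite sub0r normrN ger0_norm// in h2; split.
    by apply: eq_integrable h1 => // y _ /=; rewrite d0 subr0.
  by rewrite -h2; apply: eq_integral => y _; rewrite d0 subr0.
have [ia ea] := I1 a a0; have [ib eb] := I1 b b0; have [iab eab] := I2 a b a0 b0.
have [r1 r2] := integral_half_comb ia ib iab ea eb eab.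
split.
  by apply: eq_integrable r1 => // y _ /=; congr EFin; field.
by rewrite -r2; apply: eq_integral => y _; congr EFin; field.
Qed.

Lemma integral_dcov (H L : R) (eta : R -> R) (a b : R) :
  shift_index H L eta -> 0 < H -> 0 <= a <= L -> 0 <= b <= L ->
  mu.-integrable setT (EFin \o (fun x => dcov (eta x) a b)) /\
  (\int[mu]_x (dcov (eta x) a b)%:E = (fbm_cov H a b)%:E)%E.
Proof.
move=> etaP H0 /andP[a0 aL] /andP[b0 bL].
have [meta eta0 _] := etaP.
have abL : `|a - b| <= L.
  by rewrite ler_norml; apply/andP; split; lra.
have I1 c : 0 <= c -> c <= L ->
    mu.-integrable setT (EFin \o (fun x => 2 * Num.min (eta x) c)).
  move=> c0 cL; apply: ge0_integrable => //.
  - by apply: measurable_funM => //; apply: measurable_minr.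
  - by move=> x _; rewrite mulr_ge0// le_min eta0.
  - by rewrite (integral_min_shift_index1 etaP)// ltry.
exact: (integral_half_comb (I1 _ a0 aL) (I1 _ b0 bL) (I1 _ (normr_ge0 _) abL)
  (integral_min_shift_index1 etaP H0 a0 aL)
  (integral_min_shift_index1 etaP H0 b0 bL)
  (integral_min_shift_index1 etaP H0 (normr_ge0 _) abL)).
Qed.

End polarization.

(** * The quadratic form of the fractional Brownian sheet *)

Section quadratic_form.
Context {R : realType}.
Notation mu := (@lebesgue_measure R).
Notation mu2 := (mu \x mu)%E.
Variables eta1 eta2 : R -> R.
Hypothesis meta1 : measurable_fun setT eta1.
Hypothesis meta2 : measurable_fun setT eta2.

Definition ddif (G : R -> R -> R) (z w : R * R) : R :=
  G (w.1 + eta1 z.1) (w.2 + eta2 z.2) - G (w.1 + eta1 z.1) w.2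
  - G w.1 (w.2 + eta2 z.2) + G w.1 w.2.

(** A Gagliardo-type energy: [z] runs over the pairs of shifts produced by [eta1] and [eta2], [w]
    over the plane. Being a nonnegative integral, it is meaningful for every measurable [G],
    possibly infinite. *)
Definition qform (G : R -> R -> R) : \bar R :=
  (\int[mu2]_z \int[mu2]_w ((ddif G z w) ^+ 2)%:E)%E.

Lemma measurable_ddif (G : R -> R -> R) :
  measurable_fun [set: measurableTypeR R * measurableTypeR R] (fun p => G p.1 p.2) ->
  measurable_fun [set: (measurableTypeR R * measurableTypeR R) * (measurableTypeR R * measurableTypeR R)]
    (fun zw => ddif G zw.1 zw.2).
Proof.
move=> mG.
have n11 : measurable_fun [set: (measurableTypeR R * measurableTypeR R) * (measurableTypeR R * measurableTypeR R)]
    (fun zw => zw.1.1 : measurableTypeR R).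
  exact: (measurableT_comp measurable_fst measurable_fst).
have n12 : measurable_fun [set: (measurableTypeR R * measurableTypeR R) * (measurableTypeR R * measurableTypeR R)]
    (fun zw => zw.1.2 : measurableTypeR R).
  exact: (measurableT_comp measurable_snd measurable_fst).
have n1 : measurable_fun [set: (measurableTypeR R * measurableTypeR R) * (measurableTypeR R * measurableTypeR R)]
    (fun zw => zw.2.1 : measurableTypeR R).
  exact: (measurableT_comp measurable_fst measurable_snd).
have n2 : measurable_fun [set: (measurableTypeR R * measurableTypeR R) * (measurableTypeR R * measurableTypeR R)]
    (fun zw => zw.2.2 : measurableTypeR R).
  exact: (measurableT_comp measurable_snd measurable_snd).
have m1 : measurable_fun [set: (measurableTypeR R * measurableTypeR R) * (measurableTypeR R * measurableTypeR R)]
    (fun zw => zw.2.1 + eta1 zw.1.1).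
  by apply: (measurable_funD n1); exact: (measurableT_comp meta1 n11).
have m2 : measurable_fun [set: (measurableTypeR R * measurableTypeR R) * (measurableTypeR R * measurableTypeR R)]
    (fun zw => zw.2.2 + eta2 zw.1.2).
  by apply: (measurable_funD n2); exact: (measurableT_comp meta2 n12).
have mc (f g : (measurableTypeR R * measurableTypeR R) * (measurableTypeR R * measurableTypeR R) -> measurableTypeR R) :
    measurable_fun setT f -> measurable_fun setT g -> measurable_fun setT (fun zw => G (f zw) (g zw)).
  move=> mf mg; apply: (measurableT_comp mG (_ : measurable_fun setT (fun zw => (f zw, g zw)))).
  exact: measurable_fun_pair.
by apply: measurable_funD; [apply: measurable_funB; [apply: measurable_funB|]|]; apply: mc.
Qed.

End quadratic_form.

Section lebesgue_plane.
Context {R : realType}.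
Notation mu := (@lebesgue_measure R).

Let sigma_finite_plane : sigma_finite setT (mu \x mu)%E.
Proof.
have /sigma_finiteP[F [TF ndF Foo]] := sigma_finiteT mu.
exists (fun n => F n `*` F n).
  rewrite -setXTT {1 2}TF predeqE => -[x y]; split.
    move=> [/= [n _ Fnx] [k _ Fky]]; exists (maxn n k) => //; split.
      by move: x Fnx; exact/subsetPset/ndF/leq_maxl.
    by move: y Fky; exact/subsetPset/ndF/leq_maxr.
  by move=> [n _ []/= ? ?]; split; exists n.
move=> k; have [? ?] := Foo k; split; first exact: measurableX.
by apply: (le_lt_trans _ (lte_mul_pinfty _ _ (Foo k).2)); [rewrite product_measure1E|..]; rewrite ?ge0_fin_numE.
Qed.

(** The product measure packaged as sigma-finite, so that it can itself be a factor in Tonelli's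
    theorem. *)
Definition plane : {sigma_finite_measure set (measurableTypeR R * measurableTypeR R)%type -> \bar R} :=
  HB.pack (mu \x mu)%E (Measure_isSigmaFinite.Build _ _ _ (mu \x mu)%E sigma_finite_plane).

End lebesgue_plane.

Section qform_tensor.
Context {R : realType}.
Notation mu := (@lebesgue_measure R).
Notation mu2 := (mu \x mu)%E.

Lemma ge0_integral_tensor d1 d2 (T1 : measurableType d1) (T2 : measurableType d2)
    (m1 : {sigma_finite_measure set T1 -> \bar R})
    (m2 : {sigma_finite_measure set T2 -> \bar R})
    (f : T1 -> \bar R) (g : T2 -> \bar R) :
  measurable_fun setT f -> measurable_fun setT g ->
  (forall x, 0 <= f x)%E -> (forall y, 0 <= g y)%E ->
  (\int[m1 \x m2]_z (f z.1 * g z.2) = \int[m1]_x f x * \int[m2]_y g y)%E.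
Proof.
move=> mf mg f0 g0.
rewrite (fubini_tonelli1 (fun z => f z.1 * g z.2)%E); first last.
- by move=> z; rewrite mule_ge0.
- by apply: emeasurable_funM; apply: measurableT_comp.
transitivity (\int[m1]_x (f x * \int[m2]_y g y))%E.
  by apply: eq_integral => x _; rewrite /fubini_F /= ge0_integralZl.
by rewrite ge0_integralZr// integral_ge0.
Qed.

Lemma integral_plane (f : measurableTypeR R * measurableTypeR R -> \bar R) :
  measurable_fun setT f -> (forall z, 0 <= f z)%E ->
  (\int[mu2]_z f z = \int[mu]_x \int[mu]_y f (x, y))%E.
Proof. by move=> mf f0; apply: (fubini_tonelli1 (m1 := mu) (m2 := mu)). Qed.

Definition dnorm (h : R) (f : R -> R) : \bar R := (\int[mu]_y ((dif h f y) ^+ 2)%:E)%E.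

Lemma measurable_dnorm (eta f : R -> R) : measurable_fun setT eta -> measurable_fun setT f ->
  measurable_fun setT (fun x => dnorm (eta x) f).
Proof.
move=> meta mf.
apply: (measurable_fun_fubini_tonelli_F (m2 := mu)
  (fun z : measurableTypeR R * measurableTypeR R => ((dif (eta z.1) f z.2) ^+ 2)%:E)).
- apply/measurable_EFinP; apply: measurable_funX; apply: measurable_funB.
    apply: measurableT_comp => //; apply: measurable_funD => //.
    exact: measurableT_comp.
  exact: measurableT_comp.
- by move=> z; rewrite lee_fin sqr_ge0.
Qed.

Lemma dnorm_nneg h f : (0 <= dnorm h f)%E.
Proof. by apply: integral_ge0 => x _; rewrite lee_fin sqr_ge0. Qed.

Variables eta1 eta2 : R -> R.
Hypothesis meta1 : measurable_fun setT eta1.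
Hypothesis meta2 : measurable_fun setT eta2.

(** The rectangular increment of a product is the product of the increments, so the four-fold
    integral separates. *)
Lemma qform_tensor (a phi : R -> R) :
  measurable_fun setT a -> measurable_fun setT phi ->
  (qform eta1 eta2 (fun y r => a r * phi y)%R =
   (\int[mu]_x dnorm (eta1 x) phi) * (\int[mu]_x dnorm (eta2 x) a))%E.
Proof.
move=> ma mphi.
rewrite -ge0_integral_tensor; [|exact: measurable_dnorm|exact: measurable_dnorm|
  by move=> x; exact: dnorm_nneg|by move=> x; exact: dnorm_nneg].
apply: eq_integral => z _; rewrite /dnorm -ge0_integral_tensor; first last.
- by move=> x; rewrite lee_fin sqr_ge0.
- by move=> x; rewrite lee_fin sqr_ge0.
- by apply/measurable_EFinP; apply: measurable_funX; exact: measurable_dif.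
- by apply/measurable_EFinP; apply: measurable_funX; exact: measurable_dif.
by apply: eq_integral => w _; rewrite -EFinM; congr EFin; rewrite /ddif /dif; ring.
Qed.

Let ddif_sqr_ge0 (G : R -> R -> R) z w : (0 <= ((ddif eta1 eta2 G z w) ^+ 2)%:E)%E.
Proof. by rewrite lee_fin sqr_ge0. Qed.

(** Combinations of indicators of rectangles with a corner at the origin, to which the values of the
    sheet correspond one by one. *)
Definition gsum (s : seq (R * (R * R))) (y r : R) : R :=
  \sum_(p <- s) p.1 * (ind p.2.1 y * ind p.2.2 r).

Lemma measurable_gsum s :
  measurable_fun [set: measurableTypeR R * measurableTypeR R] (fun p => gsum s p.1 p.2).
Proof.
apply: measurable_sum => p; apply: measurable_funM => //.
by apply: measurable_funM; apply: measurableT_comp => //; exact: measurable_ind.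
Qed.

Lemma measurable_qdensity (G : R -> R -> R) :
  measurable_fun [set: measurableTypeR R * measurableTypeR R] (fun p => G p.1 p.2) ->
  measurable_fun [set: measurableTypeR R * measurableTypeR R]
    (fun z => \int[mu2]_w ((ddif eta1 eta2 G z w) ^+ 2)%:E)%E.
Proof.
move=> mG.
apply: (measurable_fun_fubini_tonelli_F (m2 := plane)
  (fun zw : (measurableTypeR R * measurableTypeR R) * (measurableTypeR R * measurableTypeR R) =>
    ((ddif eta1 eta2 G zw.1 zw.2) ^+ 2)%:E)) => //.
by apply/measurable_EFinP; apply: measurable_funX; exact: measurable_ddif.
Qed.

Lemma measurable_ddif2 (G : R -> R -> R) z :
  measurable_fun [set: measurableTypeR R * measurableTypeR R] (fun p => G p.1 p.2) ->
  measurable_fun [set: measurableTypeR R * measurableTypeR R] (ddif eta1 eta2 G z).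
Proof.
move=> mG; have mp := measurable_ddif meta1 meta2 mG.
apply: (measurableT_comp mp (_ : measurable_fun setT (fun w => (z, w)))).
exact: measurable_pair1.
Qed.

(** Squaring the sum gives a double sum of tensor products. Integrating first over the plane yields
    products of [dcov], then over the shifts products of [fbm_cov], which are the covariances of the
    sheet. *)
Lemma qform_gsum (H1 H2 L1 L2 : R) s :
  shift_index H1 L1 eta1 -> shift_index H2 L2 eta2 -> 0 < H1 -> 0 < H2 ->
  (forall p, p \in s -> 0 <= p.2.1 <= L1 /\ 0 <= p.2.2 <= L2) ->
  qform eta1 eta2 (gsum s) =
  (\sum_(pq <- [seq (p, q) | p <- s, q <- s])
     pq.1.1 * pq.2.1 * (fbm_cov H1 pq.1.2.1 pq.2.2.1) * fbm_cov H2 pq.1.2.2 pq.2.2.2)%:E.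
Proof.
move=> P1 P2 H10 H20 sL.
have [_ eta10 _] := P1; have [_ eta20 _] := P2.
set s2 := [seq _ | _ <- _, _ <- _].
have s2P pq : pq \in s2 -> pq.1 \in s /\ pq.2 \in s.
  by move=> /allpairsP[[p q]] /= [ps qs ->].
have sqE z w : (ddif eta1 eta2 (gsum s) z w) ^+ 2 =
    \sum_(pq <- s2) (pq.1.1 * pq.2.1 * (dif (eta1 z.1) (ind pq.1.2.1) w.1 * dif (eta1 z.1) (ind pq.2.2.1) w.1))
      * (dif (eta2 z.2) (ind pq.1.2.2) w.2 * dif (eta2 z.2) (ind pq.2.2.2) w.2).
  have -> : ddif eta1 eta2 (gsum s) z w =
      \sum_(p <- s) p.1 * (dif (eta1 z.1) (ind p.2.1) w.1 * dif (eta2 z.2) (ind p.2.2) w.2).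
    rewrite /ddif /gsum -!sumrB -big_split /=; apply: eq_bigr => p _.
    by rewrite /dif; ring.
  rewrite expr2 big_distrl /= /s2 big_allpairs_dep /=; apply: eq_bigr => p _.
  by rewrite big_distrr /=; apply: eq_bigr => q _; ring.
have qE x y : (\int[mu2]_w ((ddif eta1 eta2 (gsum s) (x, y) w) ^+ 2)%:E =
    (\sum_(pq <- s2) (pq.1.1 * pq.2.1 * dcov (eta1 x) pq.1.2.1 pq.2.2.1)
       * dcov (eta2 y) pq.1.2.2 pq.2.2.2)%:E)%E.
  rewrite integral_plane; [|apply/measurable_EFinP; apply: measurable_funX;
      apply: measurable_ddif2; exact: measurable_gsum|by move=> w; exact: ddif_sqr_ge0].
  pose u1 (pq : (R * (R * R)) * (R * (R * R))) w1 :=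
    pq.1.1 * pq.2.1 * (dif (eta1 x) (ind pq.1.2.1) w1 * dif (eta1 x) (ind pq.2.2.1) w1).
  pose v1 (pq : (R * (R * R)) * (R * (R * R))) w2 :=
    dif (eta2 y) (ind pq.1.2.2) w2 * dif (eta2 y) (ind pq.2.2.2) w2.
  transitivity (\int[mu]_w1 \int[mu]_w2 (\sum_(pq <- s2) u1 pq w1 * v1 pq w2)%:E)%E.
    by apply: eq_integral => w1 _; apply: eq_integral => w2 _; rewrite sqE.
  apply: (@integral_sum_tensor R _ _ _ _ mu mu _ s2 u1 v1
    (fun pq => pq.1.1 * pq.2.1 * dcov (eta1 x) pq.1.2.1 pq.2.2.1)
    (fun pq => dcov (eta2 y) pq.1.2.2 pq.2.2.2)).
  - move=> pq /s2P[/sL[/andP[p1 _] _] /sL[/andP[q1 _] _]].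
    have [h _] := integral_dif_ind (eta10 x) p1 q1.
    exact: (integrableZl _ (pq.1.1 * pq.2.1) h).
  - move=> pq /s2P[/sL[/andP[p1 _] _] /sL[/andP[q1 _] _]].
    have [h e] := integral_dif_ind (eta10 x) p1 q1.
    under eq_integral do rewrite EFinM.
    by rewrite integralZl//= e.
  - move=> pq /s2P[/sL[_ /andP[p1 _]] /sL[_ /andP[q1 _]]].
    by have [] := integral_dif_ind (eta20 y) p1 q1.
  - move=> pq /s2P[/sL[_ /andP[p1 _]] /sL[_ /andP[q1 _]]].
    by have [] := integral_dif_ind (eta20 y) p1 q1.
rewrite /qform.
rewrite integral_plane; first last.
- by move=> z; apply: integral_ge0.
- by apply: measurable_qdensity; exact: measurable_gsum.
pose u2 (pq : (R * (R * R)) * (R * (R * R))) x :=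
  pq.1.1 * pq.2.1 * dcov (eta1 x) pq.1.2.1 pq.2.2.1.
pose v2 (pq : (R * (R * R)) * (R * (R * R))) y := dcov (eta2 y) pq.1.2.2 pq.2.2.2.
transitivity (\int[mu]_x \int[mu]_y (\sum_(pq <- s2) u2 pq x * v2 pq y)%:E)%E.
  by apply: eq_integral => x _; apply: eq_integral => y _; rewrite qE.
apply: (@integral_sum_tensor R _ _ _ _ mu mu _ s2 u2 v2
  (fun pq => pq.1.1 * pq.2.1 * fbm_cov H1 pq.1.2.1 pq.2.2.1)
  (fun pq => fbm_cov H2 pq.1.2.2 pq.2.2.2)).
- move=> pq /s2P[/sL[p1 _] /sL[q1 _]].
  have [h _] := integral_dcov P1 H10 p1 q1.
  exact: (integrableZl _ (pq.1.1 * pq.2.1) h).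
- move=> pq /s2P[/sL[p1 _] /sL[q1 _]].
  have [h e] := integral_dcov P1 H10 p1 q1.
  under eq_integral do rewrite EFinM.
  by rewrite integralZl//= e.
- by move=> pq /s2P[/sL[_ p1] /sL[_ q1]]; have [] := integral_dcov P2 H20 p1 q1.
- by move=> pq /s2P[/sL[_ p1] /sL[_ q1]]; have [] := integral_dcov P2 H20 p1 q1.
Qed.

End qform_tensor.

Section square_integrals.
Context {R : realType}.

Lemma ge0_integral_double d (T : measurableType d) (m : {measure set T -> \bar R})
    (a b : T -> \bar R) : measurable_fun setT a -> measurable_fun setT b ->
  (forall x, 0 <= a x)%E -> (forall x, 0 <= b x)%E ->
  (\int[m]_x (2%:E * a x + 2%:E * b x) = 2%:E * \int[m]_x a x + 2%:E * \int[m]_x b x)%E.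
Proof.
move=> ma mb a0 b0.
have z (c : T -> \bar R) : measurable_fun setT c -> (forall x, 0 <= c x)%E ->
    (\int[m]_x (2%:E * c x) = 2%:E * \int[m]_x c x)%E.
  move=> mc c0; apply: ge0_integralZl_EFin; [exact: measurableT|by move=> x _|exact: mc|by []].
rewrite -(z _ ma a0) -(z _ mb b0); apply: ge0_integralD.
- exact: measurableT.
- by move=> x _; rewrite mule_ge0.
- exact: measurable_funeM.
- by move=> x _; rewrite mule_ge0.
- exact: measurable_funeM.
Qed.

Lemma integral_sqr_add_le d (T : measurableType d) (m : {measure set T -> \bar R})
    (f g h : T -> R) : measurable_fun setT g -> measurable_fun setT h ->
  (forall x, f x = g x + h x) ->
  (\int[m]_x ((f x) ^+ 2)%:E <=
   2%:E * \int[m]_x ((g x) ^+ 2)%:E + 2%:E * \int[m]_x ((h x) ^+ 2)%:E)%E.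
Proof.
move=> mg mh fgh.
have m2 (k : T -> R) : measurable_fun setT k -> measurable_fun setT (fun x => ((k x) ^+ 2)%:E).
  by move=> mk; apply/measurable_EFinP; apply: measurable_funX.
have p2 (k : T -> R) x : (0 <= ((k x) ^+ 2)%:E)%E by rewrite lee_fin sqr_ge0.
rewrite -(ge0_integral_double m (m2 _ mg) (m2 _ mh)); [|by move=> x; exact: p2|by move=> x; exact: p2].
apply: ge0_integral_mono => x _; first exact: p2.
rewrite fgh -!EFinM -EFinD lee_fin; set a := g x; set b := h x.
have := sqr_ge0 (a - b); rewrite !expr2; lra.
Qed.

Lemma le_limn_einf (a : \bar R) (b c : (\bar R)^nat) :
  (forall m, a <= b m + c m)%E -> c @ \oo --> 0%E -> (a <= limn_einf b)%E.
Proof.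
move=> abc /fine_cvgP[cfin c0]; apply/lee_addgt0Pr => e e0.
have [N _ HN] : \forall m \near \oo, (c m <= e%:E)%E.
  move/cvgrPdist_le : c0 => /(_ e e0) h; near=> m.
  have fm : c m \is a fin_num by near: m.
  rewrite -(fineK fm) lee_fin (le_trans (ler_norm _))//.
  by rewrite -normrN -sub0r; near: m.
rewrite limn_einf_lim (@le_trans _ _ (einfs b N + e%:E)%E)//; last first.
  rewrite leeD2r// (cvg_lim _ (@cvg_einfs_sup _ b))//.
  by apply: ereal_sup_ubound; exists N.
rewrite -leeBlDr//; apply: le_ereal_inf_tmp => _ /= [m Nm <-].
have h : (a <= b m + e%:E)%E by rewrite (le_trans (abc m))// leeD2l//; exact: HN.
by move: h; rewrite -leeBlDr.
Unshelve. all: by end_near. Qed.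

Lemma limn_einf_le (u : (\bar R)^nat) (B : \bar R) :
  (forall n, u n <= B)%E -> (limn_einf u <= B)%E.
Proof.
move=> uB; rewrite limn_einf_lim; apply: lime_le; first exact: is_cvg_einfs.
near=> n; apply: (le_trans _ (uB n)); apply: ereal_inf_lbound.
by exists n => //=.
Unshelve. all: by end_near. Qed.

Lemma cvge0_le (u : (\bar R)^nat) (e : R) : u @ \oo --> 0%E -> 0 < e ->
  exists N, forall n, (N <= n)%N -> (u n <= e%:E)%E.
Proof.
move=> /fine_cvgP[ufin u0] e0.
have [N _ HN] : \forall m \near \oo, (u m <= e%:E)%E.
  move/cvgrPdist_le : u0 => /(_ e e0) h; near=> m.
  have fm : u m \is a fin_num by near: m.
  rewrite -(fineK fm) lee_fin (le_trans (ler_norm _))//.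
  by rewrite -normrN -sub0r; near: m.
by exists N => n; exact: HN.
Unshelve. all: by end_near. Qed.

End square_integrals.

Section qform_closable.
Context {R : realType}.
Notation mu := (@lebesgue_measure R).
Notation mu2 := (mu \x mu)%E.
Variables eta1 eta2 : R -> R.
Hypothesis meta1 : measurable_fun setT eta1.
Hypothesis meta2 : measurable_fun setT eta2.

Notation meas2 G := (measurable_fun [set: measurableTypeR R * measurableTypeR R]
  (fun p => G p.1 p.2)).

Let qd (G : R -> R -> R) z := (\int[mu2]_w ((ddif eta1 eta2 G z w) ^+ 2)%:E)%E.

Let qd_ge0 G z : (0 <= qd G z)%E.
Proof. by apply: integral_ge0 => w _; rewrite lee_fin sqr_ge0. Qed.

Let qd_add (G G1 G2 : R -> R -> R) z : meas2 G1 -> meas2 G2 -> (forall y r, G y r = G1 y r + G2 y r) ->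
  (qd G z <= 2%:E * qd G1 z + 2%:E * qd G2 z)%E.
Proof.
move=> m1 m2 E; apply: integral_sqr_add_le.
- exact: measurable_ddif2.
- exact: measurable_ddif2.
- by move=> w; rewrite /ddif !E; ring.
Qed.

Lemma qform_ge0 G : (0 <= qform eta1 eta2 G)%E.
Proof. by apply: integral_ge0 => z _; exact: qd_ge0. Qed.

Lemma qform_add_le (G G1 G2 : R -> R -> R) : meas2 G1 -> meas2 G2 ->
  (forall y r, G y r = G1 y r + G2 y r) ->
  (qform eta1 eta2 G <= 2%:E * qform eta1 eta2 G1 + 2%:E * qform eta1 eta2 G2)%E.
Proof.
move=> m1 m2 E; rewrite /qform.
have mq (K : R -> R -> R) : meas2 K -> measurable_fun setT (qd K).
  by move=> mK; exact: measurable_qdensity.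
rewrite -(ge0_integral_double mu2 (mq _ m1) (mq _ m2)); [|by move=> x; exact: qd_ge0|by move=> x; exact: qd_ge0].
by apply: ge0_integral_mono => z _; [exact: qd_ge0|exact: qd_add].
Qed.

Lemma integral_plane_shift (f : R -> R -> \bar R) (h k : R) :
  measurable_fun [set: measurableTypeR R * measurableTypeR R] (fun p => f p.1 p.2) ->
  (forall y r, 0 <= f y r)%E ->
  (\int[mu2]_w f (w.1 + h)%R (w.2 + k)%R = \int[mu2]_w f w.1 w.2)%E.
Proof.
move=> mf f0.
have mh : measurable_fun [set: measurableTypeR R * measurableTypeR R]
    (fun p => (p.1 + h, p.2 + k) : measurableTypeR R * measurableTypeR R).
  by apply: measurable_fun_pair; apply: measurable_funD.
have msh : measurable_fun [set: measurableTypeR R * measurableTypeR R]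
    (fun p => f (p.1 + h) (p.2 + k)) by exact: (measurableT_comp mf mh).
rewrite !integral_plane//=.
have mf2 y : measurable_fun [set: measurableTypeR R] (f y).
  exact: (measurable_fun_pair2 y mf).
transitivity (\int[mu]_x \int[mu]_y f (x + h)%R y)%E.
  by apply: eq_integral => x _; apply: (ge0_integral_shift (f := f (x + h)%R)) => //; exact: mf2.
apply: (ge0_integral_shift (f := fun x => (\int[mu]_y f x y)%E)).
  by apply: (measurable_fun_fubini_tonelli_F (m2 := mu) (fun z : measurableTypeR R * measurableTypeR R => f z.1 z.2)).
by move=> x; exact: integral_ge0.
Qed.

(** For a fixed pair of shifts, the increment is a sum of four translates of [G], whence 16 = 4^2 by
    translation invariance. *)
Lemma qdensity_le (G : R -> R -> R) z : meas2 G ->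
  (qd G z <= 16%:E * \int[mu2]_w ((G w.1 w.2) ^+ 2)%:E)%E.
Proof.
move=> mG; set I := (\int[mu2]_w _)%E.
have mG2 : measurable_fun [set: measurableTypeR R * measurableTypeR R]
    (fun p => ((G p.1 p.2) ^+ 2)%:E).
  by apply/measurable_EFinP; apply: measurable_funX.
have sh h k : (\int[mu2]_w ((G (w.1 + h) (w.2 + k)) ^+ 2)%:E = I)%E.
  by apply: (integral_plane_shift (f := fun y r => ((G y r) ^+ 2)%:E)) => // y r; rewrite lee_fin sqr_ge0.
have mh h k : measurable_fun [set: measurableTypeR R * measurableTypeR R]
    (fun p => G (p.1 + h) (p.2 + k)).
  apply: (measurableT_comp mG (_ : measurable_fun setT (fun p : measurableTypeR R * measurableTypeR R => (p.1 + h, p.2 + k)))).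
  by apply: measurable_fun_pair; apply: measurable_funD.
pose a (w : measurableTypeR R * measurableTypeR R) := G (w.1 + eta1 z.1) (w.2 + eta2 z.2).
pose b (w : measurableTypeR R * measurableTypeR R) := G (w.1 + eta1 z.1) (w.2 + 0).
pose c (w : measurableTypeR R * measurableTypeR R) := G (w.1 + 0) (w.2 + eta2 z.2).
pose e (w : measurableTypeR R * measurableTypeR R) := G (w.1 + 0) (w.2 + 0).
have h1 : (qd G z <= 2%:E * \int[mu2]_w ((a w - b w) ^+ 2)%:E + 2%:E * \int[mu2]_w ((e w - c w) ^+ 2)%:E)%E.
  apply: integral_sqr_add_le.
  - by apply: measurable_funB; exact: mh.
  - by apply: measurable_funB; exact: mh.
  - by move=> w; rewrite /ddif /a /b /c /e !addr0; ring.
have h2 : (\int[mu2]_w ((a w - b w) ^+ 2)%:E <= 4%:E * I)%E.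
  have := integral_sqr_add_le mu2 (mh (eta1 z.1) (eta2 z.2)) (measurable_funN (mh (eta1 z.1) 0)) (fun=> erefl).
  move=> /le_trans; apply.
  under [X in (_ + _ * X)%E]eq_integral do rewrite sqrrN.
  rewrite !sh -ge0_muleDl// -EFinD (_ : (2 + 2)%R = 4 :> R)//.
  by rewrite -natrD.
have h3 : (\int[mu2]_w ((e w - c w) ^+ 2)%:E <= 4%:E * I)%E.
  have := integral_sqr_add_le mu2 (mh 0 0) (measurable_funN (mh 0 (eta2 z.2))) (fun=> erefl).
  move=> /le_trans; apply.
  under [X in (_ + _ * X)%E]eq_integral do rewrite sqrrN.
  rewrite !sh -ge0_muleDl// -EFinD (_ : (2 + 2)%R = 4 :> R)//.
  by rewrite -natrD.
apply: (le_trans h1); apply: (le_trans (leeD (lee_wpmul2l _ h2) (lee_wpmul2l _ h3))); rewrite ?lee_fin//.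
by rewrite !muleA -!EFinM -ge0_muleDl// -EFinD; rewrite (_ : 2 * 4 + 2 * 4 = 16 :> R)//; lra.
Qed.

(** L2 convergence controls the density of the form at each fixed pair of shifts, by [qdensity_le],
    but not its integral over all shifts. Fatou's lemma transfers the uniform bound to the limit;
    the 2 comes from splitting a square. *)
Lemma qform_limit (G : R -> R -> R) (S : nat -> R -> R -> R) (S0 : R -> R -> R) (B : \bar R) :
  meas2 G -> (forall m, meas2 (S m)) -> meas2 S0 ->
  (fun m => \int[mu2]_w ((G w.1 w.2 - S m w.1 w.2) ^+ 2)%:E)%E @ \oo --> 0%E ->
  (forall m, qform eta1 eta2 (fun y r => (S m y r - S0 y r)%R) <= B)%E ->
  (qform eta1 eta2 (fun y r => (G y r - S0 y r)%R) <= 2%:E * B)%E.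
Proof.
move=> mG mS mS0 cvS SB.
have mB (K1 K2 : R -> R -> R) : meas2 K1 -> meas2 K2 -> meas2 (fun y r => K1 y r - K2 y r).
  by move=> h1 h2; exact: measurable_funB.
have mq m : measurable_fun [set: measurableTypeR R * measurableTypeR R] (fun z => 2%:E * qd (fun y r => (S m y r - S0 y r)%R) z)%E.
  by apply: measurable_funeM; apply: measurable_qdensity => //; exact: mB.
have step z : (qd (fun y r => (G y r - S0 y r)%R) z <=
    limn_einf (fun m => 2%:E * qd (fun y r => (S m y r - S0 y r)%R) z))%E.
  apply: (@le_limn_einf _ _ _ (fun m => 2%:E * (16%:E * \int[mu2]_w ((G w.1 w.2 - S m w.1 w.2) ^+ 2)%:E))%E).
    move=> m; apply: (@le_trans _ _ (2%:E * qd (fun y r => (S m y r - S0 y r)%R) z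
        + 2%:E * qd (fun y r => (G y r - S m y r)%R) z)%E).
      by apply: qd_add; [exact: mB|exact: mB|move=> y r; ring].
    by rewrite leeD2l// lee_wpmul2l//; apply: qdensity_le; exact: mB.
  rewrite -[X in _ --> X](mule0 2%:E); apply: cvgeZl => //.
  by rewrite -[X in _ --> X](mule0 16%:E); apply: cvgeZl.
apply: (@le_trans _ _ (\int[mu2]_z limn_einf (fun m => 2%:E * qd (fun y r => (S m y r - S0 y r)%R) z))%E).
  by apply: ge0_integral_mono => z _; [exact: qd_ge0|exact: step].
apply: (le_trans (fatou mu2 _ _ _)) => //.
  by move=> m z _; rewrite mule_ge0// qd_ge0.
apply: limn_einf_le => m.
rewrite ge0_integralZl_EFin; [|exact: measurableT|by move=> z _; exact: qd_ge0
  |by apply: measurable_qdensity => //; exact: mB|by []].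
by apply: lee_wpmul2l => //; exact: SB.
Qed.

End qform_closable.

(** * Wiener integrals: second moments and linearity *)

Lemma norm_mul_le_sqr {R : realDomainType} (a b : R) : `|a * b| <= `|a ^+ 2 + b ^+ 2|.
Proof.
rewrite (ger0_norm (addr_ge0 (sqr_ge0 a) (sqr_ge0 b))) normrM.
have := sqr_ge0 (`|a| - `|b|); rewrite sqrrB !real_normK ?num_real// -mulr_natr.
have := mulr_ge0 (normr_ge0 a) (normr_ge0 b); lra.
Qed.

Lemma double_add_le {R : realType} (x y a b c : \bar R) : (x <= a)%E -> (y <= b)%E ->
  (2%:E * a + 2%:E * b <= c)%E -> (2%:E * x + 2%:E * y <= c)%E.
Proof.
by move=> xa yb; apply: le_trans; apply: leeD; apply: lee_wpmul2l => //; rewrite lee_fin.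
Qed.

(** The bookkeeping of [wint_bound]: the errors add up to 2 + 32 = 34 units of eps / 34. *)
Lemma wint_arith {R : realType} (Q : \bar R) (eps : R) : (0 <= Q)%E ->
  (2%:E * (eps / 34)%:E + 2%:E * (2%:E * Q + 2%:E * (2%:E * (4 * (eps / 34))%:E))
   <= 4%:E * Q + eps%:E)%E.
Proof.
case: Q => [q _| _|//]; last first.
  by rewrite [(4%:E * _)%E]gt0_muley ?lte_fin// addye// leey.
by rewrite -!(EFinM, EFinD) lee_fin; lra.
Qed.

Section wiener_isometry.
Context {R : realType} {d : measure_display} {Omega : measurableType d}.
Variables (P : probability Omega R) (T H1 H2 : R) (W : R -> R -> {RV P >-> R}).
Notation mu := (@lebesgue_measure R).
Notation mu2 := (mu \x mu)%E.
Hypothesis H1_gt0 : 0 < H1.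
Hypothesis H2_gt0 : 0 < H2.
Hypothesis covW : forall x y t r : R, D x -> D y -> 0 <= t <= T -> 0 <= r <= T ->
  'E_P[W x t \* W y r]%E = (fbm_cov H1 x y * fbm_cov H2 t r)%:E.
Variables eta1 eta2 : R -> R.
Hypothesis eta1P : shift_index H1 1 eta1.
Hypothesis eta2P : shift_index H2 T eta2.

Notation meas2 G := (measurable_fun [set: measurableTypeR R * measurableTypeR R]
  (fun p => G p.1 p.2)).

Let covWE (x y t r : R) : D x -> D y -> 0 <= t <= T -> 0 <= r <= T ->
  (\int[P]_w (W x t w * W y r w)%:E = (fbm_cov H1 x y * fbm_cov H2 t r)%:E)%E.
Proof. by move=> *; rewrite -covW// unlock. Qed.

Let integrableW2 (x t : R) : D x -> 0 <= t <= T ->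
  P.-integrable setT (EFin \o (fun w => (W x t w) ^+ 2)).
Proof.
move=> Dx tT; apply: ge0_integrable.
- exact: measurableT.
- exact: measurable_funX.
- by move=> w _; exact: sqr_ge0.
- under eq_integral do rewrite expr2.
  by rewrite covWE// ltry.
Qed.

Let integrableWW (x y t r : R) : D x -> D y -> 0 <= t <= T -> 0 <= r <= T ->
  P.-integrable setT (EFin \o (fun w => W x t w * W y r w)).
Proof.
move=> Dx Dy tT rT.
apply: (le_integrable measurableT _ _ (g := EFin \o (fun w => (W x t w) ^+ 2 + (W y r w) ^+ 2))).
- by apply/measurable_EFinP; apply: measurable_funM.
- by move=> w _ /=; rewrite lee_fin norm_mul_le_sqr.
- rewrite (_ : EFin \o _ = (fun w => (EFin \o (fun w => (W x t w) ^+ 2)%R) w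
    + (EFin \o (fun w => (W y r w) ^+ 2)%R) w)%E)//.
  by apply: integrableD => //; exact: integrableW2.
Qed.

Definition wsum (s : seq (R * (R * R))) (w : Omega) : R :=
  \sum_(p <- s) p.1 * W p.2.1 p.2.2 w.

(** Both sides expand into the same double sum of covariances, on the right by [qform_gsum]. *)
Lemma integral_wsum_sqr (s : seq (R * (R * R))) :
  (forall p, p \in s -> D p.2.1 /\ 0 <= p.2.2 <= T) ->
  (\int[P]_w ((wsum s w) ^+ 2)%:E = qform eta1 eta2 (gsum s))%E.
Proof.
move=> sD; have [me1 _ _] := eta1P; have [me2 _ _] := eta2P.
rewrite (qform_gsum me1 me2 eta1P eta2P)//; last first.
  move=> p ps; have [] := sD _ ps; rewrite /D /= in_itv /= => /andP[p0 p1] ->.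
  by rewrite !ltW.
set s2 := [seq _ | _ <- _, _ <- _].
have s2P pq : pq \in s2 -> pq.1 \in s /\ pq.2 \in s.
  by move=> /allpairsP[[p q]] /= [ps qs ->].
have sqE w : (wsum s w) ^+ 2 = \sum_(pq <- s2)
    pq.1.1 * pq.2.1 * (W pq.1.2.1 pq.1.2.2 w * W pq.2.2.1 pq.2.2.2 w).
  rewrite expr2 /wsum big_distrl /= /s2 big_allpairs_dep /=; apply: eq_bigr => p _.
  by rewrite big_distrr /=; apply: eq_bigr => q _; ring.
under eq_integral do rewrite sqE.
apply: (integral_sum_seq (s := s2) (m := P)
  (u := fun (pq : (R * (R * R)) * (R * (R * R))) w => pq.1.1 * pq.2.1 * (W pq.1.2.1 pq.1.2.2 w * W pq.2.2.1 pq.2.2.2 w))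
  (U := fun pq : (R * (R * R)) * (R * (R * R)) => pq.1.1 * pq.2.1 * fbm_cov H1 pq.1.2.1 pq.2.2.1
    * fbm_cov H2 pq.1.2.2 pq.2.2.2) _ _).2 => pq /s2P[/sD[p1 p2] /sD[q1 q2]].
  rewrite (_ : EFin \o _ = (fun w => ((pq.1.1 * pq.2.1)%:E *
    (EFin \o (fun w => W pq.1.2.1 pq.1.2.2 w * W pq.2.2.1 pq.2.2.2 w)%R) w)%E))//.
  by apply: integrableZl => //; exact: integrableWW.
under eq_integral do rewrite EFinM.
rewrite integralZl//; last exact: integrableWW.
by rewrite covWE// -EFinM !mulrA.
Qed.

(** A rectangular increment as four signed values of the sheet; the same signs turn origin-cornered
    indicators into the indicator of the rectangle. *)
Definition corners (e : step_data R) : seq (R * (R * R)) :=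
  flatten [seq [:: (q.1.1, (q.1.2.2, q.2.2)); (- q.1.1, (q.1.2.1, q.2.2));
    (- q.1.1, (q.1.2.2, q.2.1)); (q.1.1, (q.1.2.1, q.2.1))] | q <- e].

Lemma step_integral_corners e w :
  step_integral (fun x t => W x t : Omega -> R) e w = wsum (corners e) w.
Proof.
rewrite /step_integral /wsum /corners big_flatten /= big_map; apply: eq_bigr.
by move=> [[c [a b]] [l u]] _; rewrite !big_cons big_nil /=; ring.
Qed.

Lemma step_fun_corners (e : step_data R) (y r : R) : step_in T e -> step_fun e (y, r) = gsum (corners e) y r.
Proof.
move=> eT; rewrite /step_fun /gsum /corners big_flatten /= big_map.
apply: eq_big_seq => -[[c [a b]] [l u]] /= qe.
have [a0 ab b1 l0 /andP[lu uT]] := eT _ _ _ _ _ qe.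
rewrite !big_cons big_nil /= !indicE !mem_setE !in_itv /=.
rewrite -(indB y (ltW a0) ab) -(indB r l0 lu); ring.
Qed.

Lemma corners_in (e : step_data R) (p : R * (R * R)) : step_in T e -> p \in corners e -> D p.2.1 /\ 0 <= p.2.2 <= T.
Proof.
move=> eT /flattenP[s0 /mapP[[[c [a b]] [l u]] qe ->]] /=.
have [a0 ab b1 l0 /andP[lu uT]] := eT _ _ _ _ _ qe.
have [b0 a1] : 0 < b /\ a < 1 by rewrite (lt_le_trans a0 ab) (le_lt_trans ab b1).
have [u0 lT] : 0 <= u /\ l <= T by rewrite (le_trans l0 lu) (le_trans lu uT).
rewrite /D !inE /= => /or4P[] /eqP -> /=; rewrite in_itv /=.
- by rewrite b0 b1 u0 uT.
- by rewrite a0 a1 u0 uT.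
- by rewrite b0 b1 l0 lT.
- by rewrite a0 a1 l0 lT.
Qed.

Lemma wiener_isometry_step e : step_in T e ->
  (\int[P]_w ((step_integral (fun x t => W x t : Omega -> R) e w) ^+ 2)%:E
   = qform eta1 eta2 (fun y r => step_fun e (y, r)))%E.
Proof.
move=> eT; under eq_integral do rewrite step_integral_corners.
rewrite integral_wsum_sqr; last by move=> p; exact: corners_in.
congr (qform eta1 eta2 _); apply/funext => y; apply/funext => r.
by rewrite step_fun_corners.
Qed.

Lemma measurable_step_fun e : step_in T e -> meas2 (fun y r => step_fun e (y, r)).
Proof.
move=> eT; rewrite (_ : (fun p => _) = (fun p => gsum (corners e) p.1 p.2)).
  exact: measurable_gsum.
by apply/funext => p; rewrite step_fun_corners.
Qed.

Lemma measurable_step_integral e :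
  measurable_fun setT (step_integral (fun x t => W x t : Omega -> R) e).
Proof.
rewrite (_ : step_integral _ e = wsum (corners e)).
  by apply: measurable_sum => p; apply: measurable_funM.
by apply/funext => w; rewrite step_integral_corners.
Qed.

Definition scale_step (c : R) (e : step_data R) : step_data R :=
  [seq (c * q.1.1, q.1.2, q.2) | q <- e].

Lemma scale_step_fun c e p : step_fun (scale_step c e) p = c * step_fun e p.
Proof.
rewrite /step_fun big_map big_distrr /=; apply: eq_bigr.
by move=> [[c' [a b]] [l u]] _ /=; rewrite mulrA.
Qed.

Lemma scale_step_integral c e w :
  step_integral (fun x t => W x t : Omega -> R) (scale_step c e) w =
  c * step_integral (fun x t => W x t : Omega -> R) e w.
Proof.
rewrite /step_integral big_map big_distrr /=; apply: eq_bigr.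
by move=> [[c' [a b]] [l u]] _ /=; rewrite mulrA.
Qed.

Lemma scale_step_in c e : step_in T e -> step_in T (scale_step c e).
Proof.
move=> eT c' a b l u /mapP[[[c'' [a' b']] [l' u']] qe] [_ -> -> -> ->].
exact: eT qe.
Qed.

Lemma cat_step_fun (e e' : step_data R) p :
  step_fun (e ++ e') p = step_fun e p + step_fun e' p.
Proof. by rewrite /step_fun big_cat. Qed.

Lemma cat_step_integral (e e' : step_data R) w :
  step_integral (fun x t => W x t : Omega -> R) (e ++ e') w =
  step_integral (fun x t => W x t : Omega -> R) e w
  + step_integral (fun x t => W x t : Omega -> R) e' w.
Proof. by rewrite /step_integral big_cat. Qed.

Lemma cat_step_in e e' : step_in T e -> step_in T e' -> step_in T (e ++ e').
Proof.
by move=> eT e'T c a b l u; rewrite mem_cat => /orP[/eT|/e'T].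
Qed.

(* Closure of the graph of the elementary integral, for integrands extended by
   zero to the whole plane. *)
Definition wint (g : R -> R -> R) (X : Omega -> R) : Prop :=
  [/\ meas2 g, measurable_fun setT X &
   exists e : nat -> step_data R,
    [/\ forall n, step_in T (e n),
        (fun n => \int[mu2]_w ((g w.1 w.2 - step_fun (e n) w) ^+ 2)%:E)%E
          @ \oo --> 0%E
      & (fun n => (\int[P]_w
           ((X w - step_integral (fun x t => W x t : Omega -> R) (e n) w) ^+ 2)%:E)%E)
          @ \oo --> 0%E]].

(** The elementary integrals converge in L2(Omega), so by the isometry the step functions are Cauchy
    for [qform]. [qform_limit] then makes g - G N small in the form for one large N, and X is
    compared with its elementary integral. Each splitting of a square costs a factor 2, whence the
    4. *)
Lemma wint_bound g X : wint g X ->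
  (\int[P]_w ((X w) ^+ 2)%:E <= 4%:E * qform eta1 eta2 g)%E.
Proof.
move=> [mg mX [e [eT ge Xe]]].
have [me1 _ _] := eta1P; have [me2 _ _] := eta2P.
pose I n := step_integral (fun x t => W x t : Omega -> R) (e n).
pose G n (y r : R) := step_fun (e n) (y, r).
have mG n : meas2 (G n) by exact: measurable_step_fun.
have mI n : measurable_fun setT (I n) by exact: measurable_step_integral.
apply/lee_addgt0Pr => eps eps0.
have eps34 : 0 < eps / 34 by rewrite divr_gt0.
have [N HN] := cvge0_le Xe eps34.
set de := eps / 34 in eps34 HN.
have cauchy m n : (N <= m)%N -> (N <= n)%N ->
    (qform eta1 eta2 (fun y r => (G m y r - G n y r)%R) <= (4 * de)%:E)%E.
  move=> Nm Nn.
  (* A difference of step functions is again a step function, so the isometry applies to it. *)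
  have <- : (fun y r => step_fun (e m ++ scale_step (-1) (e n)) (y, r)) =
      (fun y r => G m y r - G n y r).
    apply/funext => y; apply/funext => r.
    by rewrite cat_step_fun scale_step_fun mulN1r.
  rewrite -wiener_isometry_step; last by apply: cat_step_in => //; exact: scale_step_in.
  have := @integral_sqr_add_le _ _ _ P
    (step_integral (fun x t => W x t : Omega -> R) (e m ++ scale_step (-1) (e n)))
    (fun w => X w - I n w) (fun w => - (X w - I m w)).
  move=> /(_ _ _ _)/le_trans; apply.
  - exact: measurable_funB.
  - by apply: measurable_funN; exact: measurable_funB.
  - by move=> w; rewrite cat_step_integral scale_step_integral /I; ring.
  - under [X in (_ + _ * X)%E]eq_integral do rewrite sqrrN.
    have hn := HN n Nn; have hm := HN m Nm.
    apply: (double_add_le hn hm).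
    by rewrite -!EFinM -EFinD lee_fin; lra.
have lim : (qform eta1 eta2 (fun y r => (g y r - G N y r)%R) <= 2%:E * (4 * de)%:E)%E.
  apply: (@qform_limit _ _ _ me1 me2 g (fun m => G (m + N)%N) (G N)) => //.
  - have h := ge; rewrite -(cvg_shiftn N) /= in h.
    exact: h.
  - by move=> m; apply: cauchy; rewrite ?leq_addl.
have QN : (qform eta1 eta2 (G N) <= 2%:E * qform eta1 eta2 g + 2%:E * (2%:E * (4 * de)%:E))%E.
  have mgG : meas2 (fun y r => - (g y r - G N y r)).
    by apply: measurable_funN; apply: measurable_funB.
  have := @qform_add_le _ _ _ me1 me2 (G N) g (fun y r => - (g y r - G N y r)) mg mgG.
  move=> /(_ _)/le_trans; apply; first by move=> y r; ring.
  rewrite leeD2l// lee_wpmul2l//; move: lim; congr (_ <= _)%E.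
  by apply: eq_integral => z _; apply: eq_integral => w _; rewrite /ddif; congr EFin; ring.
have := @integral_sqr_add_le _ _ _ P X (fun w => X w - I N w) (I N).
move=> /(_ _ _ _)/le_trans; apply.
- exact: measurable_funB.
- exact: mI.
- by move=> w; ring.
- have hN := HN N (leqnn N).
  rewrite [X in (_ + _ * X)%E]wiener_isometry_step; last by [].
  apply: (double_add_le hN QN).
  by apply: wint_arith; exact: qform_ge0.
Qed.

End wiener_isometry.

Section wiener_linear.
Context {R : realType} {d : measure_display} {Omega : measurableType d}.
Variables (P : probability Omega R) (T : R) (W : R -> R -> {RV P >-> R}).
Notation mu := (@lebesgue_measure R).
Notation mu2 := (mu \x mu)%E.
Notation meas2 G := (measurable_fun [set: measurableTypeR R * measurableTypeR R]
  (fun p => G p.1 p.2)).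
Notation stepW := (step_integral (fun x t => W x t : Omega -> R)).

Lemma measurable_stepW e : measurable_fun setT (stepW e).
Proof.
apply: measurable_sum => -[[c [a b]] [l u]] /=.
by apply: measurable_funM => //; apply: measurable_funD => //; apply: measurable_funB => //; apply: measurable_funB.
Qed.

Lemma wint_measurable g X : wint T W g X -> measurable_fun setT X.
Proof. by case. Qed.

Lemma integral_sqrZ d' (T' : measurableType d') (m : {measure set T' -> \bar R})
    (c : R) (h : T' -> R) : measurable_fun setT h ->
  (\int[m]_x ((c * h x) ^+ 2)%:E = (c ^+ 2)%:E * \int[m]_x ((h x) ^+ 2)%:E)%E.
Proof.
move=> mh; under eq_integral do rewrite exprMn EFinM.
apply: ge0_integralZl_EFin.
- exact: measurableT.
- by move=> x _; rewrite lee_fin sqr_ge0.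
- by apply/measurable_EFinP; apply: measurable_funX.
- exact: sqr_ge0.
Qed.

Lemma wint_scale c g X : wint T W g X ->
  wint T W (fun y r => c * g y r) (fun w => c * X w).
Proof.
move=> [mg mX [e [eT ge Xe]]]; split.
- by apply: measurable_funM.
- by apply: measurable_funM.
exists (fun n => scale_step c (e n)); split.
- by move=> n; exact: scale_step_in.
- rewrite -[X in _ --> X](mule0 (c ^+ 2)%:E).
  rewrite (_ : (fun n => _) = (fun n => (c ^+ 2)%:E *
      \int[mu2]_w ((g w.1 w.2 - step_fun (e n) w) ^+ 2)%:E)%E).
    exact: cvgeZl.
  apply/funext => n; rewrite -integral_sqrZ.
    by apply: eq_integral => w _; rewrite scale_step_fun mulrBr.
  apply: measurable_funB => //.
  by have := measurable_step_fun (eT n); rewrite (_ : (fun p => _) = step_fun (e n))//; apply/funext => -[].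
- rewrite -[X in _ --> X](mule0 (c ^+ 2)%:E).
  rewrite (_ : (fun n => _) = (fun n => (c ^+ 2)%:E *
      \int[P]_w ((X w - stepW (e n) w) ^+ 2)%:E)%E).
    exact: cvgeZl.
  apply/funext => n; rewrite -integral_sqrZ.
    by apply: eq_integral => w _; rewrite scale_step_integral mulrBr.
  by apply: measurable_funB => //; exact: measurable_stepW.
Qed.

Lemma cvge0_double (a b c : (\bar R)^nat) : (forall n, 0 <= c n)%E ->
  (forall n, c n <= 2%:E * a n + 2%:E * b n)%E ->
  a @ \oo --> 0%E -> b @ \oo --> 0%E -> c @ \oo --> 0%E.
Proof.
move=> c0 cab ca cb.
apply: (@squeeze_cvge _ _ _ _ (cst 0%E) _ (fun n => 2%:E * a n + 2%:E * b n)%E).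
- by near=> n; rewrite c0 cab.
- exact: cvg_cst.
- rewrite -[X in _ --> X](adde0 0%E); apply: cvgeD => //.
    by rewrite -[X in _ --> X](mule0 2%:E); apply: cvgeZl.
  by rewrite -[X in _ --> X](mule0 2%:E); apply: cvgeZl.
Unshelve. all: by end_near. Qed.

Lemma wint_add g X h Y : wint T W g X -> wint T W h Y ->
  wint T W (fun y r => g y r + h y r) (fun w => X w + Y w).
Proof.
move=> [mg mX [e [eT ge Xe]]] [mh mY [e' [e'T he' Ye']]]; split.
- by apply: measurable_funD.
- by apply: measurable_funD.
have ms (k : step_data R) : step_in T k -> measurable_fun [set: measurableTypeR R * measurableTypeR R] (step_fun k).
  by move=> kT; have := measurable_step_fun kT; rewrite (_ : (fun p => _) = step_fun k)//; apply/funext => -[].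
exists (fun n => e n ++ e' n); split.
- by move=> n; exact: cat_step_in.
- apply: (cvge0_double _ _ ge he').
    by move=> n; apply: integral_ge0 => w _; rewrite lee_fin sqr_ge0.
  move=> n; apply: integral_sqr_add_le.
  + by apply: measurable_funB => //; exact: ms.
  + by apply: measurable_funB => //; exact: ms.
  + by move=> w; rewrite cat_step_fun; ring.
- apply: (cvge0_double _ _ Xe Ye').
    by move=> n; apply: integral_ge0 => w _; rewrite lee_fin sqr_ge0.
  move=> n; apply: integral_sqr_add_le.
  + by apply: measurable_funB => //; exact: measurable_stepW.
  + by apply: measurable_funB => //; exact: measurable_stepW.
  + by move=> w; rewrite cat_step_integral; ring.
Qed.

Lemma wint0 : wint T W (fun _ _ => 0) (fun=> 0).
Proof.
split; [exact: measurable_cst|exact: measurable_cst|exists (fun=> [::])]; split.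
- by [].
- rewrite (_ : (fun n => _) = cst 0%E); first exact: cvg_cst.
  by apply/funext => n; apply: integral0_eq => w _; rewrite /step_fun big_nil subr0 expr0n.
- rewrite (_ : (fun n => _) = cst 0%E); first exact: cvg_cst.
  by apply/funext => n; apply: integral0_eq => w _; rewrite /step_integral big_nil subr0 expr0n.
Qed.

Lemma wint_sum (I : Type) (s : seq I) (c : I -> R) (g : I -> R -> R -> R) (X : I -> Omega -> R) :
  (forall i, wint T W (g i) (X i)) ->
  wint T W (fun y r => \sum_(i <- s) c i * g i y r) (fun w => \sum_(i <- s) c i * X i w).
Proof.
move=> gX; elim: s => [|i s IH].
  rewrite (_ : (fun y r => _) = (fun _ _ => 0)); last first.
    by apply/funext => y; apply/funext => r; rewrite big_nil.
  rewrite (_ : (fun w => _) = (fun=> 0)); first exact: wint0.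
  by apply/funext => y; rewrite big_nil.
rewrite (_ : (fun y r => _) = (fun y r => c i * g i y r + \sum_(i <- s) c i * g i y r)); last first.
  by apply/funext => y; apply/funext => r; rewrite big_cons.
rewrite (_ : (fun w => _) = (fun w => c i * X i w + \sum_(i <- s) c i * X i w)).
  by apply: wint_add => //; exact: wint_scale.
by apply/funext => y; rewrite big_cons.
Qed.

(** Step functions vanish outside D x [0, T], so extending the integrand by zero to the plane leaves
    the L2 errors unchanged. *)
Lemma wint_of_wiener_integral g (X : {RV P >-> R}) : wiener_integral P T W g X ->
  wint T W (fun y r => if (0 < y < 1) && (0 <= r <= T) then g y r else 0) X.
Proof.
move=> [mg [e [eT ge Xe]]].
have DT (p : R * R) : (p \in D `*` `[0, T]%classic) = (0 < p.1 < 1) && (0 <= p.2 <= T).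
  by apply/idP/idP; rewrite inE /D /= !in_itv /= => /andP.
have mD : measurable ((D `*` `[0, T]%classic) : set (measurableTypeR R * measurableTypeR R)).
  by apply: measurableX; exact: measurable_itv.
have gE : (fun p : R * R => if (0 < p.1 < 1) && (0 <= p.2 <= T) then g p.1 p.2 else 0) =
    (fun p => g p.1 p.2) \_ (D `*` `[0, T]%classic).
  by apply/funext => p; rewrite patchE DT.
split.
- by rewrite gE; apply/(measurable_restrictT _ _).1.
- exact: measurable_funP.
exists e; split => //.
rewrite (_ : (fun n => _) = (fun n => \int[mu2]_(p in D `*` `[0%R, T])
    ((g p.1 p.2 - step_fun (e n) p) ^+ 2)%:E)%E)//.
apply/funext => n; rewrite [RHS]integral_mkcond; apply: eq_integral => p _.
rewrite patchE DT; case: ifPn => // pD.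
suff -> : step_fun (e n) p = 0 by rewrite subr0 expr0n.
rewrite /step_fun big_seq big1// => -[[c [a b]] [l u]] /= qe.
have [a0 ab b1 l0 /andP[lu uT]] := eT _ _ _ _ _ _ qe.
rewrite !indicE !mem_setE !in_itv /=.
have [/andP[ap pb]|] := boolP (a < p.1 <= b); last by rewrite mul0r mulr0.
have [/andP[lp pu]|] := boolP (l < p.2 <= u); last by rewrite mulr0 mulr0.
by move: pD; rewrite (lt_trans a0 ap) (le_lt_trans pb b1) (le_trans l0 (ltW lp)) (le_trans pu uT).
Qed.

End wiener_linear.

(** * Increment estimates in space and in time *)

Section increment_estimates.
Context {R : realType}.
Notation mu := (@lebesgue_measure R).

Let sqr_EFin_ge0 (f : R -> R) x : (0 <= ((f x) ^+ 2)%:E)%E.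
Proof. by rewrite lee_fin sqr_ge0. Qed.

Let measurable_sqr (f : R -> R) : measurable_fun setT f ->
  measurable_fun setT (fun x => ((f x) ^+ 2)%:E).
Proof. by move=> mf; apply/measurable_EFinP; apply: measurable_funX. Qed.

Lemma dnorm_le_integral_sqr h (f : R -> R) : measurable_fun setT f ->
  (dnorm h f <= 4%:E * \int[mu]_y ((f y) ^+ 2)%:E)%E.
Proof.
move=> mf; rewrite /dnorm.
have mfh : measurable_fun setT (fun y : R => f (y + h)).
  by apply: (measurableT_comp mf (g := fun y : R => y + h)); exact: measurable_funD.
have := @integral_sqr_add_le _ _ _ mu (dif h f) (fun y : R => f (y + h)) (fun y : R => - f y) mfh
  (measurable_funN mf) (fun=> erefl).
move=> /le_trans; apply.
under [X in (_ + _ * X)%E]eq_integral do rewrite sqrrN.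
rewrite (ge0_integral_shift (f := fun y => ((f y) ^+ 2)%:E)); [|exact: measurable_sqr|exact: sqr_EFin_ge0].
rewrite -ge0_muleDl// -EFinD (_ : (2 + 2)%R = 4 :> R)//.
by rewrite -natrD.
Qed.

(** For h <= 1/w the increment is at most 2 w h and lives in [-1, 1], which gives 8 w^2 h^2 <= 8 w
    h. For larger h, four times the squared L2 norm, at most 16, suffices. *)
Lemma space_increment_le (w h : R) (phi : R -> R) : 1 <= w -> 0 <= h ->
  measurable_fun setT phi -> (forall x, `|phi x| <= 2) ->
  (forall x y, `|phi x - phi y| <= 2 * w * `|x - y|) ->
  (forall x, ~ D x -> phi x = 0) ->
  (dnorm h phi <= (16 * w * Num.min h w^-1)%:E)%E.
Proof.
move=> w1 h0 mphi phi2 lip supp.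
have w0 : 0 < w by lra.
have suppE x : ~~ (0 <= x <= 1) -> phi x = 0.
  by move=> xD; apply: supp; rewrite /D /= in_itv /= => /andP[x0 x1]; move: xD; rewrite !ltW.
have cstI (a b c : R) : 0 <= c -> a <= b ->
    (\int[mu]_(x in `[a, b]) c%:E = (c * (b - a))%:E)%E.
  move=> c0 ab; rewrite integral_cst//= lebesgue_measure_itv /= lte_fin.
  have [_|] := ltP a b; first by rewrite -EFinD -EFinM.
  by move=> ba; rewrite mule0 (_ : b = a) ?subrr ?mulr0//; apply/le_anti; rewrite ba.
have [hw|wh] := leP h w^-1.
  have hw1 : h * w <= 1 by rewrite -(mulVf (lt0r_neq0 w0)) ler_pM2r.
  have h1 : h <= 1 by rewrite (le_trans hw)// invf_le1.
  set J := `[(-1 : R), 1]%classic.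
  suff : (dnorm h phi <= \int[mu]_(y in J) ((2 * w * h) ^+ 2)%:E)%E.
    move=> /le_trans; apply; rewrite /J cstI; [|exact: sqr_ge0|lra].
    rewrite lee_fin (_ : _ * (1 - -1) = 8 * w * (h * (h * w))); last by ring.
    have : w * (h * (h * w)) <= w * (h * 1) by rewrite ler_pM2l// ler_wpM2l.
    have : 0 <= w * h by rewrite mulr_ge0// ltW.
    by rewrite mulr1 => p1 p2; rewrite -!mulrA; lra.
  rewrite /dnorm [leRHS]integral_mkcond; apply: ge0_integral_mono => y _; first exact: sqr_EFin_ge0.
  rewrite patchE mem_setE in_itv /=; case: ifPn => [_|yn].
    rewrite lee_fin -(real_normK (num_real (dif h phi y))) ler_pXn2r ?nnegrE ?normr_ge0//.
      by rewrite /dif (le_trans (lip _ _))// addrC addKr ger0_norm.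
    by rewrite !mulr_ge0// ltW.
  rewrite lee_fin /dif suppE; last first.
    apply: contra yn => /andP[a1 a2]; apply/andP; split; lra.
  rewrite suppE ?subrr ?expr0n//; apply: contra yn => /andP[a1 a2]; apply/andP; split; lra.
rewrite -mulrA mulfV ?lt0r_neq0// mulr1.
apply: (le_trans (dnorm_le_integral_sqr h mphi)).
rewrite (_ : 16%:E = 4%:E * 4%:E :> \bar R)%E; last by rewrite -EFinM -natrM.
apply: lee_wpmul2l; first by rewrite lee_fin.
set J := `[(0 : R), 1]%classic.
suff : (\int[mu]_y ((phi y) ^+ 2)%:E <= \int[mu]_(y in J) 4%:E)%E.
  by move=> /le_trans; apply; rewrite /J cstI// subr0 mulr1.
rewrite [leRHS]integral_mkcond; apply: ge0_integral_mono => y _; first exact: sqr_EFin_ge0.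
rewrite patchE mem_setE in_itv /=; case: ifPn => [_|yn]; last by rewrite suppE// expr0n.
rewrite lee_fin -(real_normK (num_real (phi y))) (_ : 4 = 2 ^+ 2); last by rewrite -natrX.
by rewrite ler_pXn2r ?nnegrE ?normr_ge0.
Qed.

(** The bound of [space_increment_le] is 8 w times 2 min(h, 1/w), whose mixture over shifts is 8 w
    times w^(-2H). *)
Lemma space_qform_le (H w : R) (eta phi : R -> R) : shift_index H 1 eta -> 0 < H ->
  1 <= w -> measurable_fun setT phi -> (forall x, `|phi x| <= 2) ->
  (forall x y, `|phi x - phi y| <= 2 * w * `|x - y|) ->
  (forall x, ~ D x -> phi x = 0) ->
  (\int[mu]_x dnorm (eta x) phi <= (8 * w * w^-1 `^ (2 * H))%:E)%E.
Proof.
move=> etaP H0 w1 mphi phi2 lip supp; have [meta eta0 _] := etaP.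
have w0 : 0 < w by lra.
have wi0 : 0 <= w^-1 by rewrite invr_ge0 ltW.
have wi1 : w^-1 <= 1 by rewrite invf_le1.
have c0 : 0 <= 8 * w by rewrite mulr_ge0// ltW.
rewrite EFinM -(integral_min_shift_index1 etaP H0 wi0 wi1).
rewrite -ge0_integralZl_EFin; [|exact: measurableT|by move=> x _; rewrite lee_fin mulr_ge0// le_min eta0|
  by apply/measurable_EFinP; apply: measurable_funM => //; apply: measurable_minr => //|exact: c0].
apply: ge0_integral_mono => x _; first exact: dnorm_nneg.
rewrite -EFinM (_ : 8 * w * (2 * _) = 16 * w * Num.min (eta x) w^-1); last by ring.
exact: space_increment_le.
Qed.

(** The common shape of a history kernel and of its cell averages: increasing up to [t], with a drop
    to 0 there. Monotonicity makes the increments telescope, so only the drop contributes. *)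
Definition rising (t : R) (a : R -> R) : Prop :=
  [/\ measurable_fun setT a, forall r, 0 <= a r,
      forall r r', r <= r' -> r' <= t -> a r <= a r',
      forall r, t < r -> a r = 0
    & (\int[mu]_r ((a r) ^+ 2)%:E < +oo)%E].

(* Pointwise, (a(r+h) - a(r))^2 + a(r)^2 <= a(r+h)^2 + 2 a(r)^2 1_{t-h<r<=t}. *)
Lemma dnorm_rising (t h : R) (a : R -> R) : rising t a -> 0 <= h ->
  (dnorm h a <= 2%:E * \int[mu]_(r in `](t - h)%R, t]) ((a r) ^+ 2)%:E)%E.
Proof.
move=> [ma a0 amon asupp afin] h0.
set I := (\int[mu]_r ((a r) ^+ 2)%:E)%E in afin.
have I0 : (0 <= I)%E by apply: integral_ge0 => r _; exact: sqr_EFin_ge0.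
have If : I \is a fin_num by rewrite ge0_fin_numE.
rewrite -(leeD2rE _ _ If).
have mdif := measurable_dif h ma.
rewrite /dnorm -ge0_integralD; [|exact: measurableT|by move=> r _; exact: sqr_EFin_ge0
  |exact: measurable_sqr|by move=> r _; exact: sqr_EFin_ge0|exact: measurable_sqr].
have -> : I = (\int[mu]_r ((a (r + h)) ^+ 2)%:E)%E.
  by rewrite (ge0_integral_shift (f := fun y => ((a y) ^+ 2)%:E)); [|exact: measurable_sqr|exact: sqr_EFin_ge0].
have mres : measurable_fun setT ((fun r => ((a r) ^+ 2)%:E) \_ `](t - h)%R, t]).
  apply/(measurable_restrictT _ _).1; first exact: measurable_itv.
  by apply: measurable_funTS; exact: measurable_sqr.
have res0 r : (0 <= ((fun r => ((a r) ^+ 2)%:E) \_ `](t - h)%R, t]) r)%E.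
  by rewrite patchE; case: ifP => _ //; exact: sqr_EFin_ge0.
have mah : measurable_fun setT (fun y : R => a (y + h)).
  by apply: (measurableT_comp ma (g := fun y : R => y + h)); exact: measurable_funD.
rewrite [X in (2%:E * X)%E]integral_mkcond.
rewrite -ge0_integralZl_EFin; [|exact: measurableT|by move=> r _; exact: res0|exact: mres|by []].
rewrite -ge0_integralD; [|exact: measurableT|by move=> r _; rewrite mule_ge0|exact: measurable_funeM
  |by move=> r _; exact: sqr_EFin_ge0|exact: measurable_sqr].
apply: ge0_integral_mono => r _; first by rewrite adde_ge0 ?sqr_EFin_ge0.
rewrite patchE mem_setE in_itv /= /dif.
have ar0 := a0 r; have arh0 := a0 (r + h).
have [tr|rt] := ltP t r.
  have -> : a r = 0 by exact: asupp.
  have -> : a (r + h) = 0 by apply: asupp; lra.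
  by rewrite andbF subrr expr0n /= mule0 !adde0.
have [thr|rth] := ltP (t - h) r; rewrite /=.
  have -> : a (r + h) = 0 by apply: asupp; lra.
  by rewrite -!EFinM -!EFinD lee_fin sub0r sqrrN !expr2; lra.
have am : a r <= a (r + h) by apply: amon; lra.
rewrite mule0 add0e -!EFinD lee_fin !expr2.
have : 0 <= a r * (a (r + h) - a r) by rewrite mulr_ge0// subr_ge0.
move: (a r) (a (r + h)) => u v p; rewrite -subr_ge0.
by rewrite (_ : _ - _ = 2 * (u * (v - u))); [rewrite mulr_ge0|ring].
Qed.

(** Shifts up to [de] use the increment bound, larger ones the L2 norm; both fit under 4 B min(h,
    de)^(1 - q). The mixture is then [integral_min_shift_index] with power 1 - q, which is where q <
    2 H enters. *)
Lemma time_qform_le (H T q B de : R) (eta b : R -> R) : shift_index H T eta -> 0 < H ->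
  0 <= q -> q < 1 -> q < 2 * H -> 0 < de -> de <= T -> 0 <= B -> measurable_fun setT b ->
  (forall h, 0 <= h -> h <= de -> (dnorm h b <= (B * h `^ (1 - q))%:E)%E) ->
  (\int[mu]_r ((b r) ^+ 2)%:E <= (B * de `^ (1 - q))%:E)%E ->
  (\int[mu]_x dnorm (eta x) b <=
   (4 * B * ((1 - q) * H / (2 * H - q)) * de `^ (2 * H - q))%:E)%E.
Proof.
move=> etaP H0 q0 q1 qH de0 deT B0 mb small large; have [meta eta0 _] := etaP.
have p0 : 0 < 1 - q by lra.
have pH : 0 < (1 - q) + 2 * H - 1 by lra.
have B4 : 0 <= 4 * B by rewrite mulr_ge0.
have -> : 2 * H - q = (1 - q) + 2 * H - 1 by ring.
rewrite -mulrA EFinM -(integral_min_shift_index etaP H0 p0 pH de0 deT).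
rewrite -ge0_integralZl_EFin; [|exact: measurableT|by move=> x _; rewrite lee_fin powR_ge0|
  by apply/measurable_EFinP; apply: (measurableT_comp (measurable_powR _)); exact: measurable_minr|exact: B4].
apply: ge0_integral_mono => x _; first exact: dnorm_nneg.
rewrite -EFinM; have [ed|de_e] := leP (eta x) de.
  apply: (le_trans (small _ (eta0 x) ed)); rewrite lee_fin.
  by rewrite ler_wpM2r ?powR_ge0//; lra.
apply: (le_trans (dnorm_le_integral_sqr _ mb)).
have four0 : (0 <= 4%:E :> \bar R)%E by rewrite lee_fin.
apply: (le_trans (lee_wpmul2l four0 large)).
by rewrite -EFinM mulrA.
Qed.

End increment_estimates.

(** The choice c = I / A is optimal; for A = 0 a large c forces I = 0. *)
Lemma discriminant_le {R : realType} (I A B : R) : 0 <= I -> 0 <= A -> 0 <= B ->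
  (forall c, 0 < c -> 2 * c * I <= c ^+ 2 * A + B) -> I ^+ 2 <= A * B.
Proof.
move=> I0 A0 B0 h; have [->|In0] := eqVneq I 0; first by rewrite expr0n mulr_ge0.
have Ip : 0 < I by rewrite lt_neqAle eq_sym In0.
have [A00|An0] := eqVneq A 0.
  have c0 : 0 < (B + 1) / I by rewrite divr_gt0// ltr_wpDl.
  have := h _ c0; rewrite A00 mulr0 add0r -mulrA divfK//; lra.
have Ap : 0 < A by rewrite lt_neqAle eq_sym An0.
have c0 : 0 < I / A by rewrite divr_gt0.
have := h _ c0; rewrite (_ : 2 * (I / A) * I = 2 * (I ^+ 2 / A)); last by rewrite expr2; ring.
rewrite (_ : (I / A) ^+ 2 * A = I ^+ 2 / A); last by field.
by move=> h'; rewrite mulrC -ler_pdivrMr//; lra.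
Qed.

(** Young's inequality with weight c bounds the integral of |f g|: c = 1 gives integrability, and
    all c together, by [discriminant_le], the product bound. *)
Lemma cauchy_schwarz {R : realType} d (T : measurableType d) (m : {measure set T -> \bar R})
    (D : set T) (f g : T -> R) (A B : R) : measurable D ->
  measurable_fun D f -> measurable_fun D g -> 0 <= A -> 0 <= B ->
  (\int[m]_(x in D) ((f x) ^+ 2)%:E <= A%:E)%E ->
  (\int[m]_(x in D) ((g x) ^+ 2)%:E <= B%:E)%E ->
  m.-integrable D (EFin \o (fun x => f x * g x)) /\
  (\int[m]_(x in D) (f x * g x)) ^+ 2 <= A * B.
Proof.
move=> mD mf mg A0 B0 fA gB.
have mfg : measurable_fun D (fun x => f x * g x) by apply: measurable_funM.
set J := (\int[m]_(x in D) (`|f x * g x|)%:E)%E.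
have m2 (k : T -> R) : measurable_fun D k -> measurable_fun D (fun x => ((k x) ^+ 2)%:E).
  by move=> mk; apply/measurable_EFinP; apply: measurable_funX.
have key (c : R) : 0 < c -> ((2 * c)%:E * J <= (c ^+ 2 * A + B)%:E)%E.
  move=> c0; rewrite /J -ge0_integralZl_EFin; [|exact: mD|by move=> x _; rewrite lee_fin
    |by apply/measurable_EFinP; apply: (measurableT_comp (@normr_measurable _ setT))|by rewrite mulr_ge0// ltW].
  apply: (@le_trans _ _ (\int[m]_(x in D) ((c ^+ 2)%:E * ((f x) ^+ 2)%:E + ((g x) ^+ 2)%:E))%E).
    apply: ge0_integral_mono => x _; first by rewrite -EFinM lee_fin !mulr_ge0// ltW.
    rewrite -!EFinM -EFinD lee_fin normrM -(real_normK (num_real (f x))) -(real_normK (num_real (g x))).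
    have := sqr_ge0 (c * `|f x| - `|g x|); rewrite sqrrB exprMn -mulr_natr.
    by rewrite (_ : 2 * c * _ = c * `|f x| * `|g x| * 2); [lra|ring].
  rewrite ge0_integralD; [|exact: mD|by move=> x _; rewrite -EFinM lee_fin mulr_ge0 ?sqr_ge0
    |by apply: measurable_funeM; exact: m2|by move=> x _; rewrite lee_fin sqr_ge0|exact: m2].
  rewrite ge0_integralZl_EFin; [|exact: mD|by move=> x _; rewrite lee_fin sqr_ge0|exact: m2|exact: sqr_ge0].
  have c2 : (0 <= (c ^+ 2)%:E)%E by rewrite lee_fin sqr_ge0.
  by rewrite EFinD; apply: leeD gB; rewrite [leRHS]EFinM; exact: (lee_wpmul2l c2 fA).
have J0 : (0 <= J)%E by apply: integral_ge0 => x _; rewrite lee_fin.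
have Jf : J \is a fin_num.
  rewrite ge0_fin_numE// ltey; apply/eqP => Jy.
  by have := key 1 ltr01; rewrite Jy gt0_muley ?lte_fin// leye_eq.
have fgi : m.-integrable D (EFin \o (fun x => f x * g x)).
  apply/integrableP; split; first exact/measurable_EFinP.
  by under eq_integral do rewrite /= ; rewrite -ge0_fin_numE// -/J.
split => //.
have le1 : `|\int[m]_(x in D) (f x * g x)| <= fine J.
  by rewrite (le_trans (le_normr_Rintegral _ _))// /Rintegral /J.
have sq : fine J ^+ 2 <= A * B.
  apply: discriminant_le => //; first exact: fine_ge0.
  by move=> c c0; have := key c c0; rewrite -(fineK Jf) -EFinM lee_fin.
apply: le_trans sq; rewrite -(real_normK (num_real (\int[m]_(x in D) _))).
by rewrite ler_pXn2r ?nnegrE ?normr_ge0 ?fine_ge0.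
Qed.

(** * History kernels and their time differences *)

Section history_kernels.
Context {R : realType}.
Notation mu := (@lebesgue_measure R).
Variable v : R -> R.
Hypothesis mv : measurable_fun setT v.
Hypothesis v01 : forall x, 0 <= x -> 0 <= v x <= 1.
Hypothesis v_nincr : forall x y, 0 <= x -> x <= y -> v y <= v x.

Definition hist (t r : R) : R := if 0 <= r <= t then v (t - r) else 0.

Lemma hist_ge0 t r : 0 <= hist t r.
Proof. by rewrite /hist; case: ifP => // /andP[_ rt]; have /andP[] := v01 (ltac:(by rewrite subr_ge0) : 0 <= t - r). Qed.

Lemma hist_le1 t r : hist t r <= 1.
Proof. by rewrite /hist; case: ifP => // /andP[_ rt]; have /andP[] := v01 (ltac:(by rewrite subr_ge0) : 0 <= t - r). Qed.

Lemma measurable_hist t : measurable_fun setT (hist t).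
Proof.
rewrite (_ : hist t = (fun r => v (t - r)) \_ `[0, t]).
  apply/(measurable_restrictT _ _).1; first exact: measurable_itv.
  apply: measurable_funTS; apply: (measurableT_comp mv (g := fun r : R => t - r)).
  exact: measurable_funB.
by apply/funext => r; rewrite patchE mem_setE in_itv.
Qed.

Lemma integral_hist_sqr t : 0 <= t -> (\int[mu]_r ((hist t r) ^+ 2)%:E <= t%:E)%E.
Proof.
move=> t0; suff : (\int[mu]_r ((hist t r) ^+ 2)%:E <= \int[mu]_(r in `[0%R, t]) 1%:E)%E.
  move=> /le_trans; apply; rewrite integral_cst//= lebesgue_measure_itv /= lte_fin mul1e.
  by case: ltP => // _; rewrite oppr0 adde0.
rewrite [leRHS]integral_mkcond; apply: ge0_integral_mono => r _; first by rewrite lee_fin sqr_ge0.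
rewrite patchE mem_setE in_itv /=; case: ifPn => [rt|rt]; last by rewrite /hist (negbTE rt) expr0n.
by rewrite lee_fin -(expr1n _ 2) ler_pXn2r ?nnegrE ?hist_ge0// hist_le1.
Qed.

Lemma rising_hist t : 0 <= t -> rising t (hist t).
Proof.
move=> t0; split.
- exact: measurable_hist.
- by move=> r; exact: hist_ge0.
- move=> r r' rr' r't; rewrite {1}/hist; case: ifPn => [/andP[r0 rt]|_]; last exact: hist_ge0.
  rewrite /hist (le_trans r0 rr') r't /=; apply: v_nincr; first by rewrite subr_ge0.
  by rewrite lerD2l lerN2.
- by move=> r tr; rewrite /hist [r <= t]leNgt tr andbF.
- by apply: (le_lt_trans (integral_hist_sqr t0)); exact: ltry.
Qed.

Variables (q K : R).
Hypothesis q0 : 0 <= q.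
Hypothesis q1 : q < 1.
Hypothesis K0 : 0 <= K.
Hypothesis v_decay : forall x, 0 < x -> (v x) ^+ 2 <= K * x `^ (- q).

(** In the variable x = t - r this is the integral of K x^(-q) over ]0, h], finite because q < 1. *)
Lemma hist_window t h : 0 <= h ->
  (\int[mu]_(r in `](t - h)%R, t]) ((hist t r) ^+ 2)%:E <= (K / (1 - q) * h `^ (1 - q))%:E)%E.
Proof.
have hq1 := q1; have hq0 := q0; have hK := K0.
have p1 : 0 < 1 - q by lra.
rewrite le_eqVlt => /predU1P[<-|h0].
  rewrite subr0 set_itvoc0 integral_set0 lee_fin.
  by rewrite mulr_ge0 ?powR_ge0// divr_ge0// ltW.
have mh2 : measurable_fun setT (fun r => ((hist t r) ^+ 2)%:E).
  by apply/measurable_EFinP; apply: measurable_funX; exact: measurable_hist.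
rewrite -integral_itv_bndo_bndc; last by apply: measurable_funTS.
pose f (x : R) := ((fun x : R => (K * x `^ (- q))%:E) \_ `]0, h]) x.
have f0 x : (0 <= f x)%E.
  by rewrite /f patchE; case: ifP => // _; rewrite lee_fin mulr_ge0// powR_ge0.
have mKp : measurable_fun setT (fun x : R => (K * x `^ (- q))%:E).
  by apply/measurable_EFinP; apply: measurable_funM => //; exact: measurable_powR.
have mf : measurable_fun setT f.
  apply/(measurable_restrictT _ _).1; first exact: measurable_itv.
  exact: measurable_funTS.
apply: (@le_trans _ _ (\int[mu]_r f (t - r)%R)%E).
  rewrite integral_mkcond; apply: ge0_integral_mono => r _.
    by rewrite patchE; case: ifP => // _; rewrite lee_fin sqr_ge0.
  rewrite patchE mem_setE in_itv /=; case: ifPn => // /andP[r1 r2].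
  rewrite /f patchE mem_setE in_itv /= (_ : _ && _ = true); last by apply/andP; split; lra.
  rewrite lee_fin /hist; case: ifP => _; first by apply: v_decay; rewrite subr_gt0.
  by rewrite expr0n mulr_ge0// powR_ge0.
rewrite (ge0_integral_refl t mf f0) -integral_mkcond.
under eq_integral do rewrite EFinM.
rewrite ge0_integralZl_EFin; [|exact: measurable_itv|by move=> x _; rewrite lee_fin powR_ge0|
  by apply/measurable_EFinP; apply: measurable_funTS; exact: measurable_powR|exact: K0].
have hqm : -1 < - q by lra.
rewrite (integral_powR hqm h0).
by rewrite -EFinM lee_fin (_ : - q + 1 = 1 - q)//; [rewrite mulrA mulrAC -mulrA|ring].
Qed.

Lemma dnorm_hist t h : 0 <= t -> 0 <= h ->
  (dnorm h (hist t) <= (2 * (K / (1 - q)) * h `^ (1 - q))%:E)%E.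
Proof.
move=> t0 h0; apply: (le_trans (dnorm_rising (rising_hist t0) h0)).
have two0 : (0 <= 2%:E :> \bar R)%E by rewrite lee_fin.
apply: (le_trans (lee_wpmul2l two0 (hist_window t h0))).
by rewrite -EFinM lee_fin -!mulrA.
Qed.

(** On [0, t'] the kernel ending at t' is the one ending at t translated by the lag t - t'. On ]t',
    t] the translate vanishes like the shorter kernel, and before 0 the left side is zero. *)
Lemma hist_sub_sqr (t' t r : R) : 0 <= t' -> t' <= t ->
  (hist t r - hist t' r) ^+ 2 <= (dif (t - t') (hist t) r) ^+ 2.
Proof.
move=> t'0 t't; rewrite /dif.
have [/andP[r0 rt']|rn] := boolP (0 <= r <= t').
  have -> : hist t (r + (t - t')) = hist t' r.
    rewrite /hist r0 rt' /= (_ : _ && _ = true); last by apply/andP; split; lra.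
    by congr v; lra.
  by rewrite -(sqrrN (hist t r - _)) opprB.
have [/andP[r0 rt]|rn'] := boolP (0 <= r <= t).
  have rt' : t' < r by move: rn; rewrite r0 /= -ltNge.
  have -> : hist t' r = 0 by rewrite /hist (negbTE rn).
  have -> : hist t (r + (t - t')) = 0.
    by rewrite /hist [_ <= t]leNgt (_ : t < _ = true) ?andbF//; lra.
  by rewrite sub0r sqrrN subr0.
by rewrite {1 2}/hist (negbTE rn) (negbTE rn') subrr expr0n /= sqr_ge0.
Qed.

Lemma integral_hist_sub_sqr (t' t : R) : 0 <= t' -> t' <= t ->
  (\int[mu]_r ((hist t r - hist t' r) ^+ 2)%:E <=
   (2 * (K / (1 - q)) * (t - t') `^ (1 - q))%:E)%E.
Proof.
move=> t'0 t't; have t0 : 0 <= t by exact: le_trans t't.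
have d0 : 0 <= t - t' by rewrite subr_ge0.
apply: (le_trans _ (dnorm_hist t0 d0)).
apply: ge0_integral_mono => r _; first by rewrite lee_fin sqr_ge0.
by rewrite lee_fin; exact: hist_sub_sqr.
Qed.

Lemma dnorm_sub_le h (f g : R -> R) (A : R) : measurable_fun setT f -> measurable_fun setT g ->
  (dnorm h f <= A%:E)%E -> (dnorm h g <= A%:E)%E ->
  (dnorm h (fun r => f r - g r)%R <= (4 * A)%:E)%E.
Proof.
move=> mf mg fA gA; apply: (@le_trans _ _ (2%:E * dnorm h f + 2%:E * dnorm h g)%E).
  rewrite /dnorm; under [X in (_ + _ * X)%E]eq_integral do rewrite -sqrrN.
  apply: (integral_sqr_add_le mu (g := dif h f) (h := fun r => - dif h g r)).
  - exact: measurable_dif.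
  - by apply: measurable_funN; exact: measurable_dif.
  - by move=> r; rewrite /dif; ring.
by apply: (double_add_le fA gA); rewrite -!EFinM -EFinD lee_fin; lra.
Qed.

(** The lag t - t' is the threshold of [time_qform_le]; the 8 is the 2 of [dnorm_hist] times the 4
    for a difference of two kernels. *)
Lemma hist_sub_qform (H T t' t : R) (eta : R -> R) : shift_index H T eta -> 0 < H ->
  q < 2 * H -> 0 <= t' -> t' < t -> t <= T ->
  (\int[mu]_x dnorm (eta x) (fun r => hist t r - hist t' r)%R <=
   (4 * (8 * (K / (1 - q))) * ((1 - q) * H / (2 * H - q)) * (t - t') `^ (2 * H - q))%:E)%E.
Proof.
move=> etaP H0 qH t'0 t't tT.
have t0 : 0 <= t by rewrite (le_trans t'0)// ltW.
have hq := q1; have p1 : 0 < 1 - q by lra.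
have M0 : 0 <= K / (1 - q) by rewrite divr_ge0// ltW.
have d0 : 0 < t - t' by rewrite subr_gt0.
have dT : t - t' <= T by rewrite lerBlDr (le_trans tT)// lerDl.
have B0 : 0 <= 8 * (K / (1 - q)) by rewrite mulr_ge0.
have mb : measurable_fun setT (fun r => hist t r - hist t' r).
  by apply: measurable_funB; exact: measurable_hist.
apply: (time_qform_le etaP H0 q0 q1 qH d0 dT B0 mb).
- move=> h h0 hd.
  rewrite (_ : 8 * _ * _ = 4 * (2 * (K / (1 - q)) * h `^ (1 - q))); last by ring.
  apply: dnorm_sub_le; [exact: measurable_hist|exact: measurable_hist|exact: dnorm_hist|exact: dnorm_hist].
- apply: (le_trans (integral_hist_sub_sqr t'0 (ltW t't))).
  by rewrite lee_fin ler_wpM2r ?powR_ge0//; lra.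
Qed.

End history_kernels.

Lemma sqr_sub_le_double {R : realFieldType} (x m y z : R) :
  (x - m) ^+ 2 <= y ^+ 2 + z ^+ 2 + (2 * x ^+ 2 + 2 * m ^+ 2).
Proof.
have := sqr_ge0 y; have := sqr_ge0 z.
have := sqr_ge0 (x + m); rewrite sqrrB sqrrD !mulr2n; lra.
Qed.

(** * Cell averages of a history kernel *)

Section cell_averages.
Context {R : realType}.
Notation mu := (@lebesgue_measure R).

Lemma in_cell (tau : R) i r : (r \in cell tau i) = (i.-1%:R * tau < r <= i%:R * tau).
Proof. by rewrite /cell /grid mem_setE in_itv. Qed.

Lemma measurable_cell (tau : R) i : measurable (cell tau i).
Proof. exact: measurable_itv. Qed.

Lemma cell_lt (tau : R) i j r r' : 0 < tau -> r \in cell tau i -> r' \in cell tau j ->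
  (0 < i)%N -> (i < j)%N -> r < r' /\ i%:R * tau <= j.-1%:R * tau.
Proof.
move=> tau0; rewrite !in_cell => /andP[_ ri] /andP[jr' _] i0 ij.
have h : i%:R * tau <= j.-1%:R * tau by rewrite ler_pM2r// ler_nat -ltnS (ltn_predK ij).
by split => //; apply: (le_lt_trans ri); apply: (le_lt_trans h).
Qed.

Lemma cell_inj (tau : R) i j r : 0 < tau -> (0 < i)%N -> (0 < j)%N ->
  r \in cell tau i -> r \in cell tau j -> i = j.
Proof.
move=> tau0 i0 j0 ri rj; case: (ltngtP i j) => // ij.
  by have [] := cell_lt tau0 ri rj i0 ij; rewrite ltxx.
by have [] := cell_lt tau0 rj ri j0 ij; rewrite ltxx.
Qed.

Lemma cell_exists (tau r : R) n : 0 < r -> r <= n%:R * tau ->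
  exists i, [/\ (0 < i)%N, (i <= n)%N & r \in cell tau i].
Proof.
move=> r0; elim: n => [|n IH] rn; first by move: rn; rewrite mul0r leNgt r0.
have [/IH[i [i0 il ri]]|nr] := leP r (n%:R * tau).
  by exists i; split => //; exact: leqW.
by exists n.+1; split => //; rewrite in_cell nr rn.
Qed.

Lemma sum_cell (tau : R) n (c : nat -> R) i r : 0 < tau -> (0 < i)%N -> (i <= n)%N ->
  r \in cell tau i -> \sum_(1 <= j < n.+1) c j * \1_(cell tau j) r = c i.
Proof.
move=> tau0 i0 il ri; rewrite (bigD1_seq i) ?iota_uniq ?mem_index_iota ?i0 ?ltnS//=.
rewrite indicE ri mulr1 big_seq_cond big1 ?addr0// => j.
rewrite mem_index_iota => /andP[/andP[j0 _] ji]; rewrite indicE.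
case: (boolP (r \in _)) => [rj|_]; last by rewrite mulr0.
by rewrite (cell_inj tau0 j0 i0 rj ri) eqxx in ji.
Qed.

Lemma sum_cell0 (tau : R) n (c : nat -> R) r : 0 < tau -> ~~ (0 < r <= n%:R * tau) ->
  \sum_(1 <= j < n.+1) c j * \1_(cell tau j) r = 0.
Proof.
move=> tau0 rn; rewrite big_seq_cond big1 => // j.
rewrite mem_index_iota => /andP[/andP[j0 jn] _]; rewrite indicE.
case: (boolP (r \in _)) => [rj|_]; last by rewrite mulr0.
move: rj; rewrite in_cell => /andP[r1 r2]; case/negP: rn; apply/andP; split.
  by apply: le_lt_trans r1; rewrite mulr_ge0// ltW.
by apply: (le_trans r2); rewrite ler_pM2r// ler_nat.
Qed.

Variable v : R -> R.
Hypothesis mv : measurable_fun setT v.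
Hypothesis v01 : forall x, 0 <= x -> 0 <= v x <= 1.
Hypothesis v_nincr : forall x y, 0 <= x -> x <= y -> v y <= v x.
Variables (tau : R) (n : nat).
Hypothesis tau0 : 0 < tau.
Hypothesis n0 : (0 < n)%N.

Notation t := (grid tau n).
Notation a := (hist v t).

Let t0 : 0 <= t. Proof. by rewrite /grid mulr_ge0// ltW. Qed.

Definition cell_mean (i : nat) : R := tau^-1 * \int[mu]_(r in cell tau i) v (t - r).

(** Integrating a kernel against the piecewise constant noise of the scheme amounts to a Wiener
    integral of this cell-averaged kernel. *)
Definition mean_hist (r : R) : R := \sum_(1 <= i < n.+1) cell_mean i * \1_(cell tau i) r.

Let hist_cell i r : (0 < i)%N -> (i <= n)%N -> r \in cell tau i -> a r = v (t - r).
Proof.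
move=> i0 il; rewrite in_cell => /andP[r1 r2]; rewrite /hist.
rewrite (_ : _ && _ = true)//; apply/andP; split.
  by apply: ltW; apply: le_lt_trans r1; rewrite mulr_ge0// ltW.
by apply: (le_trans r2); rewrite /grid ler_pM2r// ler_nat.
Qed.

Let mu_cell i : (0 < i)%N -> mu (cell tau i) = tau%:E.
Proof.
move=> i0; rewrite /cell lebesgue_measure_itv /= lte_fin /grid ltr_pM2r// ltr_nat.
have e : i%:R = i.-1%:R + 1 :> R by rewrite -{1}(prednK i0) -natr1.
by rewrite ltn_predL i0 -EFinB e; congr EFin; ring.
Qed.

Let integrable_mean i : (0 < i)%N -> (i <= n)%N ->
  mu.-integrable (cell tau i) (EFin \o (fun r => v (t - r))).
Proof.
move=> i0 il; have mc := measurable_cell tau i.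
apply: measurable_bounded_integrable; first exact: mc.
- by have := ltry tau; rewrite -(mu_cell i0).
- apply: measurable_funTS; apply: (measurableT_comp mv (g := fun r : R => t - r)).
  exact: measurable_funB.
- exists 1; split; first by rewrite num_real.
  move=> x x1 r /= rc; have h := hist_cell i0 il (mem_set rc).
  rewrite -h ger0_norm ?hist_ge0//; apply: (le_trans _ (ltW x1)); exact: hist_le1.
Qed.

Lemma cell_mean_ge i c : (0 < i)%N -> (i <= n)%N ->
  (forall r, r \in cell tau i -> c <= a r) -> c <= cell_mean i.
Proof.
move=> i0 il h; have mc := measurable_cell tau i.
rewrite /cell_mean mulrC ler_pdivlMr//.
have -> : c * tau = \int[mu]_(r in cell tau i) cst c r.
  by rewrite Rintegral_cst// [X in _ * fine X](mu_cell i0).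
apply: le_Rintegral => //.
- apply: measurable_bounded_integrable; [exact: mc|by have := ltry tau; rewrite -(mu_cell i0)|exact: measurable_cst|].
  by exists `|c|; split; [rewrite num_real|move=> x cx r _ /=; exact: ltW].
- exact: integrable_mean.
- by move=> r /mem_set rc; rewrite /= -(hist_cell i0 il rc); exact: h.
Qed.

Lemma cell_mean_le i c : (0 < i)%N -> (i <= n)%N ->
  (forall r, r \in cell tau i -> a r <= c) -> cell_mean i <= c.
Proof.
move=> i0 il h; have mc := measurable_cell tau i.
rewrite /cell_mean mulrC ler_pdivrMr//.
have -> : c * tau = \int[mu]_(r in cell tau i) cst c r.
  by rewrite Rintegral_cst// [X in _ * fine X](mu_cell i0).
apply: le_Rintegral => //.
- exact: integrable_mean.
- apply: measurable_bounded_integrable; [exact: mc|by have := ltry tau; rewrite -(mu_cell i0)|exact: measurable_cst|].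
  by exists `|c|; split; [rewrite num_real|move=> x cx r _ /=; exact: ltW].
- by move=> r /mem_set rc; rewrite /= -(hist_cell i0 il rc); exact: h.
Qed.

Lemma cell_mean01 i : (0 < i)%N -> (i <= n)%N -> 0 <= cell_mean i <= 1.
Proof.
move=> i0 il; apply/andP; split.
  by apply: cell_mean_ge => // r _; exact: hist_ge0.
by apply: cell_mean_le => // r _; exact: hist_le1.
Qed.

Lemma measurable_mean_hist : measurable_fun setT mean_hist.
Proof.
apply: measurable_sum => i; apply: measurable_funM => //.
by apply: measurable_indic; exact: measurable_cell.
Qed.

Let mono r r' : r <= r' -> r' <= t -> a r <= a r'.
Proof. by have [_ _ h _ _] := rising_hist mv v01 v_nincr t0; exact: h. Qed.

Lemma mean_hist01 r : 0 <= mean_hist r <= 1.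
Proof.
have [/andP[r0 rt]|rn] := boolP (0 < r <= n%:R * tau); last by rewrite /mean_hist sum_cell0// lexx ler01.
have [i [i0 il ri]] := cell_exists r0 rt.
by rewrite /mean_hist (sum_cell _ tau0 i0 il ri) cell_mean01.
Qed.

(** For two different cells, the value of the kernel at the right end of the earlier one separates
    the two averages. *)
Lemma rising_mean_hist : rising t mean_hist.
Proof.
split.
- exact: measurable_mean_hist.
- by move=> r; have /andP[] := mean_hist01 r.
- move=> r r' rr' r't.
  have [/andP[r0 rt]|rn] := boolP (0 < r <= n%:R * tau); last first.
    by rewrite {1}/mean_hist sum_cell0//; have /andP[] := mean_hist01 r'.
  have r'0 : 0 < r' by exact: lt_le_trans rr'.
  have [i [i0 il ri]] := cell_exists r0 rt.
  have [j [j0 jl rj]] := cell_exists r'0 r't.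
  rewrite /mean_hist (sum_cell _ tau0 i0 il ri) (sum_cell _ tau0 j0 jl rj).
  have [ij|ji|->//] := ltngtP i j; last first.
    by have [] := cell_lt tau0 rj ri j0 ji; rewrite ltNge rr'.
  apply: (@le_trans _ _ (a (i%:R * tau))).
    apply: cell_mean_le => // x; rewrite in_cell => /andP[x1 x2]; apply: mono => //.
    by rewrite /grid ler_pM2r// ler_nat.
  apply: cell_mean_ge => // x; rewrite in_cell => /andP[x1 x2]; apply: mono => //.
    have [_ h] := cell_lt tau0 ri rj i0 ij.
    by apply: (le_trans h); exact: ltW.
  by apply: (le_trans x2); rewrite /grid ler_pM2r// ler_nat.
- by move=> r tr; rewrite /mean_hist sum_cell0// [r <= _]leNgt tr andbF.
- apply: (@le_lt_trans _ _ (\int[mu]_(r in `[0%R, t]) 1%:E)%E); last first.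
    by rewrite integral_cst//= lebesgue_measure_itv /= lte_fin mul1e; case: ifP => _; [rewrite oppr0 adde0; exact: ltry|exact: lt0y].
  rewrite [leRHS]integral_mkcond; apply: ge0_integral_mono => r _; first by rewrite lee_fin sqr_ge0.
  rewrite patchE mem_setE in_itv /=; have /andP[m0 m1] := mean_hist01 r.
  case: ifPn => [rt|rt]; first by rewrite lee_fin -(expr1n _ 2) ler_pXn2r ?nnegrE.
  rewrite /mean_hist sum_cell0 ?expr0n//; apply: contra rt => /andP[r0 rt].
  by rewrite (ltW r0) rt.
Qed.

Variables (q K : R).
Hypothesis q0 : 0 <= q.
Hypothesis q1 : q < 1.
Hypothesis K0 : 0 <= K.
Hypothesis v_decay : forall x, 0 < x -> (v x) ^+ 2 <= K * x `^ (- q).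

Let M := K / (1 - q).
Let M0 : 0 <= M.
Proof. by rewrite /M divr_ge0// subr_ge0 ltW. Qed.

Let window h : 0 <= h ->
  (\int[mu]_(r in `](t - h)%R, t]) ((a r) ^+ 2)%:E <= (M * h `^ (1 - q))%:E)%E.
Proof. by move=> h0; apply: hist_window. Qed.

Let last_cell : cell tau n = `](t - tau)%R, t]%classic.
Proof.
have e : n%:R = n.-1%:R + 1 :> R by rewrite -{1}(prednK n0) -natr1.
by rewrite /cell /grid (_ : n.-1%:R * tau = n%:R * tau - tau)//; rewrite e; ring.
Qed.

(** Cauchy-Schwarz against the constant 1 on the last cell, where the square of the kernel has
    integral at most M tau^(1 - q). *)
Lemma cell_mean_last : (cell_mean n) ^+ 2 <= M * tau `^ (- q).
Proof.
have mc := measurable_cell tau n.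
have mvt : measurable_fun setT (fun r : R => v (t - r)).
  by apply: (measurableT_comp mv (g := fun r : R => t - r)); exact: measurable_funB.
have tp : 0 <= tau by exact: ltW.
have Mt : 0 <= M * tau `^ (1 - q) by rewrite mulr_ge0// powR_ge0.
have c1 : (\int[mu]_(x in cell tau n) ((1 : R) ^+ 2)%:E <= tau%:E)%E.
  by under eq_integral do rewrite expr1n; rewrite integral_cst// mul1e -(mu_cell n0).
have c2 : (\int[mu]_(x in cell tau n) ((v (t - x)) ^+ 2)%:E <= (M * tau `^ (1 - q))%:E)%E.
  apply: (le_trans _ (window tp)); rewrite -last_cell.
  apply: ge0_integral_mono => r rc; first by rewrite lee_fin sqr_ge0.
  by rewrite (hist_cell n0 (leqnn n) (mem_set rc)).
have [_] := @cauchy_schwarz _ _ (measurableTypeR R) mu (cell tau n) (fun=> 1) (fun r => v (t - r))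
  tau (M * tau `^ (1 - q)) mc (measurable_cst _) (measurable_funTS mvt) tp Mt c1 c2.
under eq_Rintegral do rewrite mul1r.
rewrite /cell_mean exprMn => h.
have ti : 0 <= tau^-1 ^+ 2 by exact: sqr_ge0.
apply: (le_trans (ler_wpM2l ti h)).
rewrite (_ : tau `^ (- q) = tau `^ (1 - q) / tau); last first.
  rewrite -[X in _ / X]powRr1// -powRN -powRD; last by rewrite (gt_eqF tau0) implybT.
  by congr (_ `^ _); ring.
have tn : tau != 0 by rewrite gt_eqF.
suff e (m p : R) : tau^-1 ^+ 2 * (tau * (m * p)) = m * (p / tau) by rewrite e.
by field.
Qed.

(** A window of length at most tau stays in the last cell, where the average is constant: its square
    integral is at most M tau^(-q) h <= M h^(1 - q). *)
Lemma mean_hist_window h : 0 <= h -> h <= tau ->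
  (\int[mu]_(r in `](t - h)%R, t]) ((mean_hist r) ^+ 2)%:E <= (M * h `^ (1 - q))%:E)%E.
Proof.
have hq1 := q1; have hq0 := q0.
move=> + htau; rewrite le_eqVlt => /predU1P[<-|h0].
  by rewrite subr0 set_itvoc0 integral_set0 lee_fin mulr_ge0 ?powR_ge0.
suff : (\int[mu]_(r in `](t - h)%R, t]) ((mean_hist r) ^+ 2)%:E <=
    \int[mu]_(r in `](t - h)%R, t]) (M * tau `^ (- q))%:E)%E.
  move=> /le_trans; apply; rewrite integral_cst//= lebesgue_measure_itv /= lte_fin.
  rewrite ifT; last by lra.
  rewrite -EFinB -EFinM lee_fin (_ : t - (t - h) = h); last by ring.
  rewrite -mulrA ler_wpM2l//.
  have -> : h `^ (1 - q) = h `^ (- q) * h.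
    rewrite -[X in _ * X]powRr1 ?(ltW h0)// -powRD; last by rewrite (gt_eqF h0) implybT.
    by congr (_ `^ _); ring.
  rewrite ler_pM2r// !powRN lef_pV2 ?posrE ?powR_gt0//.
  by apply: ge0_ler_powR => //; rewrite nnegrE ltW.
apply: ge0_integral_mono => r; first by rewrite lee_fin sqr_ge0.
rewrite /= in_itv /= => /andP[r1 r2].
have rc : r \in cell tau n by rewrite last_cell mem_setE in_itv /= r2 andbT; lra.
by rewrite lee_fin /mean_hist (sum_cell _ tau0 n0 (leqnn n) rc); exact: cell_mean_last.
Qed.

(** Away from the last cell, monotonicity places both the kernel at r and its cell average between
    the values at r - tau and r + tau, so a one-step difference dominates. In the last cell the
    shift by tau crosses the drop, and the squares themselves are used. *)
Let sub_mean_sqr r : (((a r - mean_hist r) ^+ 2)%:E <=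
  ((dif tau a r) ^+ 2)%:E + ((dif tau a (r - tau)) ^+ 2)%:E
  + (2%:E * ((fun r => ((a r) ^+ 2)%:E) \_ `](t - tau)%R, t]) r
     + 2%:E * ((fun r => ((mean_hist r) ^+ 2)%:E) \_ `](t - tau)%R, t]) r) )%E.
Proof.
rewrite !patchE mem_setE in_itv /=.
have [/andP[r1 r2]|rn] := boolP (t - tau < r <= t).
  rewrite -!EFinM -!EFinD lee_fin.
  exact: sqr_sub_le_double.
rewrite !mule0 !adde0 -EFinD lee_fin; have tp := tau0.
have aN x : x < 0 -> a x = 0 by move=> x0; rewrite /hist leNgt x0.
have [r0|r0] := ltP 0 r; last first.
  have -> : mean_hist r = 0 by rewrite /mean_hist sum_cell0// ltNge r0.
  rewrite /dif subrK subr0 (aN (r - tau)); last by lra.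
  by rewrite subr0 lerDr sqr_ge0.
have [rt|rt] := leP r t; last first.
  have -> : mean_hist r = 0 by rewrite /mean_hist sum_cell0// [r <= _]leNgt rt andbF.
  rewrite (_ : a r = 0) ?subrr ?expr0n /= ?addr_ge0 ?sqr_ge0//.
  by rewrite /hist [r <= _]leNgt rt andbF.
have rt' : r <= t - tau by rewrite leNgt; apply: contra rn => ->.
have [i [i0 il ri]] := cell_exists r0 rt.
rewrite /mean_hist (sum_cell _ tau0 i0 il ri) /dif subrK.
have ri' := ri; move: ri'; rewrite in_cell => /andP[r1 r2].
have ei : i%:R * tau = i.-1%:R * tau + tau.
  by rewrite -{1}(prednK i0) -natr1 mulrDl mul1r.
have hi : cell_mean i <= a (r + tau).
  apply: cell_mean_le => // x; rewrite in_cell => /andP[x1 x2]; apply: mono; last by lra.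
  by rewrite (le_trans x2)// ei lerD2r ltW.
have lo : a (r - tau) <= cell_mean i.
  apply: cell_mean_ge => // x; rewrite in_cell => /andP[x1 x2]; apply: mono.
    by apply: ltW; apply: le_lt_trans x1; rewrite lerBlDr -ei.
  by rewrite (le_trans x2)// /grid ler_pM2r// ler_nat.
have m1 : a r <= a (r + tau) by apply: mono; lra.
have m2 : a (r - tau) <= a r by apply: mono; lra.
move: (a r) (a (r + tau)) (a (r - tau)) (cell_mean i) hi lo m1 m2 => x y z w hi lo m1 m2.
have [xw|wx] := leP x w.
  apply: (@le_trans _ _ ((y - x) ^+ 2)); last by rewrite lerDl sqr_ge0.
  by rewrite -sqrrN opprB ler_pXn2r ?nnegrE ?subr_ge0//; lra.
apply: (@le_trans _ _ ((x - z) ^+ 2)); last by rewrite lerDr sqr_ge0.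
by rewrite ler_pXn2r ?nnegrE ?subr_ge0//; lra.
Qed.

Let ma : measurable_fun setT a. Proof. exact: measurable_hist. Qed.

(** The two one-step differences contribute 2 M each and the two terms of the last cell 2 M each. *)
Lemma integral_hist_sub_mean :
  (\int[mu]_r ((a r - mean_hist r) ^+ 2)%:E <= (8 * M * tau `^ (1 - q))%:E)%E.
Proof.
have tp : 0 <= tau by exact: ltW.
have md : measurable_fun setT (fun r => ((dif tau a r) ^+ 2)%:E).
  by apply/measurable_EFinP; apply: measurable_funX; exact: measurable_dif.
have md' : measurable_fun setT (fun r : R => ((dif tau a (r - tau)) ^+ 2)%:E).
  by apply: (measurableT_comp md (g := fun r : R => r - tau)); exact: measurable_funB.
have mw (k : R -> R) : measurable_fun setT k ->
    measurable_fun setT ((fun r => ((k r) ^+ 2)%:E) \_ `](t - tau)%R, t]).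
  move=> mk; apply/(measurable_restrictT _ _).1; first exact: measurable_itv.
  by apply: measurable_funTS; apply/measurable_EFinP; exact: measurable_funX.
have w0 (k : R -> R) r : (0 <= ((fun r => ((k r) ^+ 2)%:E) \_ `](t - tau)%R, t]) r)%E.
  by rewrite patchE; case: ifP => // _; rewrite lee_fin sqr_ge0.
set F1 := fun r : R => ((dif tau a r) ^+ 2)%:E.
set F2 := fun r : R => ((dif tau a (r - tau)) ^+ 2)%:E.
set G1 := (fun r => ((a r) ^+ 2)%:E) \_ `](t - tau)%R, t].
set G2 := (fun r => ((mean_hist r) ^+ 2)%:E) \_ `](t - tau)%R, t].
have F10 r : (0 <= F1 r)%E by rewrite lee_fin sqr_ge0.
have F20 r : (0 <= F2 r)%E by rewrite lee_fin sqr_ge0.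
have mG1 : measurable_fun setT G1 by exact: mw.
have mG2 : measurable_fun setT G2 by apply: mw; exact: measurable_mean_hist.
have step : (\int[mu]_r ((a r - mean_hist r) ^+ 2)%:E <=
   \int[mu]_r ((F1 r + F2 r) + (2%:E * G1 r + 2%:E * G2 r)))%E.
  apply: ge0_integral_mono => r _; first by rewrite lee_fin sqr_ge0.
  exact: sub_mean_sqr.
apply: (le_trans step).
rewrite ge0_integralD; [|exact: measurableT|by move=> r _; rewrite adde_ge0|exact: emeasurable_funD
  |by move=> r _; rewrite adde_ge0// mule_ge0// w0|by apply: emeasurable_funD; apply: measurable_funeM].
rewrite ge0_integralD; [|exact: measurableT|by move=> r _|exact: md|by move=> r _|exact: md'].
rewrite (ge0_integral_double mu mG1 mG2); [|by move=> r; exact: w0|by move=> r; exact: w0].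
have -> : (\int[mu]_r F2 r = \int[mu]_r F1 r)%E.
  exact: (ge0_integral_shift (f := F1) (- tau)).
have dn : (\int[mu]_r F1 r <= (2 * M * tau `^ (1 - q))%:E)%E.
  by apply: (dnorm_hist mv v01 v_nincr q0 q1 K0 v_decay t0 tp).
have g1 : (\int[mu]_r G1 r <= (M * tau `^ (1 - q))%:E)%E.
  by rewrite /G1 -integral_mkcond; exact: window.
have g2 : (\int[mu]_r G2 r <= (M * tau `^ (1 - q))%:E)%E.
  by rewrite /G2 -integral_mkcond; exact: mean_hist_window.
have g12 : (2%:E * (\int[mu]_r G1 r) + 2%:E * (\int[mu]_r G2 r) <= (4 * M * tau `^ (1 - q))%:E)%E.
  by apply: (double_add_le g1 g2); rewrite -!EFinM -EFinD lee_fin; lra.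
apply: (le_trans (leeD (leeD dn dn) g12)).
by rewrite -!EFinD lee_fin; lra.
Qed.

Lemma hist_sub_mean_qform (H T : R) (eta : R -> R) : shift_index H T eta -> 0 < H ->
  q < 2 * H -> tau <= T ->
  (\int[mu]_x dnorm (eta x) (fun r => a r - mean_hist r)%R <=
   (4 * (8 * M) * ((1 - q) * H / (2 * H - q)) * tau `^ (2 * H - q))%:E)%E.
Proof.
move=> etaP H0 qH tT.
have B0 : 0 <= 8 * M by rewrite mulr_ge0.
have mb : measurable_fun setT (fun r => a r - mean_hist r).
  by apply: measurable_funB => //; exact: measurable_mean_hist.
apply: (time_qform_le etaP H0 q0 q1 qH tau0 tT B0 mb); last exact: integral_hist_sub_mean.
move=> h h0 hd.
rewrite (_ : 8 * _ * _ = 4 * (2 * M * h `^ (1 - q))); last by ring.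
apply: dnorm_sub_le => //.
- exact: measurable_mean_hist.
- exact: (dnorm_hist mv v01 v_nincr q0 q1 K0 v_decay t0 h0).
- apply: (le_trans (dnorm_rising rising_mean_hist h0)).
  have two0 : (0 <= 2%:E :> \bar R)%E by rewrite lee_fin.
  apply: (le_trans (lee_wpmul2l two0 (mean_hist_window h0 hd))).
  by rewrite -EFinM lee_fin -!mulrA.
Qed.

End cell_averages.

(** * Summation over modes and decay in the eigenvalue *)

Section zeta_bound.
Context {R : realType}.

Lemma natr_powR_gt0 (k : nat) (p : R) : (0 < k)%N -> 0 < (k%:R : R) `^ p.
Proof. by move=> k0; rewrite powR_gt0// ltr0n. Qed.

(* Pairing 2j with 2j+1 gives S(2N+1) <= 1 + 2^(1-p) S(N). *)
Lemma sum_powR_le (p : R) (N : nat) : 1 < p ->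
  \sum_(1 <= k < N.+1) (k%:R : R) `^ (- p) <= (1 - 2 `^ (1 - p))^-1.
Proof.
move=> p1; pose S n := \sum_(1 <= k < n.+1) (k%:R : R) `^ (- p).
have rec n : S n.+1 = S n + n.+1%:R `^ (- p) by rewrite /S big_nat_recr.
have dbl n : S n.*2.+1 <= 1 + 2 `^ (1 - p) * S n.
  elim: n => [|n IH]; first by rewrite /S big_nat1 big_nil mulr0 addr0 powR1.
  rewrite doubleS 2!rec (rec n) mulrDr -addrA (addrA 1); apply: lerD IH _.
  have -> : (2 : R) `^ (1 - p) * n.+1%:R `^ (- p) = 2 * n.+1.*2%:R `^ (- p).
    rewrite -mul2n natrM powRM// powRD; last by rewrite pnatr_eq0 implybT.
    by rewrite powRr1// mulrA.
  rewrite -doubleS (_ : 2 * _ = (n.+1).*2%:R `^ (- p) + (n.+1).*2%:R `^ (- p)); last by ring.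
  rewrite lerD2l !powRN lef_pV2 ?posrE ?natr_powR_gt0//.
  apply: ge0_ler_powR; rewrite ?nnegrE ?ler0n ?ler_nat//; last by lra.
have mono n m : (n <= m)%N -> S n <= S m.
  move=> /subnK <-; elim: (m - n)%N => [|j IH]; first by rewrite add0n.
  by rewrite addSn rec (le_trans IH)// lerDl powR_ge0.
have c1 : 2 `^ (1 - p) < 1 :> R.
  rewrite (_ : 1 - p = - (p - 1)); last by ring.
  have p0 : 0 < p - 1 by lra.
  rewrite powRN invf_lt1 ?powR_gt0// [ltLHS](_ : 1 = 1 `^ (p - 1)); last by rewrite powR1.
  by apply: gt0_ltr_powR; rewrite ?nnegrE//; lra.
have h := le_trans (mono N N.*2.+1 _) (dbl N).
rewrite -/(S N) -[leRHS]mul1r ler_pdivlMr ?subr_gt0//.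
have /h : (N <= N.*2.+1)%N by rewrite -addnn leqW// leq_addr.
rewrite mulrBr mulr1 [S N * _]mulrC; move: (2 `^ (1 - p)) (S N) => c x; lra.
Qed.

End zeta_bound.

Section mittag_leffler_kernel.
Context {R : realType}.
Variable alpha : R.
Hypothesis a0 : 0 < alpha.
Hypothesis a1 : alpha < 1.

Definition mlk (l x : R) : R := mittag_leffler alpha 1 (- (l * x `^ alpha)).

Lemma measurable_mlk l : measurable_fun setT (mlk l).
Proof.
apply: (measurableT_comp (f := mittag_leffler alpha 1)).
  exact: continuous_measurable_fun (continuous_mittag_leffler a0).
by apply: measurable_funN; apply: measurable_funM => //; exact: measurable_powR.
Qed.

Lemma mlk01 l x : 0 <= l -> 0 <= mlk l x <= 1.
Proof.
move=> l0; have y0 : 0 <= l * x `^ alpha by rewrite mulr_ge0// powR_ge0.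
by rewrite /mlk mittag_leffler_ge0//= mittag_leffler_le1.
Qed.

Lemma mlk_nincr l x y : 0 <= l -> 0 <= x -> x <= y -> mlk l y <= mlk l x.
Proof.
move=> l0 x0 xy; apply: mittag_leffler_nincr => //.
  by rewrite mulr_ge0// powR_ge0.
apply: ler_wpM2l => //; apply: ge0_ler_powR => //; first exact: ltW.
by rewrite nnegrE (le_trans x0).
Qed.

(** With y = l x^alpha the kernel is at most 1 and at most Gamma(alpha + 1) / y, and min(1, y^(-2))
    <= y^(-p) for p = q / alpha in [0, 2]. The parameter [q] thus trades singularity in time for
    decay in the eigenvalue. *)
Lemma mlk_decay l x q : 0 < l -> 0 < x -> 0 <= q -> q <= 2 * alpha ->
  (mlk l x) ^+ 2 <= (1 + Gamma (alpha + 1)) ^+ 2 * l `^ (- (q / alpha)) * x `^ (- q).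
Proof.
have ha0 := a0; move=> l0 x0 q0 q2.
have G0 : 0 < Gamma (alpha + 1) by apply: Gamma_gt0; lra.
set G := Gamma _ in G0 *.
have y0 : 0 < l * x `^ alpha by rewrite mulr_gt0// powR_gt0.
rewrite -mulrA (_ : l `^ _ * x `^ _ = (l * x `^ alpha) `^ (- (q / alpha))); last first.
  rewrite powRM ?ltW ?powR_gt0// -powRrM; congr (_ * _ `^ _).
  by rewrite mulrN mulrC divfK// gt_eqF.
have p0 : 0 <= q / alpha by rewrite divr_ge0// ltW.
have p2 : q / alpha <= 2 by rewrite ler_pdivrMr.
have /andP[m0 m1] := mlk01 x (ltW l0).
have dec : mlk l x * (l * x `^ alpha) <= G by apply: mittag_leffler_decay => //; exact: ltW.
move: (mlk l x) (l * x `^ alpha) (q / alpha) y0 p0 p2 m0 m1 dec => w y p y0 p0 p2 m0 m1 dec.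
have [y1|y1] := leP y 1.
  apply: (@le_trans _ _ 1); first by rewrite -(expr1n _ 2) ler_pXn2r ?nnegrE.
  rewrite -[leLHS]mulr1; apply: ler_pM => //.
    by rewrite -{1}(expr1n _ 2) ler_pXn2r ?nnegrE// ?addr_ge0//; lra.
  rewrite powRN invf_ge1 ?powR_gt0//.
  have yn : y \in Num.nneg by rewrite nnegrE ltW.
  by have := ge0_ler_powR p0 yn (ler01 : 1 \in Num.nneg) y1; rewrite powR1.
apply: (@le_trans _ _ (G ^+ 2 * y ^- 2)).
  rewrite -expr_div_n ler_pXn2r ?nnegrE//; first by rewrite ler_pdivlMr.
  by rewrite divr_ge0 ?ltW.
have yp : 0 <= y ^- 2 by rewrite invr_ge0 exprn_ge0// ltW.
apply: ler_pM; [exact: sqr_ge0|exact: yp| |].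
  by rewrite ler_pXn2r ?nnegrE//; lra.
rewrite powRN lef_pV2 ?posrE ?powR_gt0 ?exprn_gt0// -powR_mulrn; last exact: ltW.
by apply: ler_powR => //; exact: ltW.
Qed.

End mittag_leffler_kernel.

(** * L2(D), Bessel's inequality and recovery of coefficients *)

Section square_integrable_on_D.
Context {R : realType}.
Implicit Types f g h : R -> R.

(** Membership in [L2D] ([L2DP]) in the form in which integrals of squares are computed. *)
Definition sqint (g : R -> R) : Prop :=
  measurable_fun setT g /\ (\int[lebD R]_x ((g x) ^+ 2)%:E < +oo)%E.

Lemma normD_sqr g : (normD g ^+ 2 = \int[lebD R]_x ((g x) ^+ 2)%:E)%E.
Proof.
rewrite expe2 /normD unlock.
rewrite (_ : (\int[lebD R]_x (`|(EFin \o g) x| `^ 2)%E)%E = (\int[lebD R]_x ((g x) ^+ 2)%:E)%E); last first.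
  by apply: eq_integral => x _ /=; rewrite (powR_mulrn 2)// real_normK ?num_real.
set I := (\int[_]_x _)%E.
have I0 : (0 <= I)%E by apply: integral_ge0 => x _; rewrite lee_fin sqr_ge0.
have h2 : (2^-1 : R) != 0 by rewrite invr_eq0 pnatr_eq0.
case: I I0 => [r r0|_|]; [|by rewrite !(poweRyr h2) mulyy|by []].
rewrite lee_fin in r0; rewrite poweR_EFin -EFinM -expr2 -powR_mulrn ?powR_ge0//.
by rewrite -powRrM mulVf ?powRr1// pnatr_eq0.
Qed.

Lemma L2DP g : (g \in @L2D R) <-> sqint g.
Proof.
rewrite /L2D /sqint unfold_in /Lfun inE /=.
have nE : (normD g < +oo)%E <-> (\int[lebD R]_x ((g x) ^+ 2)%:E < +oo)%E.
  rewrite -normD_sqr; have n0 : (0 <= normD g)%E by exact: Lnorm_ge0.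
  case: (normD g) n0 => [r|_|//]; last by rewrite expe2 mulyy.
  by rewrite expe2 -EFinM !ltry.
split=> [/andP[]|[mg /nE gf]].
  rewrite inE /= => mg; rewrite inE /= => gf; split; first exact: mg.
  exact/nE.
by apply/andP; split; rewrite inE.
Qed.

Lemma innerD_integrable f g : sqint f -> sqint g ->
  (lebD R).-integrable setT (EFin \o (fun x => f x * g x)).
Proof.
move=> [mf ff] [mg gf].
have ffin (k : R -> R) : (\int[lebD R]_x ((k x) ^+ 2)%:E < +oo)%E ->
    exists2 A : R, 0 <= A & (\int[lebD R]_x ((k x) ^+ 2)%:E <= A%:E)%E.
  have k0 : (0 <= \int[lebD R]_x ((k x) ^+ 2)%:E)%E by apply: integral_ge0 => x _; rewrite lee_fin sqr_ge0.
  by move=> kf; exists (fine (\int[lebD R]_x ((k x) ^+ 2)%:E)); [exact: fine_ge0|rewrite fineK// ge0_fin_numE].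
have [A A0 fA] := ffin f ff; have [B B0 gB] := ffin g gf.
by have [] := @cauchy_schwarz _ _ (measurableTypeR R) (lebD R) setT f g A B measurableT mf mg A0 B0 fA gB.
Qed.

Lemma innerD_sqr g : sqint g -> ((innerD g g)%:E = \int[lebD R]_x ((g x) ^+ 2)%:E)%E.
Proof.
move=> [mg gf]; rewrite /innerD /Rintegral fineK.
  by apply: eq_integral => x _; rewrite expr2.
under eq_integral do rewrite -expr2.
by rewrite ge0_fin_numE//; apply: integral_ge0 => x _; rewrite lee_fin sqr_ge0.
Qed.

Lemma innerDC f g : innerD f g = innerD g f.
Proof. by apply: eq_Rintegral => x _; rewrite mulrC. Qed.

Lemma sqintD f g : sqint f -> sqint g -> sqint (fun x => f x + g x).
Proof.
move=> [mf ff] [mg gf]; split; first exact: measurable_funD.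
apply: (le_lt_trans (@integral_sqr_add_le _ _ _ (lebD R) _ f g mf mg (fun=> erefl))).
by rewrite lte_add_pinfty// lte_mul_pinfty// ?lee_fin.
Qed.

Lemma sqintZ c f : sqint f -> sqint (fun x => c * f x).
Proof.
move=> [mf ff]; split; first exact: measurable_funM.
rewrite (@integral_sqrZ _ _ _ (lebD R) c f mf); apply: lte_mul_pinfty => //.
by rewrite lee_fin sqr_ge0.
Qed.

Lemma sqintB f g : sqint f -> sqint g -> sqint (fun x => f x - g x).
Proof.
move=> sf sg; rewrite (_ : (fun x => _) = (fun x => f x + -1 * g x)).
  by apply: sqintD => //; exact: sqintZ.
by apply/funext => x; rewrite mulN1r.
Qed.

Lemma innerDDl f g h : sqint f -> sqint g -> sqint h ->
  innerD (fun x => f x + g x) h = innerD f h + innerD g h.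
Proof.
move=> sf sg sh; rewrite /innerD -RintegralD; [|exact: measurableT
  |exact: innerD_integrable|exact: innerD_integrable].
by apply: eq_Rintegral => x _; rewrite mulrDl.
Qed.

Lemma innerDZl c f h : sqint f -> sqint h ->
  innerD (fun x => c * f x) h = c * innerD f h.
Proof.
move=> sf sh; rewrite /innerD -RintegralZl; [|exact: measurableT|exact: innerD_integrable].
by apply: eq_Rintegral => x _; rewrite mulrA.
Qed.

Lemma innerDBl f g h : sqint f -> sqint g -> sqint h ->
  innerD (fun x => f x - g x) h = innerD f h - innerD g h.
Proof.
move=> sf sg sh; rewrite -mulN1r -innerDZl// -innerDDl//; last exact: sqintZ.
by congr innerD; apply/funext => x; rewrite mulN1r.
Qed.

Variables (phi : nat -> R -> R) (N : nat).
Hypothesis sphi : forall k, (1 <= k)%N -> sqint (phi k).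
Hypothesis ortho : forall j k, (1 <= j)%N -> (1 <= k)%N ->
  innerD (phi j) (phi k) = (j == k)%:R.

Definition comb (c : nat -> R) (x : R) : R := \sum_(1 <= k < N.+1) c k * phi k x.

Let sum_sqint (c : nat -> R) (h : R -> R) n : sqint h ->
  sqint (fun x => \sum_(1 <= k < n.+1) c k * phi k x) /\
  innerD (fun x => \sum_(1 <= k < n.+1) c k * phi k x) h =
  \sum_(1 <= k < n.+1) c k * innerD (phi k) h.
Proof.
move=> sh; elim: n => [|n [s e]].
  rewrite (_ : (fun x => _) = (fun x => 0 * h x)); last first.
    by apply/funext => x; rewrite big_nil mul0r.
  by rewrite big_nil; split; [exact: sqintZ|rewrite innerDZl// mul0r].
rewrite (_ : (fun x => _) = (fun x =>
  \sum_(1 <= k < n.+1) c k * phi k x + c n.+1 * phi n.+1 x)); last first.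
  by apply/funext => x; rewrite big_nat_recr.
have sz : sqint (fun x => c n.+1 * phi n.+1 x) by apply: sqintZ; exact: sphi.
split; first exact: sqintD.
have sp : sqint (phi n.+1) by exact: sphi.
by rewrite innerDDl// e (innerDZl _ sp sh) [RHS]big_nat_recr.
Qed.

Lemma sqint_comb c : sqint (comb c).
Proof. by have [] := sum_sqint c N (sphi (leqnn 1)). Qed.

Lemma innerD_comb c h : sqint h -> innerD (comb c) h = \sum_(1 <= k < N.+1) c k * innerD (phi k) h.
Proof. by move=> /(sum_sqint c N)[]. Qed.

Lemma innerD_comb_phi c j : (1 <= j <= N)%N -> innerD (comb c) (phi j) = c j.
Proof.
move=> /andP[j1 jN]; rewrite innerD_comb; last by apply: sphi.
rewrite (bigD1_seq j) ?iota_uniq ?mem_index_iota ?j1 ?ltnS//= ortho// eqxx mulr1.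
rewrite big_seq_cond big1 ?addr0// => k; rewrite mem_index_iota => /andP[/andP[k1 _] kj].
by rewrite ortho// (negbTE kj) mulr0.
Qed.

Lemma innerD_comb_comb c : innerD (comb c) (comb c) = \sum_(1 <= k < N.+1) (c k) ^+ 2.
Proof.
rewrite innerD_comb; last exact: sqint_comb.
apply: eq_big_nat => k; rewrite ltnS => kN.
by rewrite innerDC innerD_comb_phi// expr2.
Qed.

Lemma normD_comb c : (normD (comb c) ^+ 2 = (\sum_(1 <= k < N.+1) (c k) ^+ 2)%:E)%E.
Proof. by rewrite normD_sqr -innerD_sqr ?innerD_comb_comb//; exact: sqint_comb. Qed.

(** Nonnegativity of the squared norm of g minus its projection. *)
Lemma bessel g : sqint g ->
  \sum_(1 <= k < N.+1) (innerD g (phi k)) ^+ 2 <= innerD g g.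
Proof.
move=> sg; pose c k := innerD g (phi k); have sc := sqint_comb c.
have sb := sqintB sg sc.
have : 0 <= innerD (fun x => g x - comb c x) (fun x => g x - comb c x).
  by rewrite -lee_fin innerD_sqr//; apply: integral_ge0 => x _; rewrite lee_fin sqr_ge0.
rewrite innerDBl// 2!(innerDC _ (fun x => g x - comb c x)) !innerDBl//.
rewrite innerD_comb_comb (innerDC g (comb c)) innerD_comb//.
rewrite (_ : \sum_(1 <= k < N.+1) c k * innerD (phi k) g = \sum_(1 <= k < N.+1) (c k) ^+ 2); last first.
  by apply: eq_bigr => k _; rewrite innerDC expr2.
rewrite -/c; move: (innerD g g) (\sum_(_ <= _ < _) _) => x y; lra.
Qed.

End square_integrable_on_D.

Section evaluation_functionals.
Context {R : realType}.
Variables (lambda : nat -> R) (phi : nat -> R -> R).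
Hypothesis es : dirichlet_eigensystem lambda phi.

Lemma measurable_eigenfunction k : (1 <= k)%N -> measurable_fun setT (phi k).
Proof. by move=> k1; apply: continuous_measurable_fun; exact: (eigenfunction_continuous es k1). Qed.

Lemma eigenfunction_orthonormal j k : (1 <= j)%N -> (1 <= k)%N ->
  innerD (phi j) (phi k) = (j == k)%:R.
Proof. by have [_ _ o _] := es; exact: o. Qed.

Lemma eigenfunction_out k x : (1 <= k)%N -> ~ D x -> phi k x = 0.
Proof. by have [h _ _ _] := es; move=> /h[_ + _]; exact. Qed.

Lemma sqint_eigenfunction k : (1 <= k)%N -> sqint (phi k).
Proof.
move=> k1; have mk := measurable_eigenfunction k1; split; first exact: mk.
have m2 : measurable_fun setT (fun x => ((phi k x) ^+ 2)%:E).
  by apply/measurable_EFinP; exact: measurable_funX.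
rewrite integral_lebD//.
have [b _] := eigenfunction_bounds es k1.
apply: (@le_lt_trans _ _ (\int[lebesgue_measure]_(x in (`]0%R, 1%R[ : set R)) 4%:E)%E).
  apply: ge0_integral_mono => x _; first by rewrite lee_fin sqr_ge0.
  rewrite lee_fin -(real_normK (num_real (phi k x))) (_ : 4 = 2 ^+ 2); last by rewrite -natrX.
  by rewrite ler_pXn2r ?nnegrE ?normr_ge0.
rewrite integral_cst//= lebesgue_measure_itv /= lte_fin ltr01.
by rewrite -EFinD -EFinM ltry.
Qed.

Variable N : nat.

Let row_phi (x : R) : 'rV[R]_N := \row_k phi k.+1 x.

Lemma comb_ord c x : comb phi N c x = \sum_(k < N) c k.+1 * phi k.+1 x.
Proof. by rewrite /comb big_add1 /= big_mkord. Qed.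

Lemma comb_eq0 c : (forall x, D x -> comb phi N c x = 0) ->
  forall k, (1 <= k <= N)%N -> c k = 0.
Proof.
move=> c0 k kN.
rewrite -(innerD_comb_phi sqint_eigenfunction eigenfunction_orthonormal c kN).
rewrite (_ : comb phi N c = fun x => 0 * phi k x).
  by rewrite innerDZl ?mul0r//; apply: sqint_eigenfunction; case/andP: kN.
apply/funext => x; rewrite mul0r; have [/c0//|nD] := pselect (D x).
rewrite /comb big_seq big1// => j; rewrite mem_index_iota => /andP[j1 _].
by rewrite eigenfunction_out// mulr0.
Qed.

(** While the evaluation matrix phi_k(x_j) has rank below N, some nonzero coefficient vector is
    killed by it. The corresponding combination of eigenfunctions is nonzero at some y in D, by
    independence, and adding y raises the rank. *)
Let rank_step n : (n <= N)%N -> exists (m : nat) (x : 'I_m -> R),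
  (forall j, D (x j)) /\ (n <= \rank (\matrix_(j < m) row_phi (x j)))%N.
Proof.
elim: n => [_|n IH nN]; first by exists 0%N, (fun=> 0); split => // -[].
have [m [x [xD rk]]] := IH (ltnW nN).
set A := (\matrix_(j < m) _) in rk.
have [|rkn] := ltnP n (\rank A); first by exists m, x.
have Arank : (\rank A < N)%N by apply: leq_ltn_trans rkn nN.
(* A nonzero column of the cokernel matrix supplies the killed coefficient vector. *)
have ck0 : cokermx A != 0 by rewrite -mxrank_eq0 mxrank_coker subn_eq0 -ltnNge.
have [j cj0] : exists j, col j (cokermx A) != 0.
  apply/existsP; apply: contraNT ck0; rewrite negb_exists => /forallP h.
  apply/eqP/matrixP => i j; have /negPn/eqP/matrixP/(_ i 0) := h j.
  by rewrite !mxE.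
set c := col j (cokermx A) in cj0.
have Ac : A *m c = 0 by rewrite /c colE mulmxA mulmx_coker mul0mx.
have [y [yD ryc]] : exists y, D y /\ row_phi y *m c != 0.
  apply: contrapT => h; move/eqP: cj0; apply; apply/matrixP => i k; rewrite ord1 [RHS]mxE.
  pose c' l := if insub l.-1 is Some i then c i 0 else 0.
  have c'E (l : 'I_N) : c' l.+1 = c l 0.
    by rewrite /c' /= insubT //=; move=> ltl; congr (c _ _); apply: val_inj.
  rewrite -c'E; apply: comb_eq0; last by rewrite ltn_ord.
  move=> x' x'D; rewrite comb_ord.
  apply: contrapT => ne; apply: h; exists x'; split => //; apply/eqP => /matrixP/(_ 0 0).
  rewrite !mxE => e; apply: ne; rewrite -[RHS]e; apply: eq_bigr => l _.
  by rewrite mxE c'E mulrC.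
pose x1 (i : 'I_(m + 1)) := match fintype.split i with inl i => x i | inr _ => y end.
exists (m + 1)%N, x1; split.
  by move=> i; rewrite /x1; case: (fintype.split i).
have -> : \matrix_(i < m + 1) row_phi (x1 i) = col_mx A (row_phi y).
  apply/row_matrixP => i; rewrite rowK /x1 -{2}[i]splitK; case: (fintype.split i) => k /=.
    by rewrite rowKu rowK.
  by rewrite rowKd ord1; apply/rowP => l; rewrite !mxE.
apply: (leq_ltn_trans rk); apply: rank_ltmx; rewrite /ltmx.
apply/andP; split; first by rewrite -addsmxE addsmxSl.
rewrite col_mx_sub; apply/negP => /andP[_ /submxP[u e]].
by move/eqP: ryc; apply; rewrite e -mulmxA Ac mulmx0.
Qed.

(** A mild equation holds almost surely for each point x, with an exceptional event that depends on
    x. Recovering all coefficients from finitely many points leaves a finite union of null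
    events. *)
Lemma coefficient_functionals : exists (m : nat) (x : 'I_m -> R) (B : nat -> 'I_m -> R),
  (forall j, D (x j)) /\
  forall c k, (1 <= k <= N)%N -> c k = \sum_(j < m) B k j * comb phi N c (x j).
Proof.
have [m [x [xD rk]]] := rank_step (leqnn N).
have /row_fullP[B BA] : row_full (\matrix_(j < m) row_phi (x j)).
  by rewrite /row_full eqn_leq rk rank_leq_col.
exists m, x, (fun k j => if insub k.-1 is Some i then B i j else 0); split => // c k /andP[k1 kN].
have kN' : (k.-1 < N)%N by rewrite prednK.
rewrite insubT.
transitivity (\sum_(l < N) c l.+1 * (1%:M : 'M[R]_N) (Ordinal kN') l).
  rewrite (bigD1 (Ordinal kN'))//= mxE eqxx mulr1 prednK// big1 ?addr0// => l ne.
  by rewrite mxE eq_sym (negbTE ne) mulr0.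
rewrite -BA; under eq_bigr do rewrite mxE big_distrr.
rewrite exchange_big; apply: eq_bigr => j _; rewrite comb_ord big_distrr /=.
by apply: eq_bigr => l _; rewrite !mxE mulrCA.
Qed.

End evaluation_functionals.

(** * The equations in coordinates *)

Section drift_coefficients.
Context {R : realType}.
Variables (lambda : nat -> R) (phi : nat -> R -> R) (N : nat).
Hypothesis es : dirichlet_eigensystem lambda phi.
Variables (f : (R -> R) -> (R -> R)) (Cf : R).
Hypothesis Cf0 : 0 < Cf.
Hypothesis hf : growth_lipschitz Cf f.

Notation sum2 c := (\sum_(1 <= k < N.+1) (c k) ^+ 2).

Definition drift (c : nat -> R) (k : nat) : R := innerD (f (comb phi N c)) (phi k).

Let sphi k : (1 <= k)%N -> sqint (phi k). Proof. exact: (sqint_eigenfunction es). Qed.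

Let scomb c : sqint (comb phi N c). Proof. exact: sqint_comb. Qed.

Let sf c : sqint (f (comb phi N c)).
Proof. by have [h _ _] := hf; apply/L2DP; apply: h; apply/L2DP. Qed.

Let combB c c' : comb phi N (fun k => c k - c' k) = comb phi N c \- comb phi N c'.
Proof.
apply/funext => x; rewrite /comb /= -sumrB; apply: eq_bigr => k _.
by rewrite mulrBl.
Qed.

Let le_expe2 (a b : \bar R) : (0 <= a)%E -> (a <= b)%E -> (a ^+ 2 <= b ^+ 2)%E.
Proof. by move=> a0 ab; rewrite !expe2; apply: lee_pmul. Qed.

Lemma drift_lipschitz c c' : sum2 (fun k => drift c k - drift c' k) <=
  Cf ^+ 2 * sum2 (fun k => c k - c' k).
Proof.
have [_ _ lip] := hf.
have sd := sqintB (sf c) (sf c').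
apply: (@le_trans _ _ (innerD (f (comb phi N c) \- f (comb phi N c')) (f (comb phi N c) \- f (comb phi N c')))).
  apply: le_trans (bessel N sphi (eigenfunction_orthonormal es) sd).
  rewrite le_eqVlt; apply/orP; left; apply/eqP; apply: eq_big_nat => k /andP[k1 _].
  by rewrite /drift -innerDBl//; exact: sphi.
rewrite -lee_fin innerD_sqr// -normD_sqr EFinM.
rewrite -(normD_comb N sphi (eigenfunction_orthonormal es)) combB.
have L2 c0 : comb phi N c0 \in @L2D R by exact/L2DP.
have := le_expe2 (Lnorm_ge0 _ _ _) (lip _ _ (L2 c) (L2 c')).
by rewrite !expe2 muleACA -EFinM -expr2.
Qed.

(** Bessel's inequality and the growth of [f], with (1 + x)^2 <= 2 (1 + x^2). *)
Lemma drift_growth c : sum2 (drift c) <= 2 * Cf ^+ 2 * (1 + sum2 c).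
Proof.
have [_ gr _] := hf.
apply: (@le_trans _ _ (innerD (f (comb phi N c)) (f (comb phi N c)))).
  exact: (bessel N sphi (eigenfunction_orthonormal es) (sf c)).
rewrite -lee_fin innerD_sqr// -normD_sqr.
have L2 : comb phi N c \in @L2D R by exact/L2DP.
apply: (le_trans (le_expe2 (Lnorm_ge0 _ _ _) (gr _ L2))).
have := normD_comb N sphi (eigenfunction_orthonormal es) c.
have : (0 <= normD (comb phi N c))%E by exact: Lnorm_ge0.
case: (normD _) => [x|_|//]; last by rewrite expe2 mulyy.
rewrite lee_fin !expe2 -!EFinM => x0 [<-]; rewrite lee_fin.
have := mulr_ge0 (sqr_ge0 Cf) (sqr_ge0 (1 - x)); rewrite !expr2 => h.
by rewrite -subr_ge0 (_ : _ - _ = Cf * Cf * ((1 - x) * (1 - x)))//; ring.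
Qed.

Lemma sum_sqr_le_sqr_sum (g : nat -> R) n : (forall k, 0 <= g k) ->
  \sum_(1 <= k < n.+1) (g k) ^+ 2 <= (\sum_(1 <= k < n.+1) g k) ^+ 2.
Proof.
move=> g0; elim: n => [|n IH]; first by rewrite !big_nil expr0n.
rewrite !(big_nat_recr n.+1)//= sqrrD; have s0 : 0 <= \sum_(1 <= k < n.+1) g k by apply: sumr_ge0.
have := mulr_ge0 s0 (g0 n.+1); move: (\sum_(_ <= _ < _) _) IH => S IH; rewrite mulr2n => h; lra.
Qed.

Lemma sqr_le_sum2 (g : nat -> R) k : (1 <= k <= N)%N -> (g k) ^+ 2 <= sum2 g.
Proof.
move=> /andP[k1 kN]; rewrite (bigD1_seq k) ?iota_uniq ?mem_index_iota ?k1 ?ltnS//=.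
by rewrite lerDl sumr_ge0// => j _; exact: sqr_ge0.
Qed.

(** The l1 form serves measurability of the drift and pathwise integrability, where only L1
    information on the path is available. *)
Lemma drift_lipschitz1 c c' k : (1 <= k <= N)%N ->
  `|drift c k - drift c' k| <= Cf * \sum_(1 <= k < N.+1) `|c k - c' k|.
Proof.
move=> kN; have s0 : 0 <= \sum_(1 <= k < N.+1) `|c k - c' k| by apply: sumr_ge0.
have cs0 := mulr_ge0 (ltW Cf0) s0.
rewrite -(@ler_pXn2r _ 2)// real_normK ?num_real//.
apply: (le_trans (sqr_le_sum2 (fun k => drift c k - drift c' k) kN)).
apply: (le_trans (drift_lipschitz c c')); rewrite exprMn ler_wpM2l ?sqr_ge0//.
apply: le_trans (sum_sqr_le_sqr_sum _ _) => //.
rewrite le_eqVlt; apply/orP; left; apply/eqP; apply: eq_bigr => j _.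
by rewrite real_normK ?num_real.
Qed.

End drift_coefficients.

(* Rational boxes on which G < a cover the set where G(c(x)) < a. *)
Lemma measurable_lipschitz_comp {R : realType} d (T : measurableType d) (N : nat)
    (G : (nat -> R) -> R) (L : R) (c : nat -> T -> R) : 0 <= L ->
  (forall a b, `|G a - G b| <= L * \sum_(1 <= k < N.+1) `|a k - b k|) ->
  (forall k, measurable_fun setT (c k)) ->
  measurable_fun setT (fun x => G (fun k => c k x)).
Proof.
move=> L0 lip mc.
apply: (measurability _ (RGenInftyO.measurableE R)) => _ [_ [a ->] <-]; rewrite setTI.
pose rho (i : {ffun 'I_N.+1 -> rat} * nat) (k : nat) : R := ratr (i.1 (inord k)).
pose good i := forall b, (forall k, (1 <= k <= N)%N -> `|b k - rho i k| < i.2.+1%:R^-1) -> G b < a.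
pose B i := [set x | forall k, (1 <= k <= N)%N -> `|c k x - rho i k| < i.2.+1%:R^-1].
have mB i : measurable (B i).
  have -> : B i = \bigcap_k (if (1 <= k <= N)%N then
      (fun x => `|c k x - rho i k|) @^-1` `]-oo, i.2.+1%:R^-1[%classic else setT).
    apply/seteqP; split => [x h k _|x h k kN].
      by case: ifP => // kN; have := h k kN; rewrite /= in_itv.
    by have := h k I; rewrite kN /= in_itv.
  apply: bigcapT_measurable => k; case: ifP => // _; rewrite -[X in measurable X]setTI.
  apply: (_ : measurable_fun setT (fun x => `|c k x - rho i k|)) => //.
  by apply: (measurableT_comp (@normr_measurable _ setT)); apply: measurable_funB.
have -> : (fun x => G (fun k => c k x)) @^-1` `]-oo, a[%classic =
    \bigcup_i (if `[< good i >] then B i else set0).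
  apply/seteqP; split => [x /=|x [i _]]; last first.
    by case: asboolP => // gi Bx; rewrite /= in_itv /=; exact: gi.
  rewrite in_itv /= => Ga.
  (* Moving every coordinate by at most 2 e raises [G] by at most 2 e L N, which is less than a -
     G(c(x)) = 2 e (1 + L N). *)
  pose e := (a - G (fun k => c k x)) / (2 * (1 + L * N%:R)).
  have den : 0 < 2 * (1 + L * N%:R) by rewrite mulr_gt0// ltr_pwDl// mulr_ge0.
  have e0 : 0 < e by rewrite divr_gt0// subr_gt0.
  pose n := Num.bound e^-1.
  have ne : n.+1%:R^-1 < e.
    rewrite -[ltRHS]invrK ltf_pV2 ?posrE ?invr_gt0//.
    by apply: (lt_le_trans (archi_boundP (ltW _))); rewrite ?invr_gt0// ler_nat.
  have approx k : exists r : rat, `|c k x - ratr r| < n.+1%:R^-1.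
    have lt : c k x < c k x + n.+1%:R^-1 by rewrite ltrDl.
    have [r] := rat_in_itvoo lt; rewrite in_itv /= => /andP[r1 r2]; exists r.
    have d0 : 0 < n.+1%:R^-1 :> R by rewrite invr_gt0.
    by rewrite ltr_distlC r2 andbT (lt_trans _ r1)// ltrBlDr ltrDl.
  have {}approx k : {r : rat | `|c k x - ratr r| < n.+1%:R^-1} by exact/cid/approx.
  pose i : {ffun 'I_N.+1 -> rat} * nat := ([ffun k : 'I_N.+1 => sval (approx k)], n).
  have iE k : (1 <= k <= N)%N -> `|c k x - rho i k| < n.+1%:R^-1.
    by move=> /andP[_ kN]; rewrite /rho ffunE /= inordK//; exact: (svalP (approx k)).
  exists i => //; rewrite asboolT// => b bi.
  have close k : (1 <= k <= N)%N -> `|b k - c k x| <= 2 * e.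
    move=> kN; have h1 : `|b k - rho i k| < n.+1%:R^-1 := bi k kN.
    have h2 := iE k kN; rewrite distrC in h2.
    rewrite (le_trans (ler_distD (rho i k) _ _))// mulr_natl mulr2n.
    by apply: lerD; apply: ltW; [exact: lt_trans h1 ne|exact: lt_trans h2 ne].
  have := lip b (fun k => c k x).
  have sle : \sum_(1 <= k < N.+1) `|b k - c k x| <= N%:R * (2 * e).
    apply: (@le_trans _ _ (\sum_(1 <= k < N.+1) 2 * e)).
      by apply: ler_sum_nat => k; rewrite ltnS; exact: close.
    by rewrite big_const_nat iter_addr addr0 subn1 /= (mulr_natl (2 * e) N).
  have h3 := ler_wpM2l L0 sle.
  have h4 : a - G (fun k => c k x) = e * (2 * (1 + L * N%:R)) by rewrite /e divfK// gt_eqF.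
  move=> /le_trans/(_ h3); rewrite ler_distl => /andP[_ h5].
  by rewrite (le_lt_trans h5)// -ltrBrDl h4 -subr_gt0 (_ : _ - _ = 2 * e); [rewrite mulr_gt0|ring].
apply: countable_bigcupT_measurable; first exact: countableP.
by move=> i; case: asboolP.
Qed.

Lemma Rintegral_sum_nat {R : realType} d (T : measurableType d) (m : {measure set T -> \bar R})
    (D : set T) (g : nat -> T -> R) (a : nat -> R) (N : nat) : measurable D ->
  (forall k, (1 <= k <= N)%N -> m.-integrable D (EFin \o g k)) ->
  \int[m]_(r in D) (\sum_(1 <= k < N.+1) g k r * a k) =
  \sum_(1 <= k < N.+1) (\int[m]_(r in D) g k r) * a k.
Proof.
move=> mD gi.
have gai k : (1 <= k <= N)%N -> m.-integrable D (EFin \o (fun r => g k r * a k)).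
  move=> kN; rewrite (_ : EFin \o _ = (fun r => (a k)%:E * (EFin \o g k) r)%E); last first.
    by apply/funext => r /=; rewrite mulrC EFinM.
  by apply: integrableZl => //; exact: gi.
suff h n : (n <= N)%N ->
    m.-integrable D (EFin \o (fun r => \sum_(1 <= k < n.+1) g k r * a k)) /\
    \int[m]_(r in D) (\sum_(1 <= k < n.+1) g k r * a k) =
    \sum_(1 <= k < n.+1) (\int[m]_(r in D) g k r) * a k by have [] := h N (leqnn N).
elim: n => [_|n IH nN].
  rewrite big_nil; split.
    rewrite (_ : EFin \o _ = cst 0%E); first exact: integrable0.
    by apply/funext => r /=; rewrite big_nil.
  by under eq_Rintegral do rewrite big_nil; rewrite Rintegral_cst// mul0r.
have [i1 e1] := IH (ltnW nN).
have i2 : m.-integrable D (EFin \o (fun r => g n.+1 r * a n.+1)) by apply: gai; rewrite nN.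
have E r : \sum_(1 <= k < n.+2) g k r * a k =
    (\sum_(1 <= k < n.+1) g k r * a k) + g n.+1 r * a n.+1 by rewrite big_nat_recr.
split.
  rewrite (_ : EFin \o _ = ((EFin \o (fun r => \sum_(1 <= k < n.+1) g k r * a k)%R)
     \+ (EFin \o (fun r => g n.+1 r * a n.+1)%R))%E); first exact: integrableD.
  by apply/funext => r /=; rewrite E EFinD.
under eq_Rintegral do rewrite E.
rewrite RintegralD// e1 [RHS]big_nat_recr//=; congr (_ + _).
by rewrite RintegralZr//; apply: gi; rewrite nN.
Qed.

Section coefficient_equations.
Context {R : realType} {d : measure_display} {Omega : measurableType d}.
Variables (P : probability Omega R) (alpha s T : R) (W : R -> R -> {RV P >-> R}).
Variables (lambda : nat -> R) (phi : nat -> R -> R) (N : nat).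
Hypothesis a0 : 0 < alpha.
Hypothesis a1 : alpha < 1.
Hypothesis es : dirichlet_eigensystem lambda phi.
Variables (f : (R -> R) -> (R -> R)) (Cf : R).
Hypothesis Cf0 : 0 < Cf.
Hypothesis hf : growth_lipschitz Cf f.
Notation mu := (@lebesgue_measure R).
Notation drift := (drift phi N f).

Definition modek (k : nat) : R -> R := mlk alpha (lambda k `^ s).
Notation v := modek.

Lemma measurable_modek k : measurable_fun setT (v k).
Proof. exact: measurable_mlk. Qed.

Lemma modek01 k x : 0 <= v k x <= 1.
Proof. by apply: mlk01 => //; exact: powR_ge0. Qed.

Lemma modek_nincr k x y : 0 <= x -> x <= y -> v k y <= v k x.
Proof. by move=> x0 xy; apply: mlk_nincr => //; exact: powR_ge0. Qed.

Let sphi k : (1 <= k)%N -> sqint (phi k). Proof. exact: (sqint_eigenfunction es). Qed.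
Let ortho := eigenfunction_orthonormal es.

Lemma integrable_modekM (D : set R) t k (g : R -> R) : measurable (D : set (measurableTypeR R)) ->
  mu.-integrable D (EFin \o g) -> mu.-integrable D (EFin \o (fun r => v k (t - r) * g r)).
Proof.
move=> mD gi; apply: (le_integrable mD _ _ gi).
  apply/measurable_EFinP; apply: measurable_funM.
    apply: measurable_funTS; apply: (measurableT_comp (measurable_modek k) (g := fun r : R => t - r)).
    exact: measurable_funB.
  by have /integrableP[/measurable_EFinP] := gi.
move=> r _; rewrite /= lee_fin normrM.
have /andP[v0 v1] := modek01 k (t - r); rewrite (ger0_norm v0).
by rewrite -[leRHS]mul1r ler_wpM2r.
Qed.

Let S_RNE (g : R -> R) t x :
  S_RN alpha s lambda phi N t (P_N phi N g) x =
  \sum_(1 <= k < N.+1) v k t * innerD g (phi k) * phi k x.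
Proof.
rewrite /S_RN; apply: eq_big_nat => k kN.
have -> // : innerD (P_N phi N g) (phi k) = innerD g (phi k).
exact: (innerD_comb_phi sphi ortho (fun k => innerD g (phi k))).
Qed.

Let G_RSE t x y : G_RS alpha s lambda phi N t x y = comb phi N (fun k => v k t * phi k x) y.
Proof. by []. Qed.

Let S_RN_integral (D : set R) t x (c : nat -> R -> R) (g : R -> R -> R) :
  measurable (D : set (measurableTypeR R)) ->
  (forall r, D r -> g r = comb phi N (fun k => c k r)) ->
  (forall k, (1 <= k <= N)%N -> mu.-integrable D (EFin \o (fun r => drift (fun j => c j r) k))) ->
  \int[mu]_(r in D) S_RN alpha s lambda phi N (t - r) (P_N phi N (f (g r))) x =
  comb phi N (fun k => \int[mu]_(r in D) (v k (t - r) * drift (fun j => c j r) k)) x.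
Proof.
move=> mD gE di.
rewrite /comb -(Rintegral_sum_nat (m := mu) (fun k => phi k x) mD); last first.
  by move=> k kN; apply: integrable_modekM => //; exact: di.
by apply: eq_Rintegral => r; rewrite inE => rD; rewrite S_RNE gE.
Qed.

Lemma integrable_drift (D : set R) (c : nat -> R -> R) k :
  measurable (D : set (measurableTypeR R)) -> (mu D < +oo)%E ->
  (forall j, measurable_fun setT (c j)) -> (1 <= k <= N)%N ->
  (forall j, (1 <= j <= N)%N -> mu.-integrable D (EFin \o c j)) ->
  mu.-integrable D (EFin \o (fun r => drift (fun j => c j r) k)).
Proof.
move=> mD Dfin mc kN ci.
have md : measurable_fun setT (fun r => drift (fun j => c j r) k).
  apply: (measurable_lipschitz_comp (G := fun a => drift a k) (ltW Cf0)) => // a b.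
  exact: (drift_lipschitz1 es Cf0 hf).
pose b r := `|drift (fun=> 0) k| + Cf * \sum_(1 <= j < N.+1) `|c j r|.
have bi : mu.-integrable D (EFin \o b).
  rewrite (_ : EFin \o b = ((EFin \o cst (`|drift (fun=> 0%R) k|%R)) \+
      (fun r => Cf%:E * \sum_(1 <= j < N.+1) (`|c j r|)%:E))%E); last first.
    by apply/funext => r /=; rewrite /b EFinD EFinM sumEFin.
  apply: integrableD => //.
    apply: measurable_bounded_integrable => //.
    by exists `|drift (fun=> 0) k|; split; [rewrite num_real|move=> x cx r _ /=; rewrite normr_id; exact: ltW].
  apply: integrableZl => //.
  rewrite (_ : (fun r => _) = (fun r => \sum_(j <- index_iota 1 N.+1 | (1 <= j <= N)%N) (`|c j r|)%:E)%E); last first.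
    by apply/funext => r; rewrite big_nat_cond; rewrite [RHS]big_seq_cond; apply: eq_bigl => j; rewrite mem_index_iota ltnS andbT andbb.
  apply: integrable_sum => // j jN.
  by have /= := integrable_abse (ci j jN).
apply: (le_integrable mD _ _ bi); first exact/measurable_EFinP/measurable_funTS.
move=> r _; rewrite /= lee_fin.
have b0 : 0 <= b r by apply: addr_ge0 => //; apply: mulr_ge0; [exact: ltW|exact: sumr_ge0].
rewrite (ger0_norm b0) -lerBlDl (le_trans (lerB_dist _ _))//.
apply: (le_trans (drift_lipschitz1 es Cf0 hf _ _ kN)); apply: ler_wpM2l; first exact: ltW.
by rewrite le_eqVlt; apply/orP; left; apply/eqP; apply: eq_bigr => j _; rewrite subr0.
Qed.

(** The evaluation functionals are applied to the mild equation at finitely many points; the kernel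
    [G_RS] is a combination of eigenfunctions in x, so they isolate its k-th mode in the drift and
    in the noise alike. *)
Lemma semidiscrete_coefficients u : semidiscrete_solution P alpha s T lambda phi f W N u ->
  exists c : nat -> measurableTypeR R * Omega -> R,
  [/\ forall k, measurable_fun setT (c k),
      forall t w, 0 <= t <= T -> u t w = comb phi N (fun k => c k (t, w)),
      {ae P, forall w, forall k, (1 <= k <= N)%N ->
         mu.-integrable `[0, T] (EFin \o (fun r => c k (r, w)))},
      {ae P, forall w, forall k, (1 <= k <= N)%N -> c k (0, w) = 0} &
      forall t, 0 <= t <= T -> exists X : nat -> Omega -> R,
        (forall k, (1 <= k <= N)%N -> wint T W (fun y r => hist (v k) t r * phi k y) (X k)) /\
        {ae P, forall w, forall k, (1 <= k <= N)%N ->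
           c k (t, w) = \int[mu]_(r in `[0, t]) (v k (t - r) * drift (fun j => c j (r, w)) k)
             + X k w}].
Proof.
move=> [[c0 [mc0 uE0]] uint u0 mild].
(* Cutting to 0 outside [0, T] makes the coefficients jointly measurable on the whole product. *)
pose c k := (c0 k) \_ (`[0, T] `*` setT).
have mD : measurable ((`[0, T]%classic `*` setT) : set (measurableTypeR R * Omega)).
  by apply: measurableX => //; exact: measurable_itv.
have mc k : measurable_fun setT (c k) by apply/(measurable_restrictT _ _).1.
have uE t w : 0 <= t <= T -> u t w = comb phi N (fun k => c k (t, w)).
  move=> tT; apply/funext => x; rewrite uE0//; apply: eq_bigr => k _.
  by rewrite /c patchE mem_set//=; split => //=; rewrite in_itv.
have msec k w : measurable_fun setT (fun r => c k (r, w)) by exact: (measurable_fun_pair1 w (mc k)).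
have cint : {ae P, forall w, forall k, (1 <= k <= N)%N ->
    mu.-integrable `[0, T] (EFin \o (fun r => c k (r, w)))}.
  apply: filterS uint => w uw k kN; apply/integrableP; split.
    by apply/measurable_EFinP; apply: measurable_funTS; exact: msec.
  apply: le_lt_trans uw; apply: ge0_integral_mono => r; first by rewrite abse_ge0.
  rewrite /= in_itv /= => rT; rewrite uE//.
  have n0 : (0 <= normD (comb phi N (fun k => c k (r, w))))%E by exact: Lnorm_ge0.
  have := normD_comb N sphi ortho (fun k => c k (r, w)); rewrite expe2.
  case: (normD _) n0 => [x x0|_|//]; last by rewrite leey.
  rewrite -EFinM => -[x2]; rewrite lee_fin -(@ler_pXn2r _ 2)// real_normK ?num_real//.
  by rewrite [x ^+ 2]expr2 x2; exact: (sqr_le_sum2 (fun k => c k (r, w)) kN).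
exists c; split => //.
  apply: filterS u0 => w u0 k kN.
  have [T0|T0] := boolP (0 <= T).
    have zT : 0 <= (0 : R) <= T by rewrite lexx.
    apply: (comb_eq0 es (c := fun k => c k (0, w)) _ kN) => x _.
    by rewrite -(uE _ w zT) u0.
  by rewrite /c patchE ifF//; apply: memNset => -[/=]; rewrite in_itv /= lexx (negbTE T0).
move=> t tT; have /andP[t0 tT'] := tT.
have [m [x [B [xD cB]]]] := coefficient_functionals es N.
have /choice[Z ZP] : forall j : 'I_m, exists Z : {RV P >-> R}, _ := fun j => mild t (x j) tT (xD j).
(* The k-th noise coefficient is the combination of Wiener integrals whose integrand is [hist] times
   phi_k, by linearity. *)
exists (fun k w => \sum_(j < m) B k j * Z j w); split.
  move=> k kN.
  have := wint_sum (W := W) (T := T) (index_enum 'I_m) (B k) (fun j => wint_of_wiener_integral (ZP j).1).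
  congr (wint T W _ _); apply/funext => y; apply/funext => r.
  have kE : hist (v k) t r * phi k y = \sum_(j < m) B k j * comb phi N (fun l => hist (v l) t r * phi l y) (x j).
    exact: (cB (fun l => hist (v l) t r * phi l y) k kN).
  rewrite kE; apply: eq_bigr => j _; congr (_ * _).
  have [yD|yD] := boolP (0 < y < 1); last first.
    rewrite /comb big_seq big1// => l; rewrite mem_index_iota => /andP[l1 _].
    rewrite (eigenfunction_out es l1) ?mulr0 ?mul0r//.
    by rewrite /D /= in_itv /=; exact/negP.
  have [/andP[r0 rt]|rn] := boolP (0 <= r <= t); last first.
    rewrite indicE mem_setE in_itv /= (negbTE rn) mul0r if_same.
    by rewrite /comb big1// => l _; rewrite /hist (negbTE rn) !mul0r.
  rewrite r0 (le_trans rt tT') /= indicE mem_setE in_itv /= r0 rt mul1r.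
  by apply: eq_bigr => l _; rewrite /hist r0 rt /=; rewrite mulrAC.
have allj : {ae P, forall w, forall j : 'I_m, u t w (x j) =
    \int[mu]_(r in `[0, t]) S_RN alpha s lambda phi N (t - r) (P_N phi N (f (u r w))) (x j) + Z j w}.
  by apply: filter_forall => j; exact: (ZP j).2.
apply: filterS2 allj cint => w wj wint k kN.
have sub : `[0, t]%classic `<=` `[0, T]%classic.
  by move=> r /=; rewrite !in_itv /= => /andP[-> /le_trans]; exact.
have m0t : measurable (`[0, t]%classic : set (measurableTypeR R)) by exact: measurable_itv.
have m0T : measurable (`[0, T]%classic : set (measurableTypeR R)) by exact: measurable_itv.
have mu0t : (mu (`[0%R, t]%classic : set (measurableTypeR R)) < +oo)%E.
  by rewrite lebesgue_measure_itv /=; case: ifP => _; rewrite -?EFinD ?ltry ?lt0y.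
have di l : (1 <= l <= N)%N ->
    mu.-integrable `[0, t] (EFin \o (fun r => drift (fun j => c j (r, w)) l)).
  move=> lN; apply: (integrable_drift m0t mu0t (c := fun j r => c j (r, w))) => // j jN.
  by apply: integrableS (wint j jN).
rewrite [LHS](cB (fun k => c k (t, w)) k kN).
rewrite [X in X + _](cB (fun k => \int[mu]_(r in `[0, t]) (v k (t - r) * drift (fun j => c j (r, w)) k)) k kN).
rewrite -big_split; apply: eq_bigr => j _ /=; rewrite -mulrDr; congr (_ * _).
rewrite -(uE _ _ tT) wj; congr (_ + _).
apply: (@S_RN_integral _ t (x j) (fun j r => c j (r, w)) (fun r => u r w)) => // r /=; rewrite in_itv /= => /andP[r0 rt].
by apply: uE; rewrite r0 (le_trans rt).
Qed.

(** Here one exceptional event serves all x, so comparing coefficients by [comb_eq0] is enough. *)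
Lemma euler_coefficients M U : 0 < T -> (0 < M)%N ->
  mittag_leffler_euler P alpha s T lambda phi f W N M U ->
  exists dd : nat -> nat -> Omega -> R,
  [/\ forall n k, measurable_fun setT (dd n k),
      forall n w, (n <= M)%N -> U n w = comb phi N (fun k => dd n k w),
      forall w k, (1 <= k <= N)%N -> dd 0%N k w = 0 &
      forall n, (1 <= n <= M)%N -> exists Y : nat -> Omega -> R,
        (forall k, (1 <= k <= N)%N ->
           wint T W (fun y r => mean_hist (v k) (T / M%:R) n r * phi k y) (Y k)) /\
        {ae P, forall w, forall k, (1 <= k <= N)%N ->
           dd n k w = \sum_(1 <= i < n.+1) \int[mu]_(r in cell (T / M%:R) i)
               (v k (grid (T / M%:R) n - r) * drift (fun j => dd i.-1 j w) k)
             + Y k w}].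
Proof.
set tau := T / M%:R => T0 M0 [] + U0 [zeta [zP UE]].
have tau0 : 0 < tau by rewrite divr_gt0// ltr0n.
move=> coef.
have /choice[d0 d0P] : forall n, exists c : nat -> {RV P >-> R}, (n <= M)%N ->
    forall w x, U n w x = \sum_(1 <= k < N.+1) c k w * phi k x.
  move=> n; have [nM|nM] := leqP n M; first by have [c cP] := coef n nM; exists c.
  by have [c _] := coef 0%N (leq0n M); exists c.
have UE' n w : (n <= M)%N -> U n w = comb phi N (fun k => d0 n k w).
  by move=> nM; apply/funext => x; exact: d0P.
exists (fun n k => d0 n k); split => //.
  move=> w k kN; apply: (comb_eq0 es (c := fun k => d0 0%N k w) _ kN) => x _.
  by rewrite -(UE' 0%N w (leq0n M)) U0.
move=> n /andP[n1 nM].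
(* On each cell the noise is constant in time, so the kernel enters only through its cell mean. *)
exists (fun k w => \sum_(1 <= i < n.+1) cell_mean (v k) tau n i * zeta i k w); split.
  move=> k kN.
  have zw i : wint T W (fun y r => if (1 <= i <= n)%N then
      (if (0 < y < 1) && (0 <= r <= T) then \1_(cell tau i) r * phi k y else 0) else 0)
      (fun w => if (1 <= i <= n)%N then zeta i k w else 0).
    case: (boolP (1 <= i <= n)%N) => iN; last exact: wint0.
    apply: wint_of_wiener_integral; apply: zP => //.
    by case/andP: iN => -> /leq_trans; exact.
  have := wint_sum (index_iota 1 n.+1) (cell_mean (v k) tau n) zw.
  rewrite (_ : (fun w => _) = (fun w => \sum_(1 <= i < n.+1) cell_mean (v k) tau n i * zeta i k w)); last first.
    by apply/funext => w; apply: eq_big_nat => i; rewrite ltnS => ->.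
  congr (wint T W _ _); apply/funext => y; apply/funext => r.
  rewrite /mean_hist big_distrl /=; apply: eq_big_nat => i; rewrite ltnS => iN; rewrite iN.
  rewrite -mulrA; congr (_ * _).
  have [yD|yD] := boolP (0 < y < 1); last first.
    rewrite (eigenfunction_out es) ?mulr0//; first by case/andP: kN.
    by rewrite /D /= in_itv /=; exact/negP.
  rewrite /=; case: ifP => // /negbT rT; rewrite indicE in_cell.
  case: (boolP (_ < r <= _)) => [/andP[r1 r2]|_]; last by rewrite mul0r.
  exfalso; move/negP: rT; apply; apply/andP; split.
    by apply: ltW; apply: le_lt_trans r1; rewrite mulr_ge0// ltW.
  have -> : T = M%:R * tau by rewrite /tau mulrCA mulfV ?mulr1// pnatr_eq0 -lt0n.
  apply: (le_trans r2); rewrite ler_pM2r// ler_nat; case/andP: iN => _ /leq_trans; exact.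
have n1M : (1 <= n <= M)%N by rewrite n1.
apply: filterS (UE n n1M) => w wE k kN.
pose e k := \sum_(1 <= i < n.+1) (\int[mu]_(r in cell tau i)
    (v k (grid tau n - r) * drift (fun j => d0 i.-1 j w) k))
  + \sum_(1 <= i < n.+1) cell_mean (v k) tau n i * zeta i k w.
rewrite -/(e k); apply/eqP; rewrite -subr_eq0; apply/eqP.
apply: (comb_eq0 es (c := fun k => d0 n k w - e k) _ kN) => x xD.
rewrite (_ : comb phi N _ x = comb phi N (fun k => d0 n k w) x - comb phi N e x); last first.
  by rewrite /comb -sumrB; apply: eq_bigr => l _; rewrite mulrBl.
rewrite -UE'// wE//; apply/eqP; rewrite subr_eq0; apply/eqP.
have mcell i : measurable (cell tau i : set (measurableTypeR R)) by exact: measurable_cell.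
have mucell i : (mu (cell tau i) < +oo)%E.
  by rewrite /cell lebesgue_measure_itv /=; case: ifP => _; rewrite -?EFinB ?ltry ?lt0y.
have ci i c : mu.-integrable (cell tau i) (EFin \o (fun _ : R => c)).
  apply: measurable_bounded_integrable; [exact: mcell|exact: mucell|exact: measurable_cst|].
  by exists `|c|; split; [rewrite num_real|move=> z cz r _ /=; exact: ltW].
have -> : comb phi N e x =
    \sum_(1 <= i < n.+1) comb phi N (fun k => \int[mu]_(r in cell tau i)
      (v k (grid tau n - r) * drift (fun j => d0 i.-1 j w) k)) x +
    \sum_(1 <= i < n.+1) comb phi N (fun k => cell_mean (v k) tau n i * zeta i k w) x.
  rewrite /comb -big_split /= [RHS](eq_bigr (fun i => \sum_(1 <= l < N.+1)
    ((\int[mu]_(r in cell tau i) (v l (grid tau n - r) * drift (fun j => d0 i.-1 j w) l)) * phi l x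
     + cell_mean (v l) tau n i * zeta i l w * phi l x))); last by move=> i _; rewrite big_split.
  rewrite exchange_big /=; apply: eq_bigr => l _.
  by rewrite /e mulrDl !big_distrl -big_split.
congr (_ + _); apply: eq_big_nat => i; rewrite ltnS => /andP[i1 il].
  apply: (@S_RN_integral _ (grid tau n) x (fun j _ => d0 i.-1 j w) (fun _ => U i.-1 w)) => //.
  by move=> r _; apply: UE'; rewrite (leq_trans _ nM)// (leq_trans (leq_pred _)).
have iM : (i <= M)%N by exact: leq_trans nM.
transitivity (\int[mu]_(r in cell tau i) \sum_(1 <= l < N.+1)
    v l (grid tau n - r) * (tau^-1 * zeta i l w * phi l x)).
  apply: eq_Rintegral => r rc.
  rewrite (_ : \int[lebD R]_y _ = innerD (comb phi N (fun l => v l (grid tau n - r) * phi l x))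
      (comb phi N (fun l => tau^-1 * zeta i l w))); last first.
    apply: eq_Rintegral => y _; rewrite G_RSE; congr (_ * _).
    rewrite /xi_R -(sum_cell (n := M) (fun i => comb phi N (fun l => tau^-1 * zeta i l w) y) tau0 i1 iM rc).
    by apply: eq_bigr => j _; rewrite /comb big_distrl.
  rewrite innerD_comb//; last exact: sqint_comb.
  apply: eq_big_nat => l; rewrite ltnS => lN; rewrite innerDC (innerD_comb_phi sphi ortho _ lN); ring.
rewrite (Rintegral_sum_nat (m := mu)); [|exact: mcell|].
  by apply: eq_bigr => l _; rewrite /cell_mean; ring.
move=> l lN; have := integrable_modekM (grid tau n) l (mcell i) (ci i 1).
by congr (_.-integrable _ _); apply/funext => r /=; rewrite mulr1.
Qed.

End coefficient_equations.

(** * Cauchy-Schwarz in coordinates and Gronwall inequalities *)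

Section integral_inequalities.
Context {R : realType}.
Notation mu := (@lebesgue_measure R).

Lemma sqr_Rintegral_le d (T : measurableType d) (m : {measure set T -> \bar R})
    (D : set T) (b g : T -> R) (M : R) : measurable D -> 0 < M ->
  measurable_fun D b -> measurable_fun D g ->
  (\int[m]_(r in D) ((b r) ^+ 2)%:E <= M%:E)%E ->
  (((\int[m]_(r in D) (b r * g r)) ^+ 2)%:E <=
   M%:E * \int[m]_(r in D) ((g r) ^+ 2)%:E)%E.
Proof.
move=> mD M0 mb mg bM.
have I0 : (0 <= \int[m]_(r in D) ((g r) ^+ 2)%:E)%E.
  by apply: integral_ge0 => r _; rewrite lee_fin sqr_ge0.
case EB : (\int[m]_(r in D) ((g r) ^+ 2)%:E)%E I0 => [B| |//] I0; last first.
  by rewrite gt0_muley ?lte_fin// leey.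
rewrite lee_fin in I0.
have gB : (\int[m]_(r in D) ((g r) ^+ 2)%:E <= B%:E)%E by rewrite EB.
by have [_ h] := cauchy_schwarz mD mb mg (ltW M0) I0 bM gB; rewrite -EFinM lee_fin.
Qed.

Lemma sum_sqr_Rintegral_le d (T : measurableType d) (m : {measure set T -> \bar R})
    (D : set T) (N : nat) (b g : nat -> T -> R) (M : R) : measurable D -> 0 < M ->
  (forall k, measurable_fun D (b k)) -> (forall k, measurable_fun D (g k)) ->
  (forall k, (1 <= k <= N)%N -> (\int[m]_(r in D) ((b k r) ^+ 2)%:E <= M%:E)%E) ->
  ((\sum_(1 <= k < N.+1) (\int[m]_(r in D) (b k r * g k r)) ^+ 2)%:E <=
   M%:E * \int[m]_(r in D) (\sum_(1 <= k < N.+1) (g k r) ^+ 2)%:E)%E.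
Proof.
move=> mD M0 mb mg bM.
have mg2 k : measurable_fun D (fun r => ((g k r) ^+ 2)%:E).
  by apply/measurable_EFinP; apply: measurable_funX.
have -> : (\int[m]_(r in D) (\sum_(1 <= k < N.+1) (g k r) ^+ 2)%:E =
    \sum_(1 <= k < N.+1) \int[m]_(r in D) ((g k r) ^+ 2)%:E)%E.
  rewrite -ge0_integral_sum//; last by move=> k r _; rewrite lee_fin sqr_ge0.
  by apply: eq_integral => r _; rewrite sumEFin.
rewrite -sumEFin ge0_sume_distrr; last first.
  by move=> k _; apply: integral_ge0 => r _; rewrite lee_fin sqr_ge0.
rewrite big_seq [leRHS]big_seq; apply: lee_sum => k; rewrite mem_index_iota ltnS => kN.
by apply: sqr_Rintegral_le => //; exact: bM.
Qed.

Lemma tonelli_restr d1 d2 (T1 : measurableType d1) (T2 : measurableType d2)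
    (m1 : {sigma_finite_measure set T1 -> \bar R})
    (m2 : {sigma_finite_measure set T2 -> \bar R}) (A1 : set T1) (A2 : set T2)
    (g : T1 -> T2 -> \bar R) : measurable A1 -> measurable A2 ->
  measurable_fun setT (fun z : T1 * T2 => g z.1 z.2) ->
  (forall x y, 0 <= g x y)%E ->
  (\int[m1]_(x in A1) \int[m2]_(y in A2) g x y =
   \int[m2]_(y in A2) \int[m1]_(x in A1) g x y)%E.
Proof.
move=> mA1 mA2 mg g0.
pose h x y := ((fun z : T1 * T2 => g z.1 z.2) \_ (A1 `*` A2)) (x, y).
have hE x y : h x y = if (x \in A1) && (y \in A2) then g x y else 0%E.
  rewrite /h patchE; congr (if _ then _ else _).
  by apply/idP/andP => [|[]]; rewrite !inE.
have mh : measurable_fun setT (fun z : T1 * T2 => h z.1 z.2).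
  rewrite (_ : (fun z => _) = (fun z : T1 * T2 => g z.1 z.2) \_ (A1 `*` A2)).
    apply/(measurable_restrictT _ _).1; first exact: measurableX.
    exact: measurable_funTS.
  by apply/funext => -[].
have h0 x y : (0 <= h x y)%E by rewrite hE; case: ifP.
transitivity (\int[m1]_x \int[m2]_y h x y)%E.
  rewrite [LHS]integral_mkcond; apply: eq_integral => x _; rewrite patchE.
  case: ifPn => xA; last by rewrite integral0_eq// => y _; rewrite hE (negbTE xA).
  rewrite [LHS]integral_mkcond; apply: eq_integral => y _.
  by rewrite patchE hE xA.
rewrite tonelli//; apply/esym.
rewrite [LHS]integral_mkcond; apply: eq_integral => y _; rewrite patchE.
case: ifPn => yA; last by rewrite integral0_eq// => x _; rewrite hE (negbTE yA) andbF.
rewrite [LHS]integral_mkcond; apply: eq_integral => x _.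
by rewrite patchE hE yA andbT.
Qed.

Lemma integral_expR_le (k t : R) : 0 < k -> 0 <= t ->
  (\int[mu]_(r in `[0%R, t]) (expR (k * r))%:E <= (expR (k * t) / k)%:E)%E.
Proof.
move=> k0; rewrite le_eqVlt => /predU1P[<-|t0].
  by rewrite set_itv1 integral_set1 lee_fin divr_ge0 ?expR_ge0// ltW.
pose G (x : R) := expR (k * x) / k.
have dG (x : R) : is_derive x 1 G (expR (k * x)).
  have kn : k != 0 by rewrite gt_eqF.
  apply: is_derive_eq; rewrite /GRing.scale /=; by field.
have cG : continuous G.
  move=> x; apply: differentiable_continuous; apply/derivable1_diffP.
  by have [] := dG x.
have cE : continuous (fun x : R => expR (k * x)).
  move=> x; apply: (@continuous_comp _ _ _ (fun x : R => k * x) (@expR R)).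
    by apply: cvgM; [exact: cvg_cst|exact: cvg_id].
  exact: continuous_expR.
rewrite (@continuous_FTC2 _ _ G)//.
- by rewrite -EFinD lee_fin gerDl oppr_le0 divr_ge0 ?expR_ge0// ltW.
- by apply: continuous_subspaceT.
- split.
  + by move=> x _; have [] := dG x.
  + by apply: cvg_at_right_filter; exact: cG.
  + by apply: cvg_at_left_filter; exact: cG.
- by move=> x _; have dx := dG x; rewrite derive1E derive_val.
Qed.

(* Iterating the inequality on the class of functions dominated by
   m exp(2bt) contracts m towards 2a. *)
Lemma gronwall (y : R -> \bar R) (a b B T : R) : 0 <= a -> 0 < b -> 0 <= B ->
  (forall t, 0 <= t <= T -> (0 <= y t)%E) ->
  (forall t, 0 <= t <= T -> (y t <= B%:E)%E) ->
  (forall t, 0 <= t <= T -> (y t <= a%:E + b%:E * \int[mu]_(r in `[0%R, t]) y r)%E) ->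
  forall t, 0 <= t <= T -> (y t <= (2 * a * expR (2 * b * T))%:E)%E.
Proof.
move=> a0 b0 B0 y0 yB yint.
have k0 : 0 < 2 * b by rewrite mulr_gt0.
have step m : 0 <= m -> (forall t, 0 <= t <= T -> (y t <= (m * expR (2 * b * t))%:E)%E) ->
    forall t, 0 <= t <= T -> (y t <= ((a + m / 2) * expR (2 * b * t))%:E)%E.
  move=> m0 ym t tT; have /andP[t0 tT'] := tT.
  apply: (le_trans (yint t tT)).
  have I : (\int[mu]_(r in `[0%R, t]) y r <= m%:E * (expR (2 * b * t) / (2 * b))%:E)%E.
    apply: (@le_trans _ _ (\int[mu]_(r in `[0%R, t]) (m * expR (2 * b * r))%:E)%E).
      apply: ge0_integral_mono => r; rewrite /= in_itv /= => /andP[r0 rt].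
        by apply: y0; rewrite r0 (le_trans rt).
      by apply: ym; rewrite r0 (le_trans rt).
    under eq_integral do rewrite EFinM.
    rewrite ge0_integralZl_EFin; [|exact: measurable_itv|by move=> r _; rewrite lee_fin expR_ge0
      |by apply/measurable_EFinP; apply: measurable_funTS; apply: (measurableT_comp (@measurable_expR R)); exact: measurable_funM|exact: m0].
    by apply: lee_wpmul2l; [rewrite lee_fin|exact: integral_expR_le].
  have bE : (0 <= b%:E)%E by rewrite lee_fin ltW.
  apply: (le_trans (leeD (lexx _) (lee_wpmul2l bE I))).
  rewrite -!EFinM -EFinD lee_fin [leRHS](mulrDl a (m / 2)); apply: lerD.
    rewrite -[leLHS]mulr1 ler_wpM2l// -[leLHS]expR0 ler_expR.
    by rewrite mulr_ge0// ltW.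
  have bn : b != 0 by rewrite gt_eqF.
  by rewrite le_eqVlt; apply/orP; left; apply/eqP; field.
have iter_ n : forall t, 0 <= t <= T ->
    (y t <= ((2 * a + B / 2 ^+ n) * expR (2 * b * t))%:E)%E.
  elim: n => [|n IH] t tT.
    apply: (le_trans (yB t tT)); rewrite lee_fin expr0 divr1 -[leLHS]mulr1.
    have /andP[t0 _] := tT.
    apply: ler_pM => //; first by rewrite lerDr mulr_ge0.
    by rewrite -[leLHS]expR0 ler_expR mulr_ge0// ltW.
  have m0 : 0 <= 2 * a + B / 2 ^+ n by rewrite addr_ge0 ?mulr_ge0// divr_ge0// exprn_ge0.
  have := step _ m0 IH t tT; rewrite (_ : a + _ / 2 = 2 * a + B / 2 ^+ n.+1)//.
  have pn : (2 : R) ^+ n != 0 by rewrite expf_neq0.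
  by rewrite exprS; field.
move=> t tT; have /andP[t0 tT'] := tT.
apply: (@le_trans _ _ (2 * a * expR (2 * b * t))%:E); last first.
  by rewrite lee_fin ler_wpM2l ?mulr_ge0// ler_expR ler_wpM2l// ltW.
apply/lee_addgt0Pr => e e0; set E := expR _.
have E0 : 0 < E by exact: expR_gt0.
pose n := Num.bound (B * E / e).
have hn : B * E / e < 2 ^+ n by apply: upper_nthrootP.
apply: (le_trans (iter_ n t tT)); rewrite -EFinD lee_fin mulrDl lerD2l -/E.
rewrite mulrAC ler_pdivrMr ?exprn_gt0// [leRHS]mulrC -ler_pdivrMr//; exact: ltW.
Qed.

(** The bound a (1 + b)^n turns the recursion into an equality, by the geometric sum [geo]. *)
Lemma discrete_gronwall (y : nat -> \bar R) (a b : R) (M : nat) : 0 <= a -> 0 <= b ->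
  (forall n, 0 <= y n)%E ->
  (forall n, (n <= M)%N -> (y n <= a%:E + b%:E * \sum_(0 <= i < n) y i)%E) ->
  forall n, (n <= M)%N -> (y n <= (a * (1 + b) ^+ n)%:E)%E.
Proof.
move=> a0 b0 y0 yrec.
have geo n : 1 + b * (\sum_(0 <= i < n) (1 + b) ^+ i) = (1 + b) ^+ n.
  elim: n => [|n IH]; first by rewrite big_nil mulr0 addr0.
  by rewrite big_nat_recr//= mulrDr addrA IH exprS mulrDl mul1r.
elim/ltn_ind => n IH nM; apply: (le_trans (yrec n nM)).
have bE : (0 <= b%:E)%E by rewrite lee_fin.
apply: (@le_trans _ _ (a%:E + b%:E * \sum_(0 <= i < n) (a * (1 + b) ^+ i)%:E)%E).
  apply: leeD => //; apply: lee_wpmul2l => //.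
  rewrite big_seq [leRHS]big_seq; apply: lee_sum => i; rewrite mem_index_iota => /andP[_ ni].
  by apply: IH => //; exact: leq_trans (ltnW ni) nM.
rewrite sumEFin -EFinM -EFinD lee_fin -(geo n) mulrDr mulr1 lerD2l.
by rewrite le_eqVlt; apply/orP; left; apply/eqP; rewrite -big_distrr /= mulrCA.
Qed.

End integral_inequalities.

(* Nested constants of the moment bound, the increment bound and the two
   Gronwall arguments. *)
Definition mild_constant {R : realType} (T L A rho : R) : R :=
  let moment := 2 * (1 + 2 * (A * T `^ rho)) * expR (2 * (4 * T * L) * T) in
  let increment := 8 * L * T * moment * T `^ (1 - rho) + 2 * A in
  (4 * T ^+ 2 * L * increment + 2 * A) * expR (4 * T ^+ 2 * L).

(** * Moment, increment and error bounds for mild solutions *)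

Section mild_solutions.
Context {R : realType} {d : measure_display} {Omega : measurableType d}.
Variables (P : probability Omega R) (T : R) (N : nat).
Notation mu := (@lebesgue_measure R).
Notation sum2 c := (\sum_(1 <= k < N.+1) (c k) ^+ 2).
Hypothesis T0 : 0 < T.
Variables (Phi : (nat -> R) -> nat -> R) (L l : R).
Hypothesis L0 : 0 < L.
Hypothesis l0 : 0 <= l.
Hypothesis Phi_lip : forall c c', sum2 (fun k => Phi c k - Phi c' k) <= L * sum2 (fun k => c k - c' k).
Hypothesis Phi_growth : forall c, sum2 (Phi c) <= 2 * L * (1 + sum2 c).
Hypothesis Phi_lip1 : forall c c' k, (1 <= k <= N)%N ->
  `|Phi c k - Phi c' k| <= l * \sum_(1 <= k < N.+1) `|c k - c' k|.
Variable v : nat -> R -> R.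
Hypothesis mv : forall k, measurable_fun setT (v k).
Hypothesis v01 : forall k x, 0 <= x -> 0 <= v k x <= 1.
Hypothesis v_nincr : forall k x y, 0 <= x -> x <= y -> v k y <= v k x.
Variable c : nat -> measurableTypeR R * Omega -> R.
Hypothesis mc : forall k, measurable_fun setT (c k).
Hypothesis cint : {ae P, forall w, forall k, (1 <= k <= N)%N ->
  mu.-integrable `[0, T] (EFin \o (fun r => c k (r, w)))}.
Hypothesis c_init : {ae P, forall w, forall k, (1 <= k <= N)%N -> c k (0, w) = 0}.
Variable X : R -> nat -> Omega -> R.
Hypothesis mX : forall t k, (1 <= k <= N)%N -> 0 <= t <= T -> measurable_fun setT (X t k).
Notation F k r w := (Phi (fun j => c j (r, w)) k).
Hypothesis Fint : {ae P, forall w, forall k, (1 <= k <= N)%N ->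
  mu.-integrable `[0, T] (EFin \o (fun r => F k r w))}.
Hypothesis c_mild : forall t, 0 <= t <= T -> {ae P, forall w, forall k, (1 <= k <= N)%N ->
  c k (t, w) = \int[mu]_(r in `[0, t]) (v k (t - r) * F k r w) + X t k w}.
Variables (A rho : R).
Hypothesis A0 : 0 <= A.
Hypothesis rho0 : 0 < rho.
Hypothesis rho1 : rho <= 1.
Hypothesis noise : forall t' t, 0 <= t' -> t' < t -> t <= T ->
  (\int[P]_w (sum2 (fun k => X t k w - X t' k w))%:E <= (A * (t - t') `^ rho)%:E)%E.

Let S (r : R) (w : Omega) : R := sum2 (fun k => c k (r, w)).

Let S0 r w : 0 <= S r w. Proof. by apply: sumr_ge0 => k _; exact: sqr_ge0. Qed.

Let mtime (t : R) : measurable (`[0, t]%classic : set (measurableTypeR R)).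
Proof. exact: measurable_itv. Qed.

Let mPhi d' (T' : measurableType d') (a : nat -> T' -> R) k : (1 <= k <= N)%N ->
  (forall j, measurable_fun setT (a j)) -> measurable_fun setT (fun x => Phi (fun j => a j x) k).
Proof.
move=> kN ma; apply: (measurable_lipschitz_comp (G := fun b => Phi b k) l0) => // b b'.
exact: Phi_lip1.
Qed.

Let msum2 d' (T' : measurableType d') (a : nat -> T' -> R) :
  (forall j, (1 <= j <= N)%N -> measurable_fun setT (a j)) -> measurable_fun setT (fun x => sum2 (fun k => a k x)).
Proof.
move=> ma; rewrite (_ : (fun x => _) = (fun x => \sum_(k <- index_iota 1 N.+1)
    (if (1 <= k <= N)%N then (a k x) ^+ 2 else 0))).
  apply: measurable_sum => k; case: (boolP (1 <= k <= N)%N) => kN; last exact: measurable_cst.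
  by apply: measurable_funX; exact: ma.
by apply/funext => x; apply: eq_big_nat => k; rewrite ltnS => ->.
Qed.

Let mcs k r : measurable_fun setT (fun w => c k (r, w)).
Proof. exact: (measurable_fun_pair2 r (mc k)). Qed.

Let mct k w : measurable_fun setT (fun r => c k (r, w)).
Proof. exact: (measurable_fun_pair1 w (mc k)). Qed.

Let mS : measurable_fun setT (fun z : measurableTypeR R * Omega => S z.1 z.2).
Proof. by apply: (msum2 (a := fun k z => c k (z.1, z.2))) => j _; rewrite (_ : (fun z => _) = c j)//; apply/funext => -[]. Qed.

Let mSw r : measurable_fun setT (S r).
Proof. by apply: (msum2 (a := fun k w => c k (r, w))) => j _. Qed.

Let mSt w : measurable_fun setT (fun r => S r w).
Proof. by apply: (msum2 (a := fun k r => c k (r, w))) => j _. Qed.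

Let mF k w : (1 <= k <= N)%N -> measurable_fun setT (fun r => F k r w).
Proof. by move=> kN; apply: (mPhi (a := fun j r => c j (r, w))). Qed.

(* The values at indices outside 1..N play no role. *)
Let drift_sqr (D : set (measurableTypeR R)) (b : nat -> R -> R) (M : R) w : measurable D -> 0 < M ->
  (forall k, measurable_fun setT (b k)) ->
  (forall k, (1 <= k <= N)%N -> (\int[mu]_(r in D) ((b k r) ^+ 2)%:E <= M%:E)%E) ->
  ((sum2 (fun k => \int[mu]_(r in D) (b k r * F k r w)))%:E <=
   M%:E * \int[mu]_(r in D) (2 * L * (1 + S r w))%:E)%E.
Proof.
move=> mD M0 mb bM.
pose g k r := if (1 <= k <= N)%N then F k r w else 0.
have mg k : measurable_fun D (g k).
  apply: measurable_funTS; rewrite /g; case: (boolP (1 <= k <= N)%N) => kN; last exact: measurable_cst.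
  exact: mF.
have := sum_sqr_Rintegral_le mD M0 (fun k => measurable_funTS (mb k)) mg bM.
rewrite (_ : \sum_(1 <= k < N.+1) _ = sum2 (fun k => \int[mu]_(r in D) (b k r * F k r w))); last first.
  by apply: eq_big_nat => k; rewrite ltnS => kN; rewrite /g kN.
move=> /le_trans; apply; apply: lee_wpmul2l; first by rewrite lee_fin ltW.
apply: ge0_integral_mono => r _; first by rewrite lee_fin sumr_ge0// => k _; exact: sqr_ge0.
rewrite lee_fin (_ : \sum_(1 <= k < N.+1) _ = sum2 (Phi (fun j => c j (r, w)))); first exact: Phi_growth.
by apply: eq_big_nat => k; rewrite ltnS => kN; rewrite /g kN.
Qed.

Let sum2D (a b e : nat -> R) : (forall k, (1 <= k <= N)%N -> a k = b k + e k) ->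
  sum2 a <= 2 * sum2 b + 2 * sum2 e.
Proof.
move=> abe; rewrite !big_distrr -big_split /= big_nat_cond [leRHS]big_nat_cond.
apply: ler_sum => k; rewrite andbT ltnS => kN; rewrite abe//.
have := sqr_ge0 (b k - e k); rewrite sqrrB sqrrD !mulr2n; move: (b k) (e k) => x y; lra.
Qed.

Let rangeT t : 0 <= t -> t <= T -> 0 <= t <= T. Proof. by move=> -> ->. Qed.

(** The mild equation at time 0 and the zero initial value make the noise vanish there, so its size
    is an increment from time 0. *)
Let noise0 t : 0 <= t <= T ->
  (\int[P]_w (sum2 (fun k => X t k w))%:E <= (A * T `^ rho)%:E)%E.
Proof.
move=> /andP[t0 tT]; have zT := rangeT (lexx 0) (ltW T0); have tT' := rangeT t0 tT.
have X0 : {ae P, forall w, forall k, (1 <= k <= N)%N -> X 0 k w = 0}.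
  apply: filterS2 (c_mild zT) c_init => w h1 h2 k kN.
  have := h1 k kN; rewrite h2// set_itv1 Rintegral_set1 add0r => <-//.
have mXt u : 0 <= u <= T -> measurable_fun setT (fun w => (sum2 (fun k => X u k w))%:E).
  by move=> uT; apply/measurable_EFinP; apply: (msum2 (a := fun k w => X u k w)) => j jN; exact: mX.
have p0 (g : nat -> R) : (0 <= (sum2 g)%:E)%E by rewrite lee_fin sumr_ge0// => k _; exact: sqr_ge0.
move: t0; rewrite le_eqVlt => /predU1P[t0|t0].
  apply: (@le_trans _ _ 0%E); last by rewrite lee_fin mulr_ge0// powR_ge0.
  rewrite -(integral0 P setT); apply: ae_ge0_le_integral => //; first exact: mXt.
  apply: filterS X0 => w w0 _; rewrite -t0 lee_fin big_nat_cond big1// => k; rewrite andbT ltnS => kN.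
  by rewrite w0// expr0n.
apply: (@le_trans _ _ (\int[P]_w (sum2 (fun k => X t k w - X 0 k w))%:E)%E).
  apply: ae_ge0_le_integral => //; first exact: mXt.
    apply/measurable_EFinP; apply: (msum2 (a := fun k w => X t k w - X 0 k w)) => j jN.
    by apply: measurable_funB; exact: mX.
  apply: filterS X0 => w w0 _; rewrite lee_fin le_eqVlt; apply/orP; left; apply/eqP.
  by apply: eq_big_nat => k; rewrite ltnS => kN; rewrite w0// subr0.
apply: (le_trans (noise (lexx 0) t0 tT)); rewrite subr0 lee_fin ler_wpM2l//.
by apply: ge0_ler_powR => //; [exact: ltW|rewrite nnegrE ltW|rewrite nnegrE ltW].
Qed.

Let mode_sqr k t : 0 <= t -> (\int[mu]_(r in `[0%R, t]) ((v k (t - r)) ^+ 2)%:E <= t%:E)%E.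
Proof.
move=> t0; apply: (le_trans _ (integral_hist_sqr (v01 k) t0)).
rewrite [leLHS]integral_mkcond; apply: ge0_integral_mono => r _.
  by rewrite patchE; case: ifP => // _; rewrite lee_fin sqr_ge0.
by rewrite patchE mem_setE in_itv /= /hist; case: ifP => // _; rewrite expr0n.
Qed.

Let mvt k t : measurable_fun setT (fun r : R => v k (t - r)).
Proof. by apply: (measurableT_comp (mv k) (g := fun r : R => t - r)); exact: measurable_funB. Qed.

(** A path is only known to have integrable coefficients, so second moments might be infinite. On
    [Om K] the drift is bounded by a constant, and these events exhaust almost all outcomes. *)
Let Om (K : nat) : set Omega :=
  [set w | (\int[mu]_(r in `[0%R, T]) (\sum_(1 <= j < N.+1) `|c j (r, w)|)%:E <= K%:R%:E)%E].

Let mabs : measurable_fun setT (fun z : measurableTypeR R * Omega => (\sum_(1 <= j < N.+1) `|c j z|)%:E).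
Proof.
apply/measurable_EFinP; apply: measurable_sum => j.
by apply: (measurableT_comp (@normr_measurable _ setT)).
Qed.

Let mpartial (D : set (measurableTypeR R)) (g : measurableTypeR R * Omega -> \bar R) :
  measurable D -> measurable_fun setT g -> (forall z, 0 <= g z)%E ->
  measurable_fun setT (fun w => \int[mu]_(r in D) g (r, w))%E.
Proof.
move=> mD mg g0.
rewrite (_ : (fun w => _) = fun w => (\int[mu]_r (g \_ (D `*` setT)) (r, w))%E); last first.
  apply/funext => w; rewrite integral_mkcond; apply: eq_integral => r _.
  rewrite !patchE; congr (if _ then _ else _).
  by apply/idP/idP; rewrite !inE /=; [move=> h; split|case].
apply: (measurable_fun_fubini_tonelli_G (m1 := mu)).
  apply/(measurable_restrictT _ _).1; first by apply: measurableX.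
  exact: measurable_funTS.
by move=> z; rewrite patchE; case: ifP.
Qed.

Let mOm K : measurable (Om K).
Proof.
have mh : measurable_fun setT (fun w => \int[mu]_(r in `[0%R, T]) (\sum_(1 <= j < N.+1) `|c j (r, w)|)%:E)%E.
  apply: (mpartial (g := fun z => (\sum_(1 <= j < N.+1) `|c j z|)%:E)) => // z.
  by rewrite lee_fin sumr_ge0.
by have := emeasurable_fun_infty_c measurableT mh K%:R%:E; rewrite setTI.
Qed.

Let Om_mono : nondecreasing_seq Om.
Proof.
move=> m n mn; apply/subsetPset => w; rewrite /Om /= => /le_trans; apply.
by rewrite lee_fin ler_nat.
Qed.

Let Om_full : {ae P, forall w, (\bigcup_K Om K) w}.
Proof.
apply: filterS cint => w wi.
have fin_ : (\int[mu]_(r in `[0%R, T]) (\sum_(1 <= j < N.+1) `|c j (r, w)|)%:E < +oo)%E.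
  have : mu.-integrable `[0%R, T] (fun r => (\sum_(j <- index_iota 1 N.+1 | (1 <= j <= N)%N) (`|c j (r, w)|)%:E)%E).
    by apply: integrable_sum => // j jN; have /= := integrable_abse (wi j jN).
  move=> /integrableP[_]; apply: le_lt_trans; apply: ge0_integral_mono => r _.
    by rewrite lee_fin sumr_ge0.
  rewrite -sumEFin big_seq_cond [X in (_ <= `|X|)%E]big_seq_cond.
  rewrite (eq_bigl (fun j => (j \in index_iota 1 N.+1) && (1 <= j <= N)%N)); last first.
    by move=> j; rewrite mem_index_iota ltnS andbT andbb.
  by rewrite lee_abs.
set I := (\int[mu]_(r in _) _)%E in fin_.
have I0 : (0 <= I)%E by apply: integral_ge0 => r _; rewrite lee_fin sumr_ge0.
have If : I \is a fin_num by rewrite ge0_fin_numE.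
exists (Num.bound (fine I)) => //; rewrite /Om /= -/I -(fineK If) lee_fin.
by apply: ltW; apply: archi_boundP; exact: fine_ge0.
Qed.

Let L_ge0 : 0 <= L. Proof. exact: ltW. Qed.
Let T_ge0 : 0 <= T. Proof. exact: ltW. Qed.
Let b0 : R := 4 * T * L.
Let a1 : R := 1 + 2 * (A * T `^ rho).

Let abs_fine_le (x : \bar R) : ((`|fine x|)%:E <= `|x|)%E.
Proof. by case: x => [x||] //=; rewrite ?normr0 leey. Qed.

Let XS t w : \bar R := (sum2 (fun k => X t k w))%:E.

Let XS0 t w : (0 <= XS t w)%E.
Proof. by rewrite lee_fin sumr_ge0// => k _; exact: sqr_ge0. Qed.

Let mXS t : 0 <= t <= T -> measurable_fun setT (XS t).
Proof.
by move=> tT; apply/measurable_EFinP; apply: (msum2 (a := fun k w => X t k w)) => j jN; exact: mX.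
Qed.

Let drift_abs K w t k : 0 <= t <= T -> (1 <= k <= N)%N -> Om K w ->
  `|\int[mu]_(r in `[0, t]) (v k (t - r) * F k r w)| <= `|Phi (fun=> 0) k| * T + l * K%:R.
Proof.
move=> /andP[t0 tT] kN Kw; rewrite -lee_fin.
apply: (le_trans (abs_fine_le _)).
have mvF : measurable_fun (`[0, t]%classic : set (measurableTypeR R)) (EFin \o (fun r => v k (t - r) * F k r w)).
  by apply/measurable_EFinP; apply: measurable_funTS; apply: measurable_funM; [exact: mvt|exact: mF].
apply: (le_trans (le_abse_integral _ (mtime t) mvF)).
pose Z r := \sum_(1 <= j < N.+1) `|c j (r, w)|.
have Z0 r : 0 <= Z r by apply: sumr_ge0.
have mZ : measurable_fun setT (fun r => (Z r)%:E) by exact: (measurable_fun_pair1 w mabs).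
have step : (\int[mu]_(x in `[0%R, t]) `|(EFin \o (fun r => v k (t - r) * F k r w)%R) x| <=
    \int[mu]_(r in `[0%R, T]) ((`|Phi (fun=> 0%R) k|%R)%:E + l%:E * (Z r)%:E))%E.
  rewrite [leLHS]integral_mkcond [leRHS]integral_mkcond; apply: ge0_integral_mono => r _.
    by rewrite patchE; case: ifP => // _; rewrite abse_ge0.
  rewrite !patchE !mem_setE !in_itv /=.
  case: ifPn => [/andP[r0 rt]|_]; last first.
    by case: ifP => // _; rewrite -EFinM -EFinD lee_fin addr_ge0// mulr_ge0.
  rewrite r0 (le_trans rt tT) /= -EFinM -EFinD lee_fin normrM.
  have /andP[v0 v1] : 0 <= v k (t - r) <= 1 by apply: v01; rewrite subr_ge0.
  rewrite (ger0_norm v0); apply: (@le_trans _ _ `|F k r w|).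
    by rewrite -[leRHS]mul1r ler_wpM2r.
  rewrite -lerBlDl (le_trans (lerB_dist _ _))//.
  apply: (le_trans (Phi_lip1 _ _ kN)); rewrite ler_wpM2l//.
  by rewrite /Z le_eqVlt; apply/orP; left; apply/eqP; apply: eq_bigr => j _; rewrite subr0.
apply: (le_trans step).
rewrite ge0_integralD; [|exact: mtime|by move=> r _; rewrite lee_fin|exact: measurable_cst
  |by move=> r _; rewrite -EFinM lee_fin mulr_ge0|by apply: measurable_funeM; exact: measurable_funTS].
rewrite integral_cst; last exact: mtime.
rewrite ge0_integralZl_EFin; [|exact: mtime|by move=> r _; rewrite lee_fin|exact: measurable_funTS|exact: l0].
have muT : (mu (`[0%R, T]%classic : set (measurableTypeR R)) = T%:E)%E.
  by rewrite lebesgue_measure_itv /= lte_fin T0 oppr0 adde0.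
rewrite [X in (_%:E * X + _)%E]muT.
by rewrite -EFinM EFinD leeD2l// EFinM lee_wpmul2l ?lee_fin.
Qed.

(** A finite a priori bound, depending on [K]: it makes [gronwall] applicable and leaves no trace in
    the resulting estimate. *)
Let localized_bound K : exists2 B : R, 0 <= B & forall t, 0 <= t <= T ->
  (\int[P]_(w in Om K) (1 + S t w)%:E <= B%:E)%E.
Proof.
pose q k : R := `|Phi (fun=> 0) k| * T + l * K%:R.
have q2 : 0 <= 1 + 2 * sum2 q by rewrite addr_ge0// mulr_ge0// sumr_ge0// => k _; exact: sqr_ge0.
exists ((1 + 2 * sum2 q) + 2 * (A * T `^ rho)).
  by rewrite addr_ge0 ?mulr_ge0 ?powR_ge0.
move=> t tT; have /andP[t0 tT'] := tT.
pose G w := ((1 + 2 * sum2 q)%:E + 2%:E * XS t w)%E.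
have G0 w : (0 <= G w)%E by apply: adde_ge0; [rewrite lee_fin|apply: mule_ge0].
have mG : measurable_fun setT G by apply: emeasurable_funD => //; apply: measurable_funeM; exact: mXS.
apply: (@le_trans _ _ (\int[P]_w G w)%E).
  rewrite integral_mkcond; apply: ae_ge0_le_integral => //.
  - by move=> w _; rewrite patchE; case: ifP => // _; rewrite lee_fin addr_ge0.
  - apply/(measurable_restrictT _ _).1 => //; apply: measurable_funTS; apply/measurable_EFinP.
    by apply: measurable_funD => //.
  apply: filterS (c_mild tT) => w wm _; rewrite patchE; case: ifPn => // /set_mem Kw.
  rewrite /G -EFinM -EFinD lee_fin -addrA lerD2l.
  apply: (le_trans (sum2D wm)); rewrite lerD2r ler_wpM2l//.
  rewrite big_nat_cond [leRHS]big_nat_cond; apply: ler_sum => k; rewrite andbT ltnS => kN.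
  have q0 : 0 <= q k by rewrite addr_ge0 ?mulr_ge0// ltW.
  rewrite -(real_normK (num_real (\int[mu]_(r in _) _))) ler_pXn2r ?nnegrE//.
  exact: drift_abs.
rewrite /G ge0_integralD; [|exact: measurableT|by move=> w _; rewrite lee_fin|exact: measurable_cst
  |by move=> w _; apply: mule_ge0|by apply: measurable_funeM; exact: mXS].
rewrite integral_cst// [X in (_ * X + _)%E](probability_setT P) mule1.
rewrite ge0_integralZl_EFin; [|exact: measurableT|by move=> w _; exact: XS0|exact: mXS|by []].
rewrite [leRHS]EFinD leeD2l// EFinM; apply: lee_wpmul2l; first by rewrite lee_fin.
exact: noise0.
Qed.

Let s1 (z : measurableTypeR R * Omega) : \bar R := (1 + S z.1 z.2)%:E.
Let s10 z : (0 <= s1 z)%E. Proof. by rewrite lee_fin addr_ge0. Qed.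
Let ms1 : measurable_fun setT s1.
Proof. by apply/measurable_EFinP; apply: measurable_funD. Qed.

Let drift_sqr1 (D : set (measurableTypeR R)) (b : nat -> R -> R) (M : R) w : measurable D -> 0 < M ->
  (forall k, measurable_fun setT (b k)) ->
  (forall k, (1 <= k <= N)%N -> (\int[mu]_(r in D) ((b k r) ^+ 2)%:E <= M%:E)%E) ->
  ((sum2 (fun k => \int[mu]_(r in D) (b k r * F k r w)))%:E <=
   (M * (2 * L))%:E * \int[mu]_(r in D) s1 (r, w))%E.
Proof.
move=> mD M0 mb bM; apply: (le_trans (drift_sqr w mD M0 mb bM)).
have L2 : 0 <= 2 * L by rewrite mulr_ge0// ltW.
under eq_integral do rewrite EFinM.
rewrite ge0_integralZl_EFin; [|exact: mD|by move=> r _; exact: (s10 (r, w))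
  |by apply: measurable_funTS; exact: (measurable_fun_pair1 w ms1)|exact: L2].
by rewrite muleA -EFinM.
Qed.

(** The event does not depend on time, so by Tonelli the localised moments satisfy a closed integral
    inequality, with constants free of [K]. *)
Let local_gronwall K t : 0 <= t <= T ->
  (\int[P]_(w in Om K) (1 + S t w)%:E <= (2 * a1 * expR (2 * b0 * T))%:E)%E.
Proof.
have [B B0 yB] := localized_bound K.
have a10 : 0 <= a1 by rewrite addr_ge0// mulr_ge0// mulr_ge0// powR_ge0.
have b00 : 0 < b0 by rewrite !mulr_gt0.
have b00' : (0 <= b0%:E)%E by rewrite lee_fin ltW.
apply: (gronwall (y := fun t => (\int[P]_(w in Om K) (1 + S t w)%:E)%E) a10 b00 B0) => // {}t.
  by move=> _; apply: integral_ge0 => w _; rewrite lee_fin addr_ge0.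
move=> tT; have /andP[t0 tT'] := tT.
pose J w := (\int[mu]_(r in `[0%R, t]) s1 (r, w))%E.
have J0 w : (0 <= J w)%E by apply: integral_ge0 => r _; exact: s10.
have mJ : measurable_fun setT J by apply: mpartial.
pose H w := (1 + (b0%:E * J w + 2%:E * XS t w))%E.
have H1 w : (0 <= b0%:E * J w + 2%:E * XS t w)%E by apply: adde_ge0; apply: mule_ge0.
have mH1 : measurable_fun setT (fun w => b0%:E * J w + 2%:E * XS t w)%E.
  by apply: emeasurable_funD; apply: measurable_funeM => //; exact: mXS.
apply: (@le_trans _ _ (\int[P]_(w in Om K) H w)%E).
  apply: ae_ge0_le_integral => //.
  - by move=> w _; rewrite lee_fin addr_ge0.
  - by apply: measurable_funTS; apply/measurable_EFinP; apply: measurable_funD.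
  - by move=> w _; apply: adde_ge0.
  - by apply: measurable_funTS; apply: emeasurable_funD.
  apply: filterS (c_mild tT) => w wm _; rewrite /H EFinD leeD2l//.
  have vM k : (1 <= k <= N)%N -> (\int[mu]_(r in `[0%R, t]) ((v k (t - r)) ^+ 2)%:E <= T%:E)%E.
    by move=> _; apply: (le_trans (mode_sqr k t0)); rewrite lee_fin.
  have h := drift_sqr1 w (mtime t) T0 (fun k => mvt k t) vM.
  apply: (@le_trans _ _ (2%:E * (sum2 (fun k => \int[mu]_(r in `[0, t]) (v k (t - r) * F k r w))%R)%:E + 2%:E * XS t w)%E).
    by rewrite -!EFinM -EFinD lee_fin; exact: sum2D.
  rewrite leeD2r//; have two0 : (0 <= 2%:E :> \bar R)%E by rewrite lee_fin.
  apply: (le_trans (lee_wpmul2l two0 h)); rewrite muleA -EFinM.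
  by rewrite (_ : 2 * (T * (2 * L)) = b0)//; rewrite /b0; ring.
rewrite /H ge0_integralD; [|exact: mOm|by []|exact: measurable_cst|by move=> w _|exact: measurable_funTS].
rewrite ge0_integralD; [|exact: mOm|by move=> w _; apply: mule_ge0|by apply: measurable_funTS; exact: measurable_funeM
  |by move=> w _; apply: mule_ge0|by apply: measurable_funTS; apply: measurable_funeM; exact: mXS].
rewrite ge0_integralZl_EFin; [|exact: mOm|by move=> w _|exact: measurable_funTS|exact: ltW].
rewrite ge0_integralZl_EFin; [|exact: mOm|by move=> w _; exact: XS0|by apply: measurable_funTS; exact: mXS|by []].
have e1 : (\int[P]_(w in Om K) 1 <= 1)%E.
  by rewrite integral_cst// mul1e; exact: probability_le1.
have e2 : (\int[P]_(w in Om K) XS t w <= (A * T `^ rho)%:E)%E.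
  apply: le_trans (noise0 tT); rewrite integral_mkcond; apply: ge0_integral_mono => w _.
    by rewrite patchE; case: ifP => // _; exact: XS0.
  by rewrite patchE; case: ifP => // _; exact: XS0.
have e3 : (\int[P]_(w in Om K) J w = \int[mu]_(r in `[0%R, t]) \int[P]_(w in Om K) (1 + S r w)%:E)%E.
  apply/esym; exact: (tonelli_restr mu P (g := fun r w => s1 (r, w)) (mtime t) (mOm K)).
have two0 : (0 <= 2%:E :> \bar R)%E by rewrite lee_fin.
rewrite e3; apply: (le_trans (leeD e1 (leeD (lexx _) (lee_wpmul2l two0 e2)))).
by rewrite addeCA -EFinM -EFinD addeC.
Qed.

Let Kmom : R := 2 * a1 * expR (2 * b0 * T).

(** Monotone convergence along [Om K], since the localised bound is uniform in [K]. *)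
Lemma mild_moment_bound t : 0 <= t <= T ->
  (\int[P]_w (1 + S t w)%:E <= Kmom%:E)%E.
Proof.
move=> tT.
have mSt1 : measurable_fun setT (fun w => (1 + S t w)%:E).
  by apply/measurable_EFinP; apply: measurable_funD.
have cv := ge0_nondecreasing_set_cvg_integral (mu := P) Om_mono mOm
  (fun i => measurable_funTS mSt1) (fun i w _ => ltac:(by rewrite lee_fin addr_ge0) : (0 <= (1 + S t w)%:E)%E).
apply: (@le_trans _ _ (\int[P]_(w in \bigcup_i Om i) (1 + S t w)%:E)%E).
  have mU : measurable (\bigcup_i Om i) by apply: bigcupT_measurable.
  rewrite [leRHS]integral_mkcond; apply: ae_ge0_le_integral => //.
  - by move=> w _; rewrite lee_fin addr_ge0.
  - by move=> w _; rewrite patchE; case: ifP => // _; rewrite lee_fin addr_ge0.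
  - by apply/(measurable_restrictT _ _).1 => //; exact: measurable_funTS.
  by apply: filterS Om_full => w wU _; rewrite patchE mem_set.
rewrite -(cvg_lim _ cv)//; apply: lime_le; first by apply/cvg_ex; eexists; exact: cv.
by apply: nearW => K; exact: local_gronwall.
Qed.

Let Kinc : R := 8 * L * T * Kmom * T `^ (1 - rho) + 2 * A.

Let hist_int k t w : 0 <= t <= T ->
  \int[mu]_(r in `[0, t]) (v k (t - r) * F k r w) = \int[mu]_(r in `[0, T]) (hist (v k) t r * F k r w).
Proof.
move=> /andP[t0 tT]; rewrite Rintegral_mkcond [RHS]Rintegral_mkcond; apply: eq_Rintegral => r _.
rewrite !patchE !mem_setE !in_itv /= /hist; case: ifPn => [/andP[r0 rt]|_]; first by rewrite r0 (le_trans rt tT).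
by rewrite mul0r if_same.
Qed.

Let integrable_histF k t w : mu.-integrable `[0, T] (EFin \o (fun r => F k r w)) ->
  mu.-integrable `[0, T] (EFin \o (fun r => hist (v k) t r * F k r w)).
Proof.
move=> Fi; apply: (le_integrable (mtime T) _ _ Fi).
  apply/measurable_EFinP; apply: measurable_funM.
    by apply: measurable_funTS; exact: measurable_hist.
  by have /integrableP[/measurable_EFinP] := Fi.
move=> r _; rewrite /= lee_fin normrM ger0_norm ?(hist_ge0 (v01 k))//.
by rewrite -[leRHS]mul1r ler_wpM2r// (hist_le1 (v01 k)).
Qed.

(** Both drift integrals are taken over [0, T] against histories, whose difference has squared L2
    norm at most 2 (t - t'). The drift therefore contributes order t - t' <= T^(1 - rho) (t -
    t')^rho, and the noise its own order rho. *)
Lemma mild_increment_bound t' t : 0 <= t' -> t' < t -> t <= T ->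
  (\int[P]_w (sum2 (fun k => c k (t, w) - c k (t', w)))%:E <= (Kinc * (t - t') `^ rho)%:E)%E.
Proof.
move=> t'0 t't tT; have t0 : 0 <= t by rewrite (le_trans t'0)// ltW.
have tT2 := rangeT t0 tT; have t'T := rangeT t'0 (le_trans (ltW t't) tT).
have de0 : 0 < t - t' by rewrite subr_gt0.
have M0 : 0 < 2 * (t - t') by rewrite mulr_gt0.
have K0 : 0 <= Kmom.
  by rewrite mulr_ge0 ?expR_ge0// mulr_ge0// addr_ge0// mulr_ge0// mulr_ge0// powR_ge0.
pose J w := (\int[mu]_(r in `[0%R, T]) s1 (r, w))%E.
have J0 w : (0 <= J w)%E by apply: integral_ge0 => r _; exact: s10.
have mJ : measurable_fun setT J by apply: mpartial.
pose m2 : R := 2 * (2 * (t - t') * (2 * L)).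
have m20 : 0 <= m2 by rewrite !mulr_ge0// ltW.
pose XD w : \bar R := (sum2 (fun k => X t k w - X t' k w))%:E.
have XD0 w : (0 <= XD w)%E by rewrite lee_fin sumr_ge0// => k _; exact: sqr_ge0.
have mXD : measurable_fun setT XD.
  apply/measurable_EFinP; apply: (msum2 (a := fun k w => X t k w - X t' k w)) => j jN.
  by apply: measurable_funB; exact: mX.
have mCD : measurable_fun setT (fun w => (sum2 (fun k => c k (t, w) - c k (t', w)))%:E).
  apply/measurable_EFinP; apply: (msum2 (a := fun k w => c k (t, w) - c k (t', w))) => j _.
  exact: measurable_funB.
have p1 w : (0 <= m2%:E * J w)%E by apply: mule_ge0; rewrite ?lee_fin.
have p2 w : (0 <= 2%:E * XD w)%E by apply: mule_ge0.
apply: (@le_trans _ _ (\int[P]_w (m2%:E * J w + 2%:E * XD w))%E).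
  apply: ae_ge0_le_integral => //.
  - by move=> w _; rewrite lee_fin sumr_ge0// => k _; exact: sqr_ge0.
  - by move=> w _; apply: adde_ge0.
  - by apply: emeasurable_funD; exact: measurable_funeM.
  apply: filterS3 (c_mild tT2) (c_mild t'T) Fint => w w1 w2 wF _.
  pose b k r := hist (v k) t r - hist (v k) t' r.
  have mb k : measurable_fun setT (b k) by apply: measurable_funB; exact: measurable_hist.
  have bM k : (1 <= k <= N)%N -> (\int[mu]_(r in `[0%R, T]) ((b k r) ^+ 2)%:E <= (2 * (t - t'))%:E)%E.
    move=> _; apply: (@le_trans _ _ (\int[mu]_r ((b k r) ^+ 2)%:E)%E).
      rewrite integral_mkcond; apply: ge0_integral_mono => r _; rewrite patchE; case: ifP => // _;
        by rewrite lee_fin sqr_ge0.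
    (* Exponent 0 and constant 1: only v <= 1 is used, which is uniform in the mode. *)
    have dec x : 0 < x -> (v k x) ^+ 2 <= 1 * x `^ (- 0).
      move=> x0; rewrite oppr0 powRr0 mulr1 -(expr1n _ 2); have /andP[v0 v1] := v01 k (ltW x0).
      by rewrite ler_pXn2r ?nnegrE.
    apply: (le_trans (integral_hist_sub_sqr (mv k) (v01 k) (@v_nincr k) (lexx 0) ltr01 ler01 dec t'0 (ltW t't))).
    by rewrite lee_fin subr0 divr1 mulr1 powRr1// ltW.
  have h := drift_sqr1 w (mtime T) M0 mb bM.
  apply: (@le_trans _ _ (2%:E * (sum2 (fun k => \int[mu]_(r in `[0, T]) (b k r * F k r w))%R)%:E + 2%:E * XD w)%E).
    rewrite -!EFinM -EFinD lee_fin; apply: sum2D => k kN.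
    rewrite w1// w2// !hist_int//.
    rewrite (_ : \int[mu]_(r in `[0, T]) (b k r * F k r w) =
       \int[mu]_(r in `[0, T]) (hist (v k) t r * F k r w) - \int[mu]_(r in `[0, T]) (hist (v k) t' r * F k r w)).
      ring.
    rewrite -RintegralB; [|exact: mtime|exact: integrable_histF (wF k kN)|exact: integrable_histF (wF k kN)].
    by apply: eq_Rintegral => r _; rewrite /b mulrBl.
  rewrite leeD2r//; have two0 : (0 <= 2%:E :> \bar R)%E by rewrite lee_fin.
  by apply: (le_trans (lee_wpmul2l two0 h)); rewrite muleA -EFinM.
rewrite ge0_integralD; [|exact: measurableT|by move=> w _|exact: measurable_funeM|by move=> w _|exact: measurable_funeM].
rewrite ge0_integralZl_EFin; [|exact: measurableT|by move=> w _|exact: mJ|exact: m20].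
rewrite ge0_integralZl_EFin; [|exact: measurableT|by move=> w _|exact: mXD|by []].
have e1 : (\int[P]_w J w <= (T * Kmom)%:E)%E.
  have -> : (\int[P]_w J w = \int[mu]_(r in `[0%R, T]) \int[P]_w s1 (r, w))%E.
    apply/esym; exact: (tonelli_restr mu P (g := fun r w => s1 (r, w)) (mtime T) measurableT).
  apply: (@le_trans _ _ (\int[mu]_(r in `[0%R, T]) Kmom%:E)%E).
    apply: ge0_integral_mono => r; rewrite /= in_itv /= => rT; last exact: mild_moment_bound.
    by apply: integral_ge0 => w _; exact: s10.
  rewrite integral_cst//= lebesgue_measure_itv /= lte_fin T0 oppr0 adde0 -EFinM lee_fin mulrC//.
have e2 := noise t'0 t't tT.
have m2E : (0 <= m2%:E)%E by rewrite lee_fin.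
have two0 : (0 <= 2%:E :> \bar R)%E by rewrite lee_fin.
apply: (le_trans (leeD (lee_wpmul2l m2E e1) (lee_wpmul2l two0 e2))).
rewrite -!EFinM -EFinD lee_fin /Kinc [leRHS]mulrDl; apply: lerD; last by rewrite mulrA.
have dT : t - t' <= T by rewrite lerBlDr (le_trans tT)// lerDl.
have -> : m2 * (T * Kmom) = 8 * L * T * Kmom * (t - t') by rewrite /m2; ring.
rewrite -[leRHS]mulrA ler_wpM2l//; first by rewrite !(K0, mulr_ge0).
have e : t - t' = (t - t') `^ (1 - rho) * (t - t') `^ rho.
  rewrite -powRD; last by rewrite (gt_eqF de0) implybT.
  by rewrite subrK powRr1// ltW.
rewrite [leLHS]e ler_wpM2r ?powR_ge0//.
by apply: ge0_ler_powR => //; rewrite ?nnegrE ?subr_ge0// ltW.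
Qed.

Variable M : nat.
Hypothesis M0 : (0 < M)%N.
Let tau : R := T / M%:R.
Variable dd : nat -> nat -> Omega -> R.
Hypothesis mdd : forall n k, measurable_fun setT (dd n k).
Hypothesis dd0 : forall w k, (1 <= k <= N)%N -> dd 0%N k w = 0.
Variable Y : nat -> nat -> Omega -> R.
Hypothesis mY : forall n k, (1 <= k <= N)%N -> (1 <= n <= M)%N -> measurable_fun setT (Y n k).
Hypothesis dd_mild : forall n, (1 <= n <= M)%N -> {ae P, forall w, forall k, (1 <= k <= N)%N ->
  dd n k w = \sum_(1 <= i < n.+1) \int[mu]_(r in cell tau i)
      (v k (grid tau n - r) * Phi (fun j => dd i.-1 j w) k) + Y n k w}.
Hypothesis noise_mean : forall n, (1 <= n <= M)%N ->
  (\int[P]_w (sum2 (fun k => X (grid tau n) k w - Y n k w))%:E <= (A * tau `^ rho)%:E)%E.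

Let tau0 : 0 < tau. Proof. by rewrite divr_gt0// ltr0n. Qed.

Let gridT n : (n <= M)%N -> 0 <= grid tau n <= T.
Proof.
move=> nM; apply/andP; split; first by apply: mulr_ge0 => //; exact: ltW.
have TE : M%:R * tau = T by rewrite /tau mulrCA mulfV ?mulr1// pnatr_eq0 -lt0n.
by rewrite -[leRHS]TE /grid ler_pM2r// ler_nat.
Qed.

Let err n w : R := sum2 (fun k => c k (grid tau n, w) - dd n k w).

Let err0 n w : 0 <= err n w.
Proof. by apply: sumr_ge0 => k _; exact: sqr_ge0. Qed.

Let merr n : measurable_fun setT (fun w => (err n w)%:E).
Proof.
apply/measurable_EFinP; apply: (msum2 (a := fun k w => c k (grid tau n, w) - dd n k w)) => j _.
exact: measurable_funB.
Qed.

(** By the Lipschitz bound this dominates the squared drift error at each time; in cell i the scheme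
    still uses its value at t_(i-1). *)
Let q n (z : measurableTypeR R * Omega) : \bar R :=
  (\sum_(1 <= i < n.+1) (L * sum2 (fun k => c k z - dd i.-1 k z.2)) * \1_(cell tau i) z.1)%:E.

Let q0 n z : (0 <= q n z)%E.
Proof.
rewrite lee_fin sumr_ge0// => i _; apply: mulr_ge0; last by rewrite indicE.
by apply: mulr_ge0; [exact: ltW|apply: sumr_ge0 => k _; exact: sqr_ge0].
Qed.

Let mq n : measurable_fun setT (q n).
Proof.
apply/measurable_EFinP; apply: measurable_sum => i; apply: measurable_funM.
  apply: measurable_funM => //.
  apply: (msum2 (a := fun k (z : measurableTypeR R * Omega) => c k z - dd i.-1 k z.2)) => j _.
  by apply: measurable_funB => //; apply: (measurableT_comp (mdd i.-1 j)); exact: measurable_snd.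
apply: (measurableT_comp (f := \1_(cell tau i) : measurableTypeR R -> R)).
  by apply: measurable_indic; exact: measurable_cell.
exact: measurable_fst.
Qed.

Let time n : set (measurableTypeR R) := `]0, grid tau n]%classic.
Let mtimen n : measurable (time n). Proof. exact: measurable_itv. Qed.

(** Writing the difference of the drift terms as one integral lets Cauchy-Schwarz be applied once,
    instead of cell by cell. *)
Let mvP n k w : (1 <= n <= M)%N -> (1 <= k <= N)%N ->
  mu.-integrable `[0, T] (EFin \o (fun r => F k r w)) ->
  \int[mu]_(r in `[0, grid tau n]) (v k (grid tau n - r) * F k r w) -
  \sum_(1 <= i < n.+1) \int[mu]_(r in cell tau i)
    (v k (grid tau n - r) * Phi (fun j => dd i.-1 j w) k) =
  \int[mu]_(r in time n) (v k (grid tau n - r) *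
    (F k r w - \sum_(1 <= i < n.+1) Phi (fun j => dd i.-1 j w) k * \1_(cell tau i) r)).
Proof.
move=> /andP[n1 nM] kN Fi; have /andP[t0 tT] := gridT nM.
have sub : time n `<=` `[0, T]%classic.
  by move=> r; rewrite /time /= !in_itv /= => /andP[/ltW -> /le_trans]; exact.
have sub2 : `[0, grid tau n]%classic `<=` `[0, T]%classic.
  by move=> r /=; rewrite !in_itv /= => /andP[-> /le_trans]; exact.
have vle (D : set (measurableTypeR R)) (g : R -> R) : measurable D -> D `<=` `[0, grid tau n]%classic ->
    mu.-integrable D (EFin \o g) -> mu.-integrable D (EFin \o (fun r => v k (grid tau n - r) * g r)).
  move=> mD Dn gi; apply: (le_integrable mD _ _ gi).
    apply/measurable_EFinP; apply: measurable_funM; first by apply: measurable_funTS; exact: mvt.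
    by have /integrableP[/measurable_EFinP] := gi.
  move=> r /Dn; rewrite /= in_itv /= => /andP[_ rt]; rewrite lee_fin normrM.
  have /andP[v0 v1] : 0 <= v k (grid tau n - r) <= 1 by apply: v01; rewrite subr_ge0.
  by rewrite (ger0_norm v0) -[leRHS]mul1r ler_wpM2r.
have subn : time n `<=` `[0, grid tau n]%classic.
  by move=> r; rewrite /time /= !in_itv /= => /andP[/ltW -> ->].
have Fit : mu.-integrable (time n) (EFin \o (fun r => F k r w)).
  by apply: integrableS Fi => //; exact: mtime.
have i1 : mu.-integrable (time n) (EFin \o (fun r => v k (grid tau n - r) * F k r w)) by exact: vle.
rewrite -Rintegral_itv_obnd_cbnd//.
have mutime : (mu (time n) < +oo)%E.
  by rewrite /time lebesgue_measure_itv /=; case: ifP => _; rewrite -?EFinD ?ltry ?lt0y.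
have i2 i : mu.-integrable (time n) (EFin \o (fun r => \1_(cell tau i) r * v k (grid tau n - r))).
  rewrite (_ : (fun r => _) = (fun r => v k (grid tau n - r) * \1_(cell tau i) r)); last first.
    by apply/funext => r; rewrite mulrC.
  apply: vle => //; apply: measurable_bounded_integrable => //.
    by apply: measurable_funTS; apply: measurable_indic; exact: measurable_cell.
  exists 1; split; first by rewrite num_real.
  move=> x x1 r _ /=; rewrite indicE; case: (_ \in _) => /=; last by rewrite normr0 ltW// (lt_trans ltr01).
  by rewrite normr1 ltW.
have cellE i (g : R -> R) : (1 <= i <= n)%N -> \int[mu]_(r in cell tau i) g r =
    \int[mu]_(r in time n) (\1_(cell tau i) r * g r).
  move=> /andP[i1' il]; rewrite Rintegral_mkcond [RHS]Rintegral_mkcond; apply: eq_Rintegral => r _.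
  rewrite !patchE indicE; case: (boolP (r \in cell tau i)) => rc; last by rewrite mul0r if_same.
  rewrite mul1r ifT// /time mem_setE in_itv /=; move: rc; rewrite in_cell => /andP[r1 r2].
  apply/andP; split; first by apply: le_lt_trans r1; rewrite mulr_ge0// ltW.
  by apply: (le_trans r2); rewrite /grid ler_pM2r// ler_nat.
pose a i := Phi (fun j => dd i.-1 j w) k.
have e2 : \sum_(1 <= i < n.+1) \int[mu]_(r in cell tau i) (v k (grid tau n - r) * a i) =
    \int[mu]_(r in time n) (\sum_(1 <= i < n.+1) (\1_(cell tau i) r * v k (grid tau n - r)) * a i).
  rewrite (Rintegral_sum_nat (m := mu))//; apply: eq_big_nat => i; rewrite ltnS => iN.
  rewrite cellE//; transitivity (\int[mu]_(r in time n) ((\1_(cell tau i) r * v k (grid tau n - r)) * a i)).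
    by apply: eq_Rintegral => r _; rewrite mulrA.
  by rewrite RintegralZr.
have i3 : mu.-integrable (time n) (EFin \o (fun r => \sum_(1 <= i < n.+1) (\1_(cell tau i) r * v k (grid tau n - r)) * a i)).
  rewrite (_ : EFin \o _ = (fun r => \sum_(i <- index_iota 1 n.+1) ((\1_(cell tau i) r * v k (grid tau n - r)) * a i)%:E)%E); last first.
    by apply/funext => r /=; rewrite sumEFin.
  apply: integrable_sum => // i _.
  rewrite (_ : (fun r => _) = (fun r => (a i)%:E * (EFin \o (fun r => \1_(cell tau i) r * v k (grid tau n - r))%R) r)%E); last first.
    by apply/funext => r /=; rewrite mulrC EFinM.
  exact: integrableZl.
rewrite e2 -RintegralB//; apply: eq_Rintegral => r _.
rewrite mulrBr; congr (_ - _); rewrite big_distrr; apply: eq_bigr => i _.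
by rewrite /a /=; ring.
Qed.

Let Kerr : R := 4 * T ^+ 2 * L * Kinc + 2 * A.

Let Kmom0 : 0 <= Kmom.
Proof.
by rewrite mulr_ge0 ?expR_ge0// mulr_ge0// addr_ge0// mulr_ge0// mulr_ge0// powR_ge0.
Qed.

Let Kinc0 : 0 <= Kinc.
Proof.
by apply: addr_ge0; rewrite !(Kmom0, powR_ge0, mulr_ge0).
Qed.

Let err_pointwise n : (1 <= n <= M)%N -> {ae P, forall w,
  ((err n w)%:E <= (2 * T)%:E * (\int[mu]_(r in time n) q n (r, w))
    + 2%:E * (sum2 (fun k => X (grid tau n) k w - Y n k w))%:E)%E}.
Proof.
move=> nM; have /andP[n1 nM'] := nM; have tT := gridT nM'; have /andP[t0 tT'] := tT.
apply: filterS3 (c_mild tT) (dd_mild nM) Fint => w w1 w2 wF.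
pose g k r := if (1 <= k <= N)%N then
  F k r w - \sum_(1 <= i < n.+1) Phi (fun j => dd i.-1 j w) k * \1_(cell tau i) r else 0.
have mg k : measurable_fun (time n) (g k).
  apply: measurable_funTS; rewrite /g; case: (boolP (1 <= k <= N)%N) => kN; last exact: measurable_cst.
  apply: measurable_funB; first exact: mF.
  apply: measurable_sum => i; apply: measurable_funM => //.
  by apply: measurable_indic; exact: measurable_cell.
have vM k : (1 <= k <= N)%N -> (\int[mu]_(r in time n) ((v k (grid tau n - r)) ^+ 2)%:E <= T%:E)%E.
  move=> _; apply: (@le_trans _ _ (grid tau n)%:E); last by rewrite lee_fin.
  apply: le_trans (mode_sqr k t0).
  rewrite [leLHS]integral_mkcond [leRHS]integral_mkcond; apply: ge0_integral_mono => r _.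
    by rewrite patchE; case: ifP => // _; rewrite lee_fin sqr_ge0.
  rewrite !patchE /time !mem_setE !in_itv /=; case: ifPn => [/andP[/ltW -> ->]//|_].
  by case: ifP => // _; rewrite lee_fin sqr_ge0.
have h := sum_sqr_Rintegral_le (mtimen n) T0 (fun k => measurable_funTS (mvt k (grid tau n))) mg vM.
have hq : (\int[mu]_(r in time n) (sum2 (fun k => g k r))%:E <= \int[mu]_(r in time n) q n (r, w))%E.
  apply: ge0_integral_mono => r; first by rewrite lee_fin sumr_ge0// => k _; exact: sqr_ge0.
  rewrite /time /= in_itv /= => /andP[r0 rt]; rewrite lee_fin /=.
  have [i [i0 il ri]] := cell_exists r0 rt.
  rewrite (sum_cell (fun i => L * sum2 (fun k => c k (r, w) - dd i.-1 k w)) tau0 i0 il ri).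
  apply: le_trans (Phi_lip _ _); rewrite le_eqVlt; apply/orP; left; apply/eqP.
  apply: eq_big_nat => k; rewrite ltnS => kN; rewrite /g kN.
  by rewrite (sum_cell (fun i => Phi (fun j => dd i.-1 j w) k) tau0 i0 il ri).
have TE : (0 <= T%:E)%E by rewrite lee_fin ltW.
have {h} h := le_trans h (lee_wpmul2l TE hq).
apply: (@le_trans _ _ (2%:E * (sum2 (fun k => \int[mu]_(r in time n) (v k (grid tau n - r) * g k r))%R)%:E
    + 2%:E * (sum2 (fun k => X (grid tau n) k w - Y n k w))%:E)%E).
  rewrite -!EFinM -EFinD lee_fin; apply: sum2D => k kN.
  have -> : \int[mu]_(r in time n) (v k (grid tau n - r) * g k r) =
      \int[mu]_(r in time n) (v k (grid tau n - r) *
    (F k r w - \sum_(1 <= i < n.+1) Phi (fun j => dd i.-1 j w) k * \1_(cell tau i) r)).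
    by apply: eq_Rintegral => r _; rewrite /g kN.
  by rewrite -(mvP nM kN (wF k kN)) w1// w2//; ring.
rewrite leeD2r//; have two0 : (0 <= 2%:E :> \bar R)%E by rewrite lee_fin.
by apply: (le_trans (lee_wpmul2l two0 h)); rewrite muleA -EFinM.
Qed.

Let y n : \bar R := (\int[P]_w (err n w)%:E)%E.
Let y0 n : (0 <= y n)%E.
Proof. by apply: integral_ge0 => w _; rewrite lee_fin. Qed.

Let G i : \bar R := (L * (2 * (Kinc * tau `^ rho)))%:E + (2 * L)%:E * y i.-1.
Let G0 i : (0 <= G i)%E.
Proof.
apply: adde_ge0; first by rewrite lee_fin !(Kinc0, powR_ge0, mulr_ge0).
by apply: mule_ge0 => //; rewrite lee_fin mulr_ge0.
Qed.

(** For r in cell i the error splits into the time increment of the solution from t_(i-1) to r and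
    the error of the scheme at t_(i-1). *)
Let cell_moment i r : (1 <= i <= M)%N -> r \in cell tau i ->
  (\int[P]_w (L * sum2 (fun k => c k (r, w) - dd i.-1 k w))%:E <= G i)%E.
Proof.
move=> /andP[i1 iM]; rewrite in_cell => /andP[r1 r2].
have LE : (0 <= L%:E)%E by rewrite lee_fin ltW.
have two0 : (0 <= 2%:E :> \bar R)%E by rewrite lee_fin.
have /andP[g0 gT] := gridT (leq_trans (leq_pred i) iM).
have /andP[_ giT] := gridT iM.
have rT : r <= T by exact: le_trans giT.
have ei : i%:R = i.-1%:R + 1 :> R by rewrite -{1}(prednK i1) -natr1.
have rtau : r - grid tau i.-1 <= tau.
  by rewrite lerBlDl /grid (le_trans r2)// ei mulrDl mul1r.
pose Dw w : \bar R := (sum2 (fun k => c k (r, w) - c k (grid tau i.-1, w)))%:E.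
have D0 w : (0 <= Dw w)%E by rewrite lee_fin sumr_ge0// => k _; exact: sqr_ge0.
have mD : measurable_fun setT Dw.
  apply/measurable_EFinP; apply: (msum2 (a := fun k w => c k (r, w) - c k (grid tau i.-1, w))) => j _.
  exact: measurable_funB.
pose H w : \bar R := (2%:E * Dw w + 2%:E * (err i.-1 w)%:E)%E.
apply: (@le_trans _ _ (\int[P]_w (L%:E * H w))%E).
  apply: ge0_integral_mono => w _.
    by rewrite lee_fin mulr_ge0 ?(ltW L0)// sumr_ge0// => k _; exact: sqr_ge0.
  have -> : (L%:E * H w = (L * (2 * sum2 (fun k => c k (r, w) - c k (grid tau i.-1, w)) + 2 * err i.-1 w))%:E)%E by [].
  by rewrite lee_fin ler_pM2l//; apply: sum2D => k _; ring.
have mH : measurable_fun setT H by apply: emeasurable_funD; exact: measurable_funeM.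
have H0 w : (0 <= H w)%E by apply: adde_ge0; apply: mule_ge0 => //; rewrite lee_fin.
rewrite ge0_integralZl_EFin; [|exact: measurableT|by move=> w _|exact: mH|exact: ltW].
rewrite /H (ge0_integral_double P mD (merr i.-1))//; last by move=> w; rewrite lee_fin.
have DK : (\int[P]_w Dw w <= (Kinc * tau `^ rho)%:E)%E.
  apply: (le_trans (mild_increment_bound g0 r1 rT)); rewrite lee_fin ler_wpM2l//.
  have rp : 0 <= r - grid tau i.-1 by rewrite subr_ge0 ltW.
  by apply: ge0_ler_powR => //; rewrite ?nnegrE; exact: ltW.
apply: (le_trans (lee_wpmul2l LE (leeD (lee_wpmul2l two0 DK) (lexx _)))).
rewrite ge0_muleDr; [|by rewrite -EFinM lee_fin !(Kinc0, powR_ge0, mulr_ge0)|by apply: mule_ge0 => //; exact: y0].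
rewrite /G; apply: leeD; first by rewrite -!EFinM lexx.
by rewrite muleA -EFinM (mulrC L 2) lexx.
Qed.

Let ind_cell n i : (\int[mu]_(r in time n) (\1_(cell tau i) r)%:E <= (if (0 < i)%N then tau else 0)%:E)%E.
Proof.
apply: (@le_trans _ _ (mu (cell tau i))).
  have -> : mu (cell tau i) = (\int[mu]_r (\1_(cell tau i) r)%:E)%E.
    by rewrite integral_indic//; [rewrite setIT|exact: measurable_cell].
  rewrite [leLHS]integral_mkcond; apply: ge0_integral_mono => r _; rewrite patchE; case: ifP => // _; rewrite lee_fin indicE//.
rewrite /cell lebesgue_measure_itv /= lte_fin /grid.
case: i => [|i] /=; first by rewrite ltxx.
rewrite ltr_pM2r// ltr_nat ltnSn -EFinB lee_fin.
by rewrite -natr1 mulrDl mul1r addrAC subrr add0r.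
Qed.

(** [err_pointwise] and [cell_moment] give a recursion for the mean square errors, in which each
    cell contributes its length tau times the error at its left end. *)
Let error_bound n : (n <= M)%N ->
  (y n <= ((Kerr * tau `^ rho) * expR (4 * T ^+ 2 * L))%:E)%E.
Proof.
have tau_ge0 : 0 <= tau by exact: ltW.
have Kerr0 : 0 <= Kerr by apply: addr_ge0; rewrite !(Kinc0, sqr_ge0, mulr_ge0).
pose a : R := Kerr * tau `^ rho; pose b : R := 4 * T * L * tau.
have a_ge0 : 0 <= a by rewrite mulr_ge0// powR_ge0.
have b_ge0 : 0 <= b by rewrite !mulr_ge0.
have rec m : (m <= M)%N -> (y m <= a%:E + b%:E * \sum_(0 <= i < m) y i)%E.
  case: m => [_|m mM].
    rewrite big_geq// mule0 adde0; apply: (@le_trans _ _ 0%E); last by rewrite lee_fin.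
    rewrite -(integral0 P setT); apply: ae_ge0_le_integral => //; first by move=> w _; rewrite lee_fin.
    apply: filterS c_init => w wc _; rewrite lee_fin /err big_nat_cond big1// => k; rewrite andbT ltnS => kN.
    by rewrite /grid mul0r wc// dd0// subrr expr0n.
  have n1 : (1 <= m.+1 <= M)%N by [].
  have /andP[t0 tT] := gridT mM.
  pose J w := (\int[mu]_(r in time m.+1) q m.+1 (r, w))%E.
  have J0 w : (0 <= J w)%E by apply: integral_ge0 => r _; exact: q0.
  have mJ : measurable_fun setT J by apply: mpartial.
  pose XY w : \bar R := (sum2 (fun k => X (grid tau m.+1) k w - Y m.+1 k w))%:E.
  have XY0 w : (0 <= XY w)%E by rewrite lee_fin sumr_ge0// => k _; exact: sqr_ge0.
  have mXY : measurable_fun setT XY.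
    apply/measurable_EFinP; apply: (msum2 (a := fun k w => X (grid tau m.+1) k w - Y m.+1 k w)) => j jN.
    by apply: measurable_funB; [apply: mX => //; exact: gridT|exact: mY].
  have T20 : 0 <= 2 * T by rewrite mulr_ge0.
  have T2E : (0 <= (2 * T)%:E)%E by rewrite lee_fin.
  have two0 : (0 <= 2%:E :> \bar R)%E by rewrite lee_fin.
  have p1 w : (0 <= (2 * T)%:E * J w)%E by apply: mule_ge0.
  have p2 w : (0 <= 2%:E * XY w)%E by apply: mule_ge0.
  apply: (@le_trans _ _ (\int[P]_w ((2 * T)%:E * J w + 2%:E * XY w))%E).
    apply: ae_ge0_le_integral => //.
    - by move=> w _; rewrite lee_fin.
    - by move=> w _; apply: adde_ge0.
    - by apply: emeasurable_funD; exact: measurable_funeM.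
    by apply: filterS (err_pointwise n1) => w h _.
  rewrite ge0_integralD; [|exact: measurableT|by move=> w _|exact: measurable_funeM|by move=> w _|exact: measurable_funeM].
  rewrite ge0_integralZl_EFin; [|exact: measurableT|by move=> w _|exact: mJ|exact: T20].
  rewrite ge0_integralZl_EFin; [|exact: measurableT|by move=> w _|exact: mXY|by []].
  have e1 : (\int[P]_w J w <= \sum_(1 <= i < m.+2) G i * tau%:E)%E.
    have -> : (\int[P]_w J w = \int[mu]_(r in time m.+1) \int[P]_w q m.+1 (r, w))%E.
      apply/esym; apply: (tonelli_restr mu P (g := fun r w => q m.+1 (r, w)) (mtimen m.+1) measurableT) => //.
      by move: (mq m.+1); congr (measurable_fun _ _); apply/funext => -[].
    apply: (@le_trans _ _ (\int[mu]_(r in time m.+1) (\sum_(1 <= i < m.+2) G i * (\1_(cell tau i) r)%:E))%E).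
      apply: ge0_integral_mono => r; first by move=> _; apply: integral_ge0 => w _; exact: q0.
      rewrite /time /= in_itv /= => /andP[r0 rt].
      have [i [i0 il ri]] := cell_exists r0 rt.
      rewrite (bigD1_seq i) ?iota_uniq ?mem_index_iota ?i0 ?ltnS//= indicE ri mule1.
      apply: (@le_trans _ _ (G i)); last first.
        by rewrite leeDl// sume_ge0// => j _; apply: mule_ge0 => //; rewrite lee_fin indicE.
      apply: le_trans (cell_moment (i := i) (r := r) _ ri); last by rewrite i0 (leq_trans il).
      rewrite le_eqVlt; apply/orP; left; apply/eqP; apply: eq_integral => w _; rewrite /q /=.
      by rewrite (sum_cell (fun i => L * sum2 (fun k => c k (r, w) - dd i.-1 k w)) tau0 i0 il ri).
    have mind i : measurable_fun (time m.+1) (fun r => (\1_(cell tau i) r : R)%:E).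
      by apply/measurable_EFinP; apply: measurable_funTS; apply: measurable_indic; exact: measurable_cell.
    have ind0 i (r : R) : (0 <= (\1_(cell tau i) r : R)%:E)%E by rewrite lee_fin indicE.
    rewrite ge0_integral_sum; [|exact: mtimen|by move=> i; apply: emeasurable_funM => //; exact: measurable_cst
      |by move=> i r _; apply: mule_ge0].
    rewrite big_seq [leRHS]big_seq; apply: lee_sum => i; rewrite mem_index_iota => /andP[i0 _].
    rewrite ge0_integralZl//; apply: lee_wpmul2l => //.
    by apply: (le_trans (ind_cell m.+1 i)); rewrite i0.
  have e2 : (\int[P]_w XY w <= (A * tau `^ rho)%:E)%E by exact: noise_mean.
  apply: (le_trans (leeD (lee_wpmul2l T2E e1) (lee_wpmul2l two0 e2))).
  rewrite big_add1 /= /G.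
  have sumE : (\sum_(0 <= i < m.+1) ((L * (2 * (Kinc * tau `^ rho)))%:E + (2 * L)%:E * y i) * tau%:E =
      (m.+1%:R * tau * (L * (2 * (Kinc * tau `^ rho))))%:E + (2 * L * tau)%:E * \sum_(0 <= i < m.+1) y i)%E.
    have c0' : 0 <= L * (2 * (Kinc * tau `^ rho)) by rewrite !mulr_ge0 ?powR_ge0.
    have tauE : (0 <= tau%:E)%E by rewrite lee_fin ltW.
    rewrite ge0_sume_distrr; last by move=> i _; exact: y0.
    transitivity (\sum_(0 <= i < m.+1) ((L * (2 * (Kinc * tau `^ rho)) * tau)%:E + (2 * L * tau)%:E * y i))%E.
      apply: eq_bigr => i _; rewrite ge0_muleDl ?lee_fin//; last by apply: mule_ge0 => //; rewrite lee_fin mulr_ge0.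
      by rewrite -EFinM muleAC -EFinM.
    rewrite big_split /=; congr (_ + _)%E; rewrite sumEFin big_const_nat iter_addr addr0 subn0.
    by rewrite -mulr_natl; congr EFin; ring.
  rewrite sumE; have Sy : (0 <= \sum_(0 <= i < m.+1) y i)%E by apply: sume_ge0 => i _.
  rewrite ge0_muleDr; [|by rewrite lee_fin !mulr_ge0 ?powR_ge0|by apply: mule_ge0 => //; rewrite lee_fin !mulr_ge0].
  rewrite muleA -!EFinM addeAC -EFinD (_ : 2 * T * (2 * L * tau) = b); last by rewrite /b; ring.
  rewrite leeD2r// lee_fin /a /Kerr [leRHS]mulrDl; apply: lerD; last by rewrite mulrA.
  have -> : 2 * T * (m.+1%:R * tau * (L * (2 * (Kinc * tau `^ rho)))) =
      (4 * T * L * Kinc * tau `^ rho) * grid tau m.+1 by rewrite /grid; ring.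
  rewrite (_ : 4 * T ^+ 2 * L * Kinc * tau `^ rho = (4 * T * L * Kinc * tau `^ rho) * T); last by rewrite expr2; ring.
  by rewrite ler_wpM2l// !mulr_ge0 ?powR_ge0.
move=> nM; apply: (le_trans (discrete_gronwall a_ge0 b_ge0 y0 rec nM)).
rewrite lee_fin -/a ler_wpM2l//.
(* (1 + b)^n <= exp(n b), and n b = 4 T L t_n is at most 4 T^2 L, whatever the step. *)
apply: (@le_trans _ _ (expR b ^+ n)).
  by apply: lerXn2r; rewrite ?nnegrE ?expR_ge0 ?addr_ge0//; exact: expR_ge1Dx.
rewrite -expRM_natl ler_expR.
have -> : n%:R * b = 4 * T * L * grid tau n by rewrite /b /grid; ring.
have /andP[_ gT] := gridT nM.
rewrite (_ : 4 * T ^+ 2 * L = 4 * T * L * T); last by rewrite expr2; ring.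
by rewrite ler_wpM2l// !mulr_ge0.
Qed.

Lemma mild_error_bound n : (n <= M)%N ->
  (\int[P]_w (\sum_(1 <= k < N.+1) (c k (grid (T / M%:R) n, w) - dd n k w) ^+ 2)%:E <=
   (mild_constant T L A rho * (T / M%:R) `^ rho)%:E)%E.
Proof.
move=> nM; apply: (le_trans (error_bound nM)).
by rewrite lee_fin /mild_constant -/tau mulrAC.
Qed.

End mild_solutions.

(** * Rate of the noise, summed over modes *)

Section noise_rate.
Context {R : realType} {d : measure_display} {Omega : measurableType d}.
Variables (P : probability Omega R) (alpha s H1 H2 T : R) (W : R -> R -> {RV P >-> R}).
Variables (lambda : nat -> R) (phi : nat -> R -> R).
Notation mu := (@lebesgue_measure R).
Hypothesis a0 : 0 < alpha.
Hypothesis H1_gt0 : 0 < H1.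
Hypothesis H2_gt0 : 0 < H2.
Hypothesis es : dirichlet_eigensystem lambda phi.
Hypothesis covW : forall x y t r : R, D x -> D y -> 0 <= t <= T -> 0 <= r <= T ->
  'E_P[W x t \* W y r]%E = (fbm_cov H1 x y * fbm_cov H2 t r)%:E.
Variables eta1 eta2 : R -> R.
Hypothesis eta1P : shift_index H1 1 eta1.
Hypothesis eta2P : shift_index H2 T eta2.
Variable q : R.
Hypothesis q1 : q < 1.
Hypothesis qH2 : q < 2 * H2.
Let p : R := 2 * H1 + 2 * s * q / alpha - 1.
Hypothesis p1 : 1 < p.

Lemma eigenvalue_gt0 k : (1 <= k)%N -> 0 < lambda k.
Proof.
move=> k1; rewrite (eigenvalueE es k1) exprn_gt0//.
by apply: lt_le_trans (eigenvalue_sqrt_ge es k1); rewrite ltr0n.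
Qed.

(** The space factor and the eigenvalue part of the time factor combine to w_k^(-p), and w_k >=
    k. *)
Lemma mode_weight_le k : (1 <= k)%N ->
  Num.sqrt (lambda k) * (Num.sqrt (lambda k))^-1 `^ (2 * H1)
    * (lambda k `^ s) `^ (- (q / alpha)) <= k%:R `^ (- p).
Proof.
move=> k1; have wk := eigenvalue_sqrt_ge es k1; rewrite {3}(eigenvalueE es k1).
set w := Num.sqrt (lambda k) in wk *.
have k0 : 0 < k%:R :> R by rewrite ltr0n.
have w0 : 0 < w by exact: lt_le_trans wk.
have -> : w * w^-1 `^ (2 * H1) * ((w ^+ 2) `^ s) `^ (- (q / alpha)) = w `^ (- p).
  rewrite -(powR_mulrn 2 (ltW w0)) -!powRrM -(powR_inv1 (ltW w0)) -powRrM.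
  rewrite -{1}(powRr1 (ltW w0)) -!powRD; try by rewrite (gt_eqF w0) implybT.
  congr (_ `^ _); rewrite /p; ring.
have p0 : 0 <= p by have := p1; lra.
rewrite !powRN lef_pV2 ?posrE ?powR_gt0//.
by apply: ge0_ler_powR => //; rewrite nnegrE ltW.
Qed.

(** From left to right: the 4 of [wint_bound], the 8 of [space_qform_le], the constant of the time
    form without its eigenvalue weight, and the bound on the sum of k^(-p). *)
Definition noise_constant : R :=
  4 * (8 * (4 * (8 * ((1 + Gamma (alpha + 1)) ^+ 2 / (1 - q))) * ((1 - q) * H2 / (2 * H2 - q))))
  * (1 - 2 `^ (1 - p))^-1.

Lemma noise_constant_ge0 : 0 <= noise_constant.
Proof.
have q1' : 0 <= 1 - q by rewrite subr_ge0 ltW.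
have qH2' : 0 <= 2 * H2 - q by rewrite subr_ge0 ltW.
have h : 0 <= (1 - 2 `^ (1 - p))^-1 :> R.
  by apply: le_trans (sum_powR_le 0 p1); rewrite big_geq.
have H20 := ltW H2_gt0.
by rewrite /noise_constant; apply: mulr_ge0 => //; rewrite !(sqr_ge0, invr_ge0, mulr_ge0).
Qed.

(** Each mode is bounded by [wint_bound] and the factorised form; the sum over modes is then uniform
    in [N] because p > 1. *)
Lemma noise_sum_le (N : nat) (b : nat -> R -> R) (Z : nat -> Omega -> R) (de : R) : 0 < de ->
  (forall k, (1 <= k <= N)%N -> measurable_fun setT (b k)) ->
  (forall k, (1 <= k <= N)%N -> wint T W (fun y r => b k r * phi k y) (Z k)) ->
  (forall k, (1 <= k <= N)%N -> (\int[mu]_x dnorm (eta2 x) (b k) <=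
    (4 * (8 * ((1 + Gamma (alpha + 1)) ^+ 2 * (lambda k `^ s) `^ (- (q / alpha)) / (1 - q)))
     * ((1 - q) * H2 / (2 * H2 - q)) * de `^ (2 * H2 - q))%:E)%E) ->
  (\int[P]_w (\sum_(1 <= k < N.+1) (Z k w) ^+ 2)%:E <= (noise_constant * de `^ (2 * H2 - q))%:E)%E.
Proof.
move=> de0 mb bZ bQ.
have [me1 _ _] := eta1P; have [me2 _ _] := eta2P.
pose X k w := if (1 <= k <= N)%N then Z k w else 0.
have XE w : \sum_(1 <= k < N.+1) (Z k w) ^+ 2 = \sum_(1 <= k < N.+1) (X k w) ^+ 2.
  by apply: eq_big_nat => k; rewrite ltnS => kN; rewrite /X kN.
have mX k : measurable_fun setT (X k).
  rewrite /X; case: (boolP (1 <= k <= N)%N) => kN; last exact: measurable_cst.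
  exact: (wint_measurable (bZ k kN)).
have mX2 k : measurable_fun setT (fun w => ((X k w) ^+ 2)%:E).
  by apply/measurable_EFinP; apply: measurable_funX.
under eq_integral do rewrite XE -sumEFin.
rewrite ge0_integral_sum; [|exact: measurableT|by []|by move=> k w _; rewrite lee_fin sqr_ge0].
set Bc := 4 * (8 * (4 * (8 * ((1 + Gamma (alpha + 1)) ^+ 2 / (1 - q))) * ((1 - q) * H2 / (2 * H2 - q)))).
have q1' : 0 <= 1 - q by rewrite subr_ge0 ltW.
have qH2' : 0 <= 2 * H2 - q by rewrite subr_ge0 ltW.
have H20 := ltW H2_gt0.
have Bc0 : 0 <= Bc by rewrite /Bc !(sqr_ge0, invr_ge0, mulr_ge0).
have de1 : 0 <= de `^ (2 * H2 - q) by exact: powR_ge0.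
apply: (@le_trans _ _ (\sum_(1 <= k < N.+1) (k%:R `^ (- p) * (Bc * de `^ (2 * H2 - q)))%:E)%E); last first.
  rewrite sumEFin lee_fin -big_distrl /= /noise_constant -/Bc.
  rewrite (_ : Bc * _ * _ = (1 - 2 `^ (1 - p))^-1 * (Bc * de `^ (2 * H2 - q))); last by ring.
  by apply: ler_wpM2r; [rewrite mulr_ge0|exact: sum_powR_le].
rewrite big_seq [leRHS]big_seq; apply: lee_sum => k; rewrite mem_index_iota ltnS => kN.
have /andP[k1 _] := kN; have wk := eigenvalue_sqrt_ge es k1.
have w1 : 1 <= Num.sqrt (lambda k) by apply: le_trans wk; rewrite ler1n.
have [phi2 plip] := eigenfunction_bounds es k1.
have mphi := measurable_eigenfunction es k1.
have sp := space_qform_le eta1P H1_gt0 w1 mphi phi2 plip (fun x => eigenfunction_out es k1 (x := x)).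
have := wint_bound H1_gt0 H2_gt0 covW eta1P eta2P (bZ k kN).
rewrite (qform_tensor me1 me2 (mb k kN) mphi).
have -> : (\int[P]_w ((X k w) ^+ 2)%:E = \int[P]_w ((Z k w) ^+ 2)%:E)%E.
  by apply: eq_integral => w _; rewrite /X kN.
move=> /le_trans; apply.
have four0 : (0 <= 4%:E :> \bar R)%E by rewrite lee_fin.
have n1 : (0 <= \int[mu]_x dnorm (eta1 x) (phi k))%E by apply: integral_ge0 => x _; exact: dnorm_nneg.
have n2 : (0 <= \int[mu]_x dnorm (eta2 x) (b k))%E by apply: integral_ge0 => x _; exact: dnorm_nneg.
apply: (le_trans (lee_wpmul2l four0 (lee_pmul n1 n2 sp (bQ k kN)))).
rewrite -!EFinM lee_fin.
have := ler_wpM2r (mulr_ge0 Bc0 de1) (mode_weight_le k1); apply: le_trans.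
by rewrite le_eqVlt; apply/orP; left; apply/eqP; rewrite /Bc; ring.
Qed.

End noise_rate.

Theorem theorem4p3 (R : realType) (alpha s H1 H2 T Cf : R)
    (lambda : nat -> R) (phi : nat -> R -> R) (f : (R -> R) -> (R -> R))
    (d : measure_display) (Omega : measurableType d) (P : probability Omega R)
    (F : R -> set (set Omega)) (W : R -> R -> {RV P >-> R})
    (halpha : 0 < alpha < 1) (hs : 0 < s < 1)
    (hH1 : 0 < H1 <= 2^-1) (hH2 : 0 < H2 <= 2^-1) (hT : 0 < T) (hCf : 0 < Cf)
    (heig : dirichlet_eigensystem lambda phi)
    (hf : growth_lipschitz Cf f)
    (hF : is_filtration T F)
    (hW : fractional_brownian_sheet P F T H1 H2 W)
    (hcond1 : 0 < 2 * s * H2 / alpha + H1 - 1)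
    (hcond2 : 0 < H1 + 2 * s - 1) :
  forall eps : R, 0 < eps ->
  exists C : R, forall (N M : nat), (0 < N)%N -> (0 < M)%N ->
  forall (u : R -> Omega -> R -> R) (U : nat -> Omega -> R -> R),
    semidiscrete_solution P alpha s T lambda phi f W N u ->
    mittag_leffler_euler P alpha s T lambda phi f W N M U ->
  forall n : nat, (1 <= n <= M)%N ->
    (\int[P]_w (normD (u (grid (T / M%:R) n) w \- U n w)%R ^+ 2) <=
      (C * (T / M%:R) `^ (H2 + alpha * (H1 - 1) / (2 * s) - eps))%:E)%E.
Proof.
move=> eps eps0.
have /andP[a0 a1] := halpha; have /andP[s0 s1] := hs.
have /andP[H1_gt0 H1_le] := hH1; have /andP[H2_gt0 H2_le] := hH2.
have [_ _ covW] := hW.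
(* The critical exponent: q > q0 is equivalent to p > 1, and the two conditions on the parameters
   become q0 < 2 H2 and q0 < 2 alpha. *)
pose q0 := alpha * (1 - H1) / s.
have q0_ge0 : 0 <= q0 by apply: divr_ge0; [apply: mulr_ge0; [exact: ltW|lra]|exact: ltW].
have q0_H2 : q0 < 2 * H2.
  rewrite /q0 ltr_pdivrMr//.
  have : 0 < (2 * s * H2 / alpha + H1 - 1) * alpha by rewrite mulr_gt0.
  by rewrite !mulrDl divfK ?gt_eqF//; lra.
have q0_a : q0 < 2 * alpha.
  rewrite /q0 ltr_pdivrMr// -mulrA mulrCA ltr_pM2l//; lra.
(* Below 2 alpha the decay estimate is available; below H2 + q0 / 2 the rate 2 H2 - q exceeds H2 -
   q0 / 2, and q < 2 H2 <= 1 follows. *)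
pose m := Num.min (2 * alpha) (H2 + q0 / 2).
have q0m : q0 < m by rewrite /m lt_min q0_a /=; lra.
pose q := (q0 + m) / 2.
have q0q : q0 < q by rewrite /q; lra.
have qm : q < m by rewrite /q; lra.
have /andP[qa qH] : (q < 2 * alpha) && (q < H2 + q0 / 2) by rewrite -lt_min.
have q_ge0 : 0 <= q by lra.
have qH2 : q < 2 * H2 by lra.
have q1 : q < 1 by lra.
pose p := 2 * H1 + 2 * s * q / alpha - 1.
have p1 : 1 < p.
  have h : 2 * s * q0 / alpha < 2 * s * q / alpha by rewrite ltr_pM2r ?invr_gt0// ltr_pM2l// mulr_gt0.
  have e : 2 * s * q0 / alpha = 2 * (1 - H1) by rewrite /q0; field; rewrite !gt_eqF.
  by rewrite /p; move: h; rewrite e; lra.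
pose rho := 2 * H2 - q.
have rho0 : 0 < rho by rewrite /rho; lra.
have rho1 : rho <= 1 by rewrite /rho; lra.
pose ga := H2 + alpha * (H1 - 1) / (2 * s) - eps.
have ga_rho : ga <= rho.
  have e : ga = H2 - q0 / 2 - eps by rewrite /ga /q0; field; rewrite gt_eqF.
  by rewrite e /rho; lra.
have half_ge0 : 0 < 1 :> R by exact: ltr01.
have [eta1 eta1P] := shift_index_exists H1_gt0 H1_le (ltr01 : 0 < 1 :> R).
have [eta2 eta2P] := shift_index_exists H2_gt0 H2_le hT.
pose A := noise_constant alpha s H1 H2 q.
have A0 : 0 <= A by exact: noise_constant_ge0.
pose L := Cf ^+ 2.
have L0 : 0 < L by rewrite exprn_gt0.
(* As tau <= T and ga <= rho, tau^rho is at most T^(rho - ga) tau^ga; no factor depends on [N], [M]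
   or [n]. *)
exists (mild_constant T L A rho * T `^ (rho - ga)) => N M N0 M0 u U hu hU n /andP[n1 nM].
have [c [mc uE cint c_init c_mild]] := semidiscrete_coefficients a0 a1 heig hCf hf hu.
have [dd [mdd UE dd0 dd_mild]] := euler_coefficients a0 a1 heig hT M0 hU.
pose tau := T / M%:R.
have tau0 : 0 < tau by rewrite divr_gt0// ltr0n.
have tauT : tau <= T.
  by rewrite ler_pdivrMr ?ltr0n// -[leLHS]mulr1 ler_pM2l// ler1n.
have gridT j : (j <= M)%N -> 0 <= grid tau j <= T.
  move=> jM; apply/andP; split; first by apply: mulr_ge0 => //; exact: ltW.
  have TE : M%:R * tau = T by rewrite /tau mulrCA mulfV ?mulr1// pnatr_eq0 -lt0n.
  by rewrite -[leRHS]TE /grid ler_pM2r// ler_nat.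
have sphi k : (1 <= k)%N -> sqint (phi k) by exact: (sqint_eigenfunction heig).
have ortho := eigenfunction_orthonormal heig.
pose v := modek alpha s lambda.
have mv k : measurable_fun setT (v k) by exact: measurable_modek.
have v01 k x : 0 <= x -> 0 <= v k x <= 1 by move=> _; exact: modek01.
have v_nincr k x y : 0 <= x -> x <= y -> v k y <= v k x by exact: modek_nincr.
have lk0 k : (1 <= k)%N -> 0 < lambda k `^ s.
  by move=> k1; rewrite powR_gt0// (eigenvalue_gt0 heig k1).
pose K k := (1 + Gamma (alpha + 1)) ^+ 2 * (lambda k `^ s) `^ (- (q / alpha)).
have K0 k : 0 <= K k by rewrite mulr_ge0 ?sqr_ge0 ?powR_ge0.
have v_decay k : (1 <= k)%N -> forall x, 0 < x -> (v k x) ^+ 2 <= K k * x `^ (- q).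
  by move=> k1 x x0; apply: mlk_decay => //; [exact: lk0|exact: ltW].
have /choice[X XP] : forall t, exists X : nat -> Omega -> R, 0 <= t <= T ->
    (forall k, (1 <= k <= N)%N -> wint T W (fun y r => hist (v k) t r * phi k y) (X k)) /\
    {ae P, forall w, forall k, (1 <= k <= N)%N ->
       c k (t, w) = \int[lebesgue_measure]_(r in `[0, t])
         (v k (t - r) * drift phi N f (fun j => c j (r, w)) k) + X k w}.
  move=> t; have [tT|tT] := boolP (0 <= t <= T); last by exists (fun _ _ => 0).
  by have [X XP] := c_mild t tT; exists X.
have /choice[Y YP] : forall j, exists Y : nat -> Omega -> R, (1 <= j <= M)%N ->
    (forall k, (1 <= k <= N)%N ->
       wint T W (fun y r => mean_hist (v k) tau j r * phi k y) (Y k)) /\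
    {ae P, forall w, forall k, (1 <= k <= N)%N ->
       dd j k w = \sum_(1 <= i < j.+1) \int[lebesgue_measure]_(r in cell tau i)
           (v k (grid tau j - r) * drift phi N f (fun j => dd i.-1 j w) k) + Y k w}.
  move=> j; have [jM|jM] := boolP (1 <= j <= M)%N; last by exists (fun _ _ => 0).
  by have [Y YP] := dd_mild j jM; exists Y.
have wintB g h Z1 Z2 : wint T W g Z1 -> wint T W h Z2 ->
    wint T W (fun y r => g y r - h y r) (fun w => Z1 w - Z2 w).
  move=> w1 w2; have := wint_add w1 (wint_scale (-1) w2).
  congr (wint T W _ _); last by apply/funext => w; rewrite mulN1r.
  by apply/funext => y; apply/funext => r; rewrite mulN1r.
have noise t' t : 0 <= t' -> t' < t -> t <= T ->
    (\int[P]_w (\sum_(1 <= k < N.+1) (X t k w - X t' k w) ^+ 2)%:E <= (A * (t - t') `^ rho)%:E)%E.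
  move=> t'0 t't tT; have t0 : 0 <= t by rewrite (le_trans t'0)// ltW.
  have tT2 : 0 <= t <= T by rewrite t0.
  have t'T2 : 0 <= t' <= T by rewrite t'0 (le_trans (ltW t't)).
  have de0 : 0 < t - t' by rewrite subr_gt0.
  apply: (noise_sum_le H1_gt0 H2_gt0 heig covW eta1P eta2P q1 qH2 p1
    (b := fun k r => hist (v k) t r - hist (v k) t' r) (Z := fun k w => X t k w - X t' k w) de0).
  - by move=> k kN; apply: measurable_funB; exact: measurable_hist.
  - move=> k kN; have := wintB _ _ _ _ ((XP t tT2).1 k kN) ((XP t' t'T2).1 k kN).
    congr (wint T W _ _); apply/funext => y; apply/funext => r; by rewrite mulrBl.
  - move=> k /andP[k1 _].
    exact: (hist_sub_qform (mv k) (v01 k) (v_nincr k) q_ge0 q1 (K0 k) (v_decay k k1) eta2P H2_gt0 qH2 t'0 t't tT).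
have noise_mean j : (1 <= j <= M)%N ->
    (\int[P]_w (\sum_(1 <= k < N.+1) (X (grid tau j) k w - Y j k w) ^+ 2)%:E <= (A * tau `^ rho)%:E)%E.
  move=> jM; have /andP[j1 jM'] := jM; have jT := gridT j jM'.
  apply: (noise_sum_le H1_gt0 H2_gt0 heig covW eta1P eta2P q1 qH2 p1
    (b := fun k r => hist (v k) (grid tau j) r - mean_hist (v k) tau j r)
    (Z := fun k w => X (grid tau j) k w - Y j k w) tau0).
  - by move=> k kN; apply: measurable_funB; [exact: measurable_hist|exact: measurable_mean_hist].
  - move=> k kN; have := wintB _ _ _ _ ((XP _ jT).1 k kN) ((YP j jM).1 k kN).
    congr (wint T W _ _); apply/funext => y; apply/funext => r; by rewrite mulrBl.
  - move=> k /andP[k1 _].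
    exact: (hist_sub_mean_qform (mv k) (v01 k) (v_nincr k) tau0 j1 q_ge0 q1 (K0 k) (v_decay k k1) eta2P H2_gt0 qH2 tauT).
have mT : measurable (`[0, T]%classic : set (measurableTypeR R)) by exact: measurable_itv.
have muT : (lebesgue_measure (`[0%R, T]%classic : set (measurableTypeR R)) < +oo)%E.
  by rewrite lebesgue_measure_itv /=; case: ifP => _; rewrite -?EFinD ?ltry ?lt0y.
have Fint : {ae P, forall w, forall k, (1 <= k <= N)%N ->
    lebesgue_measure.-integrable `[0, T] (EFin \o (fun r => drift phi N f (fun j => c j (r, w)) k))}.
  apply: filterS cint => w wi k kN.
  apply: (integrable_drift heig hCf hf mT muT (c := fun j r => c j (r, w))) => // j.
  exact: (measurable_fun_pair1 w (mc j)).
have bound := mild_error_bound hT L0 (ltW hCf) (drift_lipschitz N heig hf) (drift_growth N heig hf)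
  (drift_lipschitz1 heig hCf hf) mv v01 v_nincr mc cint c_init
  (fun t k kN tT => wint_measurable ((XP t tT).1 k kN)) Fint (fun t tT => (XP t tT).2)
  A0 rho0 rho1 noise M0 mdd dd0 (fun j k kN jM => wint_measurable ((YP j jM).1 k kN))
  (fun j jM => (YP j jM).2) noise_mean nM.
have -> : (\int[P]_w (normD (u (grid (T / M%:R) n) w \- U n w)%R ^+ 2) =
    \int[P]_w (\sum_(1 <= k < N.+1) (c k (grid (T / M%:R) n, w) - dd n k w) ^+ 2)%:E)%E.
  apply: eq_integral => w _; rewrite -(normD_comb N sphi ortho (fun k => c k (grid (T / M%:R) n, w) - dd n k w)).
  congr (_ ^+ 2)%E; rewrite (uE _ _ (gridT n nM)) (UE _ _ nM); congr (normD _).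
  apply/funext => x; rewrite /comb /= -sumrB; apply: eq_bigr => k _.
  by rewrite mulrBl.
apply: (le_trans bound); rewrite -/tau lee_fin.
have -> : tau `^ rho = tau `^ (rho - ga) * tau `^ ga.
  rewrite -powRD ?subrK//; by rewrite (gt_eqF tau0) implybT.
have C0 : 0 <= mild_constant T L A rho.
  have LL := ltW L0; have TT := ltW hT.
  rewrite /mild_constant; apply: mulr_ge0; last exact: expR_ge0.
  have m0 : 0 <= 2 * (1 + 2 * (A * T `^ rho)) * expR (2 * (4 * T * L) * T).
    by apply: mulr_ge0; [apply: mulr_ge0 => //; apply: addr_ge0 => //; rewrite !(A0, powR_ge0, mulr_ge0)|exact: expR_ge0].
  have i0 : 0 <= 8 * L * T * (2 * (1 + 2 * (A * T `^ rho)) * expR (2 * (4 * T * L) * T)) * T `^ (1 - rho) + 2 * A.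
    by apply: addr_ge0; rewrite !(A0, LL, m0, powR_ge0, mulr_ge0).
  by apply: addr_ge0; rewrite !(i0, A0, LL, sqr_ge0, mulr_ge0).
rewrite mulrA ler_wpM2r ?powR_ge0// ler_wpM2l//.
by apply: ge0_ler_powR => //; rewrite ?nnegrE ?subr_ge0//; exact: ltW.
Qed.
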